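(* Let $\nu\in\{\omega,\Omega\}$, $M$ a fixed integer and $0<a<b<r_\nu$ fixed reals. Uniformly for primes $p\geq3$ and integers $k$ with $a\leq \mathfrak r_{k,p}\leq b$, \[\lambda_\nu(p,k)=\frac{(\log\log p)^k}{k!}\bigg\{\sum_{0\leq m\leq M}\frac{g_{\nu,m}(\mathfrak r_{k,p})}{(\log\log p)^m}+O\Big(\frac1{(\log\log p)^{M+1}}\Big)\bigg\}.\]
   Context: $\lambda_\nu(p,k):=\sum_{n:\ P^+(n)<p,\ \nu(n)=k}1/n$, where $P^+(n)$ is the largest prime factor ($P^+(1)=1$) and $\omega,\Omega$ count prime factors without/with multiplicity. $r_\Omega:=2$, $r_\omega:=+\infty$. With $q$ over primes, $\mathscr H_\omega(z)=\prod_q(1-1/q)^z(1+z/(q-1))$, $\mathscr H_\Omega(z)=\prod_q(1-1/q)^z(1-z/q)^{-1}$, and $F_\nu(z):=e^{\gamma z}\mathscr H_\nu(z)$ for $|z|<r_\nu$ ($\gamma$ Euler's constant). $\mathfrak r_{t,p}:=t/\log\log p$, and $g_{\nu,m}(v):=\mathfrak C_{m,F_\nu}(v)$, where for $\phi$ holomorphic on a disc $D(0,c)$ and $0<v<c$: $\mathfrak q(z):=\sqrt{z^2/(2(1+iz-e^{iz}))}$ (principal branch, analytically extended near $0$, $\mathfrak q(0)=1$); $\mu(s):=\sum_{n\geq1}[\frac{d^{n-1}}{dz^{n-1}}\mathfrak q(z)^n]_{z=0}\frac{s^n}{n!}$; $\{d_n\}$ the coefficients of the asymptotic expansion of $\Gamma(z+1)e^z/(z^z\sqrt{2\pi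 z})$ in powers of $1/z$; and \[\mathfrak C_{m,\phi}(v):=\sum_{0\leq j\leq m}\frac{d_{m-j}\Gamma(j+\frac12)2^j}{v^m\sqrt\pi}\sum_{0\leq n\leq 2j}\frac{\mu^{(2j-n+1)}(0)}{n!(2j-n)!}\Big[\frac{d^n}{d\tau^n}\phi(ve^{i\mu(\tau)})\Big]_{\tau=0}.\] *)

(* Defs.v *)
From mathcomp Require Import all_boot all_order all_algebra.
From mathcomp Require Import all_classical all_reals all_analysis.
From mathcomp Require Import complex.

Set Implicit Arguments.
Unset Strict Implicit.
Unset Printing Implicit Defensive.

Import Order.TTheory GRing.Theory Num.Theory.
Import numFieldNormedType.Exports.

Local Open Scope classical_set_scope.
Local Open Scope complex_scope.
Local Open Scope ring_scope.

(* The complex numbers packaged as a numClosedFieldType: this gives them the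
   topology of the modulus and makes them a normed space over themselves, so
   that derive1n is the iterated complex derivative and limn the limit of a
   complex sequence. *)
Definition Cplx (R : realType) : numClosedFieldType := R[i].

(* small_omega: prime factors counted without multiplicity;
   big_omega: with multiplicity. *)
Inductive factor_count := small_omega | big_omega.

Definition nu_val (nu : factor_count) (n : nat) : nat :=
  match nu with
  | small_omega => size (primes n)
  | big_omega => (\sum_(q <- primes n) logn q n)%N
  end.

Definition nu_radius (R : realType) (nu : factor_count) : \bar R :=
  match nu with
  | small_omega => +oo%E
  | big_omega => 2%:E
  end.

(* max_pdiv 1 = 1, as required of P^+. *)
Definition lambda_nu (R : realType) (nu : factor_count) (p k : nat) : R :=
  limn (fun N => \sum_(1 <= n < N | (max_pdiv n < p)%N && (nu_val nu n == k))
                   (n%:R : R)^-1).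

Definition loglog (R : realType) (p : nat) : R := ln (ln p%:R).

Definition euler_gamma (R : realType) : R :=
  limn (fun N => \sum_(1 <= n < N.+1) (n%:R : R)^-1 - ln N%:R).

Definition cexp (R : realType) (z : Cplx R) : Cplx R :=
  (expR (complex.Re z))%:C * (cos (complex.Im z) +i* sin (complex.Im z)).

Definition euler_factor (R : realType) (nu : factor_count) (q : nat)
    (z : Cplx R) : Cplx R :=
  cexp (z * (ln (1 - q%:R^-1))%:C) *
  match nu with
  | small_omega => 1 + z / (q%:R - 1)
  | big_omega => (1 - z / q%:R)^-1
  end.

Definition euler_product (R : realType) (nu : factor_count) (z : Cplx R) : Cplx R :=
  limn (fun N => \prod_(q < N | prime q) euler_factor nu q z).

(* Only meaningful for |z| < nu_radius nu; the value elsewhere is junk. *)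
Definition F_nu (R : realType) (nu : factor_count) (z : Cplx R) : Cplx R :=
  cexp ((euler_gamma R)%:C * z) * euler_product nu z.

(* complex.sqrtc is the principal branch: its values have nonnegative real
   part, and positive imaginary part on the negative real axis. *)
Definition q_fun (R : realType) (z : Cplx R) : Cplx R :=
  if z == 0 then 1
  else sqrtc (z ^+ 2 / (2 * (1 + ('i)%C * z - cexp (('i)%C * z)))).

Definition mu_fun (R : realType) (s : Cplx R) : Cplx R :=
  limn (fun N => \sum_(1 <= n < N)
    derive1n n.-1 (fun z : Cplx R => q_fun z ^+ n) 0 * (s ^+ n / n`!%:R)).

Definition Gamma_fun (R : realType) (x : R) : R :=
  \int[lebesgue_measure]_(t in `]0, +oo[) (t `^ (x - 1) * expR (- t)).

Definition stirling_ratio (R : realType) (x : R) : R :=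
  Gamma_fun (x + 1) * expR x / (x `^ x * Num.sqrt (2 * pi * x)).

(* f has the (Poincare) asymptotic expansion sum_n d n / x^n as x -> +oo *)
Definition asymptotic_expansion (R : realType) (f : R -> R) (d : nat -> R) :
    Prop :=
  forall N : nat, exists K : R, \forall x \near +oo,
    `|f x - \sum_(n < N.+1) d n / x ^+ n| <= K / x ^+ N.+1.

(* An asymptotic expansion is unique when it exists, so xget picks out
   "the" coefficients. *)
Definition stirling_coef (R : realType) : nat -> R :=
  xget (fun=> 0) [set d | asymptotic_expansion (@stirling_ratio R) d].

Definition saddle_coef (R : realType) (m : nat) (phi : Cplx R -> Cplx R) (v : R) :
    Cplx R :=
  \sum_(j < m.+1)
    (stirling_coef R (m - j)%N * Gamma_fun (j%:R + 2^-1) * 2 ^+ j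
       / (v ^+ m * Num.sqrt pi))%:C *
    \sum_(n < (2 * j).+1)
      derive1n (2 * j - n).+1 (@mu_fun R) 0 / (n`! * (2 * j - n)`!)%:R *
      derive1n n (fun tau : Cplx R => phi (v%:C * cexp (('i)%C * mu_fun tau))) 0.

Definition g_nu (R : realType) (nu : factor_count) (m : nat) (v : R) : Cplx R :=
  saddle_coef m (@F_nu R nu) v.

(* Main.v *)
(** Put L = log log p and v = k / L.  The sum lambda_nu(p, k) is the k-th
    coefficient of the Euler product over q < p of the local factors
    sum_j z^nu(q^j) / q^j, and by Mertens' theorem, with its constant, this
    product is e^(L z) (F_nu(z) + O(1 / log p)), in the sense of absolutely
    convergent coefficient sums on a disc of radius rho > b.  Writing
    F_nu(z) = sum_l F_l z^l, the coefficient is L^k / k! times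
    sum_l F_l v^l k! / (k^l (k - l)!) up to O(1 / log p), and expanding
    k! / (k^l (k - l)!) = prod_(i < l) (1 - i / k) in powers of 1 / k gives the
    expansion of the theorem, with explicit coefficients.

    It remains to recognise these coefficients in the saddle-point ones.  By
    Lagrange inversion the j-th inner sum of C_(m, phi) is, for phi(z) = z^l,
    a number alpha(l, j) satisfying
    alpha(l + 1, j + 1) = alpha(l, j + 1) - l alpha(l, j); hence, as power
    series in y, sum_j alpha(l, j) y^j = prod_(i < l) (1 - i y) * A(y) with
    A = sum_j alpha(0, j) y^j, and one must show A(y) * sum_n d_n y^n = 1.  For
    this, applying the same identity to the exponential series in place of
    F_nu (Touchard's identity for the Bell numbers) yields the formal functional
    equation (1 + y)^(1/y + 1/2) e^(-1) A(y) = A(y / (1 + y)), which is the one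
    satisfied by the reciprocal of the Stirling ratio S(x) at x = 1 / y.
    Iterating x -> x + 1 and using S(x + n) -> 1, which follows from the
    logarithmic convexity of Gamma and Gamma(1/2) = sqrt pi, gives
    S(x) A(1/x) = 1 + O(x^-N) for every N. *)

Require Import Defs.
From mathcomp Require Import all_boot all_order all_algebra.
From mathcomp Require Import all_classical all_reals all_analysis.
From mathcomp Require Import complex.
From mathcomp Require Import measurable_realfun.
From mathcomp Require Import ring lra zify.

Set Implicit Arguments.
Unset Strict Implicit.
Unset Printing Implicit Defensive.

Import Order.TTheory GRing.Theory Num.Theory.
Import numFieldNormedType.Exports.

Local Open Scope classical_set_scope.
Local Open Scope complex_scope.
Local Open Scope ring_scope.

(** * Power series modulo X^N and Lagrange inversion *)

(** The saddle-point method enters only through its coefficients: no contour integral is estimated.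
    The Euler product alone already gives an expansion, so the difficulty is to show that its
    coefficients are the numbers of the statement, which are built from a square root, an inverse
    function and Stirling's series. After the rotation s = iz all of these series have real
    coefficients and their identities are formal, so they are proved for polynomials modulo X^N;
    complex analysis only evaluates the derivatives and limits of the statement. The coefficients
    d_n, however, are given by an asymptotic property alone, so identifying them needs analysis. The
    exponential series is the right test function for this: its sum over l is (1 + 1/k)^k, a known
    function of y = 1/k, while its saddle-point coefficients can be expressed by A, so that the
    identity becomes an equation for A alone. On the arithmetic side, an error 1 / log p = e^(-L) is
    smaller than every power of 1 / L and never disturbs the expansion. *)

Section Eqm.
Variable R : comNzRingType.
Implicit Types P Q S T f g : {poly R}.

Definition eqm (N : nat) P Q := forall i, (i < N)%N -> P`_i = Q`_i.

Definition ser N (a : nat -> R) : {poly R} := \poly_(i < N) a i.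

Lemma eqmP N P Q : eqm N P Q <-> exists S, P = Q + S * 'X^N.
Proof.
split=> [h|[S ->] i iN]; last by rewrite coefD coefMXn iN addr0.
exists (drop_poly N (P - Q)).
rewrite -[LHS](addrNK Q) addrC; congr (_ + _).
rewrite -[LHS](poly_take_drop N) -[RHS]add0r; congr (_ + _).
apply/polyP=> i; rewrite coef_take_poly coef0 coefB; case: ifP => // iN.
by rewrite h ?subrr.
Qed.

Lemma eqm_refl N P : eqm N P P. Proof. by []. Qed.
Lemma eqm_sym N P Q : eqm N P Q -> eqm N Q P.
Proof. by move=> h i iN; rewrite h. Qed.
Lemma eqm_trans N P Q S : eqm N P Q -> eqm N Q S -> eqm N P S.
Proof. by move=> h k i iN; rewrite h ?k. Qed.
Lemma eqm_le N M P Q : (M <= N)%N -> eqm N P Q -> eqm M P Q.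
Proof. by move=> MN h i iM; apply/h/(leq_trans iM). Qed.
Lemma eqmD N P Q S T : eqm N P Q -> eqm N S T -> eqm N (P + S) (Q + T).
Proof. by move=> h k i iN; rewrite !coefD h ?k. Qed.
Lemma eqmN N P Q : eqm N P Q -> eqm N (- P) (- Q).
Proof. by move=> h i iN; rewrite !coefN h. Qed.
Lemma eqmZ N c P Q : eqm N P Q -> eqm N (c *: P) (c *: Q).
Proof. by move=> h i iN; rewrite !coefZ h. Qed.
Lemma eqmM N P Q S T : eqm N P Q -> eqm N S T -> eqm N (P * S) (Q * T).
Proof.
move=> h k i iN; rewrite !coefM; apply: eq_bigr => j _.
by rewrite h ?k //; have := ltn_ord j; lia.
Qed.
Lemma eqmMl N P Q S : eqm N P Q -> eqm N (P * S) (Q * S).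
Proof. by move=> h; apply: eqmM. Qed.
Lemma eqmMr N P Q S : eqm N P Q -> eqm N (S * P) (S * Q).
Proof. by move=> h; apply: eqmM. Qed.
Lemma eqmX N P Q n : eqm N P Q -> eqm N (P ^+ n) (Q ^+ n).
Proof. by move=> h; elim: n => // n ih; rewrite !exprS; apply: eqmM. Qed.
Lemma eqm_XM N P Q : eqm N P Q -> eqm N.+1 ('X * P) ('X * Q).
Proof. by move=> h [|i] iN; rewrite !coefXM //= h. Qed.
Lemma eqm_deriv N P Q : eqm N.+1 P Q -> eqm N P^`() Q^`().
Proof. by move=> h i iN; rewrite !coef_deriv h. Qed.
Lemma eqm_sum N (I : Type) (r : seq I) (p : pred I) (F G : I -> {poly R}) :
  (forall i, p i -> eqm N (F i) (G i)) ->
  eqm N (\sum_(i <- r | p i) F i) (\sum_(i <- r | p i) G i).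
Proof. by move=> h; apply: big_ind2 => // *; apply: eqmD. Qed.

Lemma coef0_XM f : f`_0 = 0 -> f = drop_poly 1 f * 'X.
Proof.
move=> f0; rewrite -[LHS](poly_take_drop 1) expr1.
rewrite [X in X + _](_ : _ = 0) ?add0r //.
apply/polyP=> i; rewrite coef_take_poly coef0; case: ifP => //.
by case: i.
Qed.

Lemma eqm_compl N P Q f : f`_0 = 0 -> eqm N P Q -> eqm N (P \Po f) (Q \Po f).
Proof.
move=> f0 /eqmP[S ->]; apply/eqmP.
rewrite [X in _ \Po X](coef0_XM f0); set g := drop_poly 1 f.
exists ((S \Po (g * 'X)) * g ^+ N).
by rewrite comp_polyD comp_polyM rmorphXn /= comp_polyX exprMn mulrA -/g -coef0_XM.
Qed.

Lemma eqm_compr N P f g : eqm N f g -> eqm N (P \Po f) (P \Po g).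
Proof.
by move=> h; rewrite !comp_polyE; apply: eqm_sum => i _; apply/eqmZ/eqmX.
Qed.

Lemma eqm_ser N M a : (N <= M)%N -> eqm N (ser M a) (ser N a).
Proof. by move=> NM i iN; rewrite !coef_poly iN (leq_trans iN NM). Qed.
Lemma coef_ser N a i : (i < N)%N -> (ser N a)`_i = a i.
Proof. by move=> iN; rewrite coef_poly iN. Qed.
End Eqm.
#[global] Hint Resolve eqm_refl : core.

Section Char0.
Variable R : numFieldType.
Implicit Types P Q S T f g : {poly R}.

Lemma natf_neq0 n : (n.+1%:R != 0 :> R). Proof. by rewrite pnatr_eq0. Qed.
Hint Resolve natf_neq0 : core.

Lemma eqm_integral N P Q : P`_0 = Q`_0 -> eqm N P^`() Q^`() -> eqm N.+1 P Q.
Proof.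
move=> h0 h [|i] iN //; have := h i iN; rewrite !coef_deriv => /eqP.
by rewrite -subr_eq0 -mulrnBl mulrn_eq0 /= subr_eq0 => /eqP.
Qed.

Section Lagrange.
Variables (N : nat) (q s : {poly R}).
Hypotheses (q0 : q`_0 = 1) (qs : eqm N.+1 (s * q) 1).

Let f := 'X * s.

Lemma lag_f0 : f`_0 = 0. Proof. by rewrite coefXM. Qed.

Lemma lag_fq : eqm N.+2 (f * q) 'X.
Proof. by rewrite -[X in eqm _ _ X]mulr1 -mulrA; apply: eqm_XM. Qed.

Lemma lag_dfq : eqm N.+1 (f^`() * q) (1 - f * q^`()).
Proof.
have := eqm_deriv lag_fq; rewrite derivM derivX => h.
by move=> i iN; rewrite coefB -h // coefD addrK.
Qed.

(** Since q = X / f, this is the coefficient of 1/X in f' f^(j - n - 1): a logarithmic derivative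
    for j = n, the derivative of a Laurent series otherwise. Without Laurent series, the case n = j
    + m with m > 0 reduces to q^m - X (q^m)' / m, whose coefficient of X^m vanishes. *)
Lemma lag_dual n j : (n < N.+1)%N ->
  (f ^+ j * f^`() * q ^+ n.+1)`_n = (j == n)%:R.
Proof.
move=> nN; have [jn|nj] := leqP j n; last first.
  have -> : f ^+ j * f^`() * q ^+ n.+1 = 'X^j * (s ^+ j * (f^`() * q ^+ n.+1)).
    by rewrite {1}/f exprMn !mulrA.
  by rewrite coefXnM nj gtn_eqF.
have [m nE] : exists m, n = (j + m)%N by exists (n - j)%N; rewrite subnKC.
subst n.
have -> : f ^+ j * f^`() * q ^+ (j + m).+1 = (f * q) ^+ j * ((f^`() * q) * q ^+ m).
  by rewrite [(f * q) ^+ j]exprMn -addnS exprD exprS mulrACA !mulrA.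
have h : eqm N.+1 ((f * q) ^+ j * ((f^`() * q) * q ^+ m))
                  ('X ^+ j * ((1 - f * q^`()) * q ^+ m)).
  apply: eqmM; first by apply/eqmX/eqm_le/lag_fq.
  exact/eqmMl/lag_dfq.
rewrite h; last by lia.
rewrite coefXnM ltnNge leq_addr /= addKn.
case: m nN {h jn} => [|m] nN.
  by rewrite expr0 mulr1 coefB coef1 coefM big_ord1 lag_f0 mul0r subr0 addn0 eqxx.
rewrite addnS -addSn eqn_leq [X in _ && X]leqNgt ltnS leq_addr andbF.
have h : eqm N.+1 ((1 - f * q^`()) * q ^+ m.+1)
   (q ^+ m.+1 - 'X * (q^`() * q ^+ m)).
  have -> : (1 - f * q^`()) * q ^+ m.+1 = q ^+ m.+1 - (f * q) * (q^`() * q ^+ m).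
    by rewrite exprS; clearbody f; move: (q^`()) (q ^+ m) => x y; ring.
  apply: eqmD => //; apply: eqmN; apply: eqmMl; exact/eqm_le/lag_fq.
rewrite h; last by lia.
have -> : q^`() * q ^+ m = m.+1%:R^-1 *: (q ^+ m.+1)^`().
  by rewrite deriv_exp /= -[_ * _ *+ _]scaler_nat scalerA mulVf ?scale1r.
by rewrite coefB coefXM /= coefZ coef_deriv -[X in _ * X]mulr_natl mulKf // subrr.
Qed.

Let m' : {poly R} := \poly_(n < N.+1) (q ^+ n.+1)`_n.
(* Lagrange inversion: [mu] is the compositional inverse of [f = 'X * s], where
   [q] is the multiplicative inverse of [s]. *)
Let mu : {poly R} := \poly_(n < N.+2) ((q ^+ n)`_n.-1 / n%:R).

Lemma lag_mu0 : mu`_0 = 0. Proof. by rewrite coef_poly /= invr0 mulr0. Qed.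
Lemma lag_dmu : eqm N.+1 mu^`() m'.
Proof.
move=> i iN; rewrite coef_deriv !coef_poly iN ltnS iN.
by rewrite -[LHS]mulr_natr mulfVK.
Qed.

(** [lag_dual] says that the square matrix of the coefficients of f^i f' has a right inverse built
    from powers of q. It is then a left inverse too, and row 0 of the product in the other order is
    the claim. *)
Lemma lag_m'f : eqm N.+1 ((m' \Po f) * f^`()) 1.
Proof.
pose A : 'M[R]_N.+1 := \matrix_(i, j) (f ^+ i * f^`())`_j.
pose B : 'M[R]_N.+1 := \matrix_(i, j) if (i <= j)%N then (q ^+ j.+1)`_(j - i) else 0.
have AB : A *m B = 1%:M.
  apply/matrixP=> i j; rewrite !mxE -val_eqE /= -(lag_dual _ (ltn_ord j)).
  rewrite coefM [RHS](big_ord_widen N.+1 (fun k => (f ^+ i * f^`())`_k * (q ^+ j.+1)`_(j - k))); last by [].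
  rewrite [RHS]big_mkcond; apply: eq_bigr => k _; rewrite !mxE ltnS.
  by case: ifP => //; rewrite mulr0.
have := mulmx1C AB => BA.
move=> k kN; have := congr1 (fun M : 'M[R]_(N.+1) => M ord0 (Ordinal kN)) BA.
rewrite !mxE coef1 /= -val_eqE /= [0%N == k]eq_sym => <-.
rewrite comp_polyE mulr_suml coef_sum.
have sz : (size m' <= N.+1)%N by apply: size_poly.
rewrite (big_ord_widen N.+1 (fun i => (m'`_i *: f ^+ i * f^`())`_k)) // big_mkcond /=.
apply: eq_bigr => i _; rewrite !mxE /= subn0 -scalerAl coefZ coef_poly ltn_ord.
case: ifP => // /negbT; rewrite -leqNgt => /leq_sizeP/(_ i (leqnn _)).
by rewrite coef_poly ltn_ord => ->; rewrite mul0r.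
Qed.

Lemma lag_muf : eqm N.+2 (mu \Po f) 'X.
Proof.
apply: eqm_integral.
  by rewrite coefX -horner_coef0 horner_comp horner_coef0 lag_f0 horner_coef0 lag_mu0.
rewrite deriv_comp derivX; apply: eqm_trans lag_m'f.
by apply: eqmMl; apply: eqm_compl; [exact: lag_f0|exact: lag_dmu].
Qed.

(** Substituting f into the left-hand series and multiplying by f' gives Phi; pairing with q^(n + 1)
    through [lag_dual] then isolates the n-th coefficient. *)
Lemma lagrange_burmann (Phi : {poly R}) n : (n < N.+1)%N ->
  (mu^`() * (Phi \Po mu))`_n = (Phi * q ^+ n.+1)`_n.
Proof.
move=> nN; set Psi := mu^`() * (Phi \Po mu).
have h : eqm N.+1 ((Psi \Po f) * f^`()) Phi.
  rewrite /Psi comp_polyM -comp_polyA mulrAC -[X in eqm _ _ X]mul1r.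
  apply: eqmM.
    by apply: eqm_trans lag_m'f; apply/eqmMl/eqm_compl; [exact: lag_f0|exact: lag_dmu].
  rewrite -[X in eqm _ _ X]comp_polyXr; apply: eqm_compr.
  exact/eqm_le/lag_muf.
rewrite -(eqmMl (q ^+ n.+1) h nN) comp_polyE !mulr_suml coef_sum.
under eq_bigr do rewrite -!scalerAl coefZ lag_dual //.
have [nP|Pn] := ltnP n (size Psi).
  rewrite (bigD1 (Ordinal nP)) //= eqxx mulr1 big1 ?addr0 // => i.
  by rewrite -val_eqE /= => /negbTE ->; rewrite mulr0.
rewrite nth_default // big1 // => i _; rewrite ltn_eqF ?mulr0 //.
exact: leq_trans (ltn_ord i) Pn.
Qed.
End Lagrange.
End Char0.

(** * The formal saddle-point coefficients *)

Section SaddleSeries.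
Variable R : realFieldType.
Implicit Types P Q S T : {poly R}.

Lemma natS_neq0 n : (n.+1%:R != 0 :> R). Proof. by rewrite pnatr_eq0. Qed.
Lemma factf_neq0 n : (n`!%:R != 0 :> R). Proof. by rewrite pnatr_eq0 -lt0n fact_gt0. Qed.
Hint Resolve natS_neq0 factf_neq0 : core.

Lemma invfactS n : n.+1%:R * (n.+1`!%:R)^-1 = (n`!%:R)^-1 :> R.
Proof. by rewrite factS natrM invfM mulrA divff // mul1r. Qed.

(* [wc], [exc c] and [qh] are the coefficients in s of 2(e^s - 1 - s)/s^2, e^(cs)
   and (2(e^s - 1 - s)/s^2)^(-1/2); the last one is q(z) at s = iz. *)
Definition wc n : R := 2 / (n.+2)`!%:R.
Definition exc (c : R) n : R := c ^+ n / n`!%:R.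

Lemma wc0 : wc 0 = 1. Proof. by rewrite /wc divff. Qed.
Lemma wc_gt0 n : 0 < wc n. Proof. by rewrite divr_gt0 // ltr0n fact_gt0. Qed.

(** The recursion is the differential equation 2 W Q' + W' Q = 0 of Q = W^(-1/2), read
    coefficientwise; the list of earlier values encodes the course-of-values recursion. *)
Fixpoint qlist n : seq R :=
  if n is m.+1 then
    rcons (qlist m) (- (m.+1%:R^-1 * \sum_(j < m.+1)
      ((m - j)%:R + j.+1%:R / 2) * wc j.+1 * (qlist m)`_(m - j)))
  else [:: 1].
Definition qh n : R := (qlist n)`_n.

Lemma size_qlist n : size (qlist n) = n.+1.
Proof. by elim: n => //= n ih; rewrite size_rcons ih. Qed.
Lemma nth_qlist n i : (i <= n)%N -> (qlist n)`_i = qh i.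
Proof.
elim: n => [|n ih]; first by case: i.
rewrite leq_eqVlt => /orP[/eqP -> //|]; rewrite ltnS => iN.
by rewrite /= nth_rcons size_qlist ltnS iN ih.
Qed.
Lemma qh0 : qh 0 = 1. Proof. by []. Qed.
Lemma qhS m : qh m.+1 = - (m.+1%:R^-1 * \sum_(j < m.+1)
      ((m - j)%:R + j.+1%:R / 2) * wc j.+1 * qh (m - j)).
Proof.
rewrite {1}/qh /= nth_rcons size_qlist ltnn eqxx; congr (- (_ * _)).
by apply: eq_bigr => j _; rewrite nth_qlist // leq_subr.
Qed.

Lemma wcS_le n : wc n.+1 <= 3^-1 * 2^-1 ^+ n.
Proof.
elim: n => [|n ih]; first by rewrite expr0 mulr1 /wc !factS fact0 /= !natrM; lra.
have -> : wc n.+2 = wc n.+1 / n.+4%:R by rewrite /wc factS [X in _ / X]natrM invfM mulrA mulrAC.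
rewrite exprSr mulrA; apply: ler_pM; [exact/ltW/wc_gt0|by rewrite invr_ge0|exact: ih|].
by rewrite lef_pV2 ?posrE // ler_nat.
Qed.

Lemma sum_wc_le n : \sum_(j < n) wc j.+1 <= 1.
Proof.
apply: (@le_trans _ _ (3^-1 * \sum_(j < n) 2^-1 ^+ j)).
  by rewrite mulr_sumr; apply: ler_sum => j _; apply: wcS_le.
have := subrX1 (2^-1 : R) n.
have : 0 <= (2^-1 : R) ^+ n by rewrite exprn_ge0 // invr_ge0.
move: (\sum_(i < n) _) (_ ^+ n) => x y; lra.
Qed.

(** In the recursion the weight (m - j) + (j + 1) / 2 is at most m + 1 and the numbers [wc j.+1] sum
    to at most 1, so the bound 1 is inherited. It makes the series of q absolutely convergent inside
    the unit disc. *)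
Lemma qh_le1 n : `|qh n| <= 1.
Proof.
elim/ltn_ind: n => -[|m] ih; first by rewrite qh0 normr1.
rewrite qhS normrN normrM gtr0_norm ?invr_gt0 // ler_pdivrMl // mulr1.
apply: (le_trans (ler_norm_sum _ _ _)).
apply: (@le_trans _ _ (\sum_(j < m.+1) m.+1%:R * wc j.+1)).
  apply: ler_sum => j _; rewrite normrM.
  apply: le_trans (_ : `|((m - j)%:R + j.+1%:R / 2) * wc j.+1| <= _).
    by rewrite ler_piMr ?ih ?ltnS ?leq_subr.
  have wj := wc_gt0 j.+1; rewrite normrM (gtr0_norm wj) ler_pM2r //.
  rewrite gtr0_norm ?ltr_wpDl ?divr_gt0 //.
  have -> : m.+1%:R = (m - j)%:R + j.+1%:R :> R by rewrite -natrD; congr _%:R; have := ltn_ord j; lia.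
  have : 0 <= j.+1%:R :> R by []. lra.
rewrite -mulr_sumr ler_piMr // sum_wc_le //.
Qed.

Section Trunc.
Variable N : nat.
Let Q := ser N.+4 qh.
Let W := ser N.+4 wc.
Let E := ser N.+4 (exc 1).

Lemma ode_qw : eqm N.+3 (2 *: (W * Q^`()) + W^`() * Q) 0.
Proof.
move=> m mN; rewrite coef0 coefD coefZ !coefM.
have e1 : \sum_(j < m.+1) W`_j * Q^`()`_(m - j) =
   \sum_(j < m.+1) wc j * ((m - j).+1%:R * qh (m - j).+1).
  apply: eq_bigr => j _; have jm : (j <= m)%N := ltn_ord j.
  have [h1 h2] : (j < N.+4)%N /\ ((m - j).+1 < N.+4)%N.
    by move: (val j) mN jm => i; clear; lia.
  by rewrite coef_deriv (coef_ser _ h1) (coef_ser _ h2) ?mulr_natl ?(mulr_natl (wc _)).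
have e2 : \sum_(j < m.+1) W^`()`_j * Q`_(m - j) =
   \sum_(j < m.+1) j.+1%:R * wc j.+1 * qh (m - j).
  apply: eq_bigr => j _; have jm : (j <= m)%N := ltn_ord j.
  have [h1 h2] : (j.+1 < N.+4)%N /\ (m - j < N.+4)%N.
    by move: (val j) mN jm => i; clear; lia.
  by rewrite coef_deriv (coef_ser _ h1) (coef_ser _ h2) ?mulr_natl ?(mulr_natl (wc _)).
rewrite e1 e2 big_ord_recl wc0 mul1r subn0 qhS mulrN mulVKf //.
have e3 : \sum_(i < m) wc (lift ord0 i) * ((m - lift ord0 i).+1%:R * qh (m - lift ord0 i).+1)
  = \sum_(i < m.+1) wc i.+1 * ((m - i)%:R * qh (m - i)).
  rewrite [RHS]big_ord_recr /= subnn mul0r mulr0 addr0.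
  by apply: eq_bigr => i _; rewrite /bump /= add1n subnSK.
rewrite e3 mulrDr mulrN -addrA addrC; apply/eqP; rewrite subr_eq0; apply/eqP.
rewrite !mulr_sumr -big_split /=; apply: eq_bigr => i _.
by field.
Qed.

Lemma q2w : eqm N.+4 (Q ^+ 2 * W) 1.
Proof.
apply: eqm_integral.
  by rewrite coefM big_ord1 coefM big_ord1 !coef_ser // wc0 qh0 !mul1r coef1.
rewrite derivM deriv_exp derivC /= expr1.
have -> : (Q^`() * Q *+ 2) * W + Q ^+ 2 * W^`() = Q * (2 *: (W * Q^`()) + W^`() * Q).
  by rewrite scaler_nat !mulr2n; move: Q^`() W^`() => x y; ring.
by rewrite -[X in eqm _ _ X](mulr0 Q); apply/eqmMr/ode_qw.
Qed.

Lemma x2w : eqm N.+4 ('X^2 * W) (2 *: (E - 1 - 'X)).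
Proof.
move=> i iN; rewrite coefXnM coefZ !coefB coef1 coefX.
case: i iN => [|[|i]] iN /=.
- by rewrite coef_ser // /exc expr0 fact0 divr1 /=; ring.
- by rewrite coef_ser // /exc expr1 divr1 /=; ring.
- rewrite subn2 /= !coef_ser //; last by lia.
  by rewrite /wc /exc expr1n !subr0 mul1r.
Qed.

(** Differentiating s^2 W = 2 (e^s - 1 - s) gives 2 (e^s - 1) = 2 s W + s^2 W'; after multiplication
    by Q^3, the relation Q^2 W = 1 and the differential equation of Q eliminate W. This is the
    source of the recursion [Lc_rec]. *)
Lemma e1_q3 : eqm N.+3 ((E - 1) * Q ^+ 3) ('X * (Q - 'X * Q^`())).
Proof.
have h : eqm N.+3 (2 *: (E - 1)) (2 *: ('X * W) + 'X^2 * W^`()).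
  have /eqm_sym := eqm_deriv x2w.
  rewrite derivZ !derivB derivX derivC subr0 derivM derivXn /= expr1.
  have -> : E^`() = ser N.+3 (exc 1).
    apply/polyP=> i; rewrite coef_deriv !coef_poly ltnS; case: ifP => [_|_]; last by rewrite mul0rn.
    by rewrite /exc !expr1n !mul1r -[LHS]mulr_natl invfactS.
  have -> : 2 *: ('X * W) = 'X *+ 2 * W by rewrite scaler_nat mulrnAl.
  apply: eqm_trans; apply/eqmZ/eqmD => //; exact: eqm_ser.
have -> : (E - 1) * Q ^+ 3 = 2^-1 *: ((2 *: (E - 1)) * Q ^+ 3).
  by rewrite -scalerAl scalerA mulVf ?scale1r.
apply: eqm_trans (eqmZ _ (eqmMl _ h)) _.
have -> : 2^-1 *: ((2 *: ('X * W) + 'X^2 * W^`()) * Q ^+ 3) =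
   'X * (Q * (Q ^+ 2 * W)) + 2^-1 *: ('X ^+ 2 * Q ^+ 2 * (2 *: (W * Q^`()) + W^`() * Q))
   - 'X ^+ 2 * Q^`() * (Q ^+ 2 * W).
  have h2 : (2^-1)%:P * 2%:P = 1 :> {poly R} by rewrite -polyCM mulVf.
  rewrite -!mul_polyC; move: (2^-1)%:P 2%:P h2 W^`() Q^`() => c d h2 x y.
  apply/eqP; rewrite -subr_eq0; apply/eqP.
  transitivity ((c * d - 1) * ('X * W * Q ^+ 3 - 'X ^+ 2 * Q ^+ 2 * W * y)); first by ring.
  by rewrite h2 subrr mul0r.
have -> : 'X * (Q - 'X * Q^`()) = 'X * (Q * 1) + 2^-1 *: ('X ^+ 2 * Q ^+ 2 * 0) - 'X ^+ 2 * Q^`() * 1.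
  by rewrite !mulr1 mulr0 scaler0 addr0 mulrBr mulrA.
apply: eqmD; first apply: eqmD.
- by do 2 apply: eqmMr; apply: eqm_le q2w.
- by apply/eqmZ/eqmMr/ode_qw.
- by apply/eqmN/eqmMr; apply: eqm_le q2w.
Qed.

Let f := 'X * (Q * W).
(** As Q W is the inverse of Q, the series f is s / q and f^2 / 2 = e^s - 1 - s; the claim is the
    derivative of this identity. *)
Lemma f_f' : eqm N.+3 (f * f^`()) (E - 1).
Proof.
have f2 : eqm N.+4 (f ^+ 2) (2 *: (E - 1 - 'X)).
  apply: eqm_trans x2w; rewrite /f.
  have -> : ('X * (Q * W)) ^+ 2 = ('X^2 * W) * (Q ^+ 2 * W) by ring.
  by rewrite -[X in eqm _ _ X]mulr1; apply/eqmMr/q2w.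
have := eqm_deriv f2; rewrite deriv_exp derivZ !derivB derivX derivC subr0 /= expr1.
have -> : E^`() = ser N.+3 (exc 1).
    apply/polyP=> i; rewrite coef_deriv !coef_poly ltnS; case: ifP => [_|_]; last by rewrite mul0rn.
    by rewrite /exc !expr1n !mul1r -[LHS]mulr_natl invfactS.
move=> h i iN; have := h i iN; rewrite coefMn coefZ mulr2n mulrC.
have -> : (ser N.+3 (exc 1) - 1)`_i = (E - 1)`_i by rewrite !coefB !coef_ser // ltnW.
by move: (_`_i) (_`_i) => x y; lra.
Qed.
End Trunc.

Lemma q_s_trunc N : eqm N.+1 (ser N.+4 qh * ser N.+4 wc * ser N.+4 qh) 1.
Proof. rewrite mulrAC -expr2; apply: (eqm_le _ (@q2w N)); lia. Qed.

Lemma exc_mul N a b : eqm N (ser N (exc a) * ser N (exc b)) (ser N (exc (a + b))).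
Proof.
move=> n nN; rewrite coefM coef_ser // /exc addrC exprDn mulr_suml.
apply: eq_bigr => i _; have := ltn_ord i; rewrite ltnS => iN.
rewrite !coef_ser; [|lia..].
have := bin_fact iN => /(congr1 (fun k => k%:R : R)); rewrite !natrM => <-.
rewrite -mulr_natr; field; rewrite !factf_neq0 /=.
by rewrite pnatr_eq0 -lt0n bin_gt0.
Qed.

Lemma exc_deriv N c : (ser N.+1 (exc c))^`() = c *: ser N (exc c).
Proof.
apply/polyP=> i; rewrite coef_deriv coefZ !coef_poly ltnS; case: ifP => [_|_]; last by rewrite mul0rn mulr0.
by rewrite /exc exprS -[LHS]mulr_natl mulrCA invfactS mulrA.
Qed.

(* By Lagrange inversion, the coefficient of s^n in M'(s) e^(c M(s)), where M is
   the inverse function of s / qh(s), i.e. mu up to rotations by i. *)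
Definition Lc (c : R) n : R := (ser n.+1 (exc c) * ser n.+1 qh ^+ n.+1)`_n.

Lemma LcE c n N : (n < N)%N -> Lc c n = (ser N (exc c) * ser N qh ^+ n.+1)`_n.
Proof.
move=> nN; rewrite /Lc; apply/esym.
have: eqm n.+1 (ser N (exc c) * ser N qh ^+ n.+1) (ser n.+1 (exc c) * ser n.+1 qh ^+ n.+1).
  by apply: eqmM; [|apply: eqmX]; apply: eqm_ser.
exact.
Qed.

(** Raising c by 1 multiplies the exponential by e^s, so the difference carries (e^s - 1) q^(n + 3).
    By [e1_q3] this is s (q - s q') q^n, and the term with q' is absorbed by the derivative of
    e^(cs) q^(n + 1), which leaves the factor c. *)
Lemma Lc_rec c n : c * Lc c n = n.+1%:R * (Lc (c + 1) n.+2 - Lc c n.+2).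
Proof.
pose N := n.+2; pose Q := ser N.+4 qh; pose E := ser N.+4 (exc 1).
pose P := ser N.+4 (exc c).
rewrite (@LcE c n N.+4) ?(@LcE _ n.+2 N.+4) /N; [|lia..].
rewrite -coefB -mulrBl -/Q -/P.
have h : eqm N.+3 ((ser N.+4 (exc (c + 1)) - P) * Q ^+ n.+3) (P * ('X * (Q - 'X * Q^`())) * Q ^+ n).
  rewrite -(mulrA P); apply: eqm_trans (_ : eqm _ _ (P * ((E - 1) * Q ^+ 3 * Q ^+ n))) _; last first.
    by apply/eqmMr/eqmMl/e1_q3.
  rewrite -[in X in eqm _ _ X](mulrA (E - 1)) -exprD mulrA; apply: eqmMl.
  rewrite mulrBr mulr1; apply: eqmD => //.
  by apply: eqm_sym; exact: (eqm_le _ (@exc_mul N.+4 c 1)).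
rewrite h; last by rewrite /N; clear; lia.
have -> : P * ('X * (Q - 'X * Q^`())) * Q ^+ n = 'X * (P * Q ^+ n.+1 - 'X * (P * (Q^`() * Q ^+ n))).
  by rewrite exprS; move: Q^`() (Q ^+ n) => x y; ring.
rewrite coefXM /= coefB coefXM /=.
have hd : (P * Q ^+ n.+1)^`()`_n = (c *: (P * Q ^+ n.+1))`_n + (P * (Q^`() * Q ^+ n) *+ n.+1)`_n.
  rewrite derivM deriv_exp /= -coefD mulrnAr.
  have hh : eqm N.+3 P^`() (c *: P).
    by rewrite exc_deriv; apply/eqmZ/eqm_sym/eqm_ser.
  rewrite !coefD; congr (_ + _); rewrite scalerAl.
  by apply: (eqmMl _ hh); rewrite /N; clear; lia.
move: hd; rewrite coef_deriv coefZ coefMn -[X in X = _]mulr_natl -[X in _ = _ + X]mulr_natl => hd.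
by rewrite mulrBr hd addrK.
Qed.

Definition dfac j : R := \prod_(i < j) (i.*2.+1)%:R.
(* [alpha l j] is, at v = 1, the contribution of phi(z) = z^l to the j-th inner
   sum of C_(m, phi) times Gamma(j + 1/2) 2^j / sqrt pi = [dfac j]. *)
Definition alpha (l j : nat) : R := (-1) ^+ j * dfac j * Lc l%:R j.*2.
(** These are the signed Stirling numbers of the first kind s(l, l - m). *)
Definition slc (l m : nat) : R := (\prod_(i < l) (1 - i%:R *: 'X) : {poly R})`_m.

Lemma dfacS j : dfac j.+1 = dfac j * j.*2.+1%:R.
Proof. by rewrite /dfac big_ord_recr. Qed.

Lemma alpha0 l : alpha l 0 = 1.
Proof.
rewrite /alpha expr0 /dfac big_ord0 !mul1r /Lc coefM big_ord1 expr1 !coef_ser //.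
by rewrite /exc expr0 fact0 divr1 qh0 mul1r.
Qed.
Lemma alphaS l j : alpha l.+1 j.+1 = alpha l j.+1 - l%:R * alpha l j.
Proof.
rewrite /alpha -[l.+1]addn1 natrD dfacS doubleS exprS.
have h := Lc_rec l%:R j.*2; rewrite [l%:R * _]mulrCA h; ring.
Qed.

Lemma alpha_sl l m : alpha l m = \sum_(j < m.+1) slc l j * alpha 0 (m - j).
Proof.
suff h N : eqm N (ser N (alpha l)) (\prod_(i < l) (1 - i%:R *: 'X) * ser N (alpha 0)).
  have := h m.+1 m (ltnSn m); rewrite coef_ser // coefM => ->.
  by apply: eq_bigr => j _; rewrite coef_ser // ltnS leq_subr.
elim: l => [|l ih]; first by rewrite big_ord0 mul1r.
rewrite big_ord_recr /= mulrAC; apply: eqm_trans; last exact: (eqmMl _ ih).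
move=> [|j] jN; rewrite mulrBr mulr1 coefB -scalerAr coefZ coefMX !coef_ser //.
- by rewrite !alpha0 /= mulr0 subr0.
- by rewrite /= alphaS.
- exact: ltnW.
Qed.

Lemma slcS l m : slc l.+1 m = slc l m - l%:R * (if m is m'.+1 then slc l m' else 0).
Proof.
rewrite /slc big_ord_recr /= mulrBr mulr1 coefB -scalerAr coefZ coefMX.
by case: m.
Qed.

Lemma lin_ode_unique N (E P : {poly R}) : P`_0 = 0 -> eqm N P^`() (E * P) -> eqm N.+1 P 0.
Proof.
move=> P0 h; elim/ltn_ind => -[|i] ih iN; rewrite coef0 //.
have := h i iN; rewrite coef_deriv coefM big1 => [/eqP|j _].
  by rewrite mulrn_eq0 /= => /eqP.
by rewrite ih ?coef0 ?mulr0 //; have := ltn_ord j; lia.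
Qed.

(* The hypothesis says B' = e^s B, so that B = b_0 e^(e^s - 1).  With
   f = s / qh one has e^s = 1 + s + f^2/2 and hence B = b_0 e^s e^(f^2/2). *)
Lemma touchard (b : nat -> R) N m : (m.*2 < N)%N ->
  (forall n, n.+1%:R * b n.+1 = \sum_(i < n.+1) b i / (n - i)`!%:R) ->
  (ser N b * ser N qh ^+ m.*2.+1)`_(m.*2) =
  b 0%N * \sum_(i < m.+1) (2 ^+ i * i`!%:R)^-1 * Lc 1 (m - i).*2.
Proof.
move=> mN hb; have -> : (ser N b * ser N qh ^+ m.*2.+1)`_(m.*2) =
   (ser N.+4 b * ser N.+4 qh ^+ m.*2.+1)`_(m.*2).
  have: eqm N (ser N b * ser N qh ^+ m.*2.+1) (ser N.+4 b * ser N.+4 qh ^+ m.*2.+1).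
    by apply: eqmM; [|apply: eqmX]; apply/eqm_sym/eqm_ser; lia.
  exact.
set B := ser N.+4 b; set Q := ser N.+4 qh; pose W := ser N.+4 wc.
pose E := ser N.+4 (exc 1).
have hB : eqm N.+3 B^`() (E * B).
  move=> n nN; rewrite coef_deriv coef_ser // -mulr_natl hb mulrC coefM.
  apply: eq_bigr => i _; rewrite !coef_ser /exc ?expr1n ?mul1r //; have := ltn_ord i; move: nN; clear; lia.
pose f := 'X * (Q * W).
have ff' := @f_f' N; rewrite -/Q -/W -/f -/E in ff'.
pose c i : R := (2 ^+ i * i`!%:R)^-1.
pose V n := \sum_(i < n) c i *: f ^+ (i.*2).
have fX i : eqm i.*2 (f ^+ (i.*2)) 0.
  move=> j ji; rewrite /f exprMn coefXnM ji coef0 //.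
have hV n : (V n.+1)^`() = f * f^`() * V n.
  rewrite /V (raddf_sum (@deriv R)) big_ord_recl /= expr0 derivZ derivC scaler0 add0r mulr_sumr.
  apply: eq_bigr => i _; rewrite derivZ deriv_exp /= -scalerAr /bump /= add1n doubleS /=.
  rewrite -scaler_nat scalerA; have -> : c i.+1 * i.*2.+2%:R = c i.
    rewrite /c exprS factS natrM -[i.*2.+2]doubleS -muln2 natrM.
    by field; rewrite nat1r !natS_neq0 ?factf_neq0 expf_neq0.
  by congr (_ *: _); rewrite exprS; ring.
have hV2 : eqm N.+3 (V N.+4)^`() ((E - 1) * V N.+4).
  rewrite hV; apply: eqmM; first exact: ff'.
  rewrite [V N.+4]/V big_ord_recr /= -/(V _) -[X in eqm _ X]addr0.
  apply: eqmD => //; rewrite -[X in eqm _ X](scaler0 _ (c N.+3)); apply/eqm_sym/eqmZ.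
  by apply: eqm_le (fX _); rewrite -addnn leq_addr.
have V0 : (V N.+4)`_0 = 1.
  rewrite /V coef_sum big_ord_recl /= expr0 coefZ coef1 /c expr0 fact0 mul1r invr1 mulr1 big1 ?addr0 // => i _.
  by rewrite coefZ (fX _) ?coef0 ?mulr0 // /bump /=; lia.
have hEV : eqm N.+4 B (b 0%N *: (E * V N.+4)).
  have k : eqm N.+4 (B - b 0%N *: (E * V N.+4)) 0.
    apply: (@lin_ode_unique _ E).
      by rewrite coefB coefZ coefM big_ord1 V0 !coef_ser // /exc expr0 fact0 divr1 !mulr1 subrr.
    rewrite derivB derivZ mulrBr -scalerAr; apply: eqmD => //; apply/eqmN/eqmZ.
    rewrite derivM /E exc_deriv scale1r -/E.
    have -> : E * (E * V N.+4) = E * V N.+4 + E * ((E - 1) * V N.+4) by ring.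
    apply: eqmD; last exact: eqmMr.
    by apply: eqmMl; apply/eqm_sym/eqm_ser.
  by move=> i iN; have := k i iN; rewrite coefB coef0 => /eqP; rewrite subr_eq0 => /eqP.
rewrite (eqmMl _ hEV); last by move: mN; clear; lia.
rewrite -scalerAl coefZ; congr (_ * _).
rewrite /V mulr_sumr mulr_suml coef_sum.
rewrite (big_ord_widen N.+4 (fun i => (2 ^+ i * i`!%:R)^-1 * Lc 1 (m - i).*2)); last by move: mN; clear; lia.
rewrite [RHS]big_mkcond /=; apply: eq_bigr => i _.
rewrite -scalerAr -scalerAl coefZ; case: ifP => im; last first.
  have: eqm i.*2 (E * f ^+ i.*2 * Q ^+ m.*2.+1) (E * 0 * Q ^+ m.*2.+1).
    by apply/eqmMl/eqmMr.
  by move=> -> ; [rewrite mulr0 mul0r coef0 mulr0|move/negbT: im; clear; lia].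
congr (_ * _).
(* Since f Q = X, the factor f^(2i) cancels 2i of the factors Q and shifts the index by 2i, so that
   what remains is again a coefficient of the form [Lc 1]. *)
have -> : E * f ^+ i.*2 * Q ^+ m.*2.+1 = (f * Q) ^+ i.*2 * (E * Q ^+ (m - i).*2.+1).
  have -> : m.*2.+1 = (i.*2 + (m - i).*2.+1)%N by move: im; clear; lia.
  rewrite [(f * Q) ^+ _]exprMn exprD; move: (f ^+ _) (Q ^+ i.*2) (Q ^+ _) => x y z.
  by rewrite [E * x]mulrC -!mulrA; congr (_ * _); rewrite mulrCA.
have fQ : eqm N.+4 (f * Q) 'X.
  rewrite /f -mulrA -[X in eqm _ _ X]mulr1; apply: eqmMr.
  by rewrite mulrAC -expr2; apply: q2w.
rewrite (eqmMl _ (eqmX _ fQ)); last by move: mN; clear; lia.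
rewrite coefXnM ifN; last by move: im; clear; lia.
rewrite (@LcE 1 _ N.+4); last by move: mN; clear; lia.
by congr ((_ : {poly R})`_ _); move: im; clear; lia.
Qed.
End SaddleSeries.

(** * Convolution of coefficient sequences *)

Section Conv.
Variable R : comNzRingType.
Implicit Types a b c : nat -> R.

Definition conv a b n : R := \sum_(i < n.+1) a i * b (n - i)%N.
Definition delt n : R := (n == 0%N)%:R.

Lemma conv_ser a b N n : (n < N)%N -> conv a b n = (ser N a * ser N b)`_n.
Proof.
move=> nN; rewrite coefM; apply: eq_bigr => i _; have iN := ltn_ord i.
rewrite !coef_ser //; first by apply: leq_ltn_trans (leq_subr _ _) nN.
exact: leq_trans iN nN.
Qed.
Lemma convC a b n : conv a b n = conv b a n.
Proof. by rewrite !(@conv_ser _ _ n.+1) // mulrC. Qed.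
Lemma eqm_conv a b N : eqm N (ser N (conv a b)) (ser N a * ser N b).
Proof. by move=> i iN; rewrite coef_ser // (conv_ser _ _ iN). Qed.
Lemma convA a b c n : conv a (conv b c) n = conv (conv a b) c n.
Proof.
rewrite !(@conv_ser _ _ n.+1) //.
by rewrite (eqmMr _ (@eqm_conv b c n.+1)) // (eqmMl _ (@eqm_conv a b n.+1)) // mulrA.
Qed.
Lemma eq_conv a a' b b' : a =1 a' -> b =1 b' -> conv a b =1 conv a' b'.
Proof. by move=> h k n; apply: eq_bigr => i _; rewrite h k. Qed.
Lemma conv1 a n : conv delt a n = a n.
Proof.
rewrite /conv big_ord_recl /= mul1r subn0 big1 ?addr0 // => i _.
by rewrite /delt /= mul0r.
Qed.
Lemma convBl a a' b n : conv (fun i => a i - a' i) b n = conv a b n - conv a' b n.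
Proof. by rewrite /conv -sumrB; apply: eq_bigr => i _; rewrite mulrBl. Qed.
Lemma convBr a b b' n : conv a (fun i => b i - b' i) n = conv a b n - conv a b' n.
Proof. by rewrite /conv -sumrB; apply: eq_bigr => i _; rewrite mulrBr. Qed.
End Conv.

(** * Weighted l^1 norms of coefficient sequences *)

Section Norm.
Variable R : realFieldType.
Implicit Types a b c : nat -> R.
Variable rho : R.
Hypothesis rho0 : 0 < rho.

(* The coefficients [a] have weighted l^1 norm at most [K] on the disc of radius
   [rho]; this norm is submultiplicative for [conv]. *)
Definition nbd a K := forall n, \sum_(i < n) `|a i| * rho ^+ i <= K.

Lemma nbd_le a K K' : K <= K' -> nbd a K -> nbd a K'.
Proof. by move=> h k n; apply: le_trans h. Qed.
Lemma nbd_coef a K n : nbd a K -> `|a n| * rho ^+ n <= K.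
Proof.
move=> /(_ n.+1); rewrite big_ord_recr /=; apply: le_trans.
by rewrite lerDr; apply: sumr_ge0 => i _; rewrite mulr_ge0 // exprn_ge0 // ltW.
Qed.
Lemma eq_nbd a b K : a =1 b -> nbd a K -> nbd b K.
Proof. by move=> h k n; under eq_bigr do rewrite -h. Qed.
Lemma nbd_dom a b K : (forall n, `|b n| <= `|a n|) -> nbd a K -> nbd b K.
Proof.
move=> h k n; apply: le_trans (k n); apply: ler_sum => i _.
by rewrite ler_wpM2r // exprn_ge0 // ltW.
Qed.
Lemma nbdD a b K K' : nbd a K -> nbd b K' -> nbd (fun i => a i + b i) (K + K').
Proof.
move=> h k n; apply: le_trans (lerD (h n) (k n)); rewrite -big_split /=.
apply: ler_sum => i _; rewrite -mulrDl; apply: ler_wpM2r; first by rewrite exprn_ge0 // ltW.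
exact: ler_normD.
Qed.
Lemma nbdN a K : nbd a K -> nbd (fun i => - a i) K.
Proof. by move=> h n; under eq_bigr do rewrite normrN. Qed.
Lemma nbdB a b K K' : nbd a K -> nbd b K' -> nbd (fun i => a i - b i) (K + K').
Proof. by move=> h k; apply: nbdD => //; apply: nbdN. Qed.
Lemma nbdZ (c : R) a K : nbd a K -> nbd (fun i => c * a i) (`|c| * K).
Proof.
move=> h n; apply: le_trans (ler_wpM2l (normr_ge0 c) (h n)).
by rewrite mulr_sumr; apply: ler_sum => i _; rewrite normrM mulrA.
Qed.
Lemma nbd_mono k (c : R) : nbd (fun i => if i == k then c else 0) (`|c| * rho ^+ k).
Proof.
move=> n; have [kn|nk] := ltnP k n.
  rewrite (bigD1 (Ordinal kn)) //= eqxx big1 ?addr0 // => i.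
  by rewrite -val_eqE /= => /negbTE ->; rewrite normr0 mul0r.
rewrite big1 => [|i _]; first by rewrite mulr_ge0 // exprn_ge0 // ltW.
by rewrite ltn_eqF ?normr0 ?mul0r // (leq_trans (ltn_ord i) nk).
Qed.
Lemma nbd_delt : nbd (@delt R) 1.
Proof.
apply: eq_nbd (nbd_le _ (@nbd_mono 0 1)); last by rewrite expr0 mulr1 normr1.
by move=> i; rewrite /delt; case: eqP.
Qed.

Lemma nbd_conv a b K K' : nbd a K -> nbd b K' -> nbd (conv a b) (K * K').
Proof.
move=> h k n.
apply: (@le_trans _ _ (\sum_(i < n) \sum_(j < n) (`|a i| * rho ^+ i) * (`|b j| * rho ^+ j))).
  apply: (@le_trans _ _ (\sum_(m < n) \sum_(i < m.+1) (`|a i| * rho ^+ i) * (`|b (m - i)%N| * rho ^+ (m - i)))).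
    apply: ler_sum => m _; rewrite /conv.
    apply: le_trans (ler_wpM2r (exprn_ge0 _ (ltW rho0)) (ler_norm_sum _ _ _)) _.
    rewrite mulr_suml; apply: ler_sum => i _; have im : (i <= m)%N := ltn_ord i.
    have -> : rho ^+ m = rho ^+ i * rho ^+ (m - i) by rewrite -exprD subnKC.
    by rewrite normrM mulrACA.
  pose f i j := (`|a i| * rho ^+ i) * (`|b j| * rho ^+ j).
  have f0 i j : 0 <= f i j by rewrite /f !mulr_ge0 // exprn_ge0 // ltW.
  have -> : \sum_(m < n) \sum_(i < m.+1) f i (m - i)%N =
     \sum_(i < n) \sum_(m < n | (i <= m)%N) f i (m - i)%N.
    rewrite (exchange_big_dep xpredT) //=; apply: eq_bigr => m _.
    rewrite (big_ord_widen n (fun i => f i (m - i)%N)) //.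
  apply: ler_sum => i _.
  rewrite -(big_mkord (fun m => (i <= m)%N) (fun m => f i (m - i)%N)).
  rewrite -(big_mkord xpredT (fun j => f i j)).
  rewrite (big_cat_nat (n := i)) //=; last exact/ltnW.
  rewrite big_nat_cond big_pred0 ?add0r; last first.
    by move=> m; rewrite leq0n /= ltnNge; case: (i <= m)%N; rewrite ?andbF.
  rewrite -{1}[val i]add0n big_addn [leLHS](_ : _ = \sum_(0 <= j < n - i) f i j); last first.
    by apply: congr_big_nat => // j _; rewrite ?leq_addl // addnK.
  rewrite [leRHS](big_cat_nat (n := n - i)) ?leq_subr //= lerDl.
  exact: sumr_ge0.
have s0 (c : nat -> R) : 0 <= \sum_(i < n) `|c i| * rho ^+ i.
  by apply: sumr_ge0 => i _; rewrite mulr_ge0 // exprn_ge0 // ltW.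
rewrite -big_distrlr /=; exact: ler_pM (s0 _) (s0 _) (h n) (k n).
Qed.
End Norm.

Section ExcConv.
Variable R : realFieldType.
Lemma exc_conv (a b : R) n : conv (exc a) (exc b) n = exc (a + b) n.
Proof. by rewrite (@conv_ser _ _ _ n.+1) // exc_mul // coef_ser. Qed.
Lemma exc0 n : exc (0 : R) n = delt R n.
Proof. by rewrite /exc /delt expr0n; case: n => [|n] /=; rewrite ?divr1 ?mul0r. Qed.

Lemma slc0 l : slc R l 0 = 1.
Proof. by elim: l => [|l ih]; rewrite ?slcS ?ih ?mulr0 ?subr0 // /slc big_ord0 coef1. Qed.

(** Induction on l for all N at once: the error for (l + 1, N + 1) is the error for (l, N + 1) minus
    l / k times the error for (l, N). The bound holds for every l, also beyond k, which is what
    allows summation over all l later. *)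
Lemma slc_expand (k l N : nat) : (0 < k)%N ->
  `|\prod_(i < l) (1 - i%:R / k%:R) - \sum_(m < N) slc R l m / k%:R ^+ m| <=
    l%:R ^+ N.*2 / k%:R ^+ N :> R.
Proof.
move=> k0; have kR : 0 < k%:R :> R by rewrite ltr0n.
pose P l : R := \prod_(i < l) (1 - i%:R / k%:R).
(* Up to l' = k + 1 all factors lie in [0, 1]; beyond that the factor with i = k is 0. *)
have P1 l' : `|P l'| <= 1.
  have [lk|kl] := leqP l' k.+1.
    rewrite normr_prod; apply: prodr_ile1 => i _; rewrite normr_ge0 /= ger0_norm.
      by rewrite gerBl divr_ge0.
    rewrite subr_ge0 ler_pdivrMr // mul1r ler_nat -ltnS.
    exact: leq_trans (ltn_ord i) lk.
  by rewrite /P (bigD1 (Ordinal (ltn_trans (ltnSn k) kl))) //= divff ?gt_eqF // subrr mul0r normr0.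
elim: l N => [|l ih] [|N].
- by rewrite !big_ord0 subr0 normr1 expr0 divr1 expr0.
- rewrite big_ord0 big_ord_recl big1 ?addr0 => [|i _]; last by rewrite /slc big_ord0 coef1 /= mul0r.
  by rewrite slc0 expr0 divr1 subrr normr0 divr_ge0 ?exprn_ge0.
- by rewrite big_ord0 subr0 !expr0 divr1; apply: P1.
have -> : \sum_(m < N.+1) slc R l.+1 m / k%:R ^+ m =
   \sum_(m < N.+1) slc R l m / k%:R ^+ m - l%:R / k%:R * \sum_(m < N) slc R l m / k%:R ^+ m.
  under eq_bigr do rewrite slcS mulrBl.
  rewrite sumrB; congr (_ - _); rewrite big_ord_recl mulr0 mul0r add0r mulr_sumr.
  apply: eq_bigr => i _; rewrite /= exprS invfM; ring.
rewrite big_ord_recr /= -/(P l).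
have -> : P l * (1 - l%:R / k%:R) - (\sum_(m < N.+1) slc R l m / k%:R ^+ m - l%:R / k%:R * \sum_(m < N) slc R l m / k%:R ^+ m)
  = (P l - \sum_(m < N.+1) slc R l m / k%:R ^+ m) - l%:R / k%:R * (P l - \sum_(m < N) slc R l m / k%:R ^+ m).
  by move: (\sum_(m < N) _) (\sum_(m < N.+1) _) (_ / _) => x y z; ring.
apply: le_trans (ler_normB _ _) _; rewrite normrM.
have lk0 : 0 <= l%:R / k%:R :> R by rewrite divr_ge0.
apply: le_trans (lerD (ih N.+1) (ler_wpM2l (normr_ge0 _) (ih N))) _.
rewrite (ger0_norm lk0) exprS invfM.
have -> : l%:R / k%:R * (l%:R ^+ N.*2 / k%:R ^+ N) = l%:R ^+ N.*2.+1 * (k%:R^-1 * (k%:R ^+ N)^-1) :> R.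
  by rewrite exprS; ring.
rewrite -mulrDl ler_wpM2r ?mulr_ge0 ?invr_ge0 ?exprn_ge0 //.
rewrite doubleS -natrX -natrX -natrD -natrX ler_nat.
rewrite [in leqRHS]expnS [leqRHS]mulSn addnC leq_add //.
  by rewrite leq_exp2r.
by rewrite expnS leq_mul // leq_exp2r.
Qed.
End ExcConv.

(** * Convergence with a rate and absolutely convergent sums *)

Section RealSeq.
Variable R : realType.
Implicit Types u a b e : nat -> R.

Lemma cauchy_rate u e (m0 : nat) :
  (forall m n, (m0 <= m)%N -> (m <= n)%N -> `|u n - u m| <= e m) ->
  e n @[n --> \oo] --> (0 : R) ->
  exists l, u n @[n --> \oo] --> l /\ forall m, (m0 <= m)%N -> `|u m - l| <= e m.
Proof.
move=> h e0; have : cvgn u.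
  apply/cauchy_cvgP/cauchy_exP => _/posnumP[d].
  have [n0 _ hn0] : \forall n \near \oo, `|e n| <= d%:num / 2.
    by move/cvgr0Pnorm_le : e0; apply; rewrite divr_gt0.
  exists (u (maxn m0 n0)); exists (maxn m0 n0) => // n /= mn.
  rewrite /ball /= distrC; apply: le_lt_trans (h _ _ (leq_maxl _ _) mn) _.
  apply: le_lt_trans (ler_norm _) _; apply: le_lt_trans (hn0 _ (leq_maxr _ _)) _.
  by rewrite ltr_pdivrMr // ltr_pMr // ltr1n.
case/cvg_ex => l hl; exists l; split=> // m mm.
have hd : `|u n - u m| @[n --> \oo] --> `|l - u m|.
  by apply: cvg_norm; apply: cvgB => //; apply: cvg_cst.
rewrite distrC; have <- := cvg_lim (@Rhausdorff R) hd.
apply: limr_le; first by apply/cvg_ex; exists `|l - u m|.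
by exists m => // n /= mn; apply: h.
Qed.

Lemma cvg_bound u l K (m0 : nat) : u n @[n --> \oo] --> l ->
  (forall n, (m0 <= n)%N -> u n <= K) -> l <= K.
Proof.
move=> hl h; have <- := cvg_lim (@Rhausdorff R) hl.
apply: limr_le; first by apply/cvg_ex; exists l.
by exists m0 => // n /= mn; apply: h.
Qed.

Definition lsum a : R := limn (fun n => \sum_(i < n) a i).

Lemma lsum_cvg a K : (forall n, \sum_(i < n) `|a i| <= K) ->
  (fun n => \sum_(i < n) a i) @ \oo --> lsum a.
Proof.
move=> h; have : cvgn [normed series a].
  have -> : [normed series a] = (fun n => \sum_(i < n) `|a i|).
    by apply/funext => n; rewrite -(big_mkord xpredT (fun i => `|a i|)).
  apply: nondecreasing_is_cvgn; last by exists K => _ [n _ <-].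
  by apply/nondecreasing_seqP => n; rewrite big_ord_recr /= lerDl.
move/normed_cvg => hc; have e : series a = (fun n => \sum_(i < n) a i).
  by apply/funext => n; rewrite -(big_mkord xpredT a).
by rewrite e in hc.
Qed.

Lemma lsum_le a K : (forall n, \sum_(i < n) `|a i| <= K) -> `|lsum a| <= K.
Proof.
move=> h; have hc : (fun n => `|\sum_(i < n) a i|) @ \oo --> `|lsum a|.
  by apply: cvg_norm; apply: lsum_cvg h.
apply: (cvg_bound (m0 := 0%N) hc) => n _; apply: le_trans (h n); exact: ler_norm_sum.
Qed.

Lemma lsumE a l : (fun n => \sum_(i < n) a i) @ \oo --> l -> lsum a = l.
Proof. exact: cvg_lim. Qed.

Lemma eq_lsum a b : a =1 b -> lsum a = lsum b.
Proof. by move/funext => ->. Qed.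
Lemma lsumD a b K K' : (forall n, \sum_(i < n) `|a i| <= K) -> (forall n, \sum_(i < n) `|b i| <= K') ->
  lsum (fun i => a i + b i) = lsum a + lsum b.
Proof.
move=> h k; apply: lsumE.
under eq_cvg do rewrite big_split /=.
by apply: cvgD; apply: lsum_cvg.
Qed.
Lemma lsumZ c a K : (forall n, \sum_(i < n) `|a i| <= K) ->
  lsum (fun i => c * a i) = c * lsum a.
Proof.
move=> h; apply: lsumE; under eq_cvg do rewrite -mulr_sumr.
by apply: cvgMr; apply: lsum_cvg h.
Qed.
Lemma lsum_sum (N : nat) (a : nat -> nat -> R) (K : nat -> R) :
  (forall m n, \sum_(i < n) `|a m i| <= K m) ->
  lsum (fun i => \sum_(m < N) a m i) = \sum_(m < N) lsum (a m).
Proof.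
move=> h; elim: N => [|N ih].
  rewrite big_ord0; apply: lsumE; under eq_cvg => n.
    rewrite big1; first over.
    by move=> i _; rewrite big_ord0.
  exact: cvg_cst.
rewrite big_ord_recr /= -ih -(@lsumD _ _ (\sum_(m < N) K m) (K N)) //.
  by apply: eq_lsum => i; rewrite big_ord_recr.
move=> n; apply: (@le_trans _ _ (\sum_(i < n) \sum_(m < N) `|a m i|)).
  by apply: ler_sum => i _; apply: ler_norm_sum.
by rewrite exchange_big /=; apply: ler_sum => m _; apply: h.
Qed.
Lemma lsum_fin a N : (forall i, (N <= i)%N -> a i = 0) -> lsum a = \sum_(i < N) a i.
Proof.
move=> h; apply: lsumE; apply: cvg_near_cst.
exists N => // n /= Nn; rewrite -!(big_mkord xpredT a).
by rewrite (big_cat_nat (leq0n N) Nn) /= [X in _ + X]big_nat_cond [X in _ + X]big1 ?addr0 // => i /andP[/andP[/h]].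
Qed.
End RealSeq.

(** * Sums over smooth integers *)

Section MaxPdiv.
Lemma max_pdiv_ltP n P : (0 < n)%N -> (0 < P)%N ->
  reflect (forall q, prime q -> (q %| n)%N -> (q <= P)%N) (max_pdiv n < P.+1)%N.
Proof.
move=> n0 P0; apply: (iffP idP) => [h q pq qn|h].
  rewrite -ltnS; apply: leq_ltn_trans h; apply: max_pdiv_max.
  by rewrite mem_primes pq n0.
rewrite ltnS; have [n1|n1] := ltnP 1 n.
  by apply: h; [exact: max_pdiv_prime|exact: max_pdiv_dvd].
by have -> : n = 1%N by lia.
Qed.

Lemma max_pdivM P m : prime P -> (0 < m)%N ->
  (max_pdiv (P * m) < P.+1)%N = (max_pdiv m < P.+1)%N.
Proof.
move=> pP m0; have P0 := prime_gt0 pP.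
apply/max_pdiv_ltP/max_pdiv_ltP; rewrite ?muln_gt0 ?P0 // => h q pq.
  by move=> qm; apply: h => //; apply: dvdn_mull.
rewrite Euclid_dvdM // => /orP[|/h]; last exact.
by rewrite dvdn_prime2 // => /eqP ->.
Qed.

Lemma max_pdiv_eq P n : prime P -> (0 < n)%N ->
  (max_pdiv n < P)%N = (max_pdiv n < P.+1)%N && ~~ (P %| n)%N.
Proof.
move=> pP n0; have P1 := prime_gt1 pP; apply/idP/andP => [h|[]].
  split; first exact: ltnW.
  apply/negP => Pn; have : (P <= max_pdiv n)%N by apply: max_pdiv_max; rewrite mem_primes pP n0.
  by rewrite leqNgt h.
rewrite ltnS leq_eqVlt => /orP[/eqP e|//]; rewrite -{1}e; have := max_pdiv_dvd n => ->.
by [].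
Qed.

Lemma max_pdiv_nprime P n : ~~ prime P -> (1 < P)%N -> (0 < n)%N ->
  (max_pdiv n < P.+1)%N = (max_pdiv n < P)%N.
Proof.
move=> pP P1 n0; rewrite ltnS leq_eqVlt; case: eqP => //= e.
have [n1|n1] := ltnP 1 n; first by move: pP; rewrite -e max_pdiv_prime.
have n1' : n = 1%N by lia.
suff: (1 < max_pdiv 1)%N by []. by move: P1; rewrite -e n1'.
Qed.

Lemma max_pdiv_lt2 n : (0 < n)%N -> (max_pdiv n < 2)%N = (n == 1%N).
Proof.
move=> n0; have [n1|n1] := ltnP 1 n; last by have -> : n = 1%N by lia.
by rewrite gtn_eqF // ltnNge prime_gt1 // max_pdiv_prime.
Qed.

Lemma nu_small_dvd P m : prime P -> (0 < m)%N -> (P %| m)%N ->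
  nu_val small_omega (P * m) = nu_val small_omega m.
Proof.
move=> pP m0 Pm /=; apply/perm_size/uniq_perm; rewrite ?primes_uniq // => q.
rewrite primesM // ?prime_gt0 // primes_prime // inE; case: eqP => // ->.
by rewrite mem_primes pP m0 Pm.
Qed.
Lemma nu_small_ndvd P m : prime P -> (0 < m)%N -> ~~ (P %| m)%N ->
  nu_val small_omega (P * m) = (nu_val small_omega m).+1.
Proof.
move=> pP m0 Pm /=; have -> : (size (primes m)).+1 = size (P :: primes m) by [].
apply/perm_size/uniq_perm; rewrite /= ?primes_uniq // ?andbT ?mem_primes ?negb_and ?Pm ?orbT // => q.
by rewrite primesM // ?prime_gt0 // primes_prime // inE.
Qed.
Lemma nu_big_sum n B : (0 < n)%N -> (n < B)%N ->
  nu_val big_omega n = (\sum_(0 <= q < B | prime q) logn q n)%N.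
Proof.
move=> n0 nB /=.
have -> : (\sum_(q <- primes n) logn q n = \sum_(q <- index_iota 0 B | q \in primes n) logn q n)%N.
  rewrite -[in RHS]big_filter; apply: perm_big; apply: uniq_perm; rewrite ?primes_uniq ?filter_uniq ?iota_uniq // => q.
  rewrite mem_filter mem_index_iota /=; case: (boolP (q \in primes n)) => //= h.
  by move: h; rewrite mem_primes => /and3P[_ _ /dvdn_leq h]; rewrite (leq_ltn_trans (h n0) nB).
rewrite [LHS]big_mkcond [RHS]big_mkcond; apply: eq_bigr => q _.
case: ifP => h; first by move: h; rewrite mem_primes => /andP[-> _].
case: ifP => // pq; apply/esym/eqP; rewrite -leqn0 leqNgt logn_gt0.
by rewrite h.
Qed.
Lemma nu_bigM P m : prime P -> (0 < m)%N ->
  nu_val big_omega (P * m) = (nu_val big_omega m).+1.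
Proof.
move=> pP m0; have P0 := prime_gt0 pP.
rewrite (@nu_big_sum _ (P * m).+1) ?muln_gt0 ?P0 //.
rewrite (@nu_big_sum m (P * m).+1) //; last by rewrite ltnS leq_pmull.
under eq_bigr do rewrite lognM //.
rewrite big_split /=; suff -> : (\sum_(0 <= q < (P * m).+1 | prime q) logn q P = 1)%N by [].
rewrite big_mkord (bigD1 (inord P : 'I_(P * m).+1)) /= inordK ?ltnS ?leq_pmulr //.
rewrite logn_prime // eqxx big1 // => q /andP[pq]; rewrite -val_eqE /= inordK ?ltnS ?leq_pmulr //.
by rewrite logn_prime // => /negbTE; rewrite eq_sym => ->.
Qed.
Lemma nu1 nu : nu_val nu 1 = 0%N.
Proof. by case: nu => //=; rewrite big_nil. Qed.
End MaxPdiv.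

Section SmoothSums.
Variables (R : realType) (g : nat -> R).
Hypothesis g_gt0 : forall n, (0 < n)%N -> 0 < g n.
Hypothesis gM : forall p n, prime p -> (0 < n)%N -> g (p * n)%N = g p * g n.
Hypothesis g_lt1 : forall p, prime p -> g p < 1.

(* Partial sums of [g] over the integers in [B] all of whose prime factors are
   less than [P]. *)
Definition sms (P : nat) (B : pred nat) (N : nat) : R :=
  \sum_(1 <= n < N | (max_pdiv n < P)%N && B n) g n.

Lemma sms_ge0 P B N : 0 <= sms P B N.
Proof.
by rewrite /sms big_nat_cond; apply: sumr_ge0 => n /andP[/andP[n0 _] _]; apply/ltW/g_gt0.
Qed.
Lemma sms_nd P B : nondecreasing_seq (sms P B).
Proof.
move=> m n mn; rewrite /sms; have [m1|m1] := leqP 1 m; last first.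
  by rewrite big_geq //; [exact: sms_ge0|lia].
rewrite [leRHS](big_cat_nat (n := m)) //= lerDl big_nat_cond.
by apply: sumr_ge0 => i /andP[/andP[i0 _] _]; apply/ltW/g_gt0; lia.
Qed.

Lemma eq_sms P B P' B' N : (forall n, (0 < n)%N -> (max_pdiv n < P)%N && B n = (max_pdiv n < P')%N && B' n) ->
  sms P B N = sms P' B' N.
Proof.
move=> h; rewrite /sms big_nat_cond [RHS]big_nat_cond; apply: eq_bigl => n.
by case: (ltnP 0 n) => //= n0; rewrite h.
Qed.

(** Cutting at P * N makes the multiples n = P m correspond exactly to m < N, so the identity
    already holds for partial sums. It serves both g(n) = 1 / n and g(n) = n^(-1 - sg). *)
Lemma sms_split P B N : prime P ->
  sms P.+1 B (P * N)%N = sms P B (P * N)%N + g P * sms P.+1 (fun m => B (P * m)%N) N.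
Proof.
move=> pP; have P0 := prime_gt0 pP.
rewrite /sms (bigID (fun n => (P %| n)%N)) /= addrC; congr (_ + _).
  rewrite big_nat_cond [RHS]big_nat_cond; apply: eq_bigl => n.
  case: (ltnP 0 n) => //= n0; rewrite (max_pdiv_eq pP n0).
  by case: (n < P * N)%N => //=; rewrite andbAC.
rewrite mulr_sumr big_nat_cond [RHS]big_nat_cond.
transitivity (\sum_(n <- [seq (P * m)%N | m <- index_iota 1 N] | (max_pdiv n < P.+1)%N && B n) g n).
  rewrite -big_filter -[RHS]big_filter; apply/perm_big/uniq_perm.
  - by rewrite filter_uniq // iota_uniq.
  - by rewrite filter_uniq // map_inj_uniq ?iota_uniq // => x y /eqP; rewrite eqn_pmul2l // => /eqP.
  move=> n; rewrite !mem_filter mem_index_iota.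
  apply/idP/idP => [/and3P[/and3P[h1 /andP[-> ->] /dvdnP[m e]] /= n0 nN]|].
    rewrite e mulnC map_f // mem_index_iota; move: n0 nN; rewrite e mulnC ltn_pmul2l // => n0 ->.
    by rewrite muln_gt0 in n0; case/andP: n0 => _ ->.
  move=> /andP[/andP[-> ->]] /mapP[m]; rewrite mem_index_iota => /andP[m0 mN] ->.
  by rewrite ltn_pmul2l // mN muln_gt0 m0 P0 dvdn_mulr.
rewrite big_map big_seq_cond [RHS]big_seq_cond.
apply: eq_big => m.
  rewrite mem_index_iota; case: (boolP ((1 <= m)%N && (m < N)%N)) => //= /andP[m0 _].
  by rewrite max_pdivM.
by rewrite mem_index_iota => /andP[/andP[m0 _] _]; rewrite gM.
Qed.

Definition smcvg P B (l : R) := sms P B N @[N --> \oo] --> l.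

Lemma smcvg_le P B l N : smcvg P B l -> sms P B N <= l.
Proof.
move=> h; have e := cvg_lim (@Rhausdorff R) h.
rewrite -e; apply: nondecreasing_cvgn_le; first exact: sms_nd.
by apply/cvg_ex; exists l.
Qed.
Lemma smcvg_bdd P B K : (forall N, sms P B N <= K) -> exists l, smcvg P B l.
Proof.
move=> h; have : cvgn (sms P B).
  by apply: nondecreasing_is_cvgn; [exact: sms_nd|exists K => _ [N _ <-]; exact: h].
by move/cvg_ex.
Qed.
Lemma smcvg_mul P B l q : (0 < q)%N -> smcvg P B l -> sms P B (q * N)%N @[N --> \oo] --> l.
Proof.
move=> q0; apply: cvg_comp; apply/cvgnyPge => A; exists A => // n /= An.
by apply: leq_trans An _; rewrite leq_pmull.
Qed.
Lemma eq_smcvg P B P' B' l : (forall n, (0 < n)%N -> (max_pdiv n < P)%N && B n = (max_pdiv n < P')%N && B' n) ->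
  smcvg P B l -> smcvg P' B' l.
Proof.
by move=> h; rewrite /smcvg; under eq_cvg do rewrite (eq_sms _ h).
Qed.

Lemma smcvg_split P B l lS lT : prime P -> smcvg P B lS ->
  smcvg P.+1 (fun m => B (P * m)%N) lT -> smcvg P.+1 B l -> l = lS + g P * lT.
Proof.
move=> pP hS hT hl; have P0 := prime_gt0 pP.
have h1 := smcvg_mul P0 hl; have h2 : sms P.+1 B (P * N)%N @[N --> \oo] --> lS + g P * lT.
  under eq_cvg do rewrite (sms_split _ _ pP).
  by apply: cvgD; [exact: smcvg_mul|exact: cvgMr].
exact: (cvg_unique _ h1 h2).
Qed.

(** Monotonicity in N puts partial sums of the same length on both sides, so boundedness can be
    derived before any limit over P-smooth integers is known to exist. *)
Lemma sms_split_le P B lS N : prime P -> smcvg P B lS ->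
  sms P.+1 B N <= lS + g P * sms P.+1 (fun m => B (P * m)%N) N.
Proof.
move=> pP hS; have P0 := prime_gt0 pP.
apply: le_trans (_ : sms P.+1 B (P * N)%N <= _); first by apply: sms_nd; rewrite leq_pmull.
by rewrite sms_split // lerD2r; apply: smcvg_le.
Qed.

Lemma gp_gt0 P : prime P -> 0 < g P. Proof. by move/prime_gt0/g_gt0. Qed.

Lemma smcvg_total P lS : prime P -> smcvg P xpredT lS -> smcvg P.+1 xpredT (lS / (1 - g P)).
Proof.
move=> pP hS; have g1 := g_lt1 pP; have g1' : 0 < 1 - g P by rewrite subr_gt0.
have [|l hl] := @smcvg_bdd P.+1 xpredT (lS / (1 - g P)).
  by move=> N; rewrite ler_pdivlMr // mulrBr mulr1 lerBlDr mulrC; apply: sms_split_le.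
suff -> : lS / (1 - g P) = l by [].
have e := smcvg_split pP hS hl hl.
by apply/(mulIf (lt0r_neq0 g1')); rewrite divfK ?lt0r_neq0 //; move: e; move: (g P) => x e; lra.
Qed.

(** Removing one factor P lowers Omega by exactly one, so the sum at level k + 1 is [lS k.+1] plus
    g(P) times the sum at level k; iteration gives the convolution with a geometric sequence. *)
Lemma smcvg_big P (lS : nat -> R) : prime P ->
  (forall k, smcvg P (fun n => nu_val big_omega n == k) (lS k)) ->
  forall k, smcvg P.+1 (fun n => nu_val big_omega n == k) (conv lS (fun j => g P ^+ j) k).
Proof.
move=> pP hS; elim=> [|k ih].
  rewrite /conv big_ord1 expr0 mulr1.
  have h0 : smcvg P.+1 (fun m => nu_val big_omega (P * m) == 0%N) 0.
    apply: (@eq_smcvg 0 xpred0) => [n n0|]; first by rewrite nu_bigM // !andbF.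
    by rewrite /smcvg /sms; under eq_cvg do rewrite big_pred0 ?andbF //; apply: cvg_cst.
  have [|l hl] := @smcvg_bdd P.+1 (fun n => nu_val big_omega n == 0%N) (lS 0%N).
    move=> N; apply: le_trans (sms_split_le N pP (hS 0%N)) _.
    by rewrite gerDl mulr_ge0_le0 ?(ltW (gp_gt0 pP)) //; exact: smcvg_le h0.
  by have := smcvg_split pP (hS 0%N) h0 hl; rewrite mulr0 addr0 => <-.
have hT : smcvg P.+1 (fun m => nu_val big_omega (P * m) == k.+1) (conv lS (fun j => g P ^+ j) k).
  by apply: eq_smcvg ih => n n0; rewrite nu_bigM.
have [|l hl] := @smcvg_bdd P.+1 (fun n => nu_val big_omega n == k.+1)
   (lS k.+1 + g P * conv lS (fun j => g P ^+ j) k).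
  move=> N; apply: le_trans (sms_split_le N pP (hS k.+1)) _.
  by rewrite lerD2l ler_wpM2l ?(ltW (gp_gt0 pP)) //; exact: smcvg_le hT.
suff -> : conv lS (fun j => g P ^+ j) k.+1 = l by [].
rewrite (smcvg_split pP (hS k.+1) hT hl) /conv [LHS]big_ord_recr /= subnn expr0 mulr1 addrC.
congr (_ + _); rewrite mulr_sumr; apply: eq_bigr => i _.
have ik : (i <= k)%N := ltn_ord i.
by rewrite subSn // exprS mulrCA.
Qed.

(** Removing a factor P from P m lowers omega only if P does not divide m. The sum c over the
    multiples of P therefore feeds on itself, c = g(P) (c + s) with s the sum over the m prime to P,
    and solving for c gives the factor g(P) / (1 - g(P)). *)
Lemma smcvg_small P (lS : nat -> R) : prime P ->
  (forall k, smcvg P (fun n => nu_val small_omega n == k) (lS k)) ->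
  forall k, smcvg P.+1 (fun n => nu_val small_omega n == k)
    (lS k + (if k is k'.+1 then lS k' * (g P / (1 - g P)) else 0)).
Proof.
move=> pP hS k; have g1 := g_lt1 pP; have g1' : 0 < 1 - g P by rewrite subr_gt0.
have g0 := gp_gt0 pP.
pose B k n := nu_val small_omega n == k.
pose C n := (P %| n)%N && B k n.
pose A n := ~~ (P %| n)%N && ((nu_val small_omega n).+1 == k).
pose s : R := if k is k'.+1 then lS k' else 0.
have hA : smcvg P.+1 A s.
  rewrite /A /s; case: (k) => [|k'].
    apply: (@eq_smcvg 0 xpred0) => [n n0|]; first by rewrite !andbF.
    by rewrite /smcvg /sms; under eq_cvg do rewrite big_pred0 ?andbF //; apply: cvg_cst.
  by apply: eq_smcvg (hS k') => n n0; rewrite (max_pdiv_eq pP n0) andbA.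
have hC0 : smcvg P C 0.
  apply: (@eq_smcvg 0 xpred0) => [n n0|].
    by rewrite andbF (max_pdiv_eq pP n0) /C; case: (P %| n)%N; rewrite ?andbF.
  by rewrite /smcvg /sms; under eq_cvg do rewrite big_pred0 ?andbF //; apply: cvg_cst.
have CP N : sms P.+1 (fun m => C (P * m)%N) N = sms P.+1 C N + sms P.+1 A N.
  rewrite /sms [LHS](bigID (fun n => (P %| n)%N)) /=; congr (_ + _); rewrite big_nat_cond [RHS]big_nat_cond;
  apply: eq_bigl => m; case: (ltnP 0 m) => //= m0; rewrite /C /A /B dvdn_mulr //=;
  case: (boolP (P %| m)%N) => Pm; rewrite ?andbF ?andbT //=.
    by have /= -> := nu_small_dvd pP m0 Pm.
  by have /= -> := nu_small_ndvd pP m0 Pm.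
have [|c hc] := @smcvg_bdd P.+1 C (g P * s / (1 - g P)).
  move=> N; rewrite ler_pdivlMr //.
  have := sms_split_le N pP hC0; rewrite CP add0r.
  have := ler_wpM2l (ltW g0) (smcvg_le N hA).
  by move: (sms _ _ _) (sms _ _ _) (g P) => x y z; lra.
have hcA : smcvg P.+1 (fun m => C (P * m)%N) (c + s).
  by rewrite /smcvg; under eq_cvg do rewrite CP; apply: cvgD.
have ce := smcvg_split pP hC0 hcA hc.
have -> : lS k + (if k is k'.+1 then lS k' * (g P / (1 - g P)) else 0) = lS k + c.
  congr (_ + _); apply/(mulIf (lt0r_neq0 g1')).
  have -> : (if k is k'.+1 then lS k' * (g P / (1 - g P)) else 0) = s * (g P / (1 - g P)).
    by rewrite /s; case: (k) => //; rewrite mul0r.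
  rewrite mulrA divfK ?lt0r_neq0 //; move: ce; move: (g P) => x ce; lra.
rewrite /smcvg; have hh N : sms P.+1 (B k) N = sms P (B k) N + sms P.+1 C N.
  rewrite /sms [LHS](bigID (fun n => (P %| n)%N)) /= addrC; congr (_ + _); rewrite big_nat_cond [RHS]big_nat_cond;
  apply: eq_bigl => m; case: (ltnP 0 m) => //= m0.
    by rewrite (max_pdiv_eq pP m0); case: (m < N)%N => //=; rewrite andbAC.
  by rewrite /C; case: (m < N)%N => //=; rewrite -!andbA [(P %| m)%N && _]andbC.
under eq_cvg do rewrite hh.
by apply: cvgD; [exact: hS|exact: hc].
Qed.
End SmoothSums.

(** * Mertens' theorems *)

Section Mertens.
Variable R : realType.
Local Notation lnn n := (ln (n%:R : R)).

Lemma lnn_ge0 n : 0 <= lnn n.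
Proof. by case: n => [|n]; [rewrite ln0|rewrite ln_ge0 // ler1n]. Qed.
Lemma lnn_gt0 n : (1 < n)%N -> 0 < lnn n.
Proof. by move=> h; rewrite ln_gt0 // ltr1n. Qed.
Lemma lnn_le m n : (0 < m)%N -> (m <= n)%N -> lnn m <= lnn n.
Proof. by move=> m0 mn; rewrite ler_ln ?posrE ?ltr0n ?ler_nat // (leq_trans m0 mn). Qed.
Lemma ln_le_sub1 (x : R) : 0 < x -> ln x <= x - 1.
Proof. by move=> x0; rewrite -{1}[x](subrKC 1) le_ln1Dx //; lra. Qed.
Lemma lnnM m n : (0 < m)%N -> (0 < n)%N -> lnn (m * n) = lnn m + lnn n.
Proof. by move=> m0 n0; rewrite natrM lnM ?posrE ?ltr0n. Qed.
Lemma lnnX m n : (0 < m)%N -> lnn (m ^ n) = n%:R * lnn m.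
Proof. by move=> m0; rewrite natrX lnXn ?ltr0n // mulr_natl. Qed.
Lemma lnnS n : (0 < n)%N -> lnn n.+1 - lnn n <= n%:R^-1.
Proof.
move=> n0; have n0' : 0 < n%:R :> R by rewrite ltr0n.
rewrite -ln_div ?posrE ?ltr0n //; apply: le_trans (ln_le_sub1 _) _.
  by rewrite divr_gt0 ?ltr0n.
by rewrite -natr1 mulrDl divff ?gt_eqF // mul1r addrAC subrr add0r.
Qed.

Lemma ln_decomp n B : (0 < n)%N -> (n < B)%N ->
  lnn n = \sum_(0 <= q < B | prime q) (logn q n)%:R * lnn q.
Proof.
move=> n0 nB.
have -> : lnn n = \sum_(q <- primes n) (logn q n)%:R * lnn q.
  rewrite {1}(prod_prime_decomp n0) prime_decompE big_map /= big_seq [RHS]big_seq.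
  have [] : (0 < \prod_(q <- primes n | q \in primes n) q ^ logn q n)%N /\
    lnn (\prod_(q <- primes n | q \in primes n) q ^ logn q n) =
    \sum_(q <- primes n | q \in primes n) (logn q n)%:R * lnn q; last by [].
  pose K (a : nat) (b : R) := (0 < a)%N /\ lnn a = b.
  apply: (@big_ind2 _ _ K); first by split; rewrite ?ln1.
    by move=> a b c d [a0 <-] [c0 <-]; split; rewrite ?muln_gt0 ?a0 // lnnM.
  move=> q; rewrite mem_primes => /and3P[pq _ _]; have q0 := prime_gt0 pq.
  by split; [rewrite expn_gt0 q0|rewrite lnnX].
have -> : \sum_(q <- primes n) (logn q n)%:R * lnn q =
   \sum_(0 <= q < B | q \in primes n) (logn q n)%:R * lnn q.
  rewrite -[in RHS]big_filter; apply: perm_big; apply: uniq_perm; rewrite ?primes_uniq ?filter_uniq ?iota_uniq // => q.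
  rewrite mem_filter mem_index_iota /=; case: (boolP (q \in primes n)) => //= h.
  by move: h; rewrite mem_primes => /and3P[_ _ /dvdn_leq h]; rewrite (leq_ltn_trans (h n0) nB).
rewrite [LHS]big_mkcond [RHS]big_mkcond; apply: eq_bigr => q _.
case: ifP => h; first by move: h; rewrite mem_primes => /andP[-> _].
case: ifP => // pq; suff -> : logn q n = 0%N by rewrite mul0r.
by apply/eqP; rewrite -leqn0 leqNgt logn_gt0 h.
Qed.

Lemma prime_dvd_fact q m : prime q -> (q %| m`!)%N -> (q <= m)%N.
Proof.
move=> pq; elim: m => [|m ih]; first by rewrite dvdn1 => /eqP e; rewrite e in pq.
by rewrite factS Euclid_dvdM // => /orP[/dvdn_leq -> //|/ih/leq_trans]; apply.
Qed.

Definition theta n : R := \sum_(0 <= q < n.+1 | prime q) lnn q.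

Lemma theta_le m n : (m <= n)%N -> theta m <= theta n.
Proof.
move=> mn; rewrite /theta [leRHS](big_cat_nat (n := m.+1)) //= lerDl.
by apply: sumr_ge0 => i _; apply: lnn_ge0.
Qed.

Lemma bin_central_le m : ('C(m.*2, m) <= 4 ^ m)%N.
Proof.
have := expnDn 1 1 m.*2; rewrite addn1 -[in (2 ^ _)%N]muln2 mulnC expnM => ->.
rewrite (bigD1 (inord m : 'I_m.*2.+1)) //= inordK ?ltnS -?addnn ?leq_addr //.
by rewrite !exp1n !muln1 leq_addr.
Qed.

(** Chebyshev's argument: every prime in (m, 2m] divides the central binomial coefficient, which is
    at most 4^m. *)
Lemma theta_double m : theta m.*2 - theta m <= m%:R * lnn 4.
Proof.
have mm : (m.+1 <= m.*2.+1)%N by rewrite ltnS -addnn leq_addr.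
rewrite /theta [X in X - _](big_cat_nat (n := m.+1)) //= addrAC subrr add0r.
rewrite -lnnX //; apply: (@le_trans _ _ (lnn 'C(m.*2, m))); last first.
  by apply: lnn_le (bin_central_le m); rewrite bin_gt0 -addnn leq_addr.
have b0 : (0 < 'C(m.*2, m))%N by rewrite bin_gt0 -addnn leq_addr.
rewrite (@ln_decomp _ (m.*2.+1 + 'C(m.*2, m))) //; last by rewrite addSn ltnS leq_addl.
rewrite [leRHS](big_cat_nat (n := m.*2.+1)) ?leq_addr //=.
rewrite [X in _ <= X + _](big_cat_nat (n := m.+1)) //=.
rewrite -addrA addrCA -[leLHS]addr0; apply: lerD; last first.
  by rewrite addr_ge0 // sumr_ge0 // => i _; rewrite mulr_ge0 // lnn_ge0.
rewrite big_nat_cond [leRHS]big_nat_cond; apply: ler_sum => q /andP[/andP[mq q2m] pq].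
rewrite ler_peMl ?lnn_ge0 // ler1n logn_gt0 mem_primes pq b0 /=.
have mm2 : (m <= m.*2)%N by rewrite -addnn leq_addr.
have : (q %| m.*2`!)%N by rewrite dvdn_fact // prime_gt0 //=.
have hm : (m.*2 - m = m)%N by rewrite -addnn addnK.
rewrite -(bin_fact mm2) hm !Euclid_dvdM //.
have -> : (q %| m`!)%N = false.
  by apply/negbTE/negP => /(prime_dvd_fact pq); rewrite leqNgt mq.
by rewrite !orbF.
Qed.

Lemma theta_bound n : theta n <= 3 * n%:R * lnn 4.
Proof.
elim/ltn_ind: n => n ih; have l4 := lnn_ge0 4.
have [n1|n1] := leqP n 1.
  rewrite /theta big_nat_cond big1 ?mulr_ge0 // => q /andP[/andP[_ qn] pq].
  by have := prime_gt1 pq; lia.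
pose m := uphalf n; have mn : (m < n)%N by rewrite /m; lia.
(* With m the upper half of n, the recursion yields (m + 3 m) ln 4; the constant 3 reproduces itself
   because 4 m <= 3 n for n >= 2. *)
have m43 : (4 * m <= 3 * n)%N by rewrite /m; lia.
apply: (@le_trans _ _ (theta m.*2)); first by apply: theta_le; rewrite /m; lia.
have := theta_double m; rewrite lerBlDr => /le_trans; apply.
apply: le_trans (lerD (lexx _) (ih _ mn)) _.
have : (4 * m%:R <= 3 * n%:R :> R) by rewrite -!natrM ler_nat.
move: (lnn 4) l4 (m%:R : R) (n%:R : R) => x x0 y z h; nra.
Qed.

Lemma lnfact_le n : lnn n`! <= n%:R * lnn n.
Proof.
elim: n => [|n ih]; first by rewrite ln1 mul0r.
rewrite factS lnnM ?fact_gt0 // [leRHS]mulr_natl [leRHS]mulrS lerD2l -[leRHS]mulr_natl.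
apply: le_trans ih _; rewrite ler_wpM2l //.
by case: n => [|n]; [rewrite ln0 // ln1|apply: lnn_le].
Qed.
Lemma lnfact_ge n : n%:R * lnn n - n%:R <= lnn n`!.
Proof.
elim: n => [|[|n] ih]; rewrite ?mul0r ?subr0 ?ln1 ?mulr0 ?sub0r ?oppr_le0 //.
have n0 : 0 < n.+1%:R :> R by [].
have := @lnnS n.+1 isT; rewrite -(ler_pM2l n0) divff ?gt_eqF //.
rewrite factS lnnM ?fact_gt0 //; move: ih (lnn n.+2) => ih y.
by rewrite -[n.+2%:R]natr1; lra.
Qed.

Lemma ln_over_pairs M : \sum_(2 <= m < M.+2) lnn m / (m%:R * (m%:R - 1)) <= 2.
Proof.
(* A telescoping majorant: a(m - 1) - a(m) dominates the m-th term because m (ln m - ln(m - 1)) <= m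
   / (m - 1) <= 2, and a(1) = 2 is the bound. *)
pose a m : R := (lnn m + 2) / m%:R.
apply: (@le_trans _ _ (\sum_(2 <= m < M.+2) (a m.-1 - a m))).
  rewrite big_nat_cond [leRHS]big_nat_cond; apply: ler_sum => -[|[|m]] //= _.
  set x : R := m.+2%:R; have x2 : 2 <= x by rewrite /x ler_nat.
  have e : m.+1%:R = x - 1 :> R by rewrite /x -[m.+2%:R]natr1 addrK.
  have h := @lnnS m.+1 isT; rewrite e in h; rewrite /a e.
  have h2 : 0 < x * (x - 1) by apply: mulr_gt0; lra.
  rewrite -subr_ge0.
  rewrite -/x in h *; have -> : (ln (x - 1) + 2) / (x - 1) - (ln x + 2) / x - ln x / (x * (x - 1)) =
    (2 - x * (ln x - ln (x - 1))) / (x * (x - 1)).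
    by field; apply/andP; split; apply: lt0r_neq0; lra.
  apply: divr_ge0; last exact: ltW.
  rewrite subr_ge0; apply: le_trans (ler_wpM2l _ h) _; first lra.
  by rewrite ler_pdivrMr; lra.
have -> : \sum_(2 <= m < M.+2) (a m.-1 - a m) = a 1%N - a M.+1.
  elim: M => [|M ih]; first by rewrite big_geq // subrr.
  by rewrite big_nat_recr //= ih addrA subrK.
by rewrite /a ln1 add0r divr1 lerBlDr lerDl divr_ge0 // addr_ge0 // lnn_ge0.
Qed.

Definition Aq m : R := \sum_(0 <= q < m | prime q) lnn q / q%:R.

(** In ln n! the prime q has exponent at least n / q - 1; the loss of 1 per prime sums to [theta n],
    which is O(n). *)
Lemma Aq_upper n : (0 < n)%N -> Aq n.+1 <= lnn n + 3 * lnn 4.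
Proof.
move=> n0; have n0' : 0 < n%:R :> R by rewrite ltr0n.
rewrite -(ler_pM2l n0') mulrDr mulrA [n%:R * 3]mulrC.
apply: le_trans (lerD (lnfact_le n) (theta_bound n)).
rewrite (@ln_decomp n`! (n.+1 + n`!)) ?fact_gt0 //; last by rewrite addSn ltnS leq_addl.
rewrite [X in _ <= X + _](big_cat_nat (n := n.+1)) ?leq_addr //=.
rewrite -addrA addrCA -[leLHS]add0r; apply: lerD.
  by rewrite sumr_ge0 // => i _; rewrite mulr_ge0 // lnn_ge0.
rewrite /Aq /theta -big_split /= mulr_sumr; apply: ler_sum => q pq.
have q0 := prime_gt0 pq; rewrite mulrCA mulrC -[X in _ <= _ + X]mul1r -mulrDl.
rewrite ler_wpM2r ?lnn_ge0 // ler_pdivrMr ?ltr0n // natr1 -natrM ler_nat.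
apply: (@leq_trans ((n %/ q).+1 * q)); first by rewrite ltnW // ltn_ceil.
rewrite leq_mul2r ltnS; apply/orP; right.
rewrite logn_fact // big_nat_recl // expn1 leq_addr.
by [].
Qed.

Lemma logn_fact_le q n : prime q -> (logn q n`!)%:R <= n%:R / (q%:R - 1) :> R.
Proof.
move=> pq; have q1 : 1 < q%:R :> R by rewrite ltr1n prime_gt1.
have q0 : 0 < q%:R :> R by lra.
rewrite logn_fact // natr_sum.
apply: (@le_trans _ _ (\sum_(1 <= k < n.+1) n%:R * (q%:R ^- k))).
  apply: ler_sum => k _; rewrite ler_pdivlMr ?exprn_gt0 // -natrX -natrM ler_nat.
  exact: leq_trunc_div.
rewrite -mulr_sumr ler_wpM2l //.
suff -> : \sum_(1 <= k < n.+1) q%:R ^- k = (1 - q%:R ^- n) / (q%:R - 1) :> R.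
  apply: ler_piMl; first by rewrite invr_ge0 subr_ge0 ltW.
  by rewrite gerBl invr_ge0 exprn_ge0 // ltW.
elim: n => [|n ih]; first by rewrite big_geq // expr0 invr1 subrr mul0r.
rewrite big_nat_recr //= ih exprS; field.
  by repeat (apply/andP; split); rewrite ?expf_neq0 //; apply: lt0r_neq0; lra.
Qed.

(** In ln n! the prime q has exponent at most n / (q - 1), that is n / q + n / (q (q - 1)). The
    second parts cost at most 2 n by [ln_over_pairs], and ln n! >= n ln n - n costs another n; hence
    the constant 3. *)
Lemma Aq_lower n : (0 < n)%N -> lnn n - 3 <= Aq n.+1.
Proof.
move=> n0; have n0' : 0 < n%:R :> R by rewrite ltr0n.
suff : n%:R * lnn n - n%:R <= n%:R * (Aq n.+1 + 2).
  have -> : n%:R * lnn n - n%:R = n%:R * (lnn n - 1) by rewrite mulrBr mulr1.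
  rewrite ler_pM2l //; lra.
apply: le_trans (lnfact_ge n) _.
rewrite (@ln_decomp n`! (n.+1 + n`!)) ?fact_gt0 //; last by rewrite addSn ltnS leq_addl.
rewrite (big_cat_nat (n := n.+1)) ?leq_addr //=.
rewrite [X in _ + X]big_nat_cond [X in _ + X]big1 ?addr0; last first.
  move=> q /andP[/andP[nq _] pq]; suff -> : logn q n`! = 0%N by rewrite mul0r.
  apply/eqP; rewrite -leqn0 leqNgt logn_gt0 mem_primes pq fact_gt0 /=.
  by apply/negP => /(prime_dvd_fact pq); rewrite leqNgt nq.
apply: (@le_trans _ _ (\sum_(0 <= q < n.+1 | prime q) n%:R * (lnn q / q%:R + lnn q / (q%:R * (q%:R - 1))))).
  apply: ler_sum => q pq; apply: le_trans (ler_wpM2r (lnn_ge0 _) (logn_fact_le n pq)) _.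
  have q1 : 1 < q%:R :> R by rewrite ltr1n prime_gt1.
  rewrite le_eqVlt; apply/orP; left; apply/eqP; field.
  by apply/andP; split; apply: lt0r_neq0; lra.
rewrite -mulr_sumr ler_pM2l // big_split /= lerD2l.
apply: le_trans (ln_over_pairs n.-1); rewrite prednK //.
rewrite big_mkcond /= big_ltn // big_ltn // add0r add0r.
apply: (@le_trans _ _ (\sum_(2 <= q < n.+1) lnn q / (q%:R * (q%:R - 1)))).
  rewrite big_nat_cond [leRHS]big_nat_cond; apply: ler_sum => -[|[|q]] //= _.
  case: ifP => // _; rewrite divr_ge0 ?lnn_ge0 // mulr_ge0 // -natr1 addrK //.
by [].
Qed.

Definition Rq m : R := Aq m - lnn m.
Definition CR : R := 3 * lnn 4 + 4.

Lemma CR_ge0 : 0 <= CR. Proof. by rewrite addr_ge0 // mulr_ge0 // lnn_ge0. Qed.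

Lemma Rq_bound m : (1 < m)%N -> `|Rq m| <= CR.
Proof.
case: m => [|[|n]] // _; have := Aq_upper (ltn0Sn n); have := Aq_lower (ltn0Sn n).
have := @lnnS n.+1 isT; have := @lnn_le n.+1 n.+2 isT (leqnSn _).
have : n.+1%:R^-1 <= 1 :> R by rewrite invf_le1 // ler1n.
have := lnn_ge0 4; rewrite ler_norml /Rq /CR.
move: (lnn 4) (n.+1%:R^-1 : R) (lnn n.+1) (lnn n.+2) (Aq n.+2) => x y z t u.
by move=> *; apply/andP; split; lra.
Qed.

(** Working with - ln(1 - 1/q) instead of 1/q makes [Tq] exactly the exponent that the factors (1 -
    1/q)^z remove from the Euler product. *)
Definition tq n : R := - ln (1 - n%:R^-1).

Lemma tq_bounds n : (1 < n)%N -> n%:R^-1 <= tq n <= n%:R^-1 + (n%:R * (n%:R - 1))^-1.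
Proof.
move=> n1; have h : 1 < n%:R :> R by rewrite ltr1n.
have n0 : 0 < n%:R :> R by lra.
have i1 : 0 < n%:R^-1 :> R by rewrite invr_gt0.
have i2 : n%:R^-1 < 1 :> R by rewrite invf_lt1.
rewrite /tq; apply/andP; split.
  by have := @ln_le_sub1 (1 - n%:R^-1); rewrite subr_gt0 => /(_ i2); lra.
rewrite -lnV ?posrE ?subr_gt0 //; apply: le_trans (ln_le_sub1 _) _.
  by rewrite invr_gt0 subr_gt0.
rewrite le_eqVlt; apply/orP; left; apply/eqP; field.
by apply/andP; split; apply: lt0r_neq0; lra.
Qed.

Definition Tq m : R := \sum_(0 <= q < m | prime q) tq q.
Lemma TqS i : Tq i.+1 = Tq i + (if prime i then tq i else 0).
Proof. by rewrite /Tq big_mkcond big_nat_recr //= -big_mkcond. Qed.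
Lemma AqS i : Aq i.+1 = Aq i + (if prime i then lnn i / i%:R else 0).
Proof. by rewrite /Aq big_mkcond big_nat_recr //= -big_mkcond. Qed.
Definition Dq m : R := Tq m - ln (lnn m).

(** With x = ln i and y = ln(i + 1), the quantity ln y - ln x lies between (y - x) / y and (y - x) /
    x. These differ by (y - x)^2 / (x y), which is at most the telescoping 1 / x - 1 / y since y - x
    <= 1. *)
Lemma ln_lnS i : (1 < i)%N ->
  0 <= (lnn i.+1 - lnn i) / lnn i - (ln (lnn i.+1) - ln (lnn i)) <= (lnn i)^-1 - (lnn i.+1)^-1.
Proof.
move=> i1; have l0 := lnn_gt0 i1; have l1 := @lnn_gt0 i.+1 (ltnW i1).
have l01 : lnn i <= lnn i.+1 by apply: lnn_le; lia.
have d1 : lnn i.+1 - lnn i <= 1.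
  by apply: le_trans (lnnS (ltnW i1)) _; rewrite invf_le1 ?ltr0n ?ler1n // ltnW.
move: (lnn i) (lnn i.+1) l0 l1 l01 d1 => x y x0 y0 xy d1.
have h1 : ln y - ln x <= (y - x) / x.
  rewrite -ln_div ?posrE //; apply: le_trans (ln_le_sub1 (divr_gt0 y0 x0)) _.
  by rewrite mulrBl divff // gt_eqF.
have h2 : (y - x) / y <= ln y - ln x.
  have : ln x - ln y <= x / y - 1.
    by rewrite -ln_div ?posrE //; apply: ln_le_sub1 (divr_gt0 x0 y0).
  by rewrite mulrBl divff ?gt_eqF //; lra.
have -> : x^-1 - y^-1 = (y - x) / (x * y) by field; rewrite !gt_eqF.
have e : (y - x) / x - (y - x) / y = (y - x) * ((y - x) / (x * y)) by field; rewrite !gt_eqF.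
have : (y - x) * ((y - x) / (x * y)) <= (y - x) / (x * y).
  by rewrite ler_piMl // divr_ge0 ?subr_ge0 // mulr_ge0 // ltW.
by move=> h3; apply/andP; split; lra.
Qed.

(** Partial summation one step at a time: [Tq] grows by the increment of [Aq] over ln i, and [Aq] is
    ln plus the bounded [Rq]. The main terms cancel against ln ln, and all errors are bounded by
    telescoping differences. *)
Lemma Dq_step i : (1 < i)%N ->
  `|(Dq i.+1 - Dq i) - (Rq i.+1 / lnn i.+1 - Rq i / lnn i)| <=
  (i.-1%:R^-1 - i%:R^-1) + (CR + 1) * ((lnn i)^-1 - (lnn i.+1)^-1).
Proof.
move=> i1; have := ln_lnS i1; have := Rq_bound (ltnW i1 : 1 < i.+1)%N.
have l0 := lnn_gt0 i1; have l1 := @lnn_gt0 i.+1 (ltnW i1).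
have i0 : 0 < i%:R :> R by rewrite ltr0n ltnW.
have ip : i.-1%:R = i%:R - 1 :> R by rewrite -subn1 natrB // ltnW.
have i1' : 0 < i%:R - 1 :> R by rewrite subr_gt0 ltr1n.
have e1 : i.-1%:R^-1 - i%:R^-1 = (i%:R * (i%:R - 1))^-1 :> R.
  by rewrite ip; field; rewrite !gt_eqF.
have dinv : 0 <= (lnn i)^-1 - (lnn i.+1)^-1.
  by rewrite subr_ge0 lef_pV2 ?posrE // lnn_le // ltnW.
have hD : exists2 t : R, 0 <= t <= (i%:R * (i%:R - 1))^-1 &
   Tq i.+1 - Tq i = (Aq i.+1 - Aq i) / lnn i + t.
  rewrite TqS AqS ![_ + (if _ then _ else _)]addrC !addrK; case: ifP => pi.
    exists (tq i - i%:R^-1); first by have := tq_bounds i1; lra.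
    by field; rewrite !gt_eqF.
  by exists 0; rewrite ?lexx ?invr_ge0 ?mulr_ge0 ?(ltW i0) ?(ltW i1') // mul0r addr0.
case: hD => t ht hD hR hl; rewrite e1 /Dq.
have -> : Tq i.+1 - ln (lnn i.+1) - (Tq i - ln (lnn i)) - (Rq i.+1 / lnn i.+1 - Rq i / lnn i) =
  t + (((lnn i.+1 - lnn i) / lnn i - (ln (lnn i.+1) - ln (lnn i))) + Rq i.+1 * ((lnn i)^-1 - (lnn i.+1)^-1)).
  transitivity ((Tq i.+1 - Tq i) - (ln (lnn i.+1) - ln (lnn i)) - (Rq i.+1 / lnn i.+1 - Rq i / lnn i)); first by ring.
  rewrite hD /Rq; ring.
apply: le_trans (ler_normD _ _) _; apply: lerD; first by rewrite ger0_norm; lra.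
rewrite [leRHS]mulrDl mul1r addrC; apply: le_trans (ler_normD _ _) _; apply: lerD.
  rewrite normrM (ger0_norm dinv) ler_wpM2r //.
by rewrite ger0_norm; lra.
Qed.

(** The constant collects CR twice from the end values of Rq / ln, CR + 1 from the differences of 1
    / ln, and 1 from 1 / (m - 1) <= 1 / ln m. *)
Lemma Dq_cauchy m n : (1 < m)%N -> (m <= n)%N ->
  `|Dq n - Dq m| <= (3 * CR + 2) / lnn m.
Proof.
move=> m1 mn; pose U i := Rq i / lnn i.
have h : `|(Dq n - Dq m) - (U n - U m)| <=
   (m.-1%:R^-1 - n.-1%:R^-1) + (CR + 1) * ((lnn m)^-1 - (lnn n)^-1).
  rewrite -(subnKC mn); elim: (n - m)%N => [|d ih].
    by rewrite addn0 !subrr normr0 mulr0 addr0.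
  rewrite addnS; set i := (m + d)%N in ih *.
  have i1 : (1 < i)%N by rewrite (leq_trans m1) // leq_addr.
  have := Dq_step i1; rewrite -/(U i.+1) -/(U i) => h2.
  have -> : Dq i.+1 - Dq m - (U i.+1 - U m) = (Dq i - Dq m - (U i - U m)) + (Dq i.+1 - Dq i - (U i.+1 - U i)) by ring.
  apply: le_trans (ler_normD _ _) _; apply: le_trans (lerD ih h2) _.
  by rewrite le_eqVlt; apply/orP; left; apply/eqP; rewrite /=; ring.
have l0 := lnn_gt0 m1; have l1 := lnn_gt0 (leq_trans m1 mn).
have lmn := lnn_le (ltnW m1) mn.
have iv : (lnn n)^-1 <= (lnn m)^-1 by rewrite lef_pV2 ?posrE.
have hU k : (1 < k)%N -> `|U k| <= CR / lnn k.
  by move=> k1; rewrite normrM normfV (gtr0_norm (lnn_gt0 k1)) ler_wpM2r ?invr_ge0 ?lnn_ge0 // Rq_bound.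
have hm := hU _ m1; have hn := hU _ (leq_trans m1 mn).
have hn' : CR / lnn n <= CR / lnn m by rewrite ler_wpM2l // CR_ge0.
have hm1 : m.-1%:R^-1 <= (lnn m)^-1.
  have mp : (0 < m.-1)%N by rewrite -ltnS prednK // ltnW.
  rewrite lef_pV2 ?posrE ?ltr0n //.
  apply: le_trans (ln_le_sub1 _) _; first by rewrite ltr0n ltnW.
  by rewrite -subn1 natrB // ltnW.
have h3 : 0 <= (lnn n)^-1 by rewrite invr_ge0 lnn_ge0.
have h4 : 0 <= n.-1%:R^-1 :> R by rewrite invr_ge0.
have -> : Dq n - Dq m = (Dq n - Dq m - (U n - U m)) + (U n - U m) by ring.
apply: le_trans (ler_normD _ _) _; apply: le_trans (lerD h (ler_normB _ _)) _.
apply: le_trans (lerD (lexx _) (lerD hn hm)) _.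
have CR1 : 0 <= CR + 1 by rewrite addr_ge0 // CR_ge0.
have := ler_wpM2l CR1 (_ : (lnn m)^-1 - (lnn n)^-1 <= (lnn m)^-1).
rewrite gerBl h3 => /(_ isT); lra.
Qed.

Lemma ln_dvg (A : R) : \forall n \near \oo, A <= lnn n.
Proof.
exists (Num.truncn (expR A)).+1 => // n /= hn.
rewrite -[leLHS]expRK ler_ln ?posrE ?expR_gt0 //.
  by apply: ltW; apply: lt_le_trans (truncnS_gt _) _; rewrite ler_nat.
by rewrite ltr0n (leq_trans _ hn).
Qed.

Lemma cvg_div_ln (C : R) : C / lnn n @[n --> \oo] --> 0.
Proof.
apply/cvgr0Pnorm_le => e e0; near=> n.
have h : `|C| / e + 1 <= lnn n by near: n; apply: ln_dvg.
have c0 : 0 <= `|C| / e by rewrite divr_ge0 // ltW.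
have l0 : 0 < lnn n by lra.
rewrite normrM normfV (gtr0_norm l0) ler_pdivrMr // mulrC -ler_pdivrMr //; lra.
Unshelve. all: by end_near. Qed.

Lemma Dq_cvg : exists B, Dq n @[n --> \oo] --> B /\
  forall m, (1 < m)%N -> `|Dq m - B| <= (3 * CR + 2) / lnn m.
Proof.
by apply: (cauchy_rate (e := fun m => (3 * CR + 2) / lnn m)); [exact: Dq_cauchy|exact: cvg_div_ln].
Qed.
End Mertens.

Ltac glra := repeat (match goal with
  | |- context [@ln ?R ?x] => move: (@ln R x) => ?
  | |- context [@GRing.inv ?R ?x] => move: (@GRing.inv R x) => ? end); intros; lra.

(** * Euler's constant in Mertens' theorem *)

Section MertensConstant.
Variable R : realType.
Local Notation lnn n := (ln (n%:R : R)).

Definition Hn n : R := \sum_(1 <= j < n.+1) j%:R^-1.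

Lemma lnnS_ge n : (0 < n)%N -> n.+1%:R^-1 <= lnn n.+1 - lnn n.
Proof.
move=> n0; have n0' : 0 < n%:R :> R by rewrite ltr0n.
have h : lnn n - lnn n.+1 <= n%:R / n.+1%:R - 1.
  rewrite -ln_div ?posrE ?ltr0n //; apply: ln_le_sub1.
  by rewrite divr_gt0 ?ltr0n.
have e : n%:R / n.+1%:R - 1 = - n.+1%:R^-1 :> R.
  have -> : n%:R = n.+1%:R - 1 :> R by rewrite -natr1 addrK.
  by rewrite mulrBl divff ?gt_eqF ?ltr0n // mul1r addrAC subrr add0r.
by rewrite -lerN2 opprB -e.
Qed.

Lemma HnS n : Hn n.+1 = Hn n + n.+1%:R^-1.
Proof. by rewrite /Hn big_nat_recr. Qed.

(** H_n - ln n decreases and H_n - ln(n + 1) increases, and the two differ by at most 1 / n. *)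
Lemma gamma_bounds n : (0 < n)%N ->
  euler_gamma R <= Hn n - lnn n <= euler_gamma R + n%:R^-1.
Proof.
move=> n0; pose u k : R := Hn k.+1 - lnn k.+1; pose v k : R := Hn k.+1 - lnn k.+2.
have ud k : u k.+1 <= u k.
  by rewrite /u HnS; have := @lnnS_ge k.+1 isT; glra.
have vi k : v k <= v k.+1.
  by rewrite /v [Hn k.+2]HnS; have := @lnnS R k.+2 isT; glra.
have vu k : v k <= u k by rewrite /v /u lerD2l lerN2 lnn_le.
have udec m k : u (m + k)%N <= u m.
  by elim: k => [|k ih]; rewrite ?addn0 // addnS (le_trans (ud _)).
have vinc m k : v m <= v (m + k)%N.
  by elim: k => [|k ih]; rewrite ?addn0 // addnS (le_trans ih).
have ucvg : cvgn u.
  apply: nonincreasing_is_cvgn; first by apply/nonincreasing_seqP.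
  by exists (v 0%N) => _ [k _ <-]; apply: le_trans (vu k); apply: (vinc 0%N k).
have eg : euler_gamma R = limn u.
  apply: cvg_lim => //; rewrite -(cvg_shiftS _).
  exact: ucvg.
have hu : u k @[k --> \oo] --> euler_gamma R by rewrite eg.
case: n n0 => // m _; apply/andP; split.
  apply: (cvg_bound (m0 := m) hu) => k mk; rewrite -(subnKC mk); exact: udec.
have : - euler_gamma R <= - v m.
  have hNu : (fun k => - u k) @ \oo --> - euler_gamma R by apply: cvgN.
  apply: (cvg_bound (m0 := m) hNu) => k mk; rewrite lerN2.
  by apply: le_trans (vu k); rewrite -(subnKC mk); exact: vinc.
by rewrite lerN2 /v; have := @lnnS R m.+1 isT; glra.
Qed.

(* Abel summation compares sum_q tq(q) q^(-sg), which is log zeta(1 + sg) up to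
   O(sg), with sum_j 2^(-sg j) / j = - log(1 - 2^(-sg)); this identifies the
   constant in Mertens' theorem as Euler's constant. *)
Definition bcmp m : R := \sum_(1 <= j < m.+1) (if (2 ^ j)%N == m then j%:R^-1 else 0).
Definition Bcmp M : R := \sum_(0 <= m < M) bcmp m.

Lemma bcmp_ge0 m : 0 <= bcmp m.
Proof. by apply: sumr_ge0 => j _; case: ifP => _ //; rewrite invr_ge0. Qed.

Lemma sum_bcmp (f : nat -> R) J : (0 < J)%N ->
  \sum_(0 <= m < 2 ^ J) bcmp m * f m = \sum_(1 <= j < J) j%:R^-1 * f (2 ^ j)%N.
Proof.
move=> J0; transitivity (\sum_(0 <= m < 2 ^ J) \sum_(1 <= j < J) (if (2 ^ j)%N == m then j%:R^-1 * f m else 0)).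
  rewrite big_nat_cond [RHS]big_nat_cond; apply: eq_bigr => m /andP[/andP[_ mJ] _].
  rewrite /bcmp mulr_suml.
  have -> : \sum_(1 <= i < m.+1) (if (2 ^ i)%N == m then i%:R^-1 else 0) * f m =
    \sum_(1 <= i < m.+1) (if (2 ^ i)%N == m then i%:R^-1 * f m else 0).
    by apply: eq_bigr => i _; case: ifP => // _; rewrite mul0r.
  pose K := (m.+1 + J)%N.
  have h L : (L <= K)%N -> (forall j, (L <= j)%N -> (0 < j)%N -> (2 ^ j)%N != m) -> (0 < L)%N ->
    \sum_(1 <= i < L) (if (2 ^ i)%N == m then i%:R^-1 * f m else 0) =
    \sum_(1 <= i < K) (if (2 ^ i)%N == m then i%:R^-1 * f m else 0).
    move=> LK hL L0; rewrite [RHS](big_cat_nat (n := L)) //= [X in _ + X]big_nat_cond [X in _ + X]big1 ?addr0 //.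
    by move=> i /andP[/andP[Li _] _]; rewrite (negbTE (hL _ Li _)) // (leq_trans L0).
  rewrite h ?leq_addr // ?h ?leq_addl // => j hj j0.
    by apply/eqP => e; move: mJ; rewrite -e ltn_exp2l // ltnNge hj.
  by apply/eqP => e; move: hj; rewrite -e leqNgt ltnS ltnW // ltn_expl.
rewrite exchange_big /= big_nat_cond [RHS]big_nat_cond; apply: eq_bigr => j /andP[/andP[j1 jJ] _].
have jl : (2 ^ j < 2 ^ J)%N by rewrite ltn_exp2l.
rewrite big_mkord (bigD1 (Ordinal jl)) //= eqxx big1 ?addr0 // => i.
by rewrite -val_eqE /= eq_sym => /negbTE ->.
Qed.

Lemma Bcmp_pow J : Bcmp (2 ^ J.+1) = Hn J.
Proof.
rewrite /Bcmp /Hn; have := @sum_bcmp (fun _ => 1) J.+1 isT.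
under eq_bigr do rewrite mulr1. move=> ->.
by under eq_bigr do rewrite mulr1.
Qed.

Lemma Bcmp_mono m n : (m <= n)%N -> Bcmp m <= Bcmp n.
Proof.
by move=> mn; rewrite /Bcmp [leRHS](big_cat_nat (n := m)) //= lerDl sumr_ge0 // => i _; apply: bcmp_ge0.
Qed.

Lemma ln2_gt0 : 0 < lnn 2. Proof. exact: lnn_gt0. Qed.

(** [Bcmp m] lies between H_(J-1) and H_J, while ln m / ln 2 lies between J and J + 1, so that its
    logarithm is within 1 / J of ln J. *)
Lemma Bcmp_bound J m : (0 < J)%N -> (2 ^ J <= m < 2 ^ J.+1)%N ->
  `|Bcmp m - (ln (lnn m) - ln (lnn 2) + euler_gamma R)| <= 2 / J%:R.
Proof.
move=> J0 /andP[h1 h2]; have l2 := ln2_gt0.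
have m0 : (0 < m)%N by apply: leq_trans h1; rewrite expn_gt0.
have J0' : 0 < J%:R :> R by rewrite ltr0n.
have hu : Bcmp m <= Hn J by rewrite -Bcmp_pow; apply: Bcmp_mono; apply: ltnW.
have hl : Hn J.-1 <= Bcmp m by rewrite -Bcmp_pow; apply: Bcmp_mono; rewrite prednK.
have hJ : Hn J = Hn J.-1 + J%:R^-1 by rewrite -[in LHS](prednK J0) HnS prednK.
have := gamma_bounds J0.
have hlm : J%:R * lnn 2 <= lnn m by rewrite -lnnX // lnn_le // expn_gt0.
have hlm2 : lnn m <= J.+1%:R * lnn 2 by rewrite -lnnX // lnn_le // ltnW.
have lm0 : 0 < lnn m by apply: lt_le_trans hlm; rewrite mulr_gt0.
have h3 : lnn J + ln (lnn 2) <= ln (lnn m).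
  by rewrite -lnM ?posrE // ler_ln ?posrE ?mulr_gt0.
have h4 : ln (lnn m) <= lnn J.+1 + ln (lnn 2).
  by rewrite -lnM ?posrE ?ltr0n // ler_ln ?posrE ?mulr_gt0 ?ltr0n.
have := @lnnS R J J0; move=> h5 /andP[h6 h7]; rewrite ler_norml; apply/andP; split; lra.
Qed.

Section Sigma.
Variable sg : R.
Hypothesis sg0 : 0 < sg.

Definition wt n : R := expR (- (sg * lnn n)).
Definition gz n : R := wt n / n%:R.

Lemma wt_gt0 n : 0 < wt n. Proof. exact: expR_gt0. Qed.
Lemma wt_le1 n : wt n <= 1.
Proof. by rewrite /wt expR_le1 oppr_le0 mulr_ge0 ?lnn_ge0 // ltW. Qed.
Lemma wt1 : wt 1 = 1. Proof. by rewrite /wt ln1 mulr0 oppr0 expR0. Qed.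
Lemma wt_mono m n : (0 < m)%N -> (m <= n)%N -> wt n <= wt m.
Proof. by move=> m0 mn; rewrite /wt ler_expR lerN2 ler_pM2l // lnn_le. Qed.
Lemma wt_ge n : 1 - sg * lnn n <= wt n.
Proof. by rewrite /wt; apply: le_trans (expR_ge1Dx _). Qed.

Lemma gz_gt0 n : (0 < n)%N -> 0 < gz n.
Proof. by move=> n0; rewrite divr_gt0 ?wt_gt0 ?ltr0n. Qed.
Lemma wtM p n : (0 < p)%N -> (0 < n)%N -> wt (p * n) = wt p * wt n.
Proof. by move=> p0 n0; rewrite /wt lnnM // mulrDr opprD expRD. Qed.
Lemma gzM p n : prime p -> (0 < n)%N -> gz (p * n)%N = gz p * gz n.
Proof. by move=> /prime_gt0 p0 n0; rewrite /gz wtM // natrM invfM mulrACA. Qed.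
Lemma gz_lt1 p : prime p -> gz p < 1.
Proof.
move=> pp; have p1 := prime_gt1 pp; rewrite /gz ltr_pdivrMr ?ltr0n ?prime_gt0 // mul1r.
by apply: le_lt_trans (wt_le1 _) _; rewrite ltr1n.
Qed.

(** Comparison with the integral of t^(-1 - sg), in the discrete form n^(-sg) - (n + 1)^(-sg) <= sg
    n^(-1 - sg). Together with [gz_upper] it places zeta(1 + sg) between 1 / sg and 1 + 1 / sg. *)
Lemma gz_lower M : (0 < M)%N -> (1 - wt M) / sg <= \sum_(1 <= n < M) gz n.
Proof.
case: M => // M _; rewrite ler_pdivrMr //; elim: M => [|M ih].
  by rewrite wt1 subrr big_geq // mul0r.
rewrite big_nat_recr //= mulrDl.
suff : wt M.+1 - wt M.+2 <= gz M.+1 * sg by lra.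
have d := @lnnS R M.+1 isT; have w0 := wt_gt0 M.+1.
have -> : wt M.+2 = wt M.+1 * expR (- (sg * (lnn M.+2 - lnn M.+1))).
  by rewrite /wt -expRD; congr expR; ring.
have h := expR_ge1Dx (- (sg * (lnn M.+2 - lnn M.+1))).
apply: (@le_trans _ _ (wt M.+1 * (sg * (lnn M.+2 - lnn M.+1)))).
  have := ler_wpM2l (ltW w0) h; rewrite mulrDr mulr1; move: (expR _) (wt _) => x y; glra.
by rewrite /gz -mulrA ler_pM2l // mulrC ler_pM2r.
Qed.

Lemma gz_upper M : \sum_(1 <= n < M) gz n <= 1 + sg^-1.
Proof.
suff h : \sum_(1 <= n < M.+2) gz n <= 1 + (1 - wt M.+1) / sg.
  apply: (@le_trans _ _ (\sum_(1 <= n < M.+2) gz n)).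
    case: M {h} => [|M]; first by rewrite big_geq // big_nat1 ltW ?gz_gt0.
    rewrite [leRHS]big_nat_recr //= [X in _ <= X + _]big_nat_recr //= -addrA lerDl.
    by rewrite addr_ge0 // ltW // gz_gt0.
  apply: le_trans h _; rewrite lerD2l ler_pdivrMr // mulVf ?gt_eqF //.
  by rewrite gerBl ltW ?wt_gt0.
elim: M => [|M ih]; first by rewrite big_nat1 /gz wt1 divr1 subrr mul0r addr0.
rewrite big_nat_recr //=.
suff : gz M.+2 <= (wt M.+1 - wt M.+2) / sg by move: ih; rewrite !mulrBl; lra.
rewrite ler_pdivlMr //; have d := @lnnS_ge M.+1 isT; have w0 := wt_gt0 M.+2.
have -> : wt M.+1 = wt M.+2 * expR (sg * (lnn M.+2 - lnn M.+1)).
  by rewrite /wt -expRD; congr expR; ring.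
have h := expR_ge1Dx (sg * (lnn M.+2 - lnn M.+1)).
apply: (@le_trans _ _ (wt M.+2 * (sg * (lnn M.+2 - lnn M.+1)))).
  by rewrite /gz -mulrA ler_pM2l // mulrC ler_pM2l.
have := ler_wpM2l (ltW w0) h; rewrite mulrDr mulr1; move: (expR _) (wt _) => x y; glra.
Qed.

Definition Qz M : R := \sum_(0 <= q < M | prime q) - ln (1 - gz q).

Lemma Qz_smcvg M : (1 < M)%N -> smcvg gz M xpredT (expR (Qz M)).
Proof.
case: M => [|[|M]] // _; elim: M => [|M ih].
  rewrite /Qz big_mkcond big_ltn // big_ltn // big_geq //= !addr0 expR0 /smcvg /sms.
  apply: cvg_near_cst; exists 2%N => // N /= N2.
  rewrite big_mkcond big_ltn // /= /gz wt1 divr1 big_nat_cond big1 ?addr0 // => n /andP[/andP[n2 _] _].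
  by rewrite andbT max_pdiv_lt2 ?(ltnW n2) // gtn_eqF.
have QS : Qz M.+3 = Qz M.+2 + (if prime M.+2 then - ln (1 - gz M.+2) else 0).
  by rewrite /Qz big_mkcond big_nat_recr //= -big_mkcond.
rewrite QS; case: ifP => pM; last first.
  rewrite addr0; apply: eq_smcvg ih => n n0; rewrite !andbT.
  by rewrite [RHS]max_pdiv_nprime // pM.
have := smcvg_total gz_gt0 gzM gz_lt1 pM ih.
by rewrite expRD expRN lnK // posrE subr_gt0 gz_lt1.
Qed.

Lemma Qz_upper M : (1 < M)%N -> Qz M <= ln (1 + sg^-1).
Proof.
move=> M1; rewrite -[leLHS]expRK ler_ln ?posrE ?expR_gt0 ?addr_gt0 ?invr_gt0 //.
apply: (cvg_bound (m0 := 0%N) (Qz_smcvg M1)) => N _; apply: le_trans (gz_upper N).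
rewrite /sms big_mkcond /= big_nat_cond [leRHS]big_nat_cond; apply: ler_sum => n /andP[/andP[n0 _] _].
by case: ifP => // _; apply/ltW/gz_gt0.
Qed.

(** Every n < M has all its prime factors below M, so the product over q < M dominates the plain
    partial sum. *)
Lemma Qz_lower M : (1 < M)%N -> ln ((1 - wt M) / sg) <= Qz M.
Proof.
move=> M1; have w1 : wt M < 1.
  by rewrite /wt expR_lt1 oppr_lt0 mulr_gt0 // lnn_gt0.
rewrite -[leRHS]expRK ler_ln ?posrE ?expR_gt0 ?divr_gt0 ?subr_gt0 //.
apply: le_trans (gz_lower (ltnW M1)) _; apply: le_trans (smcvg_le gz_gt0 M (Qz_smcvg M1)).
rewrite /sms le_eqVlt; apply/orP; left; apply/eqP.
rewrite big_nat_cond [RHS]big_nat_cond; apply: eq_bigl => n; rewrite !andbT.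
case: (boolP ((0 < n)%N && (n < M)%N)) => //= /andP[n0 nM].
by apply/esym; apply: leq_ltn_trans nM; apply: max_pdiv_leq.
Qed.

(** Put u = 1 / q and w = q^(-sg). The lower bound is concavity of ln at 1 - w u = w (1 - u) + (1 -
    w). For the upper bound, tangent estimates leave (1 - w) (1 / (q - 1) - 1 / q), and 1 - w <= sg
    ln q. *)
Lemma tq_wt q : (1 < q)%N ->
  0 <= tq R q * wt q - - ln (1 - gz q) <= sg * (lnn q / (q%:R * (q%:R - 1))).
Proof.
move=> q1; have := tq_bounds R q1; rewrite /gz /tq.
have w0 := wt_gt0 q; have w1 := wt_le1 q; have wg := wt_ge q.
have h : 1 < q%:R :> R by rewrite ltr1n.
have qq : q%:R * q%:R^-1 = 1 :> R by rewrite divff // gt_eqF // (lt_trans _ h).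
move: (wt q) (q%:R : R) (lnn q) w0 w1 wg h qq => w x l w0 w1 wg x1 qq /andP[t1 t2].
have x0 : 0 < x by lra.
have u0 : 0 < x^-1 by rewrite invr_gt0.
have u1 : x^-1 < 1 by rewrite invf_lt1.
have A0 : 0 < 1 - w / x.
  by rewrite subr_gt0 ltr_pdivrMr // mul1r; lra.
have B0 : 0 < 1 - x^-1 by rewrite subr_gt0.
have h1 : w * (ln (1 - x^-1) - ln (1 - w / x)) <= w * ((1 - x^-1) / (1 - w / x) - 1).
  by rewrite ler_pM2l // -ln_div ?posrE //; apply: ln_le_sub1; rewrite divr_gt0.
have h2 : (1 - w) * (- ln (1 - w / x)) <= (1 - w) * ((1 - w / x)^-1 - 1).
  by rewrite ler_wpM2l ?subr_ge0 // -lnV ?posrE //; apply: ln_le_sub1; rewrite invr_gt0.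
have h3 : w * ((1 - x^-1) / (1 - w / x) - 1) + (1 - w) * ((1 - w / x)^-1 - 1) = 0.
  by field; apply/andP; split; apply: lt0r_neq0 => //; move: A0; rewrite -(pmulr_rgt0 _ x0) mulrBr mulr1 mulrCA divff ?gt_eqF // mulr1.
have h4 : ln (1 - w / x) - ln (1 - x^-1) <= (1 - w / x) / (1 - x^-1) - 1.
  by rewrite -ln_div ?posrE //; apply: ln_le_sub1; rewrite divr_gt0.
have h5 : (1 - w / x) / (1 - x^-1) - 1 = (1 - w) * (x - 1)^-1.
  by field; apply/andP; split; apply: lt0r_neq0; lra.
have h6 : (1 - w) * (x^-1) <= (1 - w) * (- ln (1 - x^-1)) by rewrite ler_wpM2l // subr_ge0.
have h7 : (1 - w) * (x - 1)^-1 - (1 - w) * x^-1 = (1 - w) * (x * (x - 1))^-1.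
  by field; apply/andP; split; apply: lt0r_neq0; lra.
have h8 : (1 - w) * (x * (x - 1))^-1 <= sg * (l / (x * (x - 1))).
  rewrite mulrA ler_wpM2r ?invr_ge0 ?mulr_ge0 //; lra.
by apply/andP; split; lra.
Qed.

Definition PT M : R := \sum_(0 <= q < M | prime q) tq R q * wt q.

Lemma PT_Qz M : Qz M <= PT M <= Qz M + 2 * sg.
Proof.
have e : PT M - Qz M = \sum_(0 <= q < M | prime q) (tq R q * wt q - - ln (1 - gz q)).
  by rewrite /PT /Qz -sumrB.
have h0 : 0 <= PT M - Qz M.
  by rewrite e; apply: sumr_ge0 => q pq; case/andP: (tq_wt (prime_gt1 pq)).
suff : PT M - Qz M <= 2 * sg by move=> h; apply/andP; split; lra.
rewrite e mulrC; apply: le_trans (ler_wpM2l (ltW sg0) (ln_over_pairs R M)); rewrite mulr_sumr.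
apply: (@le_trans _ _ (\sum_(0 <= q < M.+2 | prime q) (sg * (lnn q / (q%:R * (q%:R - 1)))))).
  rewrite [leRHS](big_cat_nat (n := M)) //=; last by rewrite ltnW.
  rewrite -[leLHS]addr0; apply: lerD.
    by apply: ler_sum => q pq; case/andP: (tq_wt (prime_gt1 pq)).
  apply: sumr_ge0 => q pq; rewrite mulr_ge0 ?divr_ge0 ?lnn_ge0 ?(ltW sg0) ?mulr_ge0 // subr_ge0 ler1n.
  exact: prime_gt0.
rewrite big_mkcond /= big_ltn // big_ltn // !add0r.
rewrite big_nat_cond [leRHS]big_nat_cond; apply: ler_sum => q /andP[/andP[q1 _] _].
case: ifP => // _; rewrite mulr_ge0 ?divr_ge0 ?lnn_ge0 ?(ltW sg0) ?mulr_ge0 // subr_ge0 ler1n.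
exact: ltnW.
Qed.

(** The weights decrease from 1. From m0 on, S stays within e of l; before m0 only the weight 1 -
    wt(m0) is spent, which is small when [sg] is small compared with 1 / ln m0. *)
Lemma abel_bound (S : nat -> R) l e C m0 M : (0 < m0)%N -> (m0 <= M)%N ->
  S 1%N = 0 -> (forall m, (m0 <= m)%N -> `|S m - l| <= e) -> (forall m, (0 < m)%N -> `|S m - l| <= C) ->
  `|\sum_(1 <= m < M) (S m.+1 - S m) * wt m - l| <= 2 * e + C * (1 - wt m0).
Proof.
move=> m00 m0M S1 hS hC; pose a m := S m - l.
have M0 : (0 < M)%N by apply: leq_trans m0M.
have -> : \sum_(1 <= m < M) (S m.+1 - S m) * wt m - l =
   a M * wt M + \sum_(1 <= m < M) a m.+1 * (wt m - wt m.+1).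
  case: (M) M0 => // n _; elim: n => [|n ih].
    by rewrite !big_geq // wt1 /a S1 mulr1 addr0 add0r.
  rewrite big_nat_recr // [in RHS]big_nat_recr //= addrAC ih /a; ring.
have e0 : 0 <= e by apply: le_trans (hS m0 (leqnn _)).
have C0 : 0 <= C by apply: le_trans (hC m0 m00).
have dw m : (0 < m)%N -> 0 <= wt m - wt m.+1 by move=> m1; rewrite subr_ge0 wt_mono.
have tel i j : (i <= j)%N -> \sum_(i <= m < j) (wt m - wt m.+1) = wt i - wt j.
  by move=> ij; rewrite (@telescope_sumr_eq _ _ _ (fun k => - wt k)) // => [|k _]; rewrite opprK addrC.
have -> : 2 * e + C * (1 - wt m0) = e + (e + C * (1 - wt m0)) by ring.
apply: le_trans (ler_normD _ _) _; apply: lerD.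
  rewrite normrM (gtr0_norm (wt_gt0 _)); apply: le_trans (hS _ m0M).
  by rewrite ler_piMr ?wt_le1.
rewrite (big_cat_nat (n := m0)) //= addrC; apply: le_trans (ler_normD _ _) _; apply: lerD.
  apply: le_trans (ler_norm_sum _ _ _) _.
  apply: (@le_trans _ _ (\sum_(m0 <= m < M) e * (wt m - wt m.+1))).
    rewrite big_nat_cond [leRHS]big_nat_cond; apply: ler_sum => m /andP[/andP[m1 _] _].
    have m1' := leq_trans m00 m1.
    by rewrite normrM (ger0_norm (dw _ m1')) ler_wpM2r ?dw // hS // leqW.
  rewrite -mulr_sumr tel // ler_piMr //; have := wt_le1 m0; have := wt_gt0 M; lra.
apply: le_trans (ler_norm_sum _ _ _) _.
apply: (@le_trans _ _ (\sum_(1 <= m < m0) C * (wt m - wt m.+1))).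
  rewrite big_nat_cond [leRHS]big_nat_cond; apply: ler_sum => m /andP[/andP[m1 _] _].
  by rewrite normrM (ger0_norm (dw _ m1)) ler_wpM2r ?dw // hC.
by rewrite -mulr_sumr tel // wt1.
Qed.
End Sigma.

(** The remainder vanishes at 0 and has derivative t^(J - 1) / (1 - t), which is increasing on [0,
    1); the mean value theorem gives both bounds. *)
Lemma log_series (x : R) J : 0 <= x -> x < 1 -> (0 < J)%N ->
  0 <= - ln (1 - x) - \sum_(1 <= j < J) j%:R^-1 * x ^+ j <= x ^+ J / (1 - x).
Proof.
case: J => // J x0 x1 _.
pose phi (J : nat) (t : R) : R := - ln (1 - t) - \sum_(1 <= j < J.+1) j%:R^-1 * t ^+ j.
have dphi (t : R) : t < 1 -> is_derive t 1 (phi J) (t ^+ J / (1 - t)).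
  move=> t1; have t1' : 0 < 1 - t by rewrite subr_gt0.
  elim: J => [|J ih].
    have -> : phi 0%N = (fun t => - ln (1 - t)).
      by apply/funext => s; rewrite /phi big_geq // subr0.
    rewrite expr0 mul1r.
    have h1 : is_derive t 1 (fun s : R => 1 - s) (- 1).
      by apply: is_derive_eq; rewrite add0r mul1r.
    have h2 := is_derive1_ln t1'.
    have h3 := @is_derive1_comp R (@ln R) (fun s : R => 1 - s) t _ _ h2 h1.
    have -> : (fun s : R => - ln (1 - s)) = - (@ln R \o (fun s => 1 - s)) by [].
    by apply: is_derive_eq; rewrite mulrN1 opprK.
  have -> : phi J.+1 = (fun s => phi J s - J.+1%:R^-1 * s ^+ J.+1).
    by apply/funext => s; rewrite /phi big_nat_recr //= opprD addrA.
  have h : is_derive t 1 (fun s : R => J.+1%:R^-1 * s ^+ J.+1) (t ^+ J).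
    have hx := @is_deriveX R R id J.+1 t 1 1 (is_derive_id t 1).
    have := is_deriveZ J.+1%:R^-1 hx; rewrite exprfctE /GRing.scale /= mulr1 mulrA mulVf ?mul1r //.
  have -> : t ^+ J.+1 / (1 - t) = t ^+ J / (1 - t) - t ^+ J.
    by rewrite exprS; field; exact: lt0r_neq0.
  exact: is_deriveB.
have [->|xN0] := eqVneq x 0.
  rewrite subr0 ln1 oppr0 expr0n /= mul0r big_nat_cond big1 ?subrr ?lexx // => i /andP[/andP[i0 _] _].
  by rewrite expr0n gtn_eqF // mulr0.
have x0' : 0 < x by rewrite lt_def xN0.
have [||c cx] := @MVT _ (phi J) (fun t => t ^+ J / (1 - t)) 0 x x0'.
- by move=> t; rewrite in_itv /= => /andP[_ tx]; apply: dphi; apply: lt_trans tx x1.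
- apply: derivable_within_continuous => t; rewrite in_itv /= => /andP[_ tx].
  by have [] := dphi t (le_lt_trans tx x1).
have -> : phi J 0 = 0.
  rewrite /phi subr0 ln1 oppr0 big_nat_cond big1 ?subrr // => i /andP[/andP[i0 _] _].
  by rewrite expr0n gtn_eqF // mulr0.
rewrite subr0 /phi subr0 => ->; move: cx; rewrite in_itv /= => /andP[c0 cx].
have c1 : c < 1 by lra.
apply/andP; split; first by rewrite mulr_ge0 // divr_ge0 ?exprn_ge0 ?subr_ge0 // ltW.
rewrite exprSr [leRHS]mulrAC ler_wpM2r //.
apply: ler_pM; rewrite ?exprn_ge0 ?invr_ge0 ?subr_ge0 ?(ltW c0) ?(ltW c1) //.
  by rewrite lerXn2r ?nnegrE // ltW.
by rewrite lef_pV2 ?posrE ?subr_gt0 // lerD2l lerN2 ltW.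
Qed.

Definition Smert m : R := Tq R m - Bcmp m.

Lemma Smert_cvg B : Dq R n @[n --> \oo] --> B ->
  Smert n @[n --> \oo] --> B + ln (lnn 2) - euler_gamma R.
Proof.
move=> hB; have h : (fun n => Bcmp n - ln (lnn n)) @ \oo --> - ln (lnn 2) + euler_gamma R.
  apply/cvgrPdist_le => e e0.
  pose J0 := (Num.truncn (2 / e)).+1.
  exists (2 ^ J0)%N => // n /= hn.
  have n0 : (0 < n)%N by apply: leq_trans hn; rewrite expn_gt0.
  pose J := trunc_log 2 n.
  have hJ : (2 ^ J <= n < 2 ^ J.+1)%N by rewrite trunc_logP // trunc_log_ltn.
  have J0J : (J0 <= J)%N by apply: trunc_log_max.
  have J1 : (0 < J)%N by apply: leq_trans J0J.
  rewrite distrC; have := Bcmp_bound J1 hJ.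
  have -> : Bcmp n - (ln (lnn n) - ln (lnn 2) + euler_gamma R) = Bcmp n - ln (lnn n) - (- ln (lnn 2) + euler_gamma R) by ring.
  move=> /le_trans; apply.
  have : 2 / e <= J%:R.
    by apply: ltW; apply: lt_le_trans (truncnS_gt _) _; rewrite ler_nat.
  by rewrite !ler_pdivrMr ?ltr0n // mulrC.
have -> : B + ln (lnn 2) - euler_gamma R = B - (- ln (lnn 2) + euler_gamma R) by ring.
have -> : Smert = (fun n => Dq R n - (Bcmp n - ln (lnn n))).
  by apply/funext => n; rewrite /Smert /Dq; ring.
exact: cvgB.
Qed.

Lemma Smert1 : Smert 1 = 0.
Proof. by rewrite /Smert /Tq /Bcmp big_mkcond !big_nat1 /= /bcmp big_geq // subr0. Qed.

Lemma Smert_sum (sg : R) J : 0 < sg -> (0 < J)%N ->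
  \sum_(1 <= m < 2 ^ J) (Smert m.+1 - Smert m) * wt sg m =
  PT sg (2 ^ J) - \sum_(1 <= j < J) j%:R^-1 * wt sg 2 ^+ j.
Proof.
move=> sg0 J0; have e m : Smert m.+1 - Smert m = (if prime m then tq R m else 0) - bcmp m.
  by rewrite /Smert TqS /Bcmp big_nat_recr //=; ring.
have -> : \sum_(1 <= m < 2 ^ J) (Smert m.+1 - Smert m) * wt sg m =
  \sum_(0 <= m < 2 ^ J) (Smert m.+1 - Smert m) * wt sg m.
  have s0 : Smert 1 - Smert 0 = 0 by rewrite e /= /bcmp big_geq // subr0.
  by rewrite [RHS]big_ltn ?expn_gt0 // s0 mul0r add0r.
under eq_bigr do rewrite e mulrBl.
rewrite sumrB sum_bcmp //; congr (_ - _).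
  by rewrite /PT [RHS]big_mkcond; apply: eq_bigr => m _; case: ifP => // _; rewrite mul0r.
apply: eq_bigr => j _; congr (_ * _).
by rewrite /wt lnnX // -expRM_natl; congr expR; ring.
Qed.

(** As sg tends to 0, the sum over primes is log zeta(1 + sg) + O(sg) = - ln sg + O(sg), while the
    sum over powers of 2 is - ln(1 - 2^(-sg)) = - ln sg - ln ln 2 + O(sg). Their difference tends to
    ln ln 2, and by Abel summation also to the limit l of [Smert]. *)
Lemma mertens_const B : Dq R n @[n --> \oo] --> B -> B = euler_gamma R.
Proof.
move=> hB; have hS := Smert_cvg hB; set l := B + _ - _ in hS.
suff : l = ln (lnn 2) by rewrite /l; lra.
have l2 := ln2_gt0.
have [C0 hC0] : exists C, forall m, `|Smert m - l| <= C.
  have : bounded_near id (Smert @ \oo) by apply: cvg_bounded; apply: hS.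
  have hb : bounded_fun Smert by apply: cvg_seq_bounded; apply/cvg_ex; exists l.
  case: (hb) => K [_ /(_ (K + 1))]; rewrite ltrDl ltr01 => /(_ isT) h.
  exists (K + 1 + `|l|) => m; apply: le_trans (ler_normB _ _) _; rewrite lerD2r.
  exact: h.
have C1 : 0 <= C0 by apply: le_trans (hC0 0%N).
suff key e : 0 < e -> `|l - ln (lnn 2)| <= e * 8.
  apply/eqP; rewrite -subr_eq0 -normr_le0; apply/ler_addgt0Pl => e e0.
  by rewrite addr0; have := key (e / 8); rewrite divr_gt0 // divfK //; apply.
move=> e0.
have [m1 _ hm1] : \forall m \near \oo, `|Smert m - l| <= e.
  by move/cvgrPdist_le : hS => /(_ _ e0); apply: filterS => n; rewrite distrC.
pose m0 := maxn m1 2.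
have m02 : (1 < m0)%N by rewrite leq_maxr.
have lm0 := lnn_gt0 R m02.
(* The part below m0 costs C0 (1 - wt(m0)) <= C0 sg ln m0; this choice keeps that cost plus [sg]
   itself below e. *)
pose sg := Num.min 1 (e / (C0 * lnn m0 + 1)).
have D0 : 0 < C0 * lnn m0 + 1 by rewrite ltr_wpDl // mulr_ge0 // ltW.
have sg0 : 0 < sg by rewrite lt_min ltr01 divr_gt0.
have sg1 : sg <= 1 by rewrite ge_min lexx.
have sge : sg * (C0 * lnn m0 + 1) <= e.
  by rewrite -ler_pdivlMr // ge_min lexx orbT.
pose x := wt sg 2.
have x0 : 0 < x := wt_gt0 sg 2.
have x1 : x < 1 by rewrite /x /wt expR_lt1 oppr_lt0 mulr_gt0.
have h1x : sg * lnn 2 / (1 + sg * lnn 2) <= 1 - x <= sg * lnn 2.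
  have s0 : 0 < sg * lnn 2 by rewrite mulr_gt0.
  have h1 := wt_ge sg 2; have h2 : x <= (1 + sg * lnn 2)^-1.
    by rewrite /x /wt expRN lef_pV2 ?posrE ?expR_gt0 ?addr_gt0 // expR_ge1Dx.
  have e2 : sg * lnn 2 / (1 + sg * lnn 2) = 1 - (1 + sg * lnn 2)^-1.
    by field; apply: lt0r_neq0; lra.
  by rewrite -/x in h1; apply/andP; split; lra.
(* With M = 2^J, the number x^J is the weight at M, hence the loss in [Qz_lower], and also controls
   the tail of the series of - ln(1 - x); one large J makes both negligible. *)
have [J [J0 Jm0 hJ1 hJ2]] : exists J, [/\ (1 < J)%N, (m0 <= 2 ^ J)%N, x ^+ J / (1 - x) <= e & x ^+ J <= Num.min (1 / 2) e].
  have hx : (fun n => x ^+ n) @ \oo --> (0 : R) by apply: cvg_expr; rewrite ger0_norm // ltW.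
  have e3 : 0 < Num.min (Num.min (1 / 2) e) (e * (1 - x)) by rewrite !lt_min e0 andbT; apply/andP; split; [lra|rewrite mulr_gt0 // subr_gt0].
  move/cvgr0Pnorm_le : hx => /(_ _ e3)[n1 _ hn1].
  exists (maxn n1 (maxn 2 m0)); have := hn1 _ (leq_maxl n1 (maxn 2 m0)).
  rewrite /= ger0_norm ?exprn_ge0 ?(ltW x0) // le_min => /andP[h1 h2]; split=> //.
  - by rewrite leq_max leq_maxl orbT.
  - apply: (@leq_trans (2 ^ m0)); first by rewrite ltnW // ltn_expl.
    by rewrite leq_exp2l // (leq_trans (leq_maxr 2 m0)) // leq_maxr.
  - by rewrite ler_pdivrMr ?subr_gt0.
pose M := (2 ^ J)%N; have M1 : (1 < M)%N by rewrite -(expn0 2) ltn_exp2l // ltnW.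
have hab : `|PT sg M - \sum_(1 <= j < J) j%:R^-1 * x ^+ j - l| <= 2 * e + C0 * (1 - wt sg m0).
  rewrite -Smert_sum ?(ltnW J0) //; apply: abel_bound => //; first exact: ltnW.
  - exact: Smert1.
  - by move=> m hm; apply: hm1; rewrite /= (leq_trans _ hm) // leq_maxl.
have hC : C0 * (1 - wt sg m0) <= e - sg.
  apply: (@le_trans _ _ (C0 * (sg * lnn m0))).
    by rewrite ler_wpM2l //; have := wt_ge sg m0; move: (wt sg m0) => w; lra.
  move: sge; rewrite mulrDr mulr1 mulrCA; lra.
have sgle : sg <= e.
  by apply: le_trans sge; rewrite -[leLHS]mulr1 ler_pM2l // lerDr mulr_ge0 // ltW.
have /andP[p1 p2] := PT_Qz sg0 M.
have q1 := Qz_upper sg0 M1; have q2 := Qz_lower sg0 M1.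
have /andP[r1 r2] := log_series (ltW x0) x1 (ltnW J0).
have wM : wt sg M = x ^+ J.
  by rewrite /x /wt /M lnnX // -expRM_natl; congr expR; ring.
rewrite wM in q2.
have y0 : 0 < x ^+ J by rewrite exprn_gt0.
move: hJ2; rewrite le_min => /andP[y12 ye].
have e1 : ln (1 + sg^-1) <= sg - ln sg.
  have -> : 1 + sg^-1 = (1 + sg) / sg by field; apply: lt0r_neq0.
  rewrite ln_div ?posrE ?addr_gt0 // lerD2r; apply: le_trans (ln_le_sub1 _) _; lra.
have e2 : ln ((1 - x ^+ J) / sg) >= - (2 * x ^+ J) - ln sg.
  have y1 : 0 < 1 - x ^+ J by lra.
  rewrite ln_div ?posrE // lerD2r lerNl -lnV ?posrE //.
  apply: le_trans (ln_le_sub1 _) _; first by rewrite invr_gt0.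
  rewrite lerBlDr -[leLHS]mul1r ler_pdivrMr //; nra.
have xx : 0 < 1 - x by rewrite subr_gt0.
case/andP: h1x => hx1 hx2.
have s0 : 0 < sg * lnn 2 by rewrite mulr_gt0.
have e3 : ln (1 - x) <= ln sg + ln (lnn 2).
  by rewrite -lnM ?posrE // ler_ln ?posrE.
have l21 : lnn 2 <= 1 by apply: le_trans (ln_le_sub1 _) _; lra.
have e4 : ln sg + ln (lnn 2) - sg <= ln (1 - x).
  apply: (@le_trans _ _ (ln (sg * lnn 2 / (1 + sg * lnn 2)))); last first.
    by rewrite ler_ln ?posrE // divr_gt0 // addr_gt0.
  rewrite ln_div ?posrE ?addr_gt0 // lnM ?posrE // lerD2l lerN2.
  apply: le_trans (ln_le_sub1 _) _; first by rewrite addr_gt0.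
  by rewrite addrAC subrr add0r -[leRHS]mulr1 ler_pM2l.
have : `|PT sg M - \sum_(1 <= j < J) j%:R^-1 * x ^+ j - ln (lnn 2)| <= 4 * e.
  move: p1 p2 q1 q2 e1 e2 e3 e4 r1 r2 hJ1 ye sgle.
  move: (ln (lnn 2)) (ln sg) (ln (1 - x)) (ln (1 + sg^-1)) (ln ((1 - x ^+ J) / sg)) (PT sg M) (Qz sg M).
  move: (x ^+ J / (1 - x)) (x ^+ J) (\sum_(1 <= j < J) _) => z1 z2 LB z3 z4 z5 z6 z7 z8 z9.
  by move=> *; rewrite ler_norml; apply/andP; split; lra.
move: hab; set X := _ - \sum_(1 <= j < J) _ => hab hX.
have -> : l - ln (lnn 2) = (X - ln (lnn 2)) - (X - l) by ring.
apply: le_trans (ler_normB _ _) _; lra.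
Qed.
End MertensConstant.

(** * The Euler product as a power series *)

Section Growth.
Variable R : realType.

Lemma sum_exc_le (x : R) n : 0 <= x -> \sum_(i < n) exc x i <= expR x.
Proof.
move=> x0; have -> : \sum_(i < n) exc x i = series (exp_coeff x) n.
  by rewrite /series /= big_mkord; apply: eq_bigr => i _; rewrite /exp_coeff.
rewrite /expR; apply: nondecreasing_cvgn_le; last exact: is_cvg_series_exp_coeff.
apply/nondecreasing_seqP => k; rewrite /series /= big_nat_recr //= lerDl.
by rewrite /exp_coeff /= divr_ge0 // exprn_ge0.
Qed.

Lemma exc_le_expR (x : R) n : 0 <= x -> exc x n <= expR x.
Proof.
move=> x0; apply: le_trans (sum_exc_le n.+1 x0); rewrite big_ord_recr /= lerDr.
by apply: sumr_ge0 => i _; rewrite /exc divr_ge0 // exprn_ge0.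
Qed.

(** x^n / n! is a single term of the series of e^x. At x = log log p it turns an error 1 / log p
    into any negative power of log log p. *)
Lemma pow_expRN (x : R) n : 0 < x -> expR (- x) <= n`!%:R / x ^+ n.
Proof.
move=> x0; have f0 : 0 < n`!%:R :> R by rewrite ltr0n fact_gt0.
rewrite expRN -[leRHS]invrK invf_div lef_pV2 ?posrE ?expR_gt0 ?divr_gt0 ?exprn_gt0 //.
exact/exc_le_expR/ltW.
Qed.

Lemma pow_geom_bound (t : R) (M : nat) : 0 < t -> t < 1 ->
  exists2 C, 0 <= C & forall l : nat, l%:R ^+ M * t ^+ l <= C.
Proof.
move=> t0 t1; have c0 : 0 < - ln t by rewrite oppr_gt0 ln_lt0 // t0.
exists (1 + M`!%:R / (- ln t) ^+ M).
  by rewrite addr_ge0 // divr_ge0 // exprn_ge0 // ltW.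
case=> [|l].
  rewrite expr0 mulr1 expr0n -[leLHS]addr0; apply: lerD; first by case: eqP.
  by rewrite divr_ge0 // exprn_ge0 // ltW.
have l0 : 0 < l.+1%:R :> R by [].
have -> : t ^+ l.+1 = expR (- (l.+1%:R * - ln t)).
  by rewrite mulrN opprK mulrC mulr_natr -lnXn // lnK // posrE exprn_gt0.
apply: (@le_trans _ _ (l.+1%:R ^+ M * (M`!%:R / (l.+1%:R * - ln t) ^+ M))).
  by rewrite ler_wpM2l ?exprn_ge0 // pow_expRN // mulr_gt0.
have a0 : l.+1%:R ^+ M != 0 :> R by rewrite expf_neq0.
have b0 : (- ln t) ^+ M != 0 by rewrite expf_neq0 // gt_eqF.
rewrite exprMn; move: (l.+1%:R ^+ M) ((- ln t) ^+ M) a0 b0 => x y a0 b0.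
have -> : x * (M`!%:R / (x * y)) = M`!%:R / y by field; rewrite a0 b0.
by rewrite lerDr.
Qed.

Lemma slc_le l m : `|slc R l m| <= l%:R ^+ m.*2.
Proof.
elim: l m => [|l ih] m.
  rewrite /slc big_ord0 coef1; case: m => [|m]; first by rewrite normr1 expr0.
  by rewrite normr0 exprn_ge0.
rewrite slcS; case: m => [|m]; first by rewrite mulr0 subr0 (le_trans (ih 0%N)) // !expr0.
apply: le_trans (ler_normB _ _) _; rewrite normrM normr_nat.
apply: le_trans (lerD (ih _) (ler_wpM2l _ (ih m))) _ => //.
rewrite -!natrX -natrM -natrD ler_nat doubleS.
rewrite [in leqRHS]expnS [leqRHS]mulSn addnC leq_add //.
  by rewrite -expnS leq_exp2r.
by rewrite expnS leq_mul // leq_exp2r.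
Qed.
End Growth.

(** * Local factors as perturbations of 1 *)

Section Factors.
Variables (R : realType) (rho : R).
Hypothesis rho0 : 0 < rho.
Local Notation nbd := (nbd rho).

Lemma nbd_exc (c : R) : nbd (exc c) (expR (`|c| * rho)).
Proof.
move=> n; apply: le_trans (sum_exc_le n (_ : 0 <= `|c| * rho)); last by rewrite mulr_ge0 // ltW.
apply: ler_sum => i _; rewrite /exc normrM normfV normr_nat normrX exprMn.
by rewrite mulrAC.
Qed.

Lemma nbd_exc1 (c : R) : nbd (fun i => exc c i - delt R i) (`|c| * rho * expR (`|c| * rho)).
Proof.
have y0 : 0 <= `|c| * rho by rewrite mulr_ge0 // ltW.
case=> [|n]; first by rewrite big_ord0 mulr_ge0 // expR_ge0.
rewrite big_ord_recl /= {1}/exc {1}/delt expr0 fact0 divr1 subrr normr0 mul0r add0r.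
apply: le_trans (ler_wpM2l y0 (sum_exc_le n y0)); rewrite mulr_sumr.
apply: ler_sum => i _; rewrite /delt /= subr0 /exc normrM normfV normr_nat normrX.
rewrite mulrAC -exprMn exprS -mulrA ler_wpM2l // ler_wpM2l ?exprn_ge0 //.
by rewrite lef_pV2 ?posrE ?ltr0n ?fact_gt0 // ler_nat factS leq_pmull.
Qed.

Definition mono1 (c : R) (i : nat) : R := if i == 1%N then c else 0.

Lemma nbd_exc2 (c : R) : nbd (fun i => exc c i - delt R i - mono1 c i) ((`|c| * rho) ^+ 2 * expR (`|c| * rho)).
Proof.
have y0 : 0 <= `|c| * rho by rewrite mulr_ge0 // ltW.
have K0 : 0 <= (`|c| * rho) ^+ 2 * expR (`|c| * rho) by rewrite mulr_ge0 ?expR_ge0 // exprn_ge0.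
have h0 : exc c 0 - delt R 0 - mono1 c 0 = 0.
  by rewrite /exc /delt /mono1 expr0 fact0 divr1 subrr subr0.
have h1 : exc c 1 - delt R 1 - mono1 c 1 = 0.
  by rewrite /exc /delt /mono1 expr1 divr1 /= subr0 subrr.
case=> [|[|n]]; first by rewrite big_ord0.
  by rewrite big_ord1 h0 normr0 mul0r.
rewrite big_ord_recl h0 normr0 mul0r add0r big_ord_recl h1 normr0 mul0r add0r.
apply: le_trans (ler_wpM2l (exprn_ge0 2 y0) (sum_exc_le n y0)); rewrite mulr_sumr.
apply: ler_sum => i _; rewrite /delt /mono1 /= !subr0 /exc normrM normfV normr_nat normrX.
rewrite mulrAC -exprMn [X in X / _](_ : _ = (`|c| * rho) ^+ 2 * (`|c| * rho) ^+ i) -?exprD //.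
rewrite exprD -mulrA ler_wpM2l ?exprn_ge0 // ler_wpM2l ?exprn_ge0 //.
rewrite lef_pV2 ?posrE ?ltr0n ?fact_gt0 // ler_nat factS factS mulnA leq_pmull //.
Qed.

(* The coefficients in z of sum_j z^nu(n^j) / n^j. *)
Definition fq nu n (j : nat) : R :=
  match nu with
  | small_omega => if j == 0%N then 1 else mono1 (n%:R^-1 / (1 - n%:R^-1)) j
  | big_omega => n%:R^-1 ^+ j
  end.

Definition xq nu n : nat -> R := conv (exc (- tq R n)) (fq nu n).

Definition uq nu n : R :=
  match nu with small_omega => n%:R^-1 / (1 - n%:R^-1) | big_omega => n%:R^-1 end.
Definition rq nu n j : R := fq nu n j - delt R j - mono1 (uq nu n) j.
(** For [big_omega] the terms of degree at least 2 form a geometric series of ratio rho / n <= rho /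
    2, convergent because rho < 2: this is the origin of r_Omega = 2. For [small_omega] they vanish,
    so the value 0 at larger rho is a valid bound. *)
Definition Krq : R := if rho < 2 then rho ^+ 2 / (1 - rho / 2) else 0.

Lemma Krq_ge0 : 0 <= Krq.
Proof.
rewrite /Krq; case: ifP => // h; rewrite divr_ge0 ?exprn_ge0 ?(ltW rho0) // subr_ge0.
by rewrite ler_pdivrMr // mul1r ltW.
Qed.

Hypothesis nu : factor_count.
Hypothesis hnu : nu = big_omega -> rho < 2.

Lemma nbd_rq n : (1 < n)%N -> nbd (rq nu n) (Krq / n%:R ^+ 2).
Proof.
move=> n1; have n2 : 2 <= n%:R :> R by rewrite ler_nat.
have n0 : 0 < n%:R :> R by lra.
case e : nu => N.
  rewrite big1 ?divr_ge0 ?Krq_ge0 ?exprn_ge0 // => i _.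
  rewrite /rq /fq /delt /mono1 /uq; case: (val i) => [|[|j]] /=; rewrite ?subr0 ?subrr ?normr0 ?mul0r //.
have r2 := hnu e; rewrite /Krq r2.
have K0 : 0 <= rho ^+ 2 / (1 - rho / 2) / n%:R ^+ 2.
  by have := Krq_ge0; rewrite /Krq r2 => h; rewrite divr_ge0 // exprn_ge0.
have h0 : rq big_omega n 0 = 0 by rewrite /rq /fq /delt /mono1 /uq expr0 subrr subr0.
have h1 : rq big_omega n 1 = 0 by rewrite /rq /fq /delt /mono1 /uq expr1 subr0 subrr.
case: N => [|[|N]]; first by rewrite big_ord0.
  by rewrite big_ord1 h0 normr0 mul0r.
rewrite big_ord_recl h0 normr0 mul0r add0r big_ord_recl h1 normr0 mul0r add0r.
pose y := rho / n%:R.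
have y0 : 0 <= y by rewrite divr_ge0 // ltW.
have y12 : y <= rho / 2 by rewrite ler_pM2l // lef_pV2 ?posrE.
have r21 : 0 < 1 - rho / 2 by rewrite subr_gt0 ltr_pdivrMr // mul1r.
have -> : rho ^+ 2 / (1 - rho / 2) / n%:R ^+ 2 = y ^+ 2 * (1 - rho / 2)^-1.
  by rewrite /y expr_div_n mulrAC.
apply: (@le_trans _ _ (y ^+ 2 * \sum_(i < N) y ^+ i)).
  rewrite mulr_sumr; apply: ler_sum => i _; rewrite /rq /fq /delt /mono1 /= !subr0.
  rewrite ger0_norm ?exprn_ge0 ?invr_ge0 // -exprMn -exprD mulrC -/y.
  by [].
rewrite ler_wpM2l ?exprn_ge0 //.
have := subrX1 y N; have : 0 <= y ^+ N by rewrite exprn_ge0.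
rewrite -[(1 - rho / 2)^-1]mul1r ler_pdivlMr //.
have s0 : 0 <= \sum_(i < N) y ^+ i by apply: sumr_ge0 => i _; apply: exprn_ge0.
move: (\sum_(i < N) y ^+ i) (y ^+ N) s0 => s z s0 z0 h; nra.
Qed.

Definition Kf : R := 1 + 2 * rho + Krq.
Definition Cx : R := 4 * rho ^+ 2 * expR rho * Kf + 2 * rho * (2 * rho + Krq) + 2 * rho + Krq.

Lemma Cx_ge0 : 0 <= Cx.
Proof.
have := Krq_ge0; have := expR_ge0 rho; rewrite /Cx /Kf => h1 h2.
by rewrite !addr_ge0 // ?mulr_ge0 ?addr_ge0 ?mulr_ge0 ?exprn_ge0 ?(ltW rho0).
Qed.

Lemma fq_decomp n j : fq nu n j = (delt R j + mono1 (uq nu n) j) + rq nu n j.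
Proof. by rewrite /rq; ring. Qed.

Lemma uq_bounds n : (1 < n)%N -> n%:R^-1 <= uq nu n <= n%:R^-1 + (n%:R * (n%:R - 1))^-1.
Proof.
move=> n1; have n2 : 2 <= n%:R :> R by rewrite ler_nat.
rewrite /uq; case: nu; last by rewrite lexx /= lerDl invr_ge0 mulr_ge0 //; lra.
have e : n%:R^-1 / (1 - n%:R^-1) = n%:R^-1 + (n%:R * (n%:R - 1))^-1 :> R.
  by field; apply/andP; split; apply: lt0r_neq0; lra.
by rewrite e lexx andbT lerDl invr_ge0 mulr_ge0 //; lra.
Qed.

(** The splitting isolates the cancellation of linear terms: [uq] and [tq] are both 1 / n + O(1 /
    n^2), and every other piece contains at least two factors of size 1 / n. Hence the local factors
    are 1 + O(1 / n^2). *)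
Lemma xq_decomp n j : xq nu n j - delt R j =
  (conv (fun i => exc (- tq R n) i - delt R i - mono1 (- tq R n) i) (fq nu n) j
   + (- tq R n) * conv (mono1 1) (fun i => fq nu n i - delt R i) j)
  + (mono1 (uq nu n - tq R n) j + rq nu n j).
Proof.
rewrite /xq convBl convBl conv1.
have e1 : conv (mono1 (- tq R n)) (fq nu n) j = - tq R n * conv (mono1 1) (fq nu n) j.
  rewrite /conv mulr_sumr; apply: eq_bigr => i _; rewrite /mono1; case: ifP => _; ring.
rewrite e1 (convBr (mono1 1) (fq nu n) (@delt R)) (convC (mono1 1) (@delt R)) conv1 mulrBr.
rewrite /rq; have -> : mono1 (uq nu n - tq R n) j = mono1 (uq nu n) j - tq R n * mono1 1 j.
  by rewrite /mono1; case: ifP => _; ring.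
ring.
Qed.

Lemma nbd_xq n : (1 < n)%N -> nbd (fun j => xq nu n j - delt R j) (Cx / n%:R ^+ 2).
Proof.
move=> n1; have n2 : 2 <= n%:R :> R by rewrite ler_nat.
have n0 : 0 < n%:R :> R by lra.
pose d : R := n%:R^-1; have d0 : 0 < d by rewrite invr_gt0.
have d12 : d <= 2^-1 by rewrite lef_pV2 ?posrE.
have dd : (n%:R * (n%:R - 1))^-1 <= 2 * d ^+ 2.
  rewrite /d exprVn ler_pdivlMr ?exprn_gt0 // mulrC ler_pdivrMr; last by apply: mulr_gt0; lra.
  nra.
have /andP[t1 t2] := tq_bounds R n1; have /andP[u1 u2] := uq_bounds n1.
rewrite -/d in t1 t2 u1 u2.
have dsq : 2 * d ^+ 2 <= d by nra.
have t0 : 0 < tq R n by lra.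
have t2d : tq R n <= 2 * d by lra.
have u0 : 0 < uq nu n by lra.
have u2d : uq nu n <= 2 * d by lra.
have ut : `|uq nu n - tq R n| <= 2 * d ^+ 2 by rewrite ler_norml; apply/andP; split; lra.
have kr0 := Krq_ge0.
have hr : nbd (rq nu n) (Krq * d ^+ 2) by have := nbd_rq n1; rewrite /d exprVn.
have hm c : nbd (mono1 c) (`|c| * rho) by have := nbd_mono rho0 1 c; rewrite expr1.
have hf1 : nbd (fun i => fq nu n i - delt R i) (d * (2 * rho + Krq)).
  have h := nbdD rho0 (hm (uq nu n)) hr.
  apply: eq_nbd (nbd_le _ h); first by move=> i; rewrite fq_decomp; ring.
  rewrite gtr0_norm //; have h1 : d ^+ 2 <= d by lra.
  have := ler_wpM2l kr0 h1; have := ler_wpM2r (ltW rho0) u2d; lra.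
have hf : nbd (fq nu n) Kf.
  have h := nbdD rho0 hf1 (nbd_delt rho0).
  apply: eq_nbd (nbd_le _ h); first by move=> i; ring.
  have r20 : 0 <= 2 * rho + Krq by rewrite addr_ge0 // mulr_ge0 // ltW.
  have d1 : d <= 1 by lra.
  have := ler_wpM2r r20 d1; rewrite mul1r => hd.
  by rewrite /Kf; lra.
have ht : `|- tq R n| = tq R n by rewrite normrN gtr0_norm.
have hE := nbd_exc2 (- tq R n); rewrite ht in hE.
have h1 := nbd_conv rho0 hE hf.
have h2 := nbdZ (- tq R n) (nbd_conv rho0 (hm 1) hf1).
have h3 := nbdD rho0 (hm (uq nu n - tq R n)) hr.
have h := nbdD rho0 (nbdD rho0 h1 h2) h3.
apply: eq_nbd (nbd_le _ h); first by move=> j; rewrite [RHS]xq_decomp.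
rewrite ht normr1 mul1r.
have -> : Cx / n%:R ^+ 2 = Cx * d ^+ 2 by rewrite /d exprVn.
have Kf0 : 0 <= Kf by rewrite /Kf !addr_ge0 // mulr_ge0 // ltW.
have e1 : expR (tq R n * rho) <= expR rho.
  by rewrite ler_expR ler_piMl ?(ltW rho0) //; lra.
have e2 : (tq R n * rho) ^+ 2 * expR (tq R n * rho) <= 4 * d ^+ 2 * rho ^+ 2 * expR rho.
  apply: ler_pM; rewrite ?expR_ge0 ?exprn_ge0 ?mulr_ge0 ?(ltW t0) ?(ltW rho0) //.
  rewrite exprMn ler_wpM2r ?exprn_ge0 ?(ltW rho0) //.
  have := ler_pM (ltW t0) (ltW t0) t2d t2d; rewrite -expr2; lra.
have e3 : (tq R n * rho) ^+ 2 * expR (tq R n * rho) * Kf <= 4 * d ^+ 2 * rho ^+ 2 * expR rho * Kf.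
  by rewrite ler_wpM2r.
have e4 : tq R n * (rho * (d * (2 * rho + Krq))) <= 2 * d * (rho * (d * (2 * rho + Krq))).
  by rewrite ler_wpM2r // !mulr_ge0 ?addr_ge0 ?mulr_ge0 ?(ltW rho0) ?(ltW d0).
have e5 : `|uq nu n - tq R n| * rho <= 2 * d ^+ 2 * rho by rewrite ler_wpM2r // ltW.
apply: le_trans (lerD (lerD e3 e4) (lerD e5 (lexx _))) _.
by rewrite /Cx le_eqVlt; apply/orP; left; apply/eqP; ring.
Qed.
End Factors.

Section Defs.
Variables (R : realType) (nu : factor_count).

(* Coefficients of the product of the local factors over the primes q < n; in
   [Xs] each factor is multiplied by (1 - 1/q)^z. *)
Fixpoint Lam n : nat -> R :=
  if n is m.+1 then (if prime m then conv (Lam m) (fq R nu m) else Lam m) else @delt R.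
Fixpoint Xs n : nat -> R :=
  if n is m.+1 then (if prime m then conv (Xs m) (xq R nu m) else Xs m) else @delt R.
Definition Hs (j : nat) : R := limn (fun n => Xs n j).
Definition Fs : nat -> R := conv (exc (euler_gamma R)) Hs.

Lemma Lam_Xs n : Lam n =1 conv (exc (Tq R n)) (Xs n).
Proof.
elim: n => [|n ih] j.
  rewrite /= (eq_conv (_ : exc (Tq R 0) =1 @delt R) (_ : @delt R =1 @delt R)) ?conv1 // => i.
  by rewrite /Tq big_geq // exc0.
rewrite TqS /=; case: ifP => pn; last by rewrite addr0 ih.
rewrite (eq_conv ih (_ : fq R nu n =1 fq R nu n)) // convC.
rewrite (eq_conv (fun i => esym (exc_conv (Tq R n) (tq R n) i)) (_ : conv (Xs n) (xq R nu n) =1 conv (xq R nu n) (Xs n))); last exact: convC.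
have h1 : conv (exc (tq R n)) (xq R nu n) =1 fq R nu n.
  move=> i; rewrite /xq convA (eq_conv (_ : conv (exc (tq R n)) (exc (- tq R n)) =1 @delt R) (_ : fq R nu n =1 fq R nu n)) ?conv1 // => k.
  by rewrite exc_conv subrr exc0.
rewrite -convA (eq_conv (_ : exc (Tq R n) =1 exc (Tq R n)) (convA _ _ _)) //.
rewrite (eq_conv (_ : exc (Tq R n) =1 exc (Tq R n)) (eq_conv h1 (_ : Xs n =1 Xs n))) //.
rewrite convA (eq_conv (convC _ _) (_ : Xs n =1 Xs n)) // -convA.
by [].
Qed.

Definition ginv (n : nat) : R := n%:R^-1.
Lemma ginv_gt0 n : (0 < n)%N -> 0 < ginv n.
Proof. by rewrite invr_gt0 ltr0n. Qed.
Lemma ginvM p n : prime p -> (0 < n)%N -> ginv (p * n) = ginv p * ginv n.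
Proof. by move=> _ _; rewrite /ginv natrM invfM. Qed.
Lemma ginv_lt1 p : prime p -> ginv p < 1.
Proof. by move=> pp; rewrite invf_lt1 ?ltr1n ?ltr0n ?prime_gt1 ?prime_gt0. Qed.

Lemma Lam_smcvg n k : (1 < n)%N -> smcvg ginv n (fun m => nu_val nu m == k) (Lam n k).
Proof.
case: n => [|[|n]] // _; elim: n k => [|n ih] k.
  rewrite /= /delt /smcvg /sms; apply: cvg_near_cst; exists 2%N => // N /= N2.
  rewrite big_mkcond big_ltn // nu1 /= big_nat_cond big1 ?addr0; last first.
    by move=> m /andP[/andP[m2 _] _]; rewrite max_pdiv_lt2 ?(ltnW m2) // gtn_eqF.
  by rewrite /ginv invr1 eq_sym; case: eqP.
have -> : Lam n.+3 = if prime n.+2 then conv (Lam n.+2) (fq R nu n.+2) else Lam n.+2 by [].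
case: ifP => pn; last first.
  by apply: eq_smcvg (ih k) => m m0; rewrite [in RHS]max_pdiv_nprime // pn.
move: ih; case: nu => ih /=.
  have hsm : forall j, smcvg ginv n.+3 (fun m => nu_val small_omega m == j) (Lam n.+2 j +
    (if j is j'.+1 then Lam n.+2 j' * (ginv n.+2 / (1 - ginv n.+2)) else 0)).
    by move=> j; apply: smcvg_small => //; [exact: ginv_gt0|exact: ginvM|exact: ginv_lt1].
  have := hsm k.
  suff -> : conv (Lam n.+2) (fq R small_omega n.+2) k = Lam n.+2 k +
    (if k is k'.+1 then Lam n.+2 k' * (ginv n.+2 / (1 - ginv n.+2)) else 0) by [].
  rewrite /conv; case: (k) => [|k'].
    by rewrite big_ord1 /= mulr1 addr0.
  rewrite big_ord_recr /= subnn eqxx mulr1 addrC; congr (_ + _).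
  rewrite big_ord_recr /= subSnn /mono1 /= big1 ?add0r // => i _.
  have ik := ltn_ord i; have -> : (k'.+1 - i == 0)%N = false by lia.
  have -> : (k'.+1 - i == 1)%N = false by lia.
  by rewrite mulr0.
have hbg : forall j, smcvg ginv n.+3 (fun m => nu_val big_omega m == j) (conv (Lam n.+2) (fun j => ginv n.+2 ^+ j) j).
  by move=> j; apply: smcvg_big => //; [exact: ginv_gt0|exact: ginvM].
exact: hbg k.
Qed.

Lemma lambda_Lam p k : (1 < p)%N -> lambda_nu R nu p k = Lam p k.
Proof. by move=> p1; apply: cvg_lim => //; exact: Lam_smcvg. Qed.
End Defs.

(** * The limiting Euler product and the expansion of lambda_nu *)

Section Limits.
Variables (R : realType) (rho : R) (nu : factor_count).
Hypothesis rho0 : 0 < rho.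
Hypothesis hnu : nu = big_omega -> rho < 2.
Local Notation nbd := (nbd rho).
Local Notation C := (Cx rho).
Local Notation X := (Xs R nu).
Let C0 : 0 <= C := Cx_ge0 rho0.

Lemma inv_pairs n : (1 < n)%N -> (n%:R ^+ 2)^-1 <= n.-1%:R^-1 - n%:R^-1 :> R.
Proof.
move=> n1; have n2 : 2 <= n%:R :> R by rewrite ler_nat.
have -> : n.-1%:R = n%:R - 1 :> R by rewrite -subn1 natrB // ltnW.
have -> : (n%:R - 1)^-1 - n%:R^-1 = (n%:R * (n%:R - 1))^-1 :> R.
  by field; apply/andP; split; apply: lt0r_neq0; lra.
by rewrite lef_pV2 ?posrE; nra.
Qed.

Lemma nbd_Xs n : (1 < n)%N -> nbd (X n) (expR (C * (1 - n.-1%:R^-1))).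
Proof.
case: n => [|[|n]] // _; elim: n => [|n ih].
  by rewrite /= invr1 subrr mulr0 expR0; apply: nbd_delt.
have -> : X n.+3 = if prime n.+2 then conv (X n.+2) (xq R nu n.+2) else X n.+2 by [].
have ip := @inv_pairs n.+2 isT.
have ee : C * (1 - n.+2.-1%:R^-1) + C / n.+2%:R ^+ 2 <= C * (1 - n.+3.-1%:R^-1).
  have := ler_wpM2l C0 ip; rewrite /= => h.
  by move: h; rewrite !mulrBr mulr1; move: (C * _^-1) (C * _^-1) (C / _) => x y z; lra.
case: ifP => pn; last first.
  apply: nbd_le ih; rewrite ler_expR; apply: le_trans ee.
  by rewrite lerDl divr_ge0 // exprn_ge0.
have hx : nbd (xq R nu n.+2) (1 + C / n.+2%:R ^+ 2).
  have h := nbdD rho0 (nbd_delt rho0) (nbd_xq rho0 hnu (isT : 1 < n.+2)%N).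
  by apply: eq_nbd h => i; ring.
apply: nbd_le (nbd_conv rho0 ih hx).
apply: (@le_trans _ _ (expR (C * (1 - n.+2.-1%:R^-1)) * expR (C / n.+2%:R ^+ 2))).
  by rewrite ler_wpM2l ?expR_ge0 // expR_ge1Dx.
by rewrite -expRD ler_expR.
Qed.

Lemma nbd_Xs' n : (1 < n)%N -> nbd (X n) (expR C).
Proof.
move=> n1; apply: nbd_le (nbd_Xs n1); rewrite ler_expR -[leRHS]mulr1 ler_wpM2l //.
Qed.

Lemma nbd_XsB m n : (1 < m)%N -> (m <= n)%N ->
  nbd (fun j => X n j - X m j) (expR C * C * (m.-1%:R^-1 - n.-1%:R^-1)).
Proof.
move=> m1 mn; rewrite -(subnKC mn); elim: (n - m)%N => [|d ih].
  rewrite addn0 subrr mulr0; apply: eq_nbd (_ : nbd (fun _ => 0) 0); first by move=> i; rewrite subrr.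
  by move=> k; rewrite big1 // => i _; rewrite normr0 mul0r.
rewrite addnS; set i := (m + d)%N in ih *.
have i1 : (1 < i)%N by rewrite (leq_trans m1) // leq_addr.
have hs : nbd (fun j => X i.+1 j - X i j) (expR C * (C / i%:R ^+ 2)).
  rewrite /=; case: ifP => pn; last first.
    move=> k; rewrite big1 ?mulr_ge0 ?expR_ge0 ?divr_ge0 ?exprn_ge0 // => j _.
    by rewrite subrr normr0 mul0r.
  apply: eq_nbd (nbd_conv rho0 (nbd_Xs' i1) (nbd_xq rho0 hnu i1)) => j.
  by rewrite (convBr _ _ (@delt R)) (convC _ (@delt R)) conv1.
apply: eq_nbd (nbd_le _ (nbdD rho0 ih hs)); first by move=> j; ring.
have h := ler_wpM2l (mulr_ge0 (expR_ge0 C) C0) (inv_pairs i1).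
move: h; rewrite -mulrA /= !mulrBr mulrA; move: (expR C * C * _) (expR C * C * _) (expR C * C * _) (expR C * C * _) => x y z t; lra.
Qed.

Lemma cvg_invp (K : R) : K * n.-1%:R^-1 @[n --> \oo] --> 0.
Proof.
have h : (fun n => (n%:R : R)^-1) @ \oo --> (0 : R).
  by rewrite -(cvg_shiftS (fun n => (n%:R : R)^-1)); exact: cvg_harmonic.
rewrite -(cvg_shiftS (fun n => K * n.-1%:R^-1)) /=.
have hm : (fun n => K * (n%:R : R)^-1) @ \oo --> K * 0 by apply: cvgMr.
by rewrite mulr0 in hm.
Qed.

Lemma Xs_cvg j : X n j @[n --> \oo] --> Hs R nu j.
Proof.
have r0 : 0 < rho ^+ j by rewrite exprn_gt0.
have hc m n : (2 <= m)%N -> (m <= n)%N -> `|X n j - X m j| <= (expR C * C / rho ^+ j) * m.-1%:R^-1.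
  move=> m1 mn; have := nbd_coef rho0 j (nbd_XsB m1 mn); rewrite -ler_pdivlMr // => /le_trans; apply.
  rewrite [leLHS]mulrAC ler_wpM2l ?mulr_ge0 ?expR_ge0 ?invr_ge0 ?(ltW r0) //.
  by rewrite gerBl invr_ge0.
have [l [hl _]] := cauchy_rate hc (cvg_invp _).
by rewrite /Hs (cvg_lim _ hl).
Qed.

Lemma nbd_lim (u : nat -> nat -> R) (l : nat -> R) K (m0 : nat) :
  (forall j, u n j @[n --> \oo] --> l j) -> (forall n, (m0 <= n)%N -> nbd (u n) K) -> nbd l K.
Proof.
move=> hl hu N; have h : (fun n => \sum_(i < N) `|u n i| * rho ^+ i) @ \oo --> \sum_(i < N) `|l i| * rho ^+ i.
  elim: (N) => [|k ih].
    by rewrite big_ord0; under eq_cvg do rewrite big_ord0; apply: cvg_cst.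
  rewrite big_ord_recr /=; under eq_cvg do rewrite big_ord_recr /=.
  apply: cvgD => //; apply: cvgMl; exact: cvg_norm.
by apply: (cvg_bound (m0 := m0) h) => n mn; apply: hu.
Qed.

Lemma nbd_XsH m : (1 < m)%N -> nbd (fun j => X m j - Hs R nu j) (expR C * C * m.-1%:R^-1).
Proof.
move=> m1; apply: (@nbd_lim (fun n j => X m j - X n j) _ _ m).
  by move=> j; apply: cvgB; [exact: cvg_cst|exact: Xs_cvg].
move=> n mn; have h := nbdN (nbd_XsB m1 mn).
apply: eq_nbd (nbd_le _ h); first by move=> i; rewrite opprB.
by rewrite ler_wpM2l ?mulr_ge0 ?expR_ge0 // gerBl invr_ge0.
Qed.

Lemma nbd_Hs : nbd (Hs R nu) (expR C).
Proof. exact: nbd_lim Xs_cvg nbd_Xs'. Qed.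

Definition KF : R := expR (`|euler_gamma R| * rho) * expR C.
Lemma nbd_Fs : nbd (Fs R nu) KF.
Proof. exact: nbd_conv (nbd_exc rho0 _) nbd_Hs. Qed.

(** The Euler product over q < p with the factor e^(L z), L = log log p, taken out (see [Lam_Gs]).
    What stays in the exponent is [Dq], which converges to Euler's constant, so that these
    coefficients converge to those of F_nu. *)
Definition Gs p : nat -> R := conv (exc (Dq R p)) (X p).

(** Two errors add up: [Dq] is within O(1 / ln p) of Euler's constant, and the primes from p on
    change the product by O(1 / (p - 1)), where p - 1 >= ln p. *)
Lemma Gs_Fs : exists2 K, 0 <= K & forall p, (1 < p)%N -> nbd (fun j => Gs p j - Fs R nu j) (K / ln p%:R).
Proof.
have [B [hB hBr]] := Dq_cvg R.
have Be := mertens_const hB; rewrite Be in hBr.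
set D := 3 * CR R + 2 in hBr; set g := euler_gamma R in hBr.
have D0 : 0 <= D by rewrite addr_ge0 // mulr_ge0 // CR_ge0.
clearbody D.
have l2 := ln2_gt0 R.
(* D rho / ln 2 bounds |d - g| rho for every p >= 2, which makes the exponential factor uniform in
   p. *)
pose K1 := expR (`|g| * rho) * (D * rho * expR (D * rho / ln 2%:R)).
exists (K1 * expR C + expR (`|g| * rho) * (expR C * C)).
  by rewrite /K1 addr_ge0 ?mulr_ge0 ?expR_ge0 ?(ltW rho0) ?D0 ?C0.
move=> p p1; have lp := lnn_gt0 R p1.
have l2p : ln 2%:R <= ln p%:R :> R by apply: lnn_le.
have hd := hBr p p1; set d := Dq R p in hd *.
have hE : nbd (fun j => exc d j - exc g j) (K1 / ln p%:R).
  have h := nbd_conv rho0 (nbd_exc rho0 g) (nbd_exc1 rho0 (d - g)).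
  apply: eq_nbd (nbd_le _ h).
    by move=> j; rewrite (convBr _ _ (@delt R)) exc_conv (convC _ (@delt R)) conv1 [g + _]addrC subrK.
  rewrite /K1 -[leRHS]mulrA ler_wpM2l ?expR_ge0 //.
  have y1 : `|d - g| * rho <= D * rho / ln p%:R.
    by rewrite [leRHS]mulrAC ler_wpM2r // ltW.
  rewrite [leRHS]mulrAC; apply: ler_pM; rewrite ?expR_ge0 ?mulr_ge0 ?(ltW rho0) // ler_expR.
  apply: le_trans y1 _; rewrite ler_wpM2l ?mulr_ge0 ?(ltW rho0) //.
  by rewrite lef_pV2 ?posrE.
have h1 := nbd_conv rho0 hE (nbd_Xs' p1).
have h2 := nbd_conv rho0 (nbd_exc rho0 g) (nbd_XsH p1).
apply: eq_nbd (nbd_le _ (nbdD rho0 h1 h2)).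
  by move=> j; rewrite convBl convBr /Gs /Fs -/g; ring.
rewrite [leRHS]mulrDl [K1 / _ * _]mulrAC lerD2l -[leRHS]mulrA ler_wpM2l ?expR_ge0 //.
rewrite ler_wpM2l ?mulr_ge0 ?expR_ge0 //.
have pm : (0 < p.-1)%N by rewrite -ltnS prednK // ltnW.
rewrite lef_pV2 ?posrE ?ltr0n //.
apply: le_trans (ln_le_sub1 _) _; first by rewrite ltr0n ltnW.
by rewrite -subn1 natrB // ltnW.
Qed.

Lemma Lam_Gs p : Lam R nu p =1 conv (exc (loglog R p)) (Gs p).
Proof.
move=> k; rewrite Lam_Xs /Gs convA; apply: eq_conv => // i.
by rewrite exc_conv /Dq /loglog [_ + (_ - _)]addrC subrK.
Qed.

Lemma fall_prod (k l : nat) : (l <= k)%N -> (0 < k)%N ->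
  (k - l)`!%:R^-1 = k%:R ^+ l / k`!%:R * \prod_(i < l) (1 - i%:R / k%:R) :> R.
Proof.
move=> lk k0; have kR : k%:R != 0 :> R by rewrite pnatr_eq0 -lt0n.
elim: l lk => [|l ih] lk; first by rewrite subn0 expr0 big_ord0 mulr1 mul1r.
rewrite big_ord_recr /= mulrA exprS -[k%:R * _ / _]mulrA -[k%:R * _ * _]mulrA -ih; last exact: ltnW.
rewrite -(invfactS R (k - l.+1)) subnSK // mulrAC; congr (_ * _).
by rewrite natrB ?(ltnW lk) // mulrBr mulr1 mulrCA divff // mulr1.
Qed.

Lemma Lam_main p k v : (0 < k)%N -> 0 < loglog R p -> v = k%:R / loglog R p ->
  Lam R nu p k = loglog R p ^+ k / k`!%:R *
    \sum_(l < k.+1) Gs p l * v ^+ l * \prod_(i < l) (1 - i%:R / k%:R).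
Proof.
move=> k0 L0 ->; rewrite Lam_Gs convC /conv mulr_sumr; apply: eq_bigr => l _.
have lk : (l <= k)%N := ltn_ord l.
have -> : loglog R p ^+ k = loglog R p ^+ (k - l) * loglog R p ^+ l by rewrite -exprD subnK.
rewrite /exc fall_prod // expr_div_n.
have h : loglog R p ^+ l != 0 by rewrite expf_neq0 // gt_eqF.
move: h (loglog R p ^+ _) => h y; move: (loglog R p ^+ l) h => x h; field.
by rewrite h (factf_neq0 R).
Qed.

(* The coefficient of k^(-m) in sum_l F_l v^l prod_(i < l) (1 - i/k). *)
Definition gco (m : nat) (v : R) : R := lsum (fun l => Fs R nu l * v ^+ l * slc R l m).

(** The gap between b and rho leaves a geometric factor (b / rho)^l, which absorbs any power of l;
    such powers arise from the Stirling numbers and from the remainder in [slc_expand]. *)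
Lemma Fs_slc_bound (b : R) M : 0 < b -> b < rho -> exists2 K, 0 <= K & forall v : R, 0 <= v -> v <= b ->
  forall n, \sum_(l < n) `|Fs R nu l * v ^+ l| * l%:R ^+ M <= K.
Proof.
move=> b0 brho; have t0 : 0 < b / rho by rewrite divr_gt0.
have t1 : b / rho < 1 by rewrite ltr_pdivrMr // mul1r.
have [C1 C10 hC1] := pow_geom_bound M t0 t1.
have KF0 : 0 <= KF by rewrite /KF mulr_ge0 ?expR_ge0.
exists (KF * C1); first exact: mulr_ge0.
move=> v v0 vb n; apply: le_trans (ler_wpM2r C10 (nbd_Fs n)); rewrite mulr_suml.
apply: ler_sum => l _; rewrite normrM -!mulrA ler_wpM2l //.
apply: (@le_trans _ _ (b ^+ l * l%:R ^+ M)).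
  rewrite ler_wpM2r ?exprn_ge0 // ger0_norm ?exprn_ge0 // lerXn2r ?nnegrE //.
  exact: ltW.
have -> : b ^+ l * l%:R ^+ M = rho ^+ l * (l%:R ^+ M * (b / rho) ^+ l).
  rewrite expr_div_n mulrCA mulrC; congr (_ * _); rewrite mulrC divfK //.
  by rewrite expf_neq0 // gt_eqF.
by rewrite ler_wpM2l // exprn_ge0 // ltW.
Qed.

Theorem main_real (N : nat) (a b : R) : 0 < a -> a < b -> b < rho ->
  exists2 K, 0 <= K & forall p k : nat, (3 <= p)%N -> 0 < loglog R p ->
    a <= k%:R / loglog R p <= b ->
    `|lambda_nu R nu p k - loglog R p ^+ k / k`!%:R *
       \sum_(m < N) gco m (k%:R / loglog R p) / k%:R ^+ m|
    <= loglog R p ^+ k / k`!%:R * (K / loglog R p ^+ N).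
Proof.
move=> a0 ab brho; have b0 : 0 < b by lra.
have [K1 K10 hK1] := Gs_Fs.
have [K2 K20 hK2] := Fs_slc_bound N.*2 b0 brho.
(* The first term pays for replacing [Gs] by [Fs], since 1 / ln p = e^(-L) <= N! / L^N; the second
   pays for truncating the product in powers of 1 / k, since k >= a L. *)
exists (K1 * N`!%:R + K2 / a ^+ N).
  by rewrite addr_ge0 ?mulr_ge0 // invr_ge0 exprn_ge0 // ltW.
move=> p k p3 L0 /andP[av vb]; set L := loglog R p in L0 av vb *.
have p1 : (1 < p)%N by apply: leq_trans p3.
set v := k%:R / L in av vb *.
have v0 : 0 < v by lra.
have k0 : (0 < k)%N.
  by rewrite lt0n; apply/eqP => e; move: v0; rewrite /v e mul0r ltxx.
have kR : 0 < k%:R :> R by rewrite ltr0n.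
have kaL : a * L <= k%:R by rewrite -ler_pdivlMr.
rewrite (@lambda_Lam R nu p k p1) (@Lam_main p k v) // -mulrBr normrM.
have P0 : 0 <= L ^+ k / k`!%:R by rewrite divr_ge0 // exprn_ge0 // ltW.
rewrite (ger0_norm P0) ler_wpM2l //.
pose P l : R := \prod_(i < l) (1 - i%:R / k%:R).
have P1 l : (l <= k)%N -> `|P l| <= 1.
  move=> lk; rewrite normr_prod; apply: prodr_ile1 => i _; rewrite normr_ge0 /= ger0_norm.
    by rewrite gerBl divr_ge0.
  by rewrite subr_ge0 ler_pdivrMr // mul1r ler_nat (leq_trans _ lk) // ltnW.
have Pk l : (k < l)%N -> P l = 0.
  by move=> kl; rewrite /P (bigD1 (Ordinal kl)) //= divff ?gt_eqF // subrr mul0r.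
(* The product vanishes for l > k, so the finite sum is the full series and can be expanded term by
   term. *)
have eF : \sum_(l < k.+1) Fs R nu l * v ^+ l * P l = lsum (fun l => Fs R nu l * v ^+ l * P l).
  by rewrite (@lsum_fin _ _ k.+1) // => i ki; rewrite Pk // mulr0.
have bT m : exists K, forall n, \sum_(i < n) `|Fs R nu i * v ^+ i * slc R i m / k%:R ^+ m| <= K.
  have [K3 K30 hK3] := Fs_slc_bound m.*2 b0 brho.
  exists (K3 / k%:R ^+ m) => n.
  apply: le_trans (ler_wpM2r _ (hK3 _ (ltW v0) vb n)); last by rewrite invr_ge0 exprn_ge0.
  rewrite mulr_suml; apply: ler_sum => l _; rewrite normrM normfV [`|k%:R ^+ m|]ger0_norm ?exprn_ge0 //.
  by rewrite ler_wpM2r ?invr_ge0 ?exprn_ge0 // normrM ler_wpM2l // slc_le.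
have [Kb hKb] := choice bT.
have eS : \sum_(m < N) gco m v / k%:R ^+ m =
  lsum (fun l => \sum_(m < N) Fs R nu l * v ^+ l * slc R l m / k%:R ^+ m).
  rewrite (@lsum_sum _ N (fun m l => Fs R nu l * v ^+ l * slc R l m / k%:R ^+ m) Kb) //.
  apply: eq_bigr => m _; rewrite /gco mulrC.
  have [K3 K30 hK3] := Fs_slc_bound m.*2 b0 brho.
  rewrite -(@lsumZ _ _ _ K3); first by apply: eq_lsum => l; rewrite mulrC.
  move=> n; apply: le_trans (hK3 _ (ltW v0) vb n); apply: ler_sum => l _.
  by rewrite normrM ler_wpM2l // slc_le.
have hG : `|\sum_(l < k.+1) (Gs p l - Fs R nu l) * v ^+ l * P l| <= K1 * N`!%:R / L ^+ N.
  apply: (@le_trans _ _ (K1 / ln p%:R)).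
    apply: le_trans (ler_norm_sum _ _ _) _; apply: le_trans (hK1 p p1 k.+1).
    apply: ler_sum => l _; have lk : (l <= k)%N := ltn_ord l.
    rewrite !normrM -mulrA ler_wpM2l //.
    apply: le_trans (ler_wpM2l (normr_ge0 _) (P1 _ lk)) _.
    rewrite mulr1 ger0_norm ?exprn_ge0 ?(ltW v0) // lerXn2r ?nnegrE ?(ltW v0) ?(ltW rho0) //.
    by apply: le_trans vb (ltW brho).
  rewrite -mulrA ler_wpM2l //.
  have lp := lnn_gt0 R p1.
  have -> : (ln (p%:R : R))^-1 = expR (- L) by rewrite expRN /L /loglog lnK // posrE.
  exact: pow_expRN.
have hb2 n : \sum_(l < n) `|Fs R nu l * v ^+ l * (P l - \sum_(m < N) slc R l m / k%:R ^+ m)| <= K2 / k%:R ^+ N.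
  apply: le_trans (ler_wpM2r _ (hK2 _ (ltW v0) vb n)); last by rewrite invr_ge0 exprn_ge0.
  rewrite mulr_suml; apply: ler_sum => l _; rewrite normrM -mulrA ler_wpM2l //.
  exact: slc_expand.
have hF : `|\sum_(l < k.+1) Fs R nu l * v ^+ l * P l - \sum_(m < N) gco m v / k%:R ^+ m| <= K2 / a ^+ N / L ^+ N.
  apply: (@le_trans _ _ (K2 / k%:R ^+ N)); last first.
    rewrite -mulrA ler_wpM2l // -invfM -exprMn lef_pV2 ?posrE ?exprn_gt0 ?mulr_gt0 //.
    by rewrite lerXn2r ?nnegrE ?mulr_ge0 ?(ltW a0) ?(ltW L0) ?(ltW kR).
  have -> : \sum_(l < k.+1) Fs R nu l * v ^+ l * P l - \sum_(m < N) gco m v / k%:R ^+ m =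
     lsum (fun l => Fs R nu l * v ^+ l * (P l - \sum_(m < N) slc R l m / k%:R ^+ m)).
    rewrite eF eS; apply/eqP; rewrite subr_eq; apply/eqP.
    have bT2 : exists K, forall n, \sum_(l < n) `|\sum_(m < N) Fs R nu l * v ^+ l * slc R l m / k%:R ^+ m| <= K.
      exists (\sum_(m < N) Kb m) => n.
      apply: (@le_trans _ _ (\sum_(l < n) \sum_(m < N) `|Fs R nu l * v ^+ l * slc R l m / k%:R ^+ m|)).
        by apply: ler_sum => l _; apply: ler_norm_sum.
      by rewrite exchange_big /=; apply: ler_sum => m _; apply: hKb.
    case: bT2 => K4 hK4; rewrite -(lsumD hb2 hK4); apply: eq_lsum => l.
    rewrite mulrBr [X in _ - X + _]mulr_sumr.
    have -> : \sum_(m < N) Fs R nu l * v ^+ l * (slc R l m / k%:R ^+ m) = \sum_(m < N) Fs R nu l * v ^+ l * slc R l m / k%:R ^+ m.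
      by apply: eq_bigr => m _; rewrite mulrA.
    by rewrite subrK.
  exact: lsum_le.
have -> : \sum_(l < k.+1) Gs p l * v ^+ l * P l - \sum_(m < N) gco m v / k%:R ^+ m =
  \sum_(l < k.+1) (Gs p l - Fs R nu l) * v ^+ l * P l +
  (\sum_(l < k.+1) Fs R nu l * v ^+ l * P l - \sum_(m < N) gco m v / k%:R ^+ m).
  rewrite addrA; congr (_ - _); rewrite -big_split /=; apply: eq_bigr => l _; ring.
by apply: le_trans (ler_normD _ _) _; rewrite mulrDl; apply: lerD.
Qed.
End Limits.

(** * Complex power series *)

Section Modulus.
Variable R : realType.
Local Notation C := (Cplx R).
Implicit Types z w : C.

(** The norm of [Cplx R] takes its values in [Cplx R] itself; this is the same number as a real, so
    that real order, limits and [lra] apply. *)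
Definition cmod (z : C) : R := Normc.normc (z : R[i]).

Lemma normE z : `|z| = (cmod z)%:C. Proof. by []. Qed.
Lemma cmod_ge0 z : 0 <= cmod z.
Proof. by case: z => a b; apply: sqrtr_ge0. Qed.
Lemma cmod0 : cmod 0 = 0. Proof. exact: Normc.normc0. Qed.
Lemma cmod1 : cmod 1 = 1. Proof. exact: Normc.normc1. Qed.
Lemma cmod_eq0 z : cmod z = 0 -> z = 0. Proof. exact: Normc.eq0_normc. Qed.
Lemma cmodM z w : cmod (z * w) = cmod z * cmod w. Proof. exact: Normc.normcM. Qed.
Lemma cmodV z : cmod z^-1 = (cmod z)^-1. Proof. exact: Normc.normcV. Qed.
Lemma cmodN z : cmod (- z) = cmod z.
Proof. by apply: (@complexI R); rewrite -!normE normrN. Qed.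
Lemma cmodD z w : cmod (z + w) <= cmod z + cmod w.
Proof. by rewrite -lecR rmorphD -!normE; apply: ler_normD. Qed.
Lemma cmodB z w : cmod (z - w) <= cmod z + cmod w.
Proof. by rewrite -(cmodN w) cmodD. Qed.
Lemma cmod_distC z w : cmod (z - w) = cmod (w - z).
Proof. by rewrite -cmodN opprB. Qed.
Lemma cmodX z n : cmod (z ^+ n) = cmod z ^+ n.
Proof. by elim: n => [|n ih]; rewrite ?expr0 ?cmod1 // !exprS cmodM ih. Qed.
Lemma cmod_real (x : R) : cmod x%:C = `|x|.
Proof. by rewrite /cmod /= expr0n /= addr0 sqrtr_sqr. Qed.
Lemma cmodi : cmod 'i = 1.
Proof. by rewrite /cmod /= expr0n expr1n add0r sqrtr1. Qed.
Lemma cmod_sum (I : Type) (r : seq I) (P : pred I) (F : I -> C) :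
  cmod (\sum_(i <- r | P i) F i) <= \sum_(i <- r | P i) cmod (F i).
Proof.
elim/big_ind2 : _ => [|x a y b h k|//]; first by rewrite cmod0.
by apply: le_trans (cmodD _ _) _; apply: lerD.
Qed.
Lemma Re_le_cmod z : `|complex.Re z| <= cmod z.
Proof. by case: z => a b; rewrite /cmod /= -sqrtr_sqr ler_wsqrtr // lerDl sqr_ge0. Qed.
Lemma Im_le_cmod z : `|complex.Im z| <= cmod z.
Proof. by case: z => a b; rewrite /cmod /= -sqrtr_sqr ler_wsqrtr // lerDr sqr_ge0. Qed.
Lemma cmod_le_ReIm z : cmod z <= `|complex.Re z| + `|complex.Im z|.
Proof.
have e : z = (complex.Re z)%:C + 'i * (complex.Im z)%:C by exact: complexE.
rewrite {1}e; apply: le_trans (cmodD _ _) _.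
by rewrite cmodM cmodi mul1r !cmod_real.
Qed.

Definition cto (u : nat -> C) (l : C) := (fun n => cmod (u n - l)) @ \oo --> (0 : R).

Lemma ctoP (u : nat -> C) l : cto u l <-> forall e : R, 0 < e -> \forall n \near \oo, cmod (u n - l) <= e.
Proof.
split=> [/cvgr0Pnorm_le h e e0|h].
  by have := h e e0; apply: filterS => n; rewrite ger0_norm ?cmod_ge0.
apply/cvgr0Pnorm_le => e e0; have := h e e0; apply: filterS => n.
by rewrite ger0_norm ?cmod_ge0.
Qed.

Lemma cto_cvg (u : nat -> C) l : cto u l -> u @ \oo --> l.
Proof.
move=> /ctoP h; apply/cvgrPdist_le => e; rewrite ltcE /= => /andP[/eqP ei e0].
have := h _ e0; apply: filterS => n hn; rewrite distrC normE lecE /= ei eqxx /=.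
exact: hn.
Qed.

Lemma cto_lim (u : nat -> C) l : cto u l -> limn u = l.
Proof. by move=> /cto_cvg h; apply: cvg_lim => //; apply: norm_hausdorff. Qed.

Lemma cto_squeeze (u : nat -> C) l (e : nat -> R) :
  (forall n, cmod (u n - l) <= e n) -> e @ \oo --> (0 : R) -> cto u l.
Proof.
move=> h he; apply: (@squeeze_cvgr _ _ _ _ (fun _ => 0) e) => //; last exact: cvg_cst.
by near=> n; rewrite cmod_ge0 h.
Unshelve. all: by end_near. Qed.

Lemma cto_unique (u : nat -> C) l l' : cto u l -> cto u l' -> l = l'.
Proof.
move=> /ctoP h /ctoP k; apply/eqP; rewrite -subr_eq0; apply/eqP/cmod_eq0/eqP.
rewrite -normr_le0 ger0_norm ?cmod_ge0 //; apply/ler_addgt0Pl => e e0; rewrite addr0.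
have e2 : 0 < e / 2 by rewrite divr_gt0.
near \oo => n.
have -> : l - l' = (u n - l') - (u n - l) by ring.
apply: le_trans (cmodB _ _) _; rewrite [leRHS]splitr; apply: lerD; near: n; [exact: k|exact: h].
Unshelve. all: by end_near. Qed.

Lemma cto_ext (u v : nat -> C) l : (forall n, u n = v n) -> cto u l -> cto v l.
Proof. by move=> h; have -> : u = v by apply/funext. Qed.

Lemma ctoM (u v : nat -> C) l l' : cto u l -> cto v l' -> cto (fun n => u n * v n) (l * l').
Proof.
move=> hu hv; have hh : (fun n => cmod (u n - l) * (cmod (v n - l') + cmod l') + cmod l * cmod (v n - l')) @ \oo --> (0 : R).
  have -> : 0 = 0 * (0 + cmod l') + cmod l * 0 by rewrite mul0r mulr0 addr0.
  have h1 : (fun n => cmod (v n - l') + cmod l') @ \oo --> 0 + cmod l'.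
    by apply: cvgD; [exact: hv|exact: cvg_cst].
  have h2 : (fun n => cmod l * cmod (v n - l')) @ \oo --> cmod l * 0.
    exact: (@cvgM _ _ _ _ (fun _ => cmod l) (fun n => cmod (v n - l')) (cmod l) 0 (cvg_cst _) hv).
  exact: cvgD (cvgM hu h1) h2.
apply: cto_squeeze hh => n.
have -> : u n * v n - l * l' = (u n - l) * ((v n - l') + l') + l * (v n - l') by ring.
apply: le_trans (cmodD _ _) _; rewrite !cmodM lerD2r ler_wpM2l ?cmod_ge0 //.
exact: cmodD.
Qed.
Lemma ctoB0 (u v : nat -> C) l : cto u l -> cto (fun n => v n - u n) 0 -> cto v l.
Proof.
move=> hu hv; have h : (fun n => cmod (v n - u n - 0) + cmod (u n - l)) @ \oo --> (0 : R).
  by have hh := cvgD hv hu; rewrite addr0 in hh; exact: hh.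
apply: cto_squeeze h => n.
have -> : v n - l = (v n - u n - 0) + (u n - l) by ring.
exact: cmodD.
Qed.
Lemma ctoS (u : nat -> C) l : cto u l -> cto (fun n => u n.+1) l.
Proof. by move=> h; rewrite /cto (cvg_shiftS (fun n => cmod (u n - l))). Qed.
Lemma cto_cst l : cto (fun _ => l) l.
Proof. by rewrite /cto; under eq_cvg do rewrite subrr cmod0; apply: cvg_cst. Qed.
End Modulus.

Section PowerSeries.
Variable R : realType.
Local Notation C := (Cplx R).
Implicit Types (z w h : C) (a b : nat -> R) (rho : R).

Definition psum a z n : C := \sum_(i < n) (a i)%:C * z ^+ i.
(* The real and imaginary parts are summed separately, so that convergence is
   that of real series. *)
Definition ev a z : C :=
  (lsum (fun i => a i * complex.Re (z ^+ i))) +i* (lsum (fun i => a i * complex.Im (z ^+ i))).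

Lemma Re_sum (I : Type) (r : seq I) (F : I -> C) :
  complex.Re (\sum_(i <- r) F i) = \sum_(i <- r) complex.Re (F i).
Proof. exact: (@raddf_sum _ _ (@complex.Re R : Rcomplex R -> R)). Qed.
Lemma Im_sum (I : Type) (r : seq I) (F : I -> C) :
  complex.Im (\sum_(i <- r) F i) = \sum_(i <- r) complex.Im (F i).
Proof. exact: (@raddf_sum _ _ (@complex.Im R : Rcomplex R -> R)). Qed.
Lemma ReB z w : complex.Re (z - w) = complex.Re z - complex.Re w.
Proof. by case: z; case: w. Qed.
Lemma ImB z w : complex.Im (z - w) = complex.Im z - complex.Im w.
Proof. by case: z; case: w. Qed.
Lemma ReZ (x : R) z : complex.Re (x%:C * z) = x * complex.Re z.
Proof. by case: z => p q; rewrite /= mul0r subr0. Qed.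
Lemma ImZ (x : R) z : complex.Im (x%:C * z) = x * complex.Im z.
Proof. by case: z => p q; rewrite /= mul0r addr0. Qed.

Lemma nbd_term rho a K z : nbd rho a K -> cmod z <= rho -> forall n, \sum_(i < n) `|a i| * cmod z ^+ i <= K.
Proof.
move=> h zr n; apply: le_trans (h n); apply: ler_sum => i _; rewrite ler_wpM2l //.
by rewrite lerXn2r ?nnegrE ?cmod_ge0 // (le_trans (cmod_ge0 z)).
Qed.

Lemma ev_cto rho a K z : nbd rho a K -> cmod z <= rho -> cto (psum a z) (ev a z).
Proof.
move=> h zr; have ht := nbd_term h zr.
have hRe : (fun n => \sum_(i < n) a i * complex.Re (z ^+ i)) @ \oo --> lsum (fun i => a i * complex.Re (z ^+ i)).
  apply: (@lsum_cvg _ _ K) => n; apply: le_trans (ht n); apply: ler_sum => i _.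
  by rewrite normrM ler_wpM2l // -cmodX Re_le_cmod.
have hIm : (fun n => \sum_(i < n) a i * complex.Im (z ^+ i)) @ \oo --> lsum (fun i => a i * complex.Im (z ^+ i)).
  apply: (@lsum_cvg _ _ K) => n; apply: le_trans (ht n); apply: ler_sum => i _.
  by rewrite normrM ler_wpM2l // -cmodX Im_le_cmod.
have dist0 (u : nat -> R) l : u @ \oo --> l -> (fun n => `|u n - l|) @ \oo --> (0 : R).
  move=> hu; have -> : (0 : R) = `|l - l| by rewrite subrr normr0.
  by apply: cvg_norm; apply: cvgB => //; exact: cvg_cst.
have hh : (fun n => `|\sum_(i < n) a i * complex.Re (z ^+ i) - lsum (fun i => a i * complex.Re (z ^+ i))| +
    `|\sum_(i < n) a i * complex.Im (z ^+ i) - lsum (fun i => a i * complex.Im (z ^+ i))|) @ \oo --> (0 : R).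
  by have h0 := cvgD (dist0 _ _ hRe) (dist0 _ _ hIm); rewrite addr0 in h0; exact: h0.
apply: cto_squeeze hh => n; apply: le_trans (cmod_le_ReIm _) _.
have eRe : complex.Re (psum a z n - ev a z) = \sum_(i < n) a i * complex.Re (z ^+ i) - lsum (fun i => a i * complex.Re (z ^+ i)).
  rewrite ReB /psum Re_sum; congr (_ - _).
  by apply: eq_bigr => i _; rewrite ReZ.
have eIm : complex.Im (psum a z n - ev a z) = \sum_(i < n) a i * complex.Im (z ^+ i) - lsum (fun i => a i * complex.Im (z ^+ i)).
  rewrite ImB /psum Im_sum; congr (_ - _).
  by apply: eq_bigr => i _; rewrite ImZ.
by rewrite eRe eIm.
Qed.

Lemma cmod_cto_le (u : nat -> C) l K : cto u l -> (forall n, cmod (u n) <= K) -> cmod l <= K.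
Proof.
move=> /ctoP h hu; apply/ler_addgt0Pl => e e0; near \oo => n.
have -> : l = u n - (u n - l) by ring.
apply: le_trans (cmodB _ _) _; rewrite addrC; apply: lerD; last exact: hu.
by near: n; apply: h.
Unshelve. all: by end_near. Qed.

Lemma psum_le rho a K z n : nbd rho a K -> cmod z <= rho -> cmod (psum a z n) <= K.
Proof.
move=> h zr; apply: le_trans (cmod_sum _ _ _) _; apply: le_trans (nbd_term h zr n).
by apply: ler_sum => i _; rewrite cmodM cmod_real cmodX.
Qed.
Lemma ev_le rho a K z : nbd rho a K -> cmod z <= rho -> cmod (ev a z) <= K.
Proof. by move=> h zr; apply: cmod_cto_le (ev_cto h zr) _ => n; apply: psum_le zr. Qed.

Lemma eq_ev a b z : a =1 b -> ev a z = ev b z.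
Proof. by move/funext => ->. Qed.

Lemma ev0 a : ev a 0 = (a 0%N)%:C.
Proof.
rewrite /ev; have h1 : lsum (fun i => a i * complex.Re ((0 : C) ^+ i)) = a 0%N.
  rewrite (@lsum_fin _ _ 1) ?big_ord1 ?expr0 ?mulr1 // => i i0.
  by rewrite expr0n gtn_eqF //= mulr0.
have h2 : lsum (fun i => a i * complex.Im ((0 : C) ^+ i)) = 0.
  rewrite (@lsum_fin _ _ 1) ?big_ord1 ?expr0 ?mulr0 // => i i0.
  by rewrite expr0n gtn_eqF //= mulr0.
by rewrite h1 h2.
Qed.

Lemma ev_real a (x : R) : ev a x%:C = (lsum (fun i => a i * x ^+ i))%:C.
Proof.
rewrite /ev; have e1 i : complex.Re ((x%:C : C) ^+ i) = x ^+ i by rewrite -rmorphXn.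
have e2 i : complex.Im ((x%:C : C) ^+ i) = 0 by rewrite -rmorphXn.
have h1 : lsum (fun i => a i * complex.Re ((x%:C : C) ^+ i)) = lsum (fun i => a i * x ^+ i).
  by apply: eq_lsum => i; rewrite e1.
have h2 : lsum (fun i => a i * complex.Im ((x%:C : C) ^+ i)) = 0.
  by rewrite (@lsum_fin _ _ 0) ?big_ord0 // => i _; rewrite e2 mulr0.
by rewrite h1 h2.
Qed.

Lemma ev_add rho a b K K' z : nbd rho a K -> nbd rho b K' -> cmod z <= rho ->
  ev (fun i => a i + b i) z = ev a z + ev b z.
Proof.
move=> ha hb zr; have r0 : 0 <= rho := le_trans (cmod_ge0 z) zr.
have h1 := ev_cto ha zr; have h2 := ev_cto hb zr.
have hab n : \sum_(i < n) `|a i + b i| * cmod z ^+ i <= K + K'.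
  apply: le_trans (lerD (nbd_term ha zr n) (nbd_term hb zr n)); rewrite -big_split /=.
  by apply: ler_sum => i _; rewrite -mulrDl ler_wpM2r ?exprn_ge0 ?cmod_ge0 // ler_normD.
have h3 := @ev_cto (cmod z) (fun i => a i + b i) (K + K') z hab (lexx _).
apply: cto_unique h3 _.
have hs : (fun n => cmod (psum a z n - ev a z) + cmod (psum b z n - ev b z)) @ \oo --> (0 : R).
  by have h0 := cvgD h1 h2; rewrite addr0 in h0; exact: h0.
apply: cto_squeeze hs => n.
have -> : psum (fun i => a i + b i) z n - (ev a z + ev b z) = (psum a z n - ev a z) + (psum b z n - ev b z).
  suff -> : psum (fun i => a i + b i) z n = psum a z n + psum b z n by ring.
  by rewrite /psum -big_split; apply: eq_bigr => i _; rewrite rmorphD mulrDl.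
exact: cmodD.
Qed.

Lemma conv_sum_defect (T : comNzRingType) (x y : nat -> T) N :
  (\sum_(i < N) x i) * (\sum_(j < N) y j) - \sum_(n < N) conv x y n =
  \sum_(i < N) \sum_(j < N | (N <= i + j)%N) x i * y j.
Proof.
have -> : \sum_(n < N) conv x y n = \sum_(i < N) \sum_(j < N | (i + j < N)%N) x i * y j.
  transitivity (\sum_(n < N) \sum_(i < N | (i <= n)%N) x i * y (n - i)%N).
    by apply: eq_bigr => n _; rewrite /conv (big_ord_widen N (fun i => x i * y (n - i)%N)).
  rewrite (exchange_big_dep xpredT) //=; apply: eq_bigr => i _.
  rewrite -(big_mkord (fun n => (i <= n)%N) (fun n => x i * y (n - i)%N)).
  rewrite -(big_mkord (fun j => (i + j < N)%N) (fun j => x i * y j)).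
  have iN : (i <= N)%N by apply: ltnW.
  rewrite (big_cat_nat (n := i)) //= big_nat_cond big_pred0 ?add0r; last first.
    by move=> m; rewrite leq0n /= ltnNge; case: (i <= m)%N; rewrite ?andbF.
  rewrite -{1}[val i]add0n big_addn.
  rewrite [RHS](big_cat_nat (n := N - i)) ?leq_subr //=.
  rewrite [X in _ = _ + X]big_nat_cond [X in _ = _ + X]big_pred0 ?addr0; last first.
    by move=> m; apply/negbTE/negP => /andP[/andP[h _] k]; lia.
  rewrite big_nat_cond [RHS]big_nat_cond; apply: eq_big => m; last by rewrite addnK.
  by rewrite leq_addl andbT; case: ltnP => //= h; apply/esym/idP; lia.
rewrite big_distrlr /= -sumrB; apply: eq_bigr => i _.
rewrite (bigID (fun j : 'I_N => (i + j < N)%N)) /= addrC addrK.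
by apply: eq_bigl => j; rewrite -leqNgt.
Qed.

(** If i + j >= N >= 2 M, then i and j are not both below M, so the pairs on the left lie outside
    the square of side M. With M about N / 2 this makes the defect of a Cauchy product tend to 0. *)
Lemma sum_le_defect (x y : nat -> R) N M : (forall i, 0 <= x i) -> (forall i, 0 <= y i) -> (M.*2 <= N)%N ->
  \sum_(i < N) \sum_(j < N | (N <= i + j)%N) x i * y j <=
  (\sum_(i < N) x i) * (\sum_(j < N) y j) - (\sum_(i < M) x i) * (\sum_(j < M) y j).
Proof.
move=> x0 y0 MN; have MN' : (M <= N)%N by lia.
rewrite !big_distrlr /= (big_ord_widen N (fun i => \sum_(j < M) x i * y j)) // [X in _ - X]big_mkcond /=.
rewrite -sumrB; apply: ler_sum => i _; case: ifP => iM.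
  rewrite (@big_ord_widen _ _ _ M N (fun j => x i * y j)) // [X in _ <= X - _](bigID (fun j : 'I_N => (j < M)%N)) /=.
  rewrite [X in _ <= X - _]addrC addrK.
  rewrite big_mkcond [leRHS]big_mkcond; apply: ler_sum => j _.
  case: ifP => h1; case: ifP => h2 //; first by move/negbFE: h2 => h2; lia.
  by rewrite mulr_ge0.
rewrite subr0 big_mkcond; apply: ler_sum => j _; case: ifP => // _.
by rewrite mulr_ge0.
Qed.

Lemma cauchy_prod (X Y : nat -> C) (x y : nat -> R) K K' lX lY :
  (forall i, cmod (X i) <= x i) -> (forall i, cmod (Y i) <= y i) ->
  (forall n, \sum_(i < n) x i <= K) -> (forall n, \sum_(i < n) y i <= K') ->
  cto (fun n => \sum_(i < n) X i) lX -> cto (fun n => \sum_(i < n) Y i) lY ->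
  cto (fun n => \sum_(m < n) conv X Y m) (lX * lY).
Proof.
move=> hX hY hx hy cX cY; apply: ctoB0 (ctoM cX cY) _.
have x0 i : 0 <= x i by apply: le_trans (hX i); exact: cmod_ge0.
have y0 i : 0 <= y i by apply: le_trans (hY i); exact: cmod_ge0.
pose A n := \sum_(i < n) x i; pose B n := \sum_(i < n) y i.
have hA : A @ \oo --> lsum x by apply: (@lsum_cvg _ _ K) => n; under eq_bigr do rewrite ger0_norm //; apply: hx.
have hB : B @ \oo --> lsum y by apply: (@lsum_cvg _ _ K') => n; under eq_bigr do rewrite ger0_norm //; apply: hy.
have half_oo : (fun n : nat => n./2) @ \oo --> \oo.
  by apply/cvgnyPge => k; exists k.*2 => // n /= kn; rewrite -(doubleK k) half_leq.
have hA2 : (fun n => A n./2) @ \oo --> lsum x by apply: cvg_comp half_oo hA.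
have hB2 : (fun n => B n./2) @ \oo --> lsum y by apply: cvg_comp half_oo hB.
have hd : (fun n => A n * B n - A n./2 * B n./2) @ \oo --> (0 : R).
  by have h0 := cvgB (cvgM hA hB) (cvgM hA2 hB2); rewrite subrr in h0; exact: h0.
apply: cto_squeeze hd => n; rewrite subr0 cmod_distC conv_sum_defect.
have n2 : (n./2.*2 <= n)%N by rewrite -[leqRHS]odd_double_half leq_addl.
apply: le_trans (sum_le_defect x0 y0 n2).
apply: le_trans (cmod_sum _ _ _) _; apply: ler_sum => i _.
apply: le_trans (cmod_sum _ _ _) _; apply: ler_sum => j _.
by rewrite cmodM; apply: ler_pM; rewrite ?cmod_ge0.
Qed.

Lemma ev_conv rho a b K K' z : 0 < rho -> nbd rho a K -> nbd rho b K' -> cmod z <= rho ->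
  ev (conv a b) z = ev a z * ev b z.
Proof.
move=> r0 ha hb zr; have hab := nbd_conv r0 ha hb.
apply: cto_unique (ev_cto hab zr) _.
have bnd c i : cmod ((c i)%:C * z ^+ i) <= `|c i| * rho ^+ i.
  by rewrite cmodM cmod_real cmodX ler_wpM2l // lerXn2r ?nnegrE ?cmod_ge0 // ltW.
have h := cauchy_prod (bnd a) (bnd b) ha hb (ev_cto ha zr) (ev_cto hb zr).
apply: cto_ext h => n; apply: eq_bigr => m _; rewrite /conv rmorph_sum mulr_suml; apply: eq_bigr => i _.
have im : (i <= m)%N := ltn_ord i.
have -> : z ^+ m = z ^+ i * z ^+ (m - i) by rewrite -exprD subnKC.
by rewrite rmorphM [RHS]mulrACA.
Qed.
End PowerSeries.

(** * Iterated complex derivatives *)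

Section Derivative.
Variable R : realType.
Local Notation C := (Cplx R).
Implicit Types (z w h : C) (a b : nat -> R) (rho : R).

Lemma ctoD (u v : nat -> C) l l' : cto u l -> cto v l' -> cto (fun n => u n + v n) (l + l').
Proof.
move=> hu hv; have hs : (fun n => cmod (u n - l) + cmod (v n - l')) @ \oo --> (0 : R).
  by have h0 := cvgD hu hv; rewrite addr0 in h0; exact: h0.
apply: cto_squeeze hs => n.
have -> : u n + v n - (l + l') = (u n - l) + (v n - l') by ring.
exact: cmodD.
Qed.
Lemma ctoZ c (u : nat -> C) l : cto u l -> cto (fun n => c * u n) (c * l).
Proof. by move=> h; apply: ctoM => //; exact: cto_cst. Qed.

Definition dseq a n : R := n.+1%:R * a n.+1.

Lemma geom_diff (s r : R) n : 0 <= s -> s <= r -> n.+1%:R * s ^+ n * (r - s) <= r ^+ n.+1.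
Proof.
move=> s0 sr; have r0 : 0 <= r by apply: le_trans sr.
apply: (@le_trans _ _ (r ^+ n.+1 - s ^+ n.+1)); last by rewrite gerBl exprn_ge0.
rewrite subrXX mulrC ler_wpM2l ?subr_ge0 //.
have -> : n.+1%:R * s ^+ n = \sum_(i < n.+1) s ^+ n.
  by rewrite sumr_const card_ord mulr_natl.
apply: ler_sum => i _; have im : (i <= n)%N := ltn_ord i.
rewrite -[X in s ^+ X](subnK im) exprD ler_wpM2r ?exprn_ge0 //.
by rewrite lerXn2r.
Qed.

(** A Cauchy estimate at the level of coefficients: (n + 1) s^n (rho - s) <= rho^(n + 1), so
    shrinking the radius pays for one derivative. *)
Lemma nbd_dseq rho s a K : 0 <= s -> s < rho -> nbd rho a K -> nbd s (dseq a) (K / (rho - s)).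
Proof.
move=> s0 sr h n; have d0 : 0 < rho - s by rewrite subr_gt0.
have r0 : 0 <= rho by lra.
rewrite ler_pdivlMr // mulr_suml; apply: le_trans (h n.+1).
rewrite big_ord_recl -[leLHS]add0r; apply: lerD; first by rewrite mulr_ge0 ?exprn_ge0.
apply: ler_sum => i _; rewrite /dseq normrM normr_nat.
have := geom_diff i s0 (ltW sr) => hg.
have := ler_wpM2l (normr_ge0 (a i.+1)) hg => /(le_trans _); apply.
by rewrite le_eqVlt; apply/orP; left; apply/eqP; ring.
Qed.

(* The quadratic remainder of z^n; over the nonnegative reals it bounds the
   complex one. *)
Definition Dn (T : comNzRingType) (z h : T) n : T := (z + h) ^+ n - z ^+ n - h * (n%:R * z ^+ n.-1).

Lemma DnS (T : comNzRingType) (z h : T) n : Dn z h n.+1 = (z + h) * Dn z h n + n%:R * h ^+ 2 * z ^+ n.-1.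
Proof.
rewrite /Dn; case: n => [|n]; first by rewrite !expr0 expr1 /=; ring.
have -> : (n.+2%:R : T) = n.+1%:R + 1 by rewrite natr1.
by rewrite /= !exprS; ring.
Qed.

(** Every term of the binomial remainder contains h at least twice, so passing from h to d >= |h|
    gains the factor (|h| / d)^2. *)
Lemma Dn_bound z h (d : R) n : cmod h <= d -> 0 < d ->
  cmod (Dn z h n) <= (cmod h / d) ^+ 2 * Dn (cmod z) d n.
Proof.
move=> hd d0; have h0 := cmod_ge0 h; have z0 := cmod_ge0 z.
elim: n => [|n ih].
  have -> : Dn z h 0 = 0 by rewrite /Dn !expr0 mul0r mulr0 subrr subr0.
  by rewrite /Dn !expr0 mul0r mulr0 subrr subr0 mulr0 cmod0.
rewrite !DnS [leRHS]mulrDr; apply: le_trans (cmodD _ _) _; apply: lerD.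
  rewrite cmodM mulrCA; apply: ler_pM; rewrite ?cmod_ge0 //.
  by apply: le_trans (cmodD _ _) _; rewrite lerD2l.
have -> : (cmod h / d) ^+ 2 * (n%:R * d ^+ 2 * cmod z ^+ n.-1) = n%:R * cmod h ^+ 2 * cmod z ^+ n.-1.
  by field; rewrite gt_eqF.
rewrite !cmodM !cmodX; have -> : (n%:R : C) = (n%:R : R)%:C by rewrite rmorph_nat.
by rewrite cmod_real normr_nat.
Qed.

Lemma Dn_le (x d : R) n : 0 <= x -> 0 <= d -> Dn x d n <= (x + d) ^+ n.
Proof.
move=> x0 d0; rewrite /Dn -addrA gerDl -opprD oppr_le0.
by rewrite addr_ge0 ?mulr_ge0 ?exprn_ge0.
Qed.

Lemma ev_quad rho a K z h (d : R) : nbd rho a K -> 0 < d -> cmod z + d <= rho -> cmod h <= d ->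
  cmod (ev a (z + h) - ev a z - h * ev (dseq a) z) <= cmod h ^+ 2 * (K / d ^+ 2).
Proof.
move=> ha d0 zd hd; have zr : cmod z < rho by lra.
have z0 := cmod_ge0 z.
have hzr : cmod (z + h) <= rho by apply: le_trans (cmodD _ _) _; lra.
have c1 := ctoS (ev_cto ha hzr); have c2 := ctoS (ev_cto ha (ltW zr)).
have c3 := ev_cto (nbd_dseq z0 zr ha) (lexx (cmod z)).
have c4 := ctoD (ctoD c1 (ctoZ (-1) c2)) (ctoZ (- h) c3).
have -> : ev a (z + h) - ev a z - h * ev (dseq a) z = ev a (z + h) + -1 * ev a z + - h * ev (dseq a) z.
  by rewrite mulN1r mulNr.
apply: cmod_cto_le c4 _ => n.
have -> : psum a (z + h) n.+1 + -1 * psum a z n.+1 + - h * psum (dseq a) z n =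
  \sum_(i < n.+1) (a i)%:C * Dn z h i.
  have -> : psum (dseq a) z n = \sum_(i < n.+1) (a i)%:C * (i%:R * z ^+ i.-1).
    rewrite big_ord_recl mul0r mulr0 add0r; apply: eq_bigr => i _.
    by rewrite /dseq rmorphM rmorph_nat /= mulrAC mulrC.
  rewrite /psum mulN1r mulNr mulr_sumr -!sumrB; apply: eq_bigr => i _.
  by rewrite /Dn; ring.
apply: le_trans (cmod_sum _ _ _) _.
apply: (@le_trans _ _ (\sum_(i < n.+1) (cmod h / d) ^+ 2 * (`|a i| * rho ^+ i))).
  apply: ler_sum => i _; rewrite cmodM cmod_real mulrCA ler_wpM2l //.
  apply: le_trans (Dn_bound z i hd d0) _; rewrite ler_wpM2l ?exprn_ge0 ?divr_ge0 ?cmod_ge0 ?(ltW d0) //.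
  apply: le_trans (Dn_le i z0 (ltW d0)) _; rewrite lerXn2r ?nnegrE ?addr_ge0 ?(ltW d0) //.
  lra.
rewrite -mulr_sumr expr_div_n -mulrA ler_wpM2l ?exprn_ge0 ?cmod_ge0 // mulrC.
by rewrite ler_wpM2r ?invr_ge0 ?exprn_ge0 ?(ltW d0) // ha.
Qed.

Lemma near_cmod_lt z (e : R) : 0 < e -> \forall w \near z, cmod (w - z) < e.
Proof.
move=> e0; have : (e%:C : C) > 0 by rewrite ltcR.
move/(cvgrPdist_lt _ _).1 : (@cvg_id _ (nbhs z)) => /(_ e%:C) h.
by move=> /h; apply: filterS => w; rewrite distrC normE ltcR.
Qed.

Lemma near_cmod z rho : cmod z < rho -> \forall w \near z, cmod w < rho.
Proof.
move=> zr; have e0 : 0 < rho - cmod z by rewrite subr_gt0.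
apply: filterS (near_cmod_lt z e0) => w hw.
have -> : w = (w - z) + z by ring.
by apply: le_lt_trans (cmodD _ _) _; rewrite -ltrBrDr.
Qed.

Lemma gt0_cplx (r : C) : 0 < r -> r = (complex.Re r)%:C /\ 0 < complex.Re r.
Proof. by case: r => x y; rewrite ltcE /= => /andP[/eqP -> ->]. Qed.

Lemma near_self (P : C -> Prop) z : (\forall w \near z, P w) -> P z.
Proof. by move=> h; have h' : nbhs z P by []; exact: nbhs_singleton h'. Qed.
Lemma near_near (P : C -> Prop) z : (\forall w \near z, P w) -> \forall w \near z, \forall u \near w, P u.
Proof. by move=> h; have h' : nbhs z P by []; exact: nbhs_interior h'. Qed.

(** The estimate uses the real modulus and covers a full disc of increments, h = 0 included, which
    makes the rules for sums and compositions elementary; [hasd_derive1] leads back to [derive1]. *)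
Definition hasd (f : C -> C) (z df : C) := forall e : R, 0 < e ->
  exists2 d : R, 0 < d & forall h, cmod h <= d -> cmod (f (z + h) - f z - h * df) <= e * cmod h.

Lemma newton_quotient (f : C -> C) (h z df : C) : h != 0 ->
  h^-1 *: (f (h *: 1 + z) - f z) - df = h^-1 * (f (z + h) - f z - h * df).
Proof.
move=> h0; have -> : h *: (1 : C) + z = z + h by rewrite /GRing.scale /= mulr1 addrC.
by rewrite [RHS]mulrBr mulKf.
Qed.

Lemma hasd_derive1 (f : C -> C) z df : hasd f z df -> derive1 f z = df.
Proof.
move=> hf; rewrite derive1E /derive; apply: cvg_lim; first exact: norm_hausdorff.
apply/cvgrPdist_le => e; rewrite ltcE /= => /andP[/eqP ei e0].
have ee : e = (complex.Re e)%:C by case: e ei {e0} => x y /= ->.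
have [d d0 hd] := hf _ e0.
near=> h.
have h0 : (h : C) != 0 by near: h; exact: (@nbhs_dnbhs_neq C 0).
have hs : `|(h : C)| < d%:C by near: h; apply: (@dnbhs0_lt C C); rewrite ltcR.
rewrite normE ltcR in hs.
rewrite distrC normE ee lecR.
have hm0 : 0 < cmod h by rewrite lt_def cmod_ge0 andbT; apply: contra h0 => /eqP/cmod_eq0/eqP.
rewrite newton_quotient // cmodM cmodV ler_pdivrMl // [leRHS]mulrC.
exact: hd (ltW hs).
Unshelve. all: by end_near. Qed.

Lemma hasd_near (f g : C -> C) z df : (\forall w \near z, f w = g w) -> hasd f z df -> hasd g z df.
Proof.
move=> fg hf e e0; have [d d0 hd] := hf _ e0.
have : nbhs z (fun w => f w = g w) by [].
rewrite -(@nbhs_ballE C C) => -[r r0 hr].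
have [re r0'] := gt0_cplx r0; rewrite re in hr; move: r0' => {}r0.
exists (Num.min d (complex.Re r / 2)); first by rewrite lt_min d0 divr_gt0.
move=> h; rewrite le_min => /andP[h1 h2].
have ez : f z = g z by apply: hr; apply: ballxx; rewrite ltcR.
have eh : f (z + h) = g (z + h).
  apply: hr; rewrite -ball_normE /ball_ /= opprD addNKr normrN normE ltcR.
  by apply: le_lt_trans h2 _; lra.
by rewrite -ez -eh; exact: hd.
Qed.

Lemma hasd_cst c z : hasd (fun _ => c) z 0.
Proof.
move=> e e0; exists 1 => // h _; rewrite subrr mulr0 subr0 cmod0.
by rewrite mulr_ge0 ?cmod_ge0 ?(ltW e0).
Qed.
Lemma hasd_lin c z : hasd (fun w => c * w) z c.
Proof.
move=> e e0; exists 1 => // h _.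
have -> : c * (z + h) - c * z - h * c = 0 by ring.
by rewrite cmod0 mulr_ge0 ?cmod_ge0 ?(ltW e0).
Qed.
Lemma hasd_add f g z df dg : hasd f z df -> hasd g z dg -> hasd (fun w => f w + g w) z (df + dg).
Proof.
move=> hf hg e e0; have e2 : 0 < e / 2 by rewrite divr_gt0.
have [d d0 hd] := hf _ e2; have [c c0 hc] := hg _ e2.
exists (Num.min d c); first by rewrite lt_min d0.
move=> h; rewrite le_min => /andP[h1 h2].
have -> : f (z + h) + g (z + h) - (f z + g z) - h * (df + dg) =
  (f (z + h) - f z - h * df) + (g (z + h) - g z - h * dg).
  move: (f (z + h)) (f z) (g (z + h)) (g z) => A B A' B'; ring.
apply: le_trans (cmodD _ _) _; rewrite [e]splitr [leRHS]mulrDl.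
by apply: lerD; [exact: hd|exact: hc].
Qed.
Lemma hasd_lip f z df : hasd f z df -> exists2 d : R, 0 < d &
  forall h, cmod h <= d -> cmod (f (z + h) - f z) <= (cmod df + 1) * cmod h.
Proof.
move=> /(_ 1 ltr01) [d d0 hd]; exists d => // h hh.
have -> : f (z + h) - f z = (f (z + h) - f z - h * df) + h * df by rewrite subrK.
apply: le_trans (cmodD _ _) _; rewrite mulrDl addrC; apply: lerD; last exact: hd.
by rewrite cmodM mulrC.
Qed.

Lemma hasd_comp f g z df dg : hasd f (g z) df -> hasd g z dg -> hasd (fun w => f (g w)) z (df * dg).
Proof.
move=> hf hg e e0.
have [c c0 hc] := hasd_lip hg; have L0 : 0 < cmod dg + 1 by rewrite ltr_wpDl ?cmod_ge0.
have M0 : 0 < cmod df + 1 by rewrite ltr_wpDl ?cmod_ge0.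
have e1 : 0 < e / 2 / (cmod dg + 1) by rewrite !divr_gt0.
have e2 : 0 < e / 2 / (cmod df + 1) by rewrite !divr_gt0.
have [d d0 hd] := hf _ e1; have [d' d0' hd'] := hg _ e2.
have d1 : 0 < d / (cmod dg + 1) by rewrite divr_gt0.
exists (Num.min c (Num.min (d / (cmod dg + 1)) d')); first by rewrite !lt_min c0 d1.
move=> h; rewrite !le_min => /and3P[h1 h2 h3].
have hk := hc h h1; set k := g (z + h) - g z in hk.
have gk : g (z + h) = g z + k by rewrite /k [RHS]addrC subrK.
have kd : cmod k <= d by apply: le_trans hk _; rewrite mulrC -ler_pdivlMr.
have A := hd k kd; have B := hd' h h3.
rewrite gk.
have -> : f (g z + k) - f (g z) - h * (df * dg) = (f (g z + k) - f (g z) - k * df) + df * (g (z + h) - g z - h * dg).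
  rewrite -/k; move: (f (g z + k)) (f (g z)) => x y; ring.
apply: le_trans (cmodD _ _) _; rewrite [e]splitr [leRHS]mulrDl; apply: lerD.
  apply: le_trans A _; have := ler_wpM2l (ltW e1) hk; move/le_trans; apply.
  by rewrite mulrA divfK // gt_eqF.
rewrite cmodM; have := ler_wpM2l (cmod_ge0 df) B; move/le_trans; apply.
rewrite mulrA ler_wpM2r ?cmod_ge0 //.
rewrite mulrCA -[leRHS]mulr1 ler_wpM2l ?divr_ge0 ?(ltW e0) //.
by rewrite ler_pdivrMr // mul1r lerDl.
Qed.

Lemma hasd_sqr z : hasd (fun w => w * w) z (2 * z).
Proof.
move=> e e0; exists e => // h he.
have -> : (z + h) * (z + h) - z * z - h * (2 * z) = h * h by ring.
by rewrite cmodM ler_wpM2r ?cmod_ge0.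
Qed.
Lemma hasd_scale c f z df : hasd f z df -> hasd (fun w => c * f w) z (c * df).
Proof. by move=> hf; apply: (hasd_comp (f := fun w => c * w)) hf; exact: hasd_lin. Qed.

(* Polarisation: the product rule follows from those for squares and sums. *)
Lemma hasd_mul f g z df dg : hasd f z df -> hasd g z dg ->
  hasd (fun w => f w * g w) z (f z * dg + g z * df).
Proof.
move=> hf hg.
have sq u du : hasd u z du -> hasd (fun w => u w * u w) z (2 * u z * du).
  by move=> hu; apply: (hasd_comp (f := fun w => w * w)) hu; exact: hasd_sqr.
have h1 := sq _ _ (hasd_add hf hg).
have h2 := sq _ _ (hasd_add hf (hasd_scale (-1) hg)).
have h3 := hasd_scale (4^-1) (hasd_add h1 (hasd_scale (-1) h2)).
have -> : f z * dg + g z * df = 4^-1 * (2 * (f z + g z) * (df + dg) + -1 * (2 * (f z + -1 * g z) * (df + -1 * dg))).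
  move: (f z) (g z) => x y; by field.
apply: hasd_near h3; near=> w; move: (f w) (g w) => x y; by field.
Unshelve. all: by end_near. Qed.

Lemma ev_hasd rho a K z : nbd rho a K -> cmod z < rho -> hasd (ev a) z (ev (dseq a) z).
Proof.
move=> ha zr e e0; have d0 : 0 < rho - cmod z by rewrite subr_gt0.
have K0 : 0 <= K by apply: le_trans (ha 0%N); rewrite big_ord0.
pose D := rho - cmod z; have K1 : 0 < K / D ^+ 2 + 1 by rewrite ltr_wpDl ?divr_ge0 ?exprn_ge0 ?(ltW d0).
exists (Num.min D (e / (K / D ^+ 2 + 1))); first by rewrite lt_min d0 divr_gt0.
move=> h; rewrite le_min => /andP[h1 h2].
have zd : cmod z + D <= rho by rewrite /D addrC subrK.
apply: le_trans (ev_quad ha d0 zd h1) _.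
rewrite expr2 -mulrA mulrC ler_wpM2r ?cmod_ge0 //.
apply: (@le_trans _ _ (cmod h * (K / D ^+ 2 + 1))); first by rewrite ler_wpM2l ?cmod_ge0 // lerDl.
by rewrite -ler_pdivlMr.
Qed.

(* [J N f P a]: near [a] the function [f] is [N - 1] times differentiable and
   [P] agrees with its Taylor polynomial at [a] below degree [N]; unlike an
   estimate [f = P + O(h^N)] this determines the iterated derivatives. *)
Fixpoint J N (f : C -> C) (P : {poly C}) (a : C) : Prop :=
  if N is N'.+1 then f a = P`_0 /\
    exists g, (\forall z \near a, hasd f z (g z)) /\ J N' g P^`() a
  else True.

Lemma J_near N f g P (a : C) : (\forall z \near a, f z = g z) -> J N f P a -> J N g P a.
Proof.
case: N => //= N hfg [fa [df [hdf hJ]]]; split.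
  by have h := near_self hfg; rewrite -fa -h.
exists df; split => //; have hfg' := near_near hfg.
by apply: filterS2 hfg' hdf => z; exact: hasd_near.
Qed.

Lemma J_le M N f P (a : C) : (M <= N)%N -> J N f P a -> J M f P a.
Proof.
elim: N M f P => [|N ih] [|M] f P //= MN [fa [g [hg hJ]]]; split=> //.
by exists g; split => //; apply: ih hJ.
Qed.

Lemma J_derive1n N f P (a : C) n : J N f P a -> (n < N)%N -> derive1n n f a = P`_n *+ n`!.
Proof.
elim: n N f P => [|n ih] [|N] f P // [fa [g [hg hJ]]] nN; first by rewrite derive1n0 fa.
rewrite derive1Sn (ih N _ P^`()) //.
  by rewrite coef_deriv -mulrnA factS mulnC.
apply: J_near hJ; apply: filterS hg => z hz.
by rewrite (hasd_derive1 hz).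
Qed.

Lemma J_eqm N f P Q (a : C) : J N f P a -> eqm N P Q -> J N f Q a.
Proof.
elim: N f P Q => [|N ih] f P Q //= [fa [g [hg hJ]]] PQ; split; first by rewrite fa PQ.
by exists g; split => //; apply: ih hJ _; apply: eqm_deriv.
Qed.

Lemma J_cst N c (a : C) : J N (fun _ => c) c%:P a.
Proof.
elim: N c => [|N ih] c //=; rewrite coefC; split=> //.
exists (fun _ => 0); split; first by near=> z; exact: hasd_cst.
by rewrite derivC.
Unshelve. all: by end_near. Qed.

Lemma J_lin N c : J N (fun z => c * z) (c *: 'X) 0.
Proof.
case: N => [|N] //=; rewrite coefZ coefX !mulr0; split=> //.
exists (fun _ => c); split; last by rewrite derivZ derivX alg_polyC; exact: J_cst.
by near=> z; exact: hasd_lin.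
Unshelve. all: by end_near. Qed.

Lemma J_add N f g P Q (a : C) : J N f P a -> J N g Q a -> J N (fun z => f z + g z) (P + Q) a.
Proof.
elim: N f g P Q => [|N ih] f g P Q //= [fa [df [hdf hf]]] [ga [dg [hdg hg]]].
split; first by rewrite coefD fa ga.
exists (fun z => df z + dg z); split; last by rewrite derivD; apply: ih.
by apply: filterS2 hdf hdg => z; exact: hasd_add.
Qed.

Lemma J_mul N f g P Q (a : C) : J N f P a -> J N g Q a -> J N (fun z => f z * g z) (P * Q) a.
Proof.
elim: N f g P Q => [|N ih] f g P Q // hf' hg'.
have hf1 := J_le (leqnSn N) hf'; have hg1 := J_le (leqnSn N) hg'.
move: hf' hg' => /= [fa [df [hdf hf]]] [ga [dg [hdg hg]]].
split; first by rewrite coefM big_ord1 fa ga.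
exists (fun z => f z * dg z + g z * df z); split.
  by apply: filterS2 hdf hdg => z; exact: hasd_mul.
have -> : (P * Q)^`() = P * Q^`() + Q * P^`() by rewrite derivM addrC [Q * _]mulrC.
by apply: J_add; apply: ih.
Qed.

Lemma J_exp N f P (a : C) n : J N f P a -> J N (fun z => f z ^+ n) (P ^+ n) a.
Proof.
move=> h; elim: n => [|n ih]; first exact: J_cst.
rewrite exprS; apply: J_near (J_mul h ih).
by near=> z; rewrite exprS.
Unshelve. all: by end_near. Qed.

(** The polynomials are Taylor polynomials in the increment, so the constant term of the inner one,
    which is the base point g(a), is removed before composing. *)
Lemma J_comp N f g P Q (a : C) : J N f P (g a) -> J N g Q a ->
  J N (fun z => f (g z)) (P \Po (Q - (Q`_0)%:P)) a.
Proof.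
elim: N f g P Q => [|N ih] f g P Q // hf' hg'.
have hg1 := J_le (leqnSn N) hg'.
move: hf' hg' => /= [fa [df [hdf hf]]] [ga [dg [hdg hg]]].
split.
  by rewrite fa -!horner_coef0 horner_comp !hornerE subrr.
exists (fun z => df (g z) * dg z); split; last first.
  rewrite deriv_comp derivB derivC subr0; apply: J_mul hg.
  exact: ih.
have gc : \forall z \near a, hasd f (g z) (df (g z)).
  have : nbhs (g a) (fun w => hasd f w (df w)) by [].
  rewrite -(@nbhs_ballE C C) => -[r r0 hr].
  have [re r0'] := gt0_cplx r0; rewrite re in hr; move: r0' => {}r0.
  have [d d0 hd] := hasd_lip (near_self hdg).
  have L0 : 0 < cmod (dg a) + 1 by rewrite ltr_wpDl ?cmod_ge0.
  have m0 : 0 < Num.min d (complex.Re r / (cmod (dg a) + 1)) by rewrite lt_min d0 divr_gt0.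
  apply: filterS (near_cmod_lt a m0) => z; rewrite lt_min => /andP[h1 h2].
  apply: hr; rewrite -ball_normE /ball_ /= distrC normE ltcR.
  have := hd _ (ltW h1); rewrite [a + _]addrC subrK => /le_lt_trans; apply.
  by rewrite mulrC -ltr_pdivlMr.
by apply: filterS2 gc hdg => z; exact: hasd_comp.
Qed.

Lemma J_ev N rho a K z : nbd rho a K -> cmod z < rho ->
  J N (ev a) (\poly_(r < N) (ev (iter r dseq a) z / r`!%:R)) z.
Proof.
elim: N rho a K => [|N ih] rho a K //= ha zr; split.
  by rewrite coef_poly /= divr1.
exists (ev (dseq a)); split.
  by apply: filterS (near_cmod zr) => w hw; apply: ev_hasd ha hw.
have z0 := cmod_ge0 z; pose s := (cmod z + rho) / 2.
have hs : cmod z < s < rho by rewrite /s; apply/andP; split; lra.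
case/andP: hs => hs1 hs2.
have := ih s (dseq a) _ (nbd_dseq (le_trans z0 (ltW hs1)) hs2 ha) hs1.
suff -> : (\poly_(r < N) (ev (iter r dseq (dseq a)) z / r`!%:R)) =
  (\poly_(r < N.+1) (ev (iter r dseq a) z / r`!%:R))^`() by [].
apply/polyP => i; rewrite coef_deriv !coef_poly ltnS; case: ifP => _; last by rewrite mul0rn.
rewrite iterSr factS natrM -[RHS]mulr_natr; move: (ev _ _) => X.
have n1 : (i.+1%:R : C) != 0 by rewrite pnatr_eq0.
have n2 : (i`!%:R : C) != 0 by rewrite pnatr_eq0 -lt0n fact_gt0.
by rewrite invfM mulrA [RHS]mulrAC mulfVK.
Qed.

Lemma iter_dseq r a n : iter r dseq a n = ((n + r)`!%:R / n`!%:R) * a (n + r)%N.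
Proof.
elim: r n => [|r ih] n; first by rewrite addn0 divff ?mul1r // pnatr_eq0 -lt0n fact_gt0.
rewrite iterS /dseq ih addSnnS mulrA; congr (_ * _).
by rewrite mulrCA; congr (_ * _); rewrite factS natrM invfM mulVKf // pnatr_eq0.
Qed.

Lemma J_ev0 N rho a K : 0 < rho -> nbd rho a K ->
  J N (ev a) (map_poly (real_complex R) (ser N a)) 0.
Proof.
move=> r0 ha; have := @J_ev N rho a K 0 ha; rewrite cmod0 => /(_ r0) h.
apply: J_eqm h _ => i iN; rewrite coef_map !coef_poly iN ev0 iter_dseq add0n fact0 divr1.
by rewrite rmorphM rmorph_nat /= mulrC mulKf // pnatr_eq0 -lt0n fact_gt0.
Qed.
End Derivative.

(** * The functions F_nu as power series *)

Section Exponential.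
Variable R : realType.
Local Notation C := (Cplx R).
Implicit Types (z w h : C) (a b : nat -> R) (rho : R).

Lemma nbd_exc_gt0 rho (c : R) : 0 <= rho -> exists K, nbd rho (exc c) K.
Proof.
move=> r0; exists (expR (`|c| * (rho + 1))) => n.
have r1 : 0 < rho + 1 by rewrite ltr_wpDl.
apply: le_trans (nbd_exc r1 c n); apply: ler_sum => i _.
by rewrite ler_wpM2l // lerXn2r ?nnegrE ?(ltW r1) // lerDl.
Qed.

Lemma ev_scale a (t : R) z : ev a (z * t%:C) = ev (fun i => a i * t ^+ i) z.
Proof.
have e i : (z * t%:C) ^+ i = (t ^+ i)%:C * z ^+ i by rewrite exprMn -rmorphXn mulrC.
have h1 : lsum (fun i => a i * complex.Re ((z * t%:C) ^+ i)) = lsum (fun i => a i * t ^+ i * complex.Re (z ^+ i)).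
  by apply: eq_lsum => i; rewrite e ReZ mulrA.
have h2 : lsum (fun i => a i * complex.Im ((z * t%:C) ^+ i)) = lsum (fun i => a i * t ^+ i * complex.Im (z ^+ i)).
  by apply: eq_lsum => i; rewrite e ImZ mulrA.
by rewrite /ev h1 h2.
Qed.

Lemma exc_binomial z w n :
  conv (fun i => (exc (1 : R) i)%:C * z ^+ i) (fun i => (exc (1 : R) i)%:C * w ^+ i) n = (exc (1 : R) n)%:C * (z + w) ^+ n.
Proof.
rewrite /conv [z + w]addrC exprDn mulr_sumr; apply: eq_bigr => i _.
have im : (i <= n)%N := ltn_ord i.
have nz k : (k`!%:R : R) != 0 by rewrite pnatr_eq0 -lt0n fact_gt0.
have e : exc (1 : R) i * exc (1 : R) (n - i) = exc (1 : R) n * 'C(n, i)%:R.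
  rewrite /exc !expr1n !mul1r; apply: (mulfI (nz n)); rewrite mulVKf //.
  by rewrite -{1}(bin_fact im) !natrM; field; rewrite !nz.
have e' : (exc (1 : R) i)%:C * (exc (1 : R) (n - i))%:C = (exc (1 : R) n)%:C * 'C(n, i)%:R :> C.
  by rewrite -rmorphM e rmorphM rmorph_nat.
by rewrite mulrACA e' -mulr_natr; ring.
Qed.

Lemma ev_expD z w : ev (exc 1) (z + w) = ev (exc 1) z * ev (exc 1) w.
Proof.
have [K1 h1] := nbd_exc_gt0 1 (cmod_ge0 z); have [K2 h2] := nbd_exc_gt0 1 (cmod_ge0 w).
have [K3 h3] := nbd_exc_gt0 1 (cmod_ge0 (z + w)).
have bnd u i : cmod ((exc (1 : R) i)%:C * u ^+ i) <= `|exc (1 : R) i| * cmod u ^+ i.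
  by rewrite cmodM cmod_real cmodX.
have h := cauchy_prod (bnd z) (bnd w) h1 h2 (ev_cto h1 (lexx _)) (ev_cto h2 (lexx _)).
apply: cto_unique (ev_cto h3 (lexx _)) _.
by apply: cto_ext h => n; apply: eq_bigr => m _; rewrite exc_binomial.
Qed.

Lemma ev_exp_real (x : R) : ev (exc 1) x%:C = (expR x)%:C.
Proof.
rewrite ev_real; congr (_%:C).
have h : lsum (fun i => exc (1 : R) i * x ^+ i) = limn (series (exp_coeff x)).
  congr (limn _); apply/funext => n; rewrite /series /= big_mkord.
  by apply: eq_bigr => i _; rewrite /exc expr1n /exp_coeff /= mul1r mulrC.
by rewrite h.
Qed.

Lemma ImaginaryX (y : R) n : (('i : C) * y%:C) ^+ n =
  ((~~ odd n)%:R * (-1) ^+ n./2 * y ^+ n) +i* ((odd n)%:R * (-1) ^+ n.-1./2 * y ^+ n).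
Proof.
elim: n => [|n ih]; first by rewrite !expr0 /= !mul1r !mul0r.
rewrite exprS ih exprS /= uphalf_half negbK.
case: n ih => [|n] ih; first by rewrite /= !expr0 !mul1r !mul0r; simpc.
rewrite /= negbK !uphalf_half; case: (odd n); rewrite /= ?add1n ?add0n ?mul1r ?mul0r; simpc; rewrite ?exprS; congr (_ +i* _); ring.
Qed.

Lemma ev_exp_imag (y : R) : ev (exc 1) ('i * y%:C) = cos y +i* sin y.
Proof.
have h1 : lsum (fun i => exc (1 : R) i * complex.Re ((('i : C) * y%:C) ^+ i)) = cos y.
  rewrite cos.unlock; congr (limn _); apply/funext => n; rewrite /series /= big_mkord.
  by apply: eq_bigr => i _; rewrite ImaginaryX /= /exc expr1n /cos_coeff mul1r mulrC.
have h2 : lsum (fun i => exc (1 : R) i * complex.Im ((('i : C) * y%:C) ^+ i)) = sin y.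
  rewrite sin.unlock; congr (limn _); apply/funext => n; rewrite /series /= big_mkord.
  by apply: eq_bigr => i _; rewrite ImaginaryX /= /exc expr1n /sin_coeff mul1r mulrC.
by rewrite /ev h1 h2.
Qed.

Lemma cexpE z : cexp z = ev (exc 1) z.
Proof.
rewrite [in RHS](complexE z) ev_expD ev_exp_real ev_exp_imag //.
Qed.

Lemma cexp_scale z (t : R) : cexp (z * t%:C) = ev (exc t) z.
Proof.
rewrite cexpE ev_scale; apply: eq_ev => i.
by rewrite /exc expr1n mul1r mulrC.
Qed.

Lemma ev_sub rho a b K K' z : 0 < rho -> nbd rho a K -> nbd rho b K' -> cmod z <= rho ->
  ev (fun i => a i - b i) z = ev a z - ev b z.
Proof.
move=> r0 ha hb zr; apply: (addIr (ev b z)); rewrite subrK -(ev_add (nbdB r0 ha hb) hb zr).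
by apply: eq_ev => i; rewrite subrK.
Qed.

Lemma ev_shift rho a K z : nbd rho a K -> cmod z < rho ->
  ev a z = (a 0%N)%:C + z * ev (fun i => a i.+1) z.
Proof.
move=> ha zr; have r0 : 0 < rho := le_lt_trans (cmod_ge0 z) zr.
have ha' : nbd rho (fun i => a i.+1) (K / rho).
  move=> n; rewrite ler_pdivlMr // mulr_suml; apply: le_trans (ha n.+1).
  rewrite big_ord_recl -[leLHS]add0r; apply: lerD; first by rewrite mulr_ge0 ?exprn_ge0 ?(ltW r0).
  by apply: ler_sum => i _; rewrite exprSr mulrA.
apply: cto_unique (ctoS (ev_cto ha (ltW zr))) _.
have h := ctoD (cto_cst (a 0%N)%:C) (ctoZ z (ev_cto ha' (ltW zr))).
apply: cto_ext h => n; rewrite /psum big_ord_recl expr0 mulr1 mulr_sumr; congr (_ + _).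
by apply: eq_bigr => i _; rewrite exprS mulrCA.
Qed.
End Exponential.

Section Euler.
Variables (R : realType) (rho : R) (nu : factor_count).
Hypothesis rho0 : 0 < rho.
Hypothesis hnu : nu = big_omega -> rho < 2.
Local Notation C := (Cplx R).
Implicit Types z : C.

Lemma ev_delt z : ev (@delt R) z = 1.
Proof.
have z1 : 0 < cmod z + 1 by rewrite ltr_wpDl ?cmod_ge0.
have zl : cmod z <= cmod z + 1 by rewrite lerDl.
have h := @nbd_delt R _ z1.
apply: cto_unique (ctoS (ev_cto h zl)) _; apply: cto_ext (cto_cst 1) => n.
rewrite /psum big_ord_recl expr0 mulr1 big1 ?addr0 // => i _.
by rewrite /delt /= mul0r.
Qed.

Lemma nbd_fq q : (1 < q)%N -> exists K, nbd rho (fq R nu q) K.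
Proof.
move=> q1; have h := nbdD rho0 (nbdD rho0 (nbd_delt rho0) (nbd_mono rho0 1 (uq R nu q))) (nbd_rq rho0 hnu q1).
by eexists; apply: eq_nbd h => j; rewrite [RHS]fq_decomp.
Qed.

(** For [big_omega] the coefficients are geometric, so the sum S satisfies S = 1 + (z / q) S, and
    |z| < rho < 2 <= q allows division by 1 - z / q. For [small_omega] only two coefficients are
    nonzero. *)
Lemma ev_fq q z : (1 < q)%N -> cmod z < rho -> ev (fq R nu q) z =
  match nu with small_omega => 1 + z / (q%:R - 1) | big_omega => (1 - z / q%:R)^-1 end.
Proof.
move=> q1 zr; have [K hK] := nbd_fq q1; have qR : (q%:R : R) != 0 by rewrite pnatr_eq0; lia.
have q1R : (q%:R - 1 : R) != 0 by rewrite subr_eq0 pnatr_eq1; lia.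
have eq1 : (q%:R : C) = (q%:R : R)%:C by rewrite rmorph_nat.
case: nu hK hnu => hK h2.
  rewrite (ev_shift hK zr) /=.
  have -> : (fun i => fq R small_omega q i.+1) = (fun i => (uq R small_omega q) * delt R i).
    by apply/funext => -[|i]; rewrite /fq /mono1 /delt /= ?mulr1 ?mulr0.
  have -> : ev (fun i => uq R small_omega q * delt R i) z = (uq R small_omega q)%:C.
    have hd := nbdZ (uq R small_omega q) (nbd_delt rho0).
    apply: cto_unique (ctoS (ev_cto hd (ltW zr))) _; apply: cto_ext (cto_cst _) => n.
    rewrite /psum big_ord_recl expr0 mulr1 big1 ?addr0 /delt /= ?mulr1 // => i _.
    by rewrite /= mulr0 mul0r.
  have -> : (q%:R - 1 : C) = (q%:R - 1 : R)%:C by rewrite rmorphB rmorph_nat rmorph1.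
  congr (_ + _ * _); rewrite -fmorphV /uq; congr (_%:C).
  by field; rewrite q1R.
have rq : rho < q%:R by apply: lt_le_trans (h2 erefl) _; rewrite ler_nat.
have nz : 1 - z / q%:R != 0.
  apply/eqP => /subr0_eq h; have : cmod 1 = cmod (z / q%:R) by rewrite -h.
  rewrite cmod1 cmodM cmodV eq1 cmod_real normr_nat => h1.
  have h3 := congr1 (fun x => x * (q%:R : R)) h1; rewrite mul1r mulfVK // in h3.
  by have : cmod z < q%:R by [exact: lt_trans rq]; rewrite h3 ltxx.
have := ev_shift hK zr; rewrite {2}/fq expr0.
have -> : ev (fun i => fq R big_omega q i.+1) z = q%:R^-1 * ev (fq R big_omega q) z.
  have hK' : nbd rho (fun i => q%:R^-1 * fq R big_omega q i) (`|q%:R^-1| * K) by apply: nbdZ.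
  have -> : (fun i => fq R big_omega q i.+1) = (fun i => q%:R^-1 * fq R big_omega q i).
    by apply/funext => i; rewrite /fq exprS.
  apply: cto_unique (ev_cto hK' (ltW zr)) _.
  apply: cto_ext (ctoZ _ (ev_cto hK (ltW zr))) => n; rewrite /psum mulr_sumr.
  by apply: eq_bigr => i _; rewrite rmorphM mulrA fmorphV rmorph_nat.
move=> h; apply: (mulfI nz); rewrite divff // mulrBl mul1r {1}h -mulrA; exact: addrK.
Qed.

Lemma euler_factorE q z : prime q -> cmod z < rho -> euler_factor nu q z = ev (xq R nu q) z.
Proof.
move=> pq zr; have q1 := prime_gt1 pq; have [K hK] := nbd_fq q1.
rewrite /xq (ev_conv rho0 (nbd_exc rho0 _) hK (ltW zr)) (ev_fq q1 zr) -cexp_scale.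
by congr (cexp (z * _%:C) * _); rewrite /tq opprK.
Qed.

Lemma nbd_Xs_ex n : exists K, nbd rho (Xs R nu n) K.
Proof.
case: n => [|[|n]]; [by exists 1; exact: (nbd_delt rho0)|by exists 1; exact: (nbd_delt rho0)|].
by eexists; apply: nbd_Xs'.
Qed.

Lemma euler_partial N z : cmod z < rho -> \prod_(q < N | prime q) euler_factor nu q z = ev (Xs R nu N) z.
Proof.
move=> zr; rewrite big_mkcond; elim: N => [|N ih]; first by rewrite big_ord0 /= ev_delt.
rewrite big_ord_recr ih /=; case: ifP => pN; last by rewrite mulr1.
have [K hK] := nbd_Xs_ex N; have N1 := prime_gt1 pN.
have hx : nbd rho (xq R nu N) (Cx rho / N%:R ^+ 2 + 1).
  by apply: eq_nbd (nbdD rho0 (nbd_xq rho0 hnu N1) (nbd_delt rho0)) => j; rewrite subrK.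
by rewrite (ev_conv rho0 hK hx (ltW zr)) (euler_factorE pN zr).
Qed.

Lemma F_nuE z : cmod z < rho -> F_nu nu z = ev (Fs R nu) z.
Proof.
move=> zr; rewrite /F_nu /Fs (ev_conv rho0 (nbd_exc rho0 _) (nbd_Hs rho0 hnu) (ltW zr)).
rewrite -cexp_scale; congr (_ * _); first by rewrite mulrC.
rewrite /euler_product.
apply: cto_lim; have h := cvg_invp (expR (Cx rho) * Cx rho).
(* The norm estimates for [Xs] start at index 2, hence the shift by two. *)
suff hs : cto (fun n => ev (Xs R nu n.+2) z) (ev (Hs R nu) z).
  move: hs; rewrite /cto; under eq_fun do rewrite -(euler_partial _ zr).
  rewrite (cvg_shiftS (fun n => cmod (\prod_(q < n.+1 | prime q) euler_factor nu q z - ev (Hs R nu) z))).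
  by rewrite (cvg_shiftS (fun n => cmod (\prod_(q < n | prime q) euler_factor nu q z - ev (Hs R nu) z))).
have h' : (fun n : nat => expR (Cx rho) * Cx rho * n.+1%:R^-1) @ \oo --> (0 : R).
  move: h; rewrite -(cvg_shiftS (fun n : nat => expR (Cx rho) * Cx rho * n.-1%:R^-1)).
  by rewrite -(cvg_shiftS (fun n : nat => expR (Cx rho) * Cx rho * n%:R^-1)).
apply: cto_squeeze h' => n.
rewrite -(ev_sub rho0 (nbd_Xs' rho0 hnu (isT : (1 < n.+2)%N)) (nbd_Hs rho0 hnu) (ltW zr)).
exact: ev_le (nbd_XsH rho0 hnu (isT : (1 < n.+2)%N)) (ltW zr).
Qed.
End Euler.

(** * The saddle-point coefficients of F_nu *)

Section Saddle.
Variable R : realType.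
Local Notation C := (Cplx R).
Implicit Types (z w h : C) (rho : R).
Local Notation toC := (map_poly (real_complex R)).

Lemma coef_comp_scale (P : {poly C}) (c : C) k : (P \Po (c *: 'X))`_k = c ^+ k * P`_k.
Proof.
have -> : P \Po (c *: 'X) = \poly_(i < size P) (P`_i * c ^+ i).
  by rewrite comp_polyE poly_def; apply: eq_bigr => i _; rewrite exprZn scalerA.
by rewrite coef_poly; case: ltnP => h; [rewrite mulrC|rewrite nth_default ?mulr0].
Qed.

Lemma J_evi N rho (a : nat -> R) K : 0 < rho -> nbd rho a K ->
  J N (fun z => ev a ('i * z)) (toC (ser N a) \Po ('i *: 'X)) 0.
Proof.
move=> r0 ha; have h := J_ev0 N r0 ha; rewrite -[X in J _ _ _ X](mulr0 ('i : C)) in h.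
have := J_comp h (J_lin N 'i); by rewrite coefZ coefX mulr0 polyC0 subr0.
Qed.

Lemma J_cont f P z r : J 1 f P z -> cmod (f z) < r -> \forall w \near z, cmod (f w) < r.
Proof.
move=> /= [_ [g [hg _]]] fr; have [d d0 hd] := hasd_lip (near_self hg).
have L0 : 0 < cmod (g z) + 1 by rewrite ltr_wpDl ?cmod_ge0.
have r0 : 0 < r - cmod (f z) by rewrite subr_gt0.
have m0 : 0 < Num.min d ((r - cmod (f z)) / (cmod (g z) + 1)) by rewrite lt_min d0 divr_gt0.
apply: filterS (near_cmod_lt z m0) => w; rewrite lt_min => /andP[h1 h2].
have := hd _ (ltW h1); rewrite [z + _]addrC subrK => h3.
have h4 : cmod (f w - f z) < r - cmod (f z).
  by apply: le_lt_trans h3 _; rewrite mulrC -ltr_pdivlMr.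
have -> : f w = (f w - f z) + f z by rewrite subrK.
by apply: le_lt_trans (cmodD _ _) _; rewrite -ltrBrDr.
Qed.

Lemma Re_sqrtc_ge0 (x : R[i]) : 0 <= complex.Re (sqrtc x).
Proof. by case: x => a b; rewrite /sqrtc /= sqrtr_ge0. Qed.

Lemma sqrtc_sqr (Q : R[i]) : 0 < complex.Re Q -> sqrtc (Q ^+ 2) = Q.
Proof.
move=> Q0; have /eqP := sqr_sqrtc (Q ^+ 2); rewrite eqf_sqr => /orP[/eqP //|/eqP e].
have := Re_sqrtc_ge0 (Q ^+ 2); rewrite e; case: Q Q0 {e} => x y /= x0 h.
have {}h : 0 <= - x by exact: h.
by exfalso; lra.
Qed.

Lemma sum_half n : \sum_(i < n) (2^-1 : R) ^+ i = 2 - 2 * 2^-1 ^+ n.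
Proof.
elim: n => [|n ih]; first by rewrite big_ord0 expr0 mulr1 subrr.
by rewrite big_ord_recr ih /= exprS; field.
Qed.

Lemma nbd_geom rho (c : R) (a : nat -> R) : 0 <= rho -> 0 <= c -> c * rho <= 2^-1 ->
  (forall n, `|a n| <= c ^+ n) -> nbd rho a 2.
Proof.
move=> r0 c0 cr ha n; apply: (@le_trans _ _ (\sum_(i < n) (2^-1 : R) ^+ i)).
  apply: ler_sum => i _; apply: (@le_trans _ _ (c ^+ i * rho ^+ i)).
    by rewrite ler_wpM2r ?exprn_ge0.
  by rewrite -exprMn lerXn2r ?nnegrE ?mulr_ge0.
by rewrite sum_half gerBl mulr_ge0 ?exprn_ge0.
Qed.

Lemma nbd_qh : nbd 2^-1 (qh R) 2.
Proof.
apply: (@nbd_geom _ 1) => //; rewrite ?invr_ge0 ?mul1r // => n.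
by rewrite expr1n qh_le1.
Qed.

Lemma wc_le1 n : wc R n <= 1.
Proof.
rewrite /wc ler_pdivrMr ?ltr0n ?fact_gt0 // mul1r ler_nat factS.
by have := fact_gt0 n.+1; nia.
Qed.
Lemma nbd_wc : nbd 2^-1 (wc R) 2.
Proof.
apply: (@nbd_geom _ 1) => //; rewrite ?invr_ge0 ?mul1r // => n.
by rewrite expr1n ger0_norm ?wc_le1 // ltW // wc_gt0.
Qed.

Lemma conv_qqw n : conv (conv (qh R) (qh R)) (wc R) n = delt R n.
Proof.
have nN : (n < n.+4)%N by lia.
rewrite (conv_ser _ _ nN) (eqmMl (ser n.+4 (wc R)) (@eqm_conv R (qh R) (qh R) n.+4) nN) -expr2 q2w //.
by rewrite coef1.
Qed.

Lemma half_gt0 : 0 < 2^-1 :> R. Proof. by rewrite invr_gt0. Qed.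

Lemma ev_qqw z : cmod z <= 2^-1 -> ev (qh R) z ^+ 2 * ev (wc R) z = 1.
Proof.
move=> hz; have r0 := half_gt0; have h2 := nbd_conv r0 nbd_qh nbd_qh.
rewrite expr2 -(ev_conv r0 nbd_qh nbd_qh hz) -(ev_conv r0 h2 nbd_wc hz).
by rewrite (eq_ev _ conv_qqw) ev_delt.
Qed.

Lemma exp_wc z : cmod z < 2^-1 -> 2 * (ev (exc 1) z - 1 - z) = z ^+ 2 * ev (wc R) z.
Proof.
move=> hz; have r0 := half_gt0; have [K hK] := nbd_exc_gt0 1 (ltW r0).
have [K1 hK1] : exists K, nbd 2^-1 (fun i => exc (1 : R) i.+1) K.
  exists (K / 2^-1) => n; rewrite ler_pdivlMr // mulr_suml; apply: le_trans (hK n.+1).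
  rewrite big_ord_recl -[leLHS]add0r; apply: lerD; first by rewrite mulr_ge0 ?exprn_ge0 ?(ltW r0).
  by apply: ler_sum => i _; rewrite exprSr mulrA.
rewrite (ev_shift hK hz) (ev_shift hK1 hz).
have -> : (fun i => exc (1 : R) i.+2) = (fun i => 2^-1 * wc R i).
  by apply/funext => i; rewrite /exc /wc expr1n mulrA mulVf.
have -> : ev (fun i => 2^-1 * wc R i) z = 2^-1 * ev (wc R) z.
  apply: cto_unique (ev_cto (nbdZ _ nbd_wc) (ltW hz)) _.
  apply: cto_ext (ctoZ _ (ev_cto nbd_wc (ltW hz))) => n; rewrite /psum mulr_sumr.
  apply: eq_bigr => i _; rewrite [LHS]mulrA; congr (_ * _).
  by rewrite [RHS]rmorphM fmorphV rmorph_nat.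
have -> : exc (1 : R) 0 = 1 by rewrite /exc expr1n fact0 divr1.
have -> : exc (1 : R) 1 = 1 by rewrite /exc expr1n divr1.
by move: (ev _ _) => X; field.
Qed.

(** The value Q of the series satisfies Q^2 W = 1, and |Q - 1| < 1 near 0 forces Re Q > 0, so Q is
    the principal square root. At z = 0 the prescribed value 1 agrees with [qh 0]. *)
Lemma q_fun_near : \forall z \near (0 : C), q_fun z = ev (qh R) ('i * z).
Proof.
have r0 := half_gt0; have hb : cmod (0 : C) < 2^-1 by rewrite cmod0.
have hc : \forall z \near (0 : C), cmod (ev (qh R) ('i * z) - 1) < 1.
  have h := J_add (J_evi 1 r0 nbd_qh) (J_cst 1 (-1) 0).
  by apply: (J_cont h); rewrite mulr0 ev0 qh0 subrr cmod0.
apply: filterS2 hc (near_cmod hb) => z h1 h2; rewrite /q_fun; case: eqP => [->|/eqP z0].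
  by rewrite mulr0 ev0 qh0.
have iz : cmod ('i * z) < 2^-1 by rewrite cmodM cmodi mul1r.
set s := ('i : C) * z in h1 iz *; set Q := ev (qh R) s in h1 *.
have hq := ev_qqw (ltW iz); rewrite -/Q in hq.
have hw := exp_wc iz.
have s2 : s ^+ 2 = - z ^+ 2 by rewrite /s exprMn sqr_i mulN1r.
have -> : 2 * (1 + s - cexp s) = z ^+ 2 * ev (wc R) s.
  have -> : 1 + s - cexp s = - (ev (exc 1) s - 1 - s) by rewrite cexpE; move: (ev _ _) => X; ring.
  by rewrite mulrN hw s2 mulNr opprK.
have w0 : ev (wc R) s != 0 by apply/eqP => w0; move: hq; rewrite w0 mulr0 => /eqP; rewrite eq_sym oner_eq0.
have -> : z ^+ 2 / (z ^+ 2 * ev (wc R) s) = Q ^+ 2.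
  by rewrite invfM mulVKf ?expf_neq0 //; apply: (mulIf w0); rewrite mulVf.
apply: sqrtc_sqr; have := le_lt_trans (Re_le_cmod (Q - 1)) h1; rewrite ReB /= ltr_norml => /andP[h _].
lra.
Qed.

(* mu(s) = -i * (sum_n mh_n (i s)^n). *)
Definition mh n : R := (ser n (qh R) ^+ n)`_n.-1 / n%:R.

Lemma mhE n N : (n <= N)%N -> (ser N (qh R) ^+ n)`_n.-1 / n%:R = mh n.
Proof.
case: n => [|n] nN; first by rewrite /mh invr0 !mulr0.
by congr (_ / _); apply: (eqmX _ (eqm_ser _ nN)).
Qed.
Lemma mh0 : mh 0 = 0. Proof. by rewrite /mh invr0 mulr0. Qed.

Lemma nbd_pow rho (P : {poly R}) K n : 0 < rho -> nbd rho (fun i => P`_i) K -> nbd rho (fun i => (P ^+ n)`_i) (K ^+ n).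
Proof.
move=> r0 h; elim: n => [|n ih].
  by apply: eq_nbd (nbd_delt r0) => i; rewrite expr0 coef1.
rewrite !exprS; apply: eq_nbd (nbd_conv r0 h ih) => i; by rewrite coefM.
Qed.

(** The series of q has norm at most 2 on the radius 1/2, so its n-th power has norm at most 2^n and
    coefficient of index n - 1 at most 2^n 2^(n - 1). Hence the radius 1/8, on which the terms of mu
    are at most 2^(-n). *)
Lemma mh_bound n : `|mh n| <= 4 ^+ n.
Proof.
case: n => [|n]; first by rewrite mh0 normr0.
have r0 := half_gt0.
have hq : nbd 2^-1 (fun i => (ser n.+1 (qh R))`_i) 2.
  apply: (nbd_dom r0 _ nbd_qh) => i; rewrite coef_poly; case: ifP => // _.
  by rewrite normr0.
have := nbd_coef r0 n (nbd_pow n.+1 r0 hq).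
rewrite exprVn ler_pdivrMr ?exprn_gt0 // => h.
rewrite /mh normrM normfV normr_nat /= ler_pdivrMr ?ltr0n //; apply: le_trans h _.
have n1 : 1 <= n.+1%:R :> R by rewrite ler1n.
have e4 : 4 ^+ n.+1 = 2 ^+ n.+1 * 2 ^+ n.+1 :> R by rewrite -exprMn; congr (_ ^+ _); ring.
rewrite e4 -mulrA ler_wpM2l ?exprn_ge0 //.
apply: (@le_trans _ _ (2 ^+ n.+1)); first by rewrite ler_eXn2l // ltr1n.
by rewrite ler_peMr ?exprn_ge0.
Qed.

Lemma eighth_gt0 : 0 < 8^-1 :> R. Proof. by rewrite invr_gt0. Qed.
Lemma nbd_mh : nbd 8^-1 mh 2.
Proof. by apply: (@nbd_geom _ 4) mh_bound => //; lra. Qed.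

Lemma derive_q_pow m n : derive1n n (fun z : C => q_fun z ^+ m) 0 =
  'i ^+ n * ((ser n.+1 (qh R) ^+ m)`_n)%:C *+ n`!.
Proof.
have h := J_exp m (J_evi n.+1 half_gt0 nbd_qh).
have h1 : J n.+1 (fun z : C => q_fun z ^+ m) ((toC (ser n.+1 (qh R)) \Po ('i *: 'X)) ^+ m) 0.
  by apply: J_near h; apply: filterS q_fun_near => z ->.
rewrite (J_derive1n h1 (ltnSn n)); congr (_ *+ _).
by rewrite -rmorphXn coef_comp_scale -rmorphXn coef_map.
Qed.

Lemma mu_funE (s : C) : cmod s <= 8^-1 -> mu_fun s = - 'i * ev mh ('i * s).
Proof.
move=> hs; have his : cmod ('i * s) <= 8^-1 by rewrite cmodM cmodi mul1r.
apply: cto_lim; apply: cto_ext (ctoZ (- 'i) (ev_cto nbd_mh his)) => -[|N].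
  by rewrite /psum big_ord0 mulr0 big_geq.
rewrite /psum big_ord_recl mh0 mul0r add0r mulr_sumr big_add1 /= big_mkord.
apply: eq_bigr => i _; rewrite derive_q_pow /bump /= add1n /mh /= factS natrM.
have f0 : (i`!%:R : C) != 0 by rewrite pnatr_eq0 -lt0n fact_gt0.
have i0 : (i.+1%:R : C) != 0 by rewrite pnatr_eq0.
have -> : (((ser i.+1 (qh R) ^+ i.+1)`_i / i.+1%:R)%:C : C) = ((ser i.+1 (qh R) ^+ i.+1)`_i)%:C / i.+1%:R.
  by rewrite rmorphM fmorphV rmorph_nat.
move: ((ser _ _ ^+ _)`_i)%:C => X.
have ii : ('i : C) ^+ 2 = -1 by rewrite sqr_i.
have -> : - 'i * (X / i.+1%:R * ('i * s) ^+ i.+1) = - ('i ^+ 2) * (X / i.+1%:R * ('i ^+ i * s ^+ i.+1)).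
  by rewrite exprMn [in LHS]exprS; ring.
rewrite ii opprK mul1r -mulr_natr.
by field; rewrite ?f0 ?nat1r ?i0.
Qed.

Lemma J_mu N : J N (@mu_fun R) ((- 'i)%:P * (toC (ser N mh) \Po ('i *: 'X))) 0.
Proof.
apply: J_near (J_mul (J_cst N (- 'i) 0) (J_evi N eighth_gt0 nbd_mh)).
have hb : cmod (0 : C) < 8^-1 by rewrite cmod0 eighth_gt0.
by apply: filterS (near_cmod hb) => z hz; rewrite mu_funE // ltW.
Qed.

Lemma derive_mu k : derive1n k.+1 (@mu_fun R) 0 = 'i ^+ k * (mh k.+1)%:C *+ (k.+1)`!.
Proof.
rewrite (J_derive1n (J_mu k.+2) (ltnSn k.+1)) coefCM coef_comp_scale coef_map coef_ser //=.
congr (_ *+ _); have ii : ('i : C) ^+ 2 = -1 by rewrite sqr_i.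
have -> : - 'i * ('i ^+ k.+1 * (mh k.+1)%:C) = - ('i ^+ 2) * ('i ^+ k * (mh k.+1)%:C) :> C by rewrite exprS; ring.
by rewrite ii opprK mul1r.
Qed.

Variables (nu : factor_count) (rho v : R).
Hypotheses (rho0 : 0 < rho) (hnu : nu = big_omega -> rho < 2) (v0 : 0 < v) (vrho : v < rho).
Local Notation F := (Fs R nu).

Definition Av N : {poly R} := \poly_(r < N) (lsum (fun i => iter r (@dseq R) F i * v ^+ i) / r`!%:R).
(* The Taylor polynomial at s = 0 of F_nu(v e^s), obtained by composing the one
   of F_nu at v with v e^s - v. *)
Definition PhiR N : {poly R} := Av N \Po (v *: ser N (exc 1) - v%:P).

Lemma J_H N : J N (fun s => ev F (v%:C * ev (exc 1) s)) (toC (PhiR N)) 0.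
Proof.
have [K hK] := nbd_exc_gt0 1 (ltW rho0).
have hF := nbd_Fs rho0 hnu.
have hv : cmod v%:C < rho by rewrite cmod_real gtr0_norm.
have h1 := J_mul (J_cst N v%:C 0) (J_ev0 N rho0 hK).
have h2 := J_ev N hF hv.
have e0 : (v%:C : C) * ev (exc 1) 0 = v%:C by rewrite ev0 /exc expr1n fact0 divr1 mulr1.
case: N h1 h2 => [|N] // h1 h2.
rewrite -[X in J _ _ _ X]e0 in h2; have h3 := @J_comp _ N.+1 (ev F) (fun s => v%:C * ev (exc 1) s) _ _ 0 h2 h1.
apply: J_eqm h3 _ => i iN.
rewrite /PhiR map_comp_poly rmorphB /= map_polyZ map_polyC /= -mul_polyC coefCM coef_map coef_ser //=.
have -> : v%:C * (exc 1 0)%:C = v%:C :> C by rewrite /exc expr1n fact0 divr1 mulr1.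
congr ((_ \Po _)`_i); apply/polyP => r; rewrite coef_map !coef_poly; case: ifP => _ //=.
by rewrite ev_real rmorphM fmorphV rmorph_nat.
Qed.

Lemma exc1_pow N l : eqm N (ser N (exc (1 : R)) ^+ l) (ser N (exc l%:R)).
Proof.
elim: l => [|l ih].
  by move=> i iN; rewrite expr0 coef1 coef_ser // exc0.
rewrite exprS -natr1 addrC => i iN; rewrite (eqmMr (ser N (exc 1)) ih iN); exact: exc_mul.
Qed.

Lemma nbd_iter_dseq r : exists K, nbd v (iter r (@dseq R) F) K.
Proof.
suff h s : v <= s -> s < rho -> exists K, nbd s (iter r (@dseq R) F) K by exact: h.
elim: r s => [|r ih] s vs sr.
  exists (KF rho) => n; apply: le_trans (nbd_Fs rho0 hnu n); apply: ler_sum => i _.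
  have s0 : 0 <= s := le_trans (ltW v0) vs.
  by rewrite ler_wpM2l // lerXn2r ?nnegrE ?(ltW rho0) // ltW.
pose t := (s + rho) / 2; have t1 : v <= t by rewrite /t; lra.
have t2 : t < rho by rewrite /t; lra.
have [K hK] := ih t t1 t2; have st : s < t by rewrite /t; lra.
have s0 : 0 <= s := le_trans (ltW v0) vs.
by eexists; apply: nbd_dseq s0 st hK.
Qed.

Lemma lsum_shift (a : nat -> R) r K : (forall l, (l < r)%N -> a l = 0) ->
  (forall n, \sum_(i < n) `|a (i + r)%N| <= K) ->
  (forall n, \sum_(i < n) `|a i| <= K) /\ lsum a = lsum (fun i => a (i + r)%N).
Proof.
move=> h0 hb; have e (f : nat -> R) n : (forall l, (l < r)%N -> f l = 0) -> \sum_(i < n + r) f i = \sum_(i < n) f (i + r)%N.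
  move=> f0; rewrite addnC big_split_ord /= big1 ?add0r; last by move=> i _; rewrite f0.
  by apply: eq_bigr => i _; rewrite addnC.
have hb' n : \sum_(i < n) `|a i| <= K.
  apply: le_trans (hb n); rewrite -(e (fun i => `|a i|)); last by move=> l lr; rewrite h0 ?normr0.
  by rewrite addnC addnC big_split_ord /= lerDl sumr_ge0.
split=> //; apply: lsumE.
rewrite -(cvg_shiftn r (fun n => \sum_(i < n) a i)).
under eq_fun do rewrite e //.
exact: lsum_cvg hb.
Qed.

(** Put y = v e^s - v. The binomial expansion of (v + y)^l, summed against F_l, becomes after
    interchanging the sums over l and r the Taylor expansion of F_nu at v in powers of y. Only r <=
    n contributes to s^n, as y has no constant term. *)
Lemma PhiR_coef N n : (n < N)%N -> (PhiR N)`_n = lsum (fun l => F l * v ^+ l * exc l%:R n).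
Proof.
move=> nN; pose y := v *: ser N (exc 1) - v%:P; pose c r := (y ^+ r)`_n.
have y0 : y`_0 = 0.
  by rewrite coefB coefZ coefC coef_ser ?(leq_trans _ nN) // /exc expr1n fact0 divr1 mulr1 subrr.
have c0 r : (n < r)%N -> c r = 0.
  move=> nr; rewrite /c (coef0_XM y0) exprMn coefMXn nr //.
have eP : (PhiR N)`_n = \sum_(r < N) lsum (fun i => iter r (@dseq R) F i * v ^+ i) / r`!%:R * c r.
  rewrite /PhiR -/y /Av poly_def raddf_sum coef_sum /=; apply: eq_bigr => r _.
  by rewrite comp_polyZ comp_Xn_poly coefZ.
have eT l : F l * v ^+ l * exc l%:R n = \sum_(r < N) F l * ('C(l, r)%:R * v ^+ (l - r) * c r).
  rewrite -mulr_sumr -mulrA; congr (_ * _).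
  have -> : v ^+ l * exc l%:R n = ((v%:P + y) ^+ l)`_n.
    have -> : v%:P + y = v *: ser N (exc 1) by rewrite /y addrC subrK.
    by rewrite exprZn coefZ (exc1_pow _ nN) coef_ser.
  rewrite exprDn coef_sum.
  transitivity (\sum_(r < N + l.+1) 'C(l, r)%:R * v ^+ (l - r) * c r).
    rewrite addnC big_split_ord /= [X in _ + X]big1 ?addr0; last first.
      by move=> i _; rewrite bin_small ?mul0r //; lia.
    apply: eq_bigr => i _; rewrite coefMn -rmorphXn coefCM -[LHS]mulr_natl mulrA //.
  rewrite big_split_ord /= [X in _ + X]big1 ?addr0 // => i _.
  by rewrite c0 ?mulr0 //; lia.
have hsh r : exists2 K, (forall m, \sum_(i < m) `|F i * ('C(i, r)%:R * v ^+ (i - r) * c r)| <= K) &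
    lsum (fun l => F l * ('C(l, r)%:R * v ^+ (l - r) * c r)) = lsum (fun i => iter r (@dseq R) F i * v ^+ i) / r`!%:R * c r.
  have [K hK] := nbd_iter_dseq r.
  have ei i : F (i + r)%N * ('C(i + r, r)%:R * v ^+ (i + r - r) * c r) = (r`!%:R^-1 * c r) * (iter r (@dseq R) F i * v ^+ i).
    have nz k : (k`!%:R : R) != 0 by rewrite pnatr_eq0 -lt0n fact_gt0.
    have := bin_fact (leq_addl i r); rewrite addnK => /(congr1 (fun k : nat => (k%:R : R))); rewrite !natrM => hbf.
    rewrite iter_dseq -hbf; field; by rewrite !nz.
  have hK' n0 : \sum_(i < n0) `|iter r (@dseq R) F i * v ^+ i| <= K.
    apply: le_trans (hK n0); apply: ler_sum => i _.
    by rewrite normrM [`|v ^+ i|]ger0_norm ?exprn_ge0 ?(ltW v0).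
  have [||h1 h2] := @lsum_shift (fun i => F i * ('C(i, r)%:R * v ^+ (i - r) * c r)) r (`|r`!%:R^-1 * c r| * K).
  - by move=> l lr; rewrite bin_small // !mul0r mulr0.
  - move=> m; apply: le_trans (ler_wpM2l (normr_ge0 _) (hK' m)); rewrite mulr_sumr.
    by apply: ler_sum => i _; rewrite ei normrM.
  exists (`|r`!%:R^-1 * c r| * K); first exact: h1.
  rewrite h2 (eq_lsum ei) (lsumZ _ hK'); ring.
rewrite eP; under eq_lsum do rewrite eT.
have hch r : {K | forall m, \sum_(i < m) `|F i * ('C(i, r)%:R * v ^+ (i - r) * c r)| <= K}.
  by apply: cid; have [K hK _] := hsh r; exists K.
rewrite (@lsum_sum _ N (fun r l => F l * ('C(l, r)%:R * v ^+ (l - r) * c r)) (fun r => sval (hch r))); last first.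
  by move=> r m; exact: (svalP (hch r)).
by apply: eq_bigr => r _; have [K _ ->] := hsh r.
Qed.
End Saddle.

Section Summable.
Variable R : realType.
Implicit Types f g : nat -> R.
Definition summ f := exists K, forall n, \sum_(i < n) `|f i| <= K.

Lemma summ_dom f g : (forall l, `|f l| <= `|g l|) -> summ g -> summ f.
Proof. by move=> h [K hK]; exists K => n; apply: le_trans (hK n); apply: ler_sum => i _. Qed.
Lemma summZ c f : summ f -> summ (fun l => c * f l).
Proof.
move=> [K hK]; exists (`|c| * K) => n; apply: le_trans (ler_wpM2l (normr_ge0 c) (hK n)).
by rewrite mulr_sumr; apply: ler_sum => i _; rewrite normrM.
Qed.
Lemma summ_lsumZ c f : summ f -> lsum (fun l => c * f l) = c * lsum f.
Proof. by move=> [K hK]; apply: lsumZ hK. Qed.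
Lemma summ_sum N (f : nat -> nat -> R) : (forall i, summ (f i)) ->
  summ (fun l => \sum_(i < N) f i l).
Proof.
move=> h; pose K i := sval (cid (h i)); exists (\sum_(i < N) K i) => n.
apply: (@le_trans _ _ (\sum_(i < N) \sum_(l < n) `|f i l|)).
  by rewrite exchange_big; apply: ler_sum => l _; apply: ler_norm_sum.
by apply: ler_sum => i _; exact: (svalP (cid (h i))).
Qed.
Lemma summ_lsum_sum N (f : nat -> nat -> R) : (forall i, summ (f i)) ->
  lsum (fun l => \sum_(i < N) f i l) = \sum_(i < N) lsum (f i).
Proof.
move=> h; apply: (@lsum_sum _ N f (fun i => sval (cid (h i)))) => i n.
exact: (svalP (cid (h i))).
Qed.
End Summable.

Section SaddleSum.
Variable R : realType.
Local Notation C := (Cplx R).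
Local Notation toC := (map_poly (real_complex R)).
Variables (nu : factor_count) (rho v : R).
Hypotheses (rho0 : 0 < rho) (hnu : nu = big_omega -> rho < 2) (v0 : 0 < v) (vrho : v < rho).
Local Notation F := (Fs R nu).
Local Notation Phi := (PhiR nu v).
Local Notation phi := (fun tau : C => F_nu nu (v%:C * cexp (('i)%C * mu_fun tau))).

Lemma J_phi N : J N phi (toC (Phi N \Po ser N (mh R)) \Po ('i *: 'X)) 0.
Proof.
have hM := @nbd_mh R; have e8 := eighth_gt0 R.
have [K hK] := nbd_exc_gt0 (1 : R) (ltW rho0).
have z0 : ev (mh R) (('i : C) * 0) = 0 by rewrite mulr0 ev0 mh0.
have M0 n : (toC (ser n (mh R)) \Po ('i *: 'X))`_0 = 0 :> C.
  by rewrite coef_comp_scale coef_map coef_poly /= mh0 if_same mulr0.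
have h1 := J_H rho0 hnu v0 vrho N; rewrite -[X in J _ _ _ X]z0 in h1.
have h2 := @J_comp _ N (fun s => ev F (v%:C * ev (exc 1) s)) (fun t => ev (mh R) ('i * t)) _ _ 0 h1 (J_evi N e8 hM).
rewrite M0 polyC0 subr0 comp_polyA in h2.
rewrite map_comp_poly.
apply: J_near h2.
have g1 := J_ev0 1 rho0 hK; rewrite -[X in J _ _ _ X]z0 in g1.
have g2 := @J_comp _ 1 (ev (exc 1)) (fun t => ev (mh R) ('i * t)) _ _ 0 g1 (J_evi 1 e8 hM).
have g3 := J_mul (J_cst 1 v%:C 0) g2.
have hv : cmod (v%:C * ev (exc (1 : R)) (ev (mh R) ('i * 0))) < rho.
  by rewrite z0 ev0 /exc expr1n fact0 divr1 mulr1 cmod_real gtr0_norm.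
have hb : cmod (0 : C) < 8^-1 by rewrite cmod0.
apply: filterS2 (J_cont g3 hv) (near_cmod hb) => t ht1 ht2.
have e : ('i)%C * mu_fun t = ev (mh R) ('i * t).
  rewrite mu_funE ?(ltW ht2) // mulrA mulrN -expr2 sqr_i opprK mul1r //.
rewrite e cexpE; apply/esym; exact: (F_nuE rho0 hnu ht1).
Qed.

Lemma summ_F i : summ (fun l => F l * v ^+ l * exc l%:R i).
Proof.
have [K K0 hK] := Fs_slc_bound rho0 hnu i v0 vrho.
exists K => n; apply: le_trans (hK v (ltW v0) (lexx v) n); apply: ler_sum => l _.
rewrite normrM ler_wpM2l // /exc normrM normfV normr_nat normrX normr_nat.
by rewrite ler_pdivrMr ?ltr0n ?fact_gt0 // ler_peMr ?exprn_ge0 // ler1n fact_gt0.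
Qed.

Lemma Lc_sum (l : nat) n : F l * v ^+ l * Lc l%:R n = \sum_(i < n.+1)
  (ser n.+4 (qh R) ^+ n.+1)`_(n - i) * (F l * v ^+ l * exc l%:R i).
Proof.
rewrite (@LcE _ _ _ n.+4) ?coefM ?mulr_sumr; last by lia.
apply: eq_bigr => i _; rewrite coef_ser; last by have := ltn_ord i; lia.
by rewrite mulrA mulrC.
Qed.

Lemma summ_Lc n : summ (fun l => F l * v ^+ l * Lc l%:R n).
Proof.
under [X in summ X]funext do rewrite Lc_sum.
by apply: (@summ_sum _ n.+1 (fun i l => (ser n.+4 (qh R) ^+ n.+1)`_(n - i) * (F l * v ^+ l * exc l%:R i))) => i; apply: summZ; exact: summ_F.
Qed.

Lemma Phi_Lagrange n : ((ser n.+2 (mh R))^`() * (Phi n.+2 \Po ser n.+2 (mh R)))`_n =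
  lsum (fun l => F l * v ^+ l * Lc l%:R n).
Proof.
have em : ser n.+2 (mh R) = \poly_(i < n.+2) ((ser n.+4 (qh R) ^+ i)`_i.-1 / i%:R).
  apply/polyP => i; rewrite !coef_poly; case: ltnP => // h; rewrite mhE //; lia.
have q0 : (ser n.+4 (qh R))`_0 = 1 by rewrite coef_ser ?qh0.
have qs : eqm n.+1 (ser n.+4 (qh R) * ser n.+4 (wc R) * ser n.+4 (qh R)) 1 by exact: q_s_trunc.
rewrite em (lagrange_burmann qs _ (ltnSn n)) coefM.
under eq_lsum do rewrite Lc_sum.
rewrite (@summ_lsum_sum _ n.+1 (fun i l => (ser n.+4 (qh R) ^+ n.+1)`_(n - i) * (F l * v ^+ l * exc l%:R i))); last first.
  by move=> i; apply: summZ; exact: summ_F.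
apply: eq_bigr => i _; rewrite (summ_lsumZ _ (summ_F i)) mulrC; congr (_ * _).
by apply: (PhiR_coef rho0 hnu v0 vrho); have := ltn_ord i; lia.
Qed.

(** Derivatives over factorials are Taylor coefficients, so the inner sum is the coefficient of
    order 2j of mu'(s) F_nu(v e^(i mu(s))), to which Lagrange inversion applies. The rotations
    contribute i^(2j - n) i^n = (-1)^j. *)
Lemma saddle_sum j : \sum_(n < (2 * j).+1)
      derive1n (2 * j - n).+1 (@mu_fun R) 0 / (n`! * (2 * j - n)`!)%:R * derive1n n phi 0 =
  ((-1) ^+ j * lsum (fun l => F l * v ^+ l * Lc l%:R j.*2))%:C.
Proof.
rewrite mul2n -Phi_Lagrange coefMr mulr_sumr rmorph_sum; apply: eq_bigr => n _.
have nj : (n <= j.*2)%N := ltn_ord n.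
rewrite derive_mu (J_derive1n (J_phi j.*2.+2)) ?coef_comp_scale ?coef_map; last by lia.
rewrite coef_deriv coef_ser; last by lia.
move: ((_ \Po _)`_n) (mh R (j.*2 - n).+1) => x y.
have ij : (-1) ^+ j = 'i ^+ (j.*2 - n) * 'i ^+ n :> C by rewrite -exprD subnK // -mul2n exprM sqr_i.
have f1 : (n`!%:R : C) != 0 by rewrite pnatr_eq0 -lt0n fact_gt0.
have f2 : ((j.*2 - n)`!%:R : C) != 0 by rewrite pnatr_eq0 -lt0n fact_gt0.
have e : ((-1) ^+ j * (y *+ (j.*2 - n).+1 * x))%:C = 'i ^+ (j.*2 - n) * 'i ^+ n * (y%:C * (j.*2 - n).+1%:R * x%:C) :> C.
  by rewrite -ij !rmorphM rmorphXn rmorphN1 rmorphMn -[y%:C *+ _]mulr_natr.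
have mn2 (c d : C) k : (c * d) *+ k = c * d * k%:R by rewrite mulr_natr.
rewrite [RHS]e !mn2 factS !natrM /=.
move: f1 f2; move: (n`!%:R) ((j.*2 - n)`!%:R) (_.+1%:R) ('i ^+ (_ - _)) ('i ^+ n) x%:C y%:C => A B D I1 I2 X Y f1 f2.
by field; rewrite f1 f2.
Qed.

(** By [alpha_sl], alpha(l, .) is slc(l, .) convolved with alpha(0, .); convolving with the Stirling
    coefficients, inverse to alpha(0, .), leaves slc(l, m). The two facts about Gamma enter as
    hypotheses, which separates this algebra from the analysis. *)
Lemma saddle_gco m :
  (forall j, Gamma_fun (j%:R + 2^-1) * 2 ^+ j / Num.sqrt pi = dfac R j) ->
  (forall n, conv (alpha R 0) (stirling_coef R) n = delt R n) ->
  saddle_coef m (F_nu nu) v = (gco nu m v / v ^+ m)%:C.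
Proof.
move=> hG hd; rewrite /saddle_coef.
have e (j : 'I_m.+1) : (stirling_coef R (m - j)%N * Gamma_fun (j%:R + 2^-1) * 2 ^+ j / (v ^+ m * Num.sqrt pi))%:C *
    \sum_(n < (2 * j).+1) derive1n (2 * j - n).+1 (@mu_fun R) 0 / (n`! * (2 * j - n)`!)%:R * derive1n n phi 0 =
    ((v ^+ m)^-1 * lsum (fun l => stirling_coef R (m - j) * (F l * v ^+ l * alpha R l j)))%:C.
  rewrite saddle_sum -rmorphM; congr (_%:C).
  have -> : lsum (fun l => stirling_coef R (m - j) * (F l * v ^+ l * alpha R l j)) =
     stirling_coef R (m - j) * ((-1) ^+ j * dfac R j) * lsum (fun l => F l * v ^+ l * Lc l%:R j.*2).
    rewrite -(summ_lsumZ _ (summ_Lc _)); apply: eq_lsum => l; rewrite /alpha.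
    move: (Fs _ _ l) (Lc _ _) => X Y; ring.
  rewrite -hG invfM; move: (lsum _) (Gamma_fun _) (Num.sqrt _)^-1 (v ^+ m)^-1 => X Y Z W; ring.
rewrite (eq_bigr _ (fun j _ => e j)) -rmorph_sum -mulr_sumr mulrC; congr ((_ / _)%:C).
have hs j : summ (fun l => stirling_coef R (m - j) * (F l * v ^+ l * alpha R l j)).
  apply: summZ; apply: summ_dom (summZ ((-1) ^+ j * dfac R j) (summ_Lc j.*2)) => l.
  by rewrite /alpha le_eqVlt; apply/orP; left; apply/eqP; congr (`|_|); move: (Fs _ _ l) (Lc _ _) => X Y; ring.
rewrite -(summ_lsum_sum m.+1 hs); apply: eq_lsum => l.
have -> : slc R l m = conv (alpha R l) (stirling_coef R) m.
  have ea : alpha R l =1 conv (slc R l) (alpha R 0) by move=> i; rewrite alpha_sl.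
  rewrite (eq_conv ea (fun=> erefl)) -convA (eq_conv (fun=> erefl) hd) convC conv1 //.
rewrite /conv mulr_sumr; apply: eq_bigr => j _; move: (Fs _ _ l) (alpha _ _ _) => X Y; ring.
Qed.
End SaddleSum.

(** * Asymptotic expansions *)

Lemma leq_fact_addl N i : (i`! <= (N + i)`!)%N.
Proof.
elim: N => [|N ih]; first by [].
by rewrite addSn factS; apply: leq_trans ih _; rewrite leq_pmull.
Qed.

Section Expansion.
Variable R : realType.
Implicit Types (f g : R -> R) (P Q A : {poly R}) (y : R).

(* [f y = P(y) + O(y^N)] as [y] tends to 0 from the right. *)
Definition app N f P := exists K d : R, [/\ 0 <= K, 0 < d, d <= 1 &
  forall y, 0 < y -> y <= d -> `|f y - P.[y]| <= K * y ^+ N].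

Lemma poly_bound P : exists2 K, 0 <= K & forall y, 0 < y -> y <= 1 -> `|P.[y]| <= K.
Proof.
exists (\sum_(i < size P) `|P`_i|); first by apply: sumr_ge0.
move=> y y0 y1; rewrite horner_coef; apply: le_trans (ler_norm_sum _ _ _) _.
apply: ler_sum => i _; rewrite normrM [`|y ^+ i|]ger0_norm ?exprn_ge0 ?(ltW y0) //.
by rewrite ler_piMr // exprn_ile1 // ltW.
Qed.

Lemma app_eqm N f P Q : app N f P -> eqm N P Q -> app N f Q.
Proof.
move=> [K [d [K0 d0 d1 h]]] /eqmP[S e]; have [C C0 hC] := poly_bound S.
exists (K + C), d; split=> // [|y y0 yd]; first exact: addr_ge0.
have -> : f y - Q.[y] = (f y - P.[y]) + S.[y] * y ^+ N by rewrite e !hornerE; ring.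
apply: le_trans (ler_normD _ _) _; rewrite mulrDl; apply: lerD; first exact: h.
rewrite normrM [`|y ^+ N|]ger0_norm ?exprn_ge0 ?(ltW y0) //.
by rewrite ler_wpM2r ?exprn_ge0 ?(ltW y0) // hC // (le_trans yd).
Qed.
Lemma app_poly N P : app N (fun y => P.[y]) P.
Proof.
by exists 0, 1; split=> // y _ _; rewrite subrr normr0 mul0r.
Qed.
Lemma app_near N f g P e : 0 < e -> (forall y, 0 < y -> y <= e -> f y = g y) -> app N f P -> app N g P.
Proof.
move=> e0 fg [K [d [K0 d0 d1 h]]]; exists K, (Num.min d e); split=> //.
- by rewrite lt_min d0.
- by rewrite ge_min d1.
by move=> y y0; rewrite le_min => /andP[yd ye]; rewrite -fg // h.
Qed.
Lemma app_add N f g P Q : app N f P -> app N g Q -> app N (fun y => f y + g y) (P + Q).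
Proof.
move=> [K [d [K0 d0 d1 h]]] [K' [d' [K0' d0' d1' h']]].
exists (K + K'), (Num.min d d'); split; [exact: addr_ge0|by rewrite lt_min d0|by rewrite ge_min d1|].
move=> y y0; rewrite le_min => /andP[yd yd'].
have -> : f y + g y - (P + Q).[y] = (f y - P.[y]) + (g y - Q.[y]) by rewrite hornerD; ring.
by apply: le_trans (ler_normD _ _) _; rewrite mulrDl; apply: lerD; [exact: h|exact: h'].
Qed.
Lemma app_mul N f g P Q : app N f P -> app N g Q -> app N (fun y => f y * g y) (P * Q).
Proof.
move=> [K [d [K0 d0 d1 h]]] [K' [d' [K0' d0' d1' h']]].
have [CP CP0 hP] := poly_bound P; have [CQ CQ0 hQ] := poly_bound Q.
exists (K * (K' + CQ) + CP * K'), (Num.min d d'); split.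
- by rewrite addr_ge0 ?mulr_ge0 ?addr_ge0.
- by rewrite lt_min d0.
- by rewrite ge_min d1.
move=> y y0; rewrite le_min => /andP[yd yd']; have y1 : y <= 1 := le_trans yd d1.
have yN0 : 0 <= y ^+ N by rewrite exprn_ge0 ?ltW.
have yN1 : y ^+ N <= 1 by rewrite exprn_ile1 // ltW.
have -> : f y * g y - (P * Q).[y] = (f y - P.[y]) * ((g y - Q.[y]) + Q.[y]) + P.[y] * (g y - Q.[y]).
  by rewrite hornerM; ring.
apply: le_trans (ler_normD _ _) _; rewrite !normrM [leRHS]mulrDl; apply: lerD; last first.
  by rewrite -mulrA; apply: ler_pM => //; [exact: hP|exact: h'].
rewrite mulrAC; apply: ler_pM => //; first exact: h.
apply: le_trans (ler_normD _ _) _; apply: lerD; last exact: hQ.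
by apply: le_trans (h' y y0 yd') _; rewrite ler_piMr.
Qed.
Lemma app_comp N f P A : app N f P -> app N (fun y => A.[f y]) (A \Po P).
Proof.
move=> hf; elim/poly_ind: A => [|A c ih].
  by rewrite comp_poly0; apply: app_near (@ltr01 R) _ (app_poly N 0) => y _ _; rewrite !horner0.
rewrite comp_poly_MXaddC; apply: app_near (@ltr01 R) _ (app_add (app_mul ih hf) (app_poly N c%:P)) => y _ _.
by rewrite hornerMXaddC hornerC.
Qed.
Lemma app_bigO N f g P (C : R) : (forall y, 0 < y -> y <= 1 -> `|f y - g y| <= C * y ^+ N) -> 0 <= C ->
  app N f P -> app N g P.
Proof.
move=> hfg C0 [K [d [K0 d0 d1 h]]]; exists (C + K), d; split=> // [|y y0 yd]; first exact: addr_ge0.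
have -> : g y - P.[y] = - (f y - g y) + (f y - P.[y]) by ring.
apply: le_trans (ler_normD _ _) _; rewrite normrN mulrDl; apply: lerD; last exact: h.
by apply: hfg => //; exact: le_trans d1.
Qed.
Lemma app_divX N f P : P`_0 = 0 -> app N.+1 f P -> app N (fun y => y^-1 * f y) (drop_poly 1 P).
Proof.
move=> P0 [K [d [K0 d0 d1 h]]]; exists K, d; split=> // y y0 yd.
have e : P.[y] = (drop_poly 1 P).[y] * y by rewrite {1}(coef0_XM P0) hornerMX.
have -> : y^-1 * f y - (drop_poly 1 P).[y] = y^-1 * (f y - P.[y]) by rewrite e; field; rewrite gt_eqF.
rewrite normrM gtr0_norm ?invr_gt0 // ler_pdivrMl // mulrCA -exprS; exact: h.
Qed.

(** Large integers suffice: dividing by the lowest power and letting k grow kills one coefficient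
    difference at a time. Only integral k are available when (1 + 1/k)^k is expanded through its
    binomial sum. *)
Lemma inv_uniq N P Q (K : R) (k0 : nat) :
  (forall k, (k0 < k)%N -> `|P.[k%:R^-1] - Q.[k%:R^-1]| <= K * k%:R^-1 ^+ N) -> eqm N P Q.
Proof.
move=> h; suff hi i : (i <= N)%N -> eqm i P Q by exact: (hi N).
elim: i => [|i ih] iN; first by [].
have {}ih := ih (ltnW iN); pose D := P - Q; pose E := drop_poly i D.
have eD : D = E * 'X^i.
  rewrite -[LHS](poly_take_drop i) -/E [X in X + _](_ : _ = 0) ?add0r //.
  by apply/polyP => j; rewrite coef_take_poly coef0; case: ifP => // ji; rewrite coefB ih ?subrr.
have E0 : E`_0 = P`_i - Q`_i by rewrite coef_drop_poly add0n coefB.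
suff e0 : E`_0 = 0.
  move=> j; rewrite ltnS leq_eqVlt => /orP[/eqP ->|]; last exact: ih.
  by apply/eqP; rewrite -subr_eq0 -E0 e0.
have [C C0 hC] := poly_bound (drop_poly 1 E).
have eE : E = (E`_0)%:P + drop_poly 1 E * 'X.
  rewrite -[LHS](poly_take_drop 1) expr1; congr (_ + _).
  by apply/polyP => j; rewrite coef_take_poly coefC; case: j.
have hk k : (k0 < k)%N -> `|E`_0| <= (`|K| + C) * k%:R^-1.
  move=> kk; have kp : 0 < k%:R :> R by rewrite ltr0n; lia.
  have y0 : 0 < k%:R^-1 :> R by rewrite invr_gt0.
  have y1 : k%:R^-1 <= 1 :> R by rewrite invf_le1 // ler1n; lia.
  have := h k kk; rewrite -hornerN -hornerD -/D eD hornerM hornerXn normrM.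
  set y := (k%:R^-1 : R) in y0 y1 *.
  rewrite [`|y ^+ i|]ger0_norm ?exprn_ge0 ?(ltW y0) // -(subnK iN) addnS -addSn exprD mulrA ler_pM2r ?exprn_gt0 //.
  move=> h1; have h2 : `|E.[y]| <= `|K| * y.
    apply: le_trans h1 _; apply: (@le_trans _ _ (`|K| * y ^+ (N - i.+1).+1)).
      by rewrite ler_wpM2r ?exprn_ge0 ?(ltW y0) // ler_norm.
    by rewrite ler_wpM2l // exprS ler_piMr ?(ltW y0) // exprn_ile1 ?(ltW y0).
  have -> : E`_0 = E.[y] - (drop_poly 1 E).[y] * y by rewrite {2}eE !hornerE; ring.
  apply: le_trans (ler_normB _ _) _; rewrite mulrDl; apply: lerD => //.
  by rewrite normrM [`|y|]gtr0_norm // ler_wpM2r ?(ltW y0) // hC.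
have hcv : (fun n : nat => (`|K| + C) * n.+1%:R^-1) @ \oo --> (0 : R).
  have h0 := cvgM (cvg_cst (`|K| + C) : (fun _ : nat => `|K| + C) @ \oo --> `|K| + C) (@cvg_harmonic R).
  by rewrite mulr0 in h0; exact: h0.
apply/eqP; rewrite -normr_le0; have hc : (fun _ : nat => `|E`_0|) @ \oo --> `|E`_0| by exact: cvg_cst.
apply: (ler_cvg_to hc hcv); exists k0 => // n /= kn; exact: hk.
Qed.

(** The truncated series of y / (1 + y), which is 1 / (x + 1) for y = 1 / x: the shift x -> x + 1
    seen at infinity. *)
Definition rhop N : {poly R} := 'X * \sum_(i < N) (- 'X) ^+ i.

Lemma geomN (T : comNzRingType) (x : T) N : (1 + x) * (\sum_(i < N) (- x) ^+ i) = 1 - (- x) ^+ N.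
Proof.
elim: N => [|N ih]; first by rewrite big_ord0 expr0 subrr mulr0.
by rewrite big_ord_recr /= mulrDr ih exprS; ring.
Qed.
Lemma rhop_eqm N : eqm N (rhop N * (1 + 'X)) 'X.
Proof.
apply/eqmP; exists (- ((-1) ^+ N *: 'X)); rewrite /rhop -mulrA [_ * (1 + _)]mulrC geomN.
have -> : (- 'X : {poly R}) ^+ N = (-1) ^+ N *: 'X^N by rewrite -scaleN1r exprZn.
by rewrite mulrBr mulr1 -scalerAr mulNr -scalerAl.
Qed.
Lemma rhop0 N : (rhop N)`_0 = 0. Proof. by rewrite /rhop coefXM. Qed.
Lemma app_rho N : app N (fun y => y / (1 + y)) (rhop N).
Proof.
exists 1, 1; split=> // y y0 y1; have p0 : 0 < 1 + y by lra.
rewrite /rhop hornerM hornerX horner_sum.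
have -> : \sum_(i < N) ((- 'X) ^+ i).[y] = (1 - (- y) ^+ N) / (1 + y).
  rewrite -geomN mulrAC mulfV ?gt_eqF // mul1r; apply: eq_bigr => i _.
  by rewrite horner_exp hornerN hornerX.
have -> : y / (1 + y) - y * ((1 - (- y) ^+ N) / (1 + y)) = y / (1 + y) * (- y) ^+ N by ring.
rewrite normrM normrX normrN (gtr0_norm y0) ler_wpM2r ?exprn_ge0 ?(ltW y0) //.
by rewrite gtr0_norm ?divr_gt0 // ler_pdivrMr //; lra.
Qed.

Definition lnp J : {poly R} := \poly_(j < J) j%:R^-1.
Lemma lnp0 J : (lnp J)`_0 = 0. Proof. by rewrite coef_poly invr0 if_same. Qed.

(** In the variable y / (1 + y) the logarithmic series has positive terms, so that the two-sided
    bound [log_series] applies. *)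
Lemma ln1D_rho y : 0 < y -> ln (1 + y) = - ln (1 - y / (1 + y)).
Proof.
move=> y0; have p0 : 0 < 1 + y by lra.
have -> : 1 - y / (1 + y) = (1 + y)^-1 by field; rewrite gt_eqF.
by rewrite lnV ?posrE // opprK.
Qed.

Lemma app_ln1D N : app N (fun y => ln (1 + y)) (lnp N \Po rhop N).
Proof.
case: N => [|N].
  exists 1, 1; split=> // y y0 y1; rewrite expr0 mulr1.
  have -> : lnp 0 = 0 by apply/polyP => i; rewrite coef_poly coef0.
  rewrite comp_poly0 horner0 subr0 ger0_norm ?ln_ge0 //; last by lra.
  apply: le_trans (ln_le_sub1 _) _; lra.
apply: (@app_bigO _ (fun y => (lnp N.+1).[y / (1 + y)]) _ _ 2) => //; last first.
  exact: app_comp (app_rho N.+1).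
move=> y y0 y1; have p0 : 0 < 1 + y by lra.
have x0 : 0 <= y / (1 + y) by rewrite divr_ge0 ?ltW.
have x1 : y / (1 + y) < 1 by rewrite ltr_pdivrMr //; lra.
have xy : y / (1 + y) <= y by rewrite ler_pdivrMr //; nra.
have := log_series x0 x1 (ltn0Sn N); rewrite -(ln1D_rho y0).
have -> : (lnp N.+1).[y / (1 + y)] = \sum_(1 <= j < N.+1) j%:R^-1 * (y / (1 + y)) ^+ j.
  rewrite horner_poly big_ord_recl invr0 mul0r add0r big_add1 /= big_mkord.
  by apply: eq_bigr => i _.
set s := \sum_(1 <= j < N.+1) _; have -> : 1 - y / (1 + y) = (1 + y)^-1 by field; rewrite gt_eqF.
rewrite invrK => /andP[h1 h2]; rewrite distrC ger0_norm //; apply: le_trans h2 _.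
rewrite mulrC; apply: ler_pM; rewrite ?exprn_ge0 ?(ltW p0) //; first by lra.
by rewrite lerXn2r ?nnegrE ?(ltW y0).
Qed.

(* (1 + y)^(1/y) / e. *)
Definition cfun y : R := expR (ln (1 + y) / y - 1).

Lemma exp_taylor (h : R) N : `|h| <= 1 -> `|expR h - \sum_(i < N) h ^+ i / i`!%:R| <= expR 1 * `|h| ^+ N.
Proof.
move=> h1; have hc : (fun n : nat => \sum_(i < n) h ^+ i / i`!%:R) @ \oo --> expR h.
  have := is_cvg_series_exp_coeff h; rewrite /expR; set l := limn _ => hl.
  have {}hl : series (exp_coeff h) @ \oo --> l by exact: hl.
  suff -> : (fun n : nat => \sum_(i < n) h ^+ i / i`!%:R) = series (exp_coeff h) by [].
  by apply/funext => n; rewrite /series /= big_mkord.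
have hd : (fun n : nat => `|\sum_(i < n) h ^+ i / i`!%:R - \sum_(i < N) h ^+ i / i`!%:R|) @ \oo -->
    `|expR h - \sum_(i < N) h ^+ i / i`!%:R|.
  by apply: cvg_norm; apply: cvgB => //; exact: cvg_cst.
apply: (cvg_bound (m0 := N) hd) => n Nn.
rewrite -(subnKC Nn) big_split_ord /= addrAC subrr add0r.
apply: le_trans (ler_norm_sum _ _ _) _; rewrite mulrC.
apply: (@le_trans _ _ (`|h| ^+ N * \sum_(i < n - N) exc (1 : R) i)); last first.
  by rewrite ler_wpM2l ?exprn_ge0 // sum_exc_le.
rewrite mulr_sumr; apply: ler_sum => i _; rewrite normrM normfV normr_nat normrX exprD -mulrA ler_wpM2l ?exprn_ge0 //.
rewrite /exc expr1n; apply: ler_pM; rewrite ?exprn_ge0 ?invr_ge0 // ?exprn_ile1 //.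
by rewrite lef_pV2 ?posrE ?ltr0n ?fact_gt0 // ler_nat leq_fact_addl.
Qed.
End Expansion.

(** * Bell numbers and the functional equation of A *)

Section Connection.
Variable R : realType.
Implicit Types (P Q A : {poly R}) (y : R).
Local Notation cfun := (@cfun R).

Lemma ln1D_bounds y : 0 < y -> y / (1 + y) <= ln (1 + y) <= y.
Proof.
move=> y0; have p0 : 0 < 1 + y by lra.
have h1 := ln_le_sub1 p0; have i0 : 0 < (1 + y)^-1 by rewrite invr_gt0.
have := ln_le_sub1 i0; rewrite lnV ?posrE // => h2.
have e : y / (1 + y) = 1 - (1 + y)^-1 by field; rewrite gt_eqF.
by rewrite e; apply/andP; split; lra.
Qed.

(** The exponent ln(1 + y) / y - 1 is at most y in absolute value, so truncating the exponential
    series costs O(y^N). The division by y loses one order, hence the start at N + 1. *)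
Lemma app_cfun N : exists P, app N cfun P.
Proof.
have l0 : (lnp R N.+1 \Po rhop R N.+1)`_0 = 0.
  by rewrite -horner_coef0 horner_comp horner_coef0 rhop0 horner_coef0 lnp0.
have h1 := app_add (app_divX l0 (app_ln1D R N.+1)) (app_poly N (-1)%:P).
set Hp := drop_poly 1 _ + _ in h1.
pose E := \poly_(i < N) (i`!%:R^-1 : R).
exists (E \Po Hp); apply: (app_bigO (C := expR 1)) (app_comp E h1); last exact: expR_ge0.
move=> y y0 y1; rewrite hornerC; set h := y^-1 * ln (1 + y) + -1.
have -> : cfun y = expR h by rewrite /cfun /h mulrC.
have /andP[b1 b2] := ln1D_bounds y0; have p0 : 0 < 1 + y by lra.
have hy : `|h| <= y.
  have e1 : y^-1 * ln (1 + y) <= 1 by rewrite mulrC ler_pdivrMr // mul1r.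
  have e2 : (1 + y)^-1 <= y^-1 * ln (1 + y) by rewrite ler_pdivlMl.
  have e3 : 1 - y <= (1 + y)^-1 by rewrite -[leRHS]mul1r ler_pdivlMr //; nra.
  rewrite /h ler_norml; apply/andP; split; lra.
have := exp_taylor N (le_trans hy y1); rewrite distrC.
have -> : E.[h] = \sum_(i < N) h ^+ i / i`!%:R by rewrite horner_poly; apply: eq_bigr => i _; rewrite mulrC.
move/le_trans; apply; rewrite ler_wpM2l ?expR_ge0 // lerXn2r ?nnegrE ?(ltW y0) //.
Qed.

Lemma cfun_nat k : (0 < k)%N -> expR 1 * cfun k%:R^-1 = (1 + k%:R^-1) ^+ k.
Proof.
move=> k0; have kp : 0 < k%:R :> R by rewrite ltr0n.
have p0 : 0 < 1 + k%:R^-1 :> R by rewrite addr_gt0 // invr_gt0.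
rewrite /cfun -expRD invrK addrC subrK mulrC expRM_natl lnK ?posrE //.
Qed.

Lemma summ_pow M : summ (fun l => l%:R ^+ M / l`!%:R : R).
Proof.
have h0 : 0 < 2^-1 :> R by rewrite invr_gt0.
have h1 : 2^-1 < 1 :> R by rewrite invf_lt1 // ltr1n.
have [C C0 hC] := pow_geom_bound M h0 h1.
exists (C * expR 2) => n; apply: (@le_trans _ _ (C * \sum_(i < n) exc (2 : R) i)); last first.
  by rewrite ler_wpM2l // sum_exc_le.
rewrite mulr_sumr; apply: ler_sum => l _; rewrite /exc ger0_norm ?divr_ge0 ?exprn_ge0 //.
rewrite mulrA ler_wpM2r ?invr_ge0 //; have := hC l.
by rewrite exprVn ler_pdivrMr ?exprn_gt0.
Qed.

(* The coefficient of k^(-m) in (1 + 1/k)^k, from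
   (1 + 1/k)^k = sum_l (1 / l!) prod_(i < l) (1 - i/k). *)
Definition snum m : R := lsum (fun l => slc R l m / l`!%:R).
Lemma summ_slc m : summ (fun l => slc R l m / l`!%:R).
Proof.
apply: summ_dom (summ_pow m.*2) => l; rewrite !normrM ler_wpM2r // [leRHS]ger0_norm ?exprn_ge0 //.
exact: slc_le.
Qed.

Lemma snum_bound N : exists2 K, 0 <= K & forall k, (0 < k)%N ->
  `|(1 + k%:R^-1) ^+ k - \sum_(m < N) snum m * k%:R^-1 ^+ m| <= K * k%:R^-1 ^+ N.
Proof.
have [K hK] := summ_pow N.*2; exists K; first by apply: le_trans (hK 0%N); rewrite big_ord0.
move=> k k0; have kp : 0 < k%:R :> R by rewrite ltr0n.
pose a l : R := l`!%:R^-1 * \prod_(i < l) (1 - i%:R / k%:R).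
pose g l : R := \sum_(m < N) k%:R^-1 ^+ m * (slc R l m / l`!%:R).
have ea : (1 + k%:R^-1) ^+ k = lsum a.
  rewrite (@lsum_fin _ a k.+1) => [|l kl]; last first.
    rewrite /a (bigD1 (Ordinal kl)) //= mulfV ?gt_eqF // subrr mul0r mulr0 //.
  rewrite exprDn; apply: eq_bigr => l _; have lk : (l <= k)%N := ltn_ord l.
  rewrite expr1n mul1r /a; have := @fall_prod R k l lk k0 => hf.
  have nz j : (j`!%:R : R) != 0 by rewrite pnatr_eq0 -lt0n fact_gt0.
  have := bin_fact lk => /(congr1 (fun j : nat => (j%:R : R))); rewrite !natrM => hb.
  have {}hf : (\prod_(i < l) (1 - i%:R / k%:R) : R) = k`!%:R / (k - l)`!%:R * k%:R^-1 ^+ l.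
    rewrite hf exprVn; move: (\prod_(_ < _) _) => X.
    by field; rewrite nz expf_neq0 ?gt_eqF.
  by rewrite hf -hb -mulr_natr; field; rewrite !nz.
have sg : summ g by apply: (@summ_sum _ N (fun m l => k%:R^-1 ^+ m * (slc R l m / l`!%:R))) => m; exact: summZ (summ_slc m).
have hd l : `|a l - g l| <= k%:R^-1 ^+ N * (l%:R ^+ N.*2 / l`!%:R).
  have -> : a l - g l = l`!%:R^-1 * (\prod_(i < l) (1 - i%:R / k%:R) - \sum_(m < N) slc R l m / k%:R ^+ m).
    rewrite /a /g mulrBr mulr_sumr; congr (_ - _); apply: eq_bigr => m _; rewrite exprVn.
    by move: (slc R l m) (_^-1) (_^-1) => X Y Z; ring.
  have h := @slc_expand R k l N k0; rewrite normrM normfV normr_nat.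
  have -> : k%:R^-1 ^+ N * (l%:R ^+ N.*2 / l`!%:R) = l`!%:R^-1 * (l%:R ^+ N.*2 / k%:R ^+ N) :> R.
    by rewrite exprVn; move: (k%:R ^- N) (l%:R ^+ _) => X Y; ring.
  by rewrite ler_wpM2l ?invr_ge0.
have sd : summ (fun l => a l - g l).
  exists (k%:R^-1 ^+ N * K) => n; have := ler_wpM2l (_ : 0 <= (k%:R^-1 : R) ^+ N) (hK n).
  rewrite exprn_ge0 ?invr_ge0 ?(ltW kp) // => /(_ isT); apply: le_trans.
  rewrite mulr_sumr; apply: ler_sum => l _; apply: le_trans (hd l) _.
  by rewrite ler_wpM2l ?exprn_ge0 ?invr_ge0 ?(ltW kp) // ler_norm.
have [K1 hK1] := sd; have [K2 hK2] := sg.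
have eg : lsum g = \sum_(m < N) snum m * k%:R^-1 ^+ m.
  rewrite /g (@summ_lsum_sum _ N (fun m l => k%:R^-1 ^+ m * (slc R l m / l`!%:R))); last by move=> m; exact: summZ (summ_slc m).
  by apply: eq_bigr => m _; rewrite (summ_lsumZ _ (summ_slc m)) mulrC.
have el : lsum a = lsum (fun l => a l - g l) + lsum g.
  by rewrite -(lsumD hK1 hK2); apply: eq_lsum => l; rewrite subrK.
rewrite ea el eg addrK mulrC; apply: lsum_le => n.
have := ler_wpM2l (_ : 0 <= (k%:R^-1 : R) ^+ N) (hK n).
rewrite exprn_ge0 ?invr_ge0 ?(ltW kp) // => /(_ isT); apply: le_trans.
rewrite mulr_sumr; apply: ler_sum => l _; apply: le_trans (hd l) _.
by rewrite ler_wpM2l ?exprn_ge0 ?invr_ge0 ?(ltW kp) // ler_norm.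
Qed.

Lemma cfun_coef N P m : app N cfun P -> (m < N)%N -> expR 1 * P`_m = snum m.
Proof.
move=> [K [d [K0 d0 d1 h]]] mN; have [K' K0' h'] := snum_bound N.
suff e : eqm N (expR 1 *: P) (ser N snum) by have := e m mN; rewrite coefZ coef_ser.
apply: (@inv_uniq _ _ _ _ (expR 1 * K + K') (Num.truncn d^-1).+1) => k kk.
have kp : 0 < k%:R :> R by rewrite ltr0n; lia.
have y0 : 0 < k%:R^-1 :> R by rewrite invr_gt0.
have yd : k%:R^-1 <= d.
  rewrite -[leRHS]invrK lef_pV2 ?posrE ?invr_gt0 //; apply/ltW.
  by apply: lt_trans (truncnS_gt _) _; rewrite ltr_nat.
have k0 : (0 < k)%N by lia.
have -> : (expR 1 *: P).[k%:R^-1] - (ser N snum).[k%:R^-1] =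
  - (expR 1 * (cfun k%:R^-1 - P.[k%:R^-1])) + ((1 + k%:R^-1) ^+ k - \sum_(m < N) snum m * k%:R^-1 ^+ m).
  by rewrite -cfun_nat // hornerZ horner_poly; ring.
apply: le_trans (ler_normD _ _) _; rewrite normrN mulrDl; apply: lerD; last exact: h'.
by rewrite normrM ger0_norm ?expR_ge0 // -mulrA ler_wpM2l ?expR_ge0 // h.
Qed.

(* The coefficients of (1 + y)^(-r - 1/2). *)
Definition bet r i : R := (-1) ^+ i * dfac R (r + i) / (dfac R r * (2 ^+ i * i`!%:R)).

Lemma dfac_neq0 j : dfac R j != 0.
Proof. by elim: j => [|j ih]; [rewrite /dfac big_ord0 oner_eq0|rewrite dfacS mulf_neq0 // pnatr_eq0]. Qed.

Lemma alpha1 j : alpha R 1 j = alpha R 0 j.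
Proof. by case: j => [|j]; rewrite ?alpha0 // alphaS mul0r subr0. Qed.

(* e B_i / i!, where B_i is the i-th Bell number (Dobinski's formula). *)
Definition bell i : R := lsum (fun l => exc (l%:R : R) i / l`!%:R).
Lemma summ_bell i : summ (fun l => exc (l%:R : R) i / l`!%:R).
Proof.
apply: summ_dom (summZ (i`!%:R^-1) (summ_pow i)) => l; rewrite /exc le_eqVlt; apply/orP; left; apply/eqP.
by congr (`|_|); ring.
Qed.

(** The recursion of the Bell numbers: in Dobinski's series (l + 1)^(n + 1) / (l + 1)! = (l + 1)^n /
    l!, and (l + 1)^n is expanded by the binomial theorem. It is the hypothesis of [touchard]. *)
Lemma bell_ode n : n.+1%:R * bell n.+1 = \sum_(i < n.+1) bell i / (n - i)`!%:R.
Proof.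
have nz k : (k`!%:R : R) != 0 by rewrite pnatr_eq0 -lt0n fact_gt0.
rewrite -(summ_lsumZ _ (summ_bell n.+1)).
have [K hK] := summZ n.+1%:R (summ_bell n.+1).
pose f l : R := n.+1%:R * (exc l%:R n.+1 / l`!%:R).
have ef l : f (l + 1)%N = \sum_(i < n.+1) (n - i)`!%:R^-1 * (exc (l%:R : R) i / l`!%:R).
  have -> : f (l + 1)%N = exc (l%:R + 1) n / l`!%:R.
    rewrite /f /exc addn1 !factS !natrM exprS.
    have -> : l.+1%:R = l%:R + 1 :> R by rewrite natr1.
    have l1 : l%:R + 1 != 0 :> R by rewrite natr1 pnatr_eq0.
    have n1 : (n.+1%:R : R) != 0 by rewrite pnatr_eq0.
    move: (n.+1%:R) n1 (nz n) (nz l) => X X0 n0 l0.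
    by field; rewrite n0 l0 l1 X0.
  rewrite -exc_conv /conv mulr_suml; apply: eq_bigr => i _; rewrite /exc expr1n mul1r.
  by move: (l%:R ^+ i) => X; ring.
have hs : summ (fun l => f (l + 1)%N).
  under [X in summ X]funext do rewrite ef.
  apply: (@summ_sum _ n.+1 (fun i l => (n - i)`!%:R^-1 * (exc (l%:R : R) i / l`!%:R))) => i.
  exact: summZ (summ_bell i).
have [K2 hK2] := hs.
have [|_ ->] := @lsum_shift R f 1 K2 _ hK2.
  by case=> // _; rewrite /f /exc expr0n /= mul0r mul0r mulr0.
under eq_lsum do rewrite ef.
rewrite (@summ_lsum_sum _ n.+1 (fun i l => (n - i)`!%:R^-1 * (exc (l%:R : R) i / l`!%:R))); last by move=> i; exact: summZ (summ_bell i).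
by apply: eq_bigr => i _; rewrite (summ_lsumZ _ (summ_bell i)) mulrC.
Qed.

Lemma bell0 : bell 0 = expR 1.
Proof.
rewrite /bell /expR /lsum; congr (limn _); apply/funext => n; rewrite /series /= big_mkord.
by apply: eq_bigr => i _; rewrite /exc expr0 fact0 divr1 mul1r /exp_coeff /= expr1n mul1r.
Qed.

(** The sum over l of alpha(l, j) / l! is computed in two ways. Expanding alpha by [alpha_sl] gives
    the left side; expanding [Lc] produces Bell numbers, for which [touchard] leaves only values of
    [Lc 1], that is alpha(0, .) by [alpha1]. *)
Lemma conv_snum j : conv snum (alpha R 0) j = expR 1 * \sum_(i < j.+1) bet (j - i) i * alpha R 0 (j - i).
Proof.
have -> : conv snum (alpha R 0) j = lsum (fun l => alpha R l j / l`!%:R).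
  transitivity (\sum_(i < j.+1) lsum (fun l => alpha R 0 (j - i) * (slc R l i / l`!%:R))).
    by apply: eq_bigr => i _; rewrite (summ_lsumZ _ (summ_slc i)) mulrC.
  rewrite -(@summ_lsum_sum _ j.+1 (fun i l => alpha R 0 (j - i) * (slc R l i / l`!%:R))); last by move=> i; exact: summZ (summ_slc i).
  apply: eq_lsum => l; rewrite alpha_sl mulr_suml; apply: eq_bigr => i _; ring.
pose n := j.*2; pose w i := (ser n.+1 (qh R) ^+ n.+1)`_(n - i).
have eL l : alpha R l j / l`!%:R = \sum_(i < n.+1) ((-1) ^+ j * dfac R j * w i) * (exc l%:R i / l`!%:R).
  rewrite /alpha (@LcE _ _ _ n.+1) // coefM -/n mulr_sumr mulr_suml; apply: eq_bigr => i _.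
  rewrite coef_ser // /w; ring.
under eq_lsum do rewrite eL.
rewrite (@summ_lsum_sum _ n.+1 (fun i l => ((-1) ^+ j * dfac R j * w i) * (exc l%:R i / l`!%:R))); last by move=> i; exact: summZ (summ_bell i).
transitivity ((-1) ^+ j * dfac R j * (ser n.+1 bell * ser n.+1 (qh R) ^+ n.+1)`_n).
  rewrite coefM mulr_sumr; apply: eq_bigr => i _; rewrite (summ_lsumZ _ (summ_bell i)) coef_ser //.
  by rewrite -/(bell i) /w; ring.
rewrite (touchard (ltnSn n) bell_ode) bell0 mulrCA; congr (_ * _).
rewrite mulr_sumr; apply: eq_bigr => i _; have ij : (i <= j)%N := ltn_ord i.
rewrite -alpha1 /alpha /bet subnK // -{1}(subnK ij) exprD.
have s1 : (-1) ^+ (j - i) * (-1) ^+ (j - i) = 1 :> R by rewrite -expr2 sqrr_sign.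
have d0 := dfac_neq0 (j - i); have i0 : (i`!%:R : R) != 0 by rewrite pnatr_eq0 -lt0n fact_gt0.
have t0 : (2 ^+ i : R) != 0 by rewrite expf_neq0.
move: (Lc _ _) (dfac R (j - i)) d0 ((-1) ^+ (j - i)) s1 ((-1) ^+ i) (2 ^+ i) t0 => L D D0 S s1 T U t0.
by field; rewrite D0 i0 t0.
Qed.

Lemma bet_rec r i : bet r.+1 i.+1 + bet r.+1 i = bet r i.+1.
Proof.
rewrite /bet !addSn !addnS !dfacS factS natrM !exprS.
have d0 := dfac_neq0 r; have i0 : (i`!%:R : R) != 0 by rewrite pnatr_eq0 -lt0n fact_gt0.
have t0 : (2 ^+ i : R) != 0 by rewrite expf_neq0.
have i1 : (i.+1%:R : R) != 0 by rewrite pnatr_eq0.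
have r1 : (r.*2.+1%:R : R) != 0 by rewrite pnatr_eq0.
have e1 : ((r + i).+1.*2.+1%:R : R) = r.*2.+1%:R + 2 * i.+1%:R by rewrite -natrM -natrD; congr (_%:R); lia.
rewrite e1; move: (dfac R (r + i)) (dfac R r) d0 ((-1) ^+ i) (2 ^+ i) t0 (i.+1%:R) i1 (r.*2.+1%:R) r1 ((r + i).*2.+1%:R) => A D D0 T U t0 I I0 B B0 X.
by field; rewrite D0 i0 t0 I0 B0.
Qed.
Lemma bet0 r : bet r 0 = 1.
Proof. by rewrite /bet addn0 expr0 fact0 !mul1r mulr1 divff // dfac_neq0. Qed.

Variable N : nat.
Local Notation B r := (ser N (bet r)).
Local Notation A0 := (ser N (alpha R 0)).
Local Notation rho := (rhop R N).

Lemma B_step r : eqm N ((1 + 'X) * B r.+1) (B r).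
Proof.
move=> i iN; rewrite mulrDl mul1r coefD coefXM.
case: i iN => [|i] iN /=; rewrite !coef_ser ?(ltnW iN) //; first by rewrite addr0 !bet0.
exact: bet_rec.
Qed.

Lemma B0_sq : eqm N ((1 + 'X) * B 0 ^+ 2) 1.
Proof.
case: (N) => [|n]; first by [].
have h0 : ((1 + 'X) * ser n.+1 (bet 0) ^+ 2)`_0 = (1 : {poly R})`_0.
  by rewrite expr2 !coef0M coefD coef1 coefX coef_ser // bet0 addr0 !mulr1.
apply: eqm_integral => //.
have hb : eqm n (2 *: ((1 + 'X) * (ser n.+1 (bet 0))^`()) + ser n.+1 (bet 0)) 0.
  move=> i iN; rewrite coef0 coefD coefZ.
  have -> : ((1 + 'X) * (ser n.+1 (bet 0))^`())`_i = (ser n.+1 (bet 0))^`()`_i + (if i == 0 then 0 else (ser n.+1 (bet 0))^`()`_i.-1).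
    by rewrite mulrDl mul1r coefD coefXM.
  have hr : 2 * i.+1%:R * bet 0 i.+1 = - (i.*2.+1%:R * bet 0 i).
    rewrite /bet !add0n dfacS exprS !exprS factS natrM.
    have i0 : (i`!%:R : R) != 0 by rewrite pnatr_eq0 -lt0n fact_gt0.
    have t0 : (2 ^+ i : R) != 0 by rewrite expf_neq0.
    have i1 : (i.+1%:R : R) != 0 by rewrite pnatr_eq0.
    have d0 := dfac_neq0 0.
    move: (dfac R i) (dfac R 0) d0 ((-1) ^+ i) (2 ^+ i) t0 (i.+1%:R) i1 (i.*2.+1%:R) => A D D0 T U t0 I I0 X.
    by field; rewrite D0 i0 t0 I0.
  have -> : (if i == 0 then 0 else (ser n.+1 (bet 0))^`()`_i.-1) = i%:R * bet 0 i.
    case: i iN {hr} => [|i] iN; first by rewrite mul0r.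
    by rewrite /= coef_deriv coef_ser ?mulr_natl // ltnW.
  have iN1 : (i < n.+1)%N := ltnW iN; have iN2 : (i.+1 < n.+1)%N := iN.
  rewrite coef_deriv (coef_ser _ iN2) (coef_ser _ iN1) -[X in 2 * (X + _)]mulr_natl mulrDr mulrA hr; have -> : i.*2.+1%:R = 2 * i%:R + 1 :> R by rewrite -natr1 -muln2 natrM mulrC.
  by ring.
have -> : ((1 + 'X) * ser n.+1 (bet 0) ^+ 2)^`() = ser n.+1 (bet 0) * (2 *: ((1 + 'X) * (ser n.+1 (bet 0))^`()) + ser n.+1 (bet 0)).
  by rewrite derivM derivD derivX -[1]polyC1 derivC expr2 derivM -mul_polyC !polyC1 rmorph_nat; ring.
rewrite derivC -[X in eqm _ _ X](mulr0 (ser n.+1 (bet 0))); exact: eqmMr.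
Qed.

(** In closed form, (1 + y)^(-1/2) (y / (1 + y))^r = y^r (1 + y)^(-r - 1/2). Thus A composed with y
    / (1 + y) produces the sums with [bet] found in [conv_snum]. *)
Lemma B_rho r : eqm N (B 0 * rho ^+ r) ('X^r * B r).
Proof.
elim: r => [|r ih]; first by rewrite !expr0 mulr1 mul1r.
have h1 : eqm N (B 0 * rho ^+ r.+1) ('X^r * B r * rho).
  by rewrite exprSr mulrA; apply: eqmMl.
have h2 : eqm N ('X^r * B r * rho) ('X^r * ((1 + 'X) * B r.+1) * rho).
  by apply: eqmMl; apply: eqmMr; apply: eqm_sym; exact: B_step.
have h3 : eqm N ('X^r * ((1 + 'X) * B r.+1) * rho) ('X^(r.+1) * B r.+1).
  have -> : 'X^r * ((1 + 'X) * B r.+1) * rho = ('X^r * B r.+1) * (rho * (1 + 'X)) by ring.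
  have -> : 'X^(r.+1) * B r.+1 = ('X^r * B r.+1) * 'X by rewrite exprS; ring.
  by apply: eqmMr; exact: rhop_eqm.
exact: eqm_trans h1 (eqm_trans h2 h3).
Qed.

Lemma A0_rho : eqm N (B 0 * (A0 \Po rho)) (ser N (fun j => \sum_(i < j.+1) bet (j - i) i * alpha R 0 (j - i))).
Proof.
have -> : B 0 * (A0 \Po rho) = \sum_(r < N) alpha R 0 r *: (B 0 * rho ^+ r).
  rewrite /ser [X in X \Po _]poly_def raddf_sum mulr_sumr; apply: eq_bigr => r _ /=.
  by rewrite comp_polyZ comp_Xn_poly scalerAr.
have h : eqm N (\sum_(r < N) alpha R 0 r *: (B 0 * rho ^+ r)) (\sum_(r < N) alpha R 0 r *: ('X^r * B r)).
  by apply: eqm_sum => r _; apply: eqmZ; exact: B_rho.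
apply: eqm_trans h _ => j jN; rewrite coef_ser // coef_sum.
transitivity (\sum_(r < N) if (r <= j)%N then alpha R 0 r * bet r (j - r) else 0).
  apply: eq_bigr => r _; rewrite coefZ coefXnM ltnNge; case: leqP => rj /=; last by rewrite mulr0.
  by rewrite coef_ser //; lia.
transitivity (\sum_(i < j.+1) alpha R 0 i * bet i (j - i)).
  rewrite (big_ord_widen N (fun r => alpha R 0 r * bet r (j - r)) jN) [RHS]big_mkcond.
  by apply: eq_bigr => r _; rewrite ltnS.
rewrite [RHS](reindex_inj rev_ord_inj) /=; apply: eq_bigr => i _; have ij : (i <= j)%N := ltn_ord i.
by rewrite subSS subKn // mulrC.
Qed.

(** Squaring replaces the factor (1 + y)^(1/2) of the functional equation by a polynomial; the
    square is undone later by halving logarithms of positive quantities. *)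
Lemma formal_sq (P : {poly R}) : app N cfun P ->
  eqm N ((1 + 'X) * (P * A0) ^+ 2) ((A0 \Po rho) ^+ 2).
Proof.
move=> hP; have e1 : eqm N (P * A0) (B 0 * (A0 \Po rho)).
  apply: eqm_trans (eqm_sym A0_rho) => j jN; rewrite coef_ser //.
  apply: (mulfI (_ : expR (1 : R) != 0)); first by rewrite gt_eqF ?expR_gt0.
  rewrite -conv_snum coefM mulr_sumr; apply: eq_bigr => i _; have ij : (i <= j)%N := ltn_ord i.
  by rewrite mulrA (cfun_coef hP) ?coef_ser //; lia.
have h1 : eqm N ((1 + 'X) * (P * A0) ^+ 2) ((1 + 'X) * (B 0 * (A0 \Po rho)) ^+ 2).
  by apply: eqmMr; apply: eqmX.
apply: eqm_trans h1 _; have -> : (1 + 'X) * (B 0 * (A0 \Po rho)) ^+ 2 = ((1 + 'X) * B 0 ^+ 2) * (A0 \Po rho) ^+ 2 by ring.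
by rewrite -[X in eqm _ _ X]mul1r; apply: eqmMl; exact: B0_sq.
Qed.
End Connection.

(** * The Gamma function *)

Section GammaFunction.
Variable R : realType.
Notation mu := (@lebesgue_measure R).
Implicit Types (a b s t x r : R).

Definition gker s t : R := t `^ (s - 1) * expR (- t).
(** With values in the extended reals, the recursion and the convexity inequality can be proved
    before finiteness, which is then deduced from them. *)
Definition GE s : \bar R := (\int[mu]_(t in `]0%R, +oo[) (gker s t)%:E)%E.

Lemma gker_ge0 s t : 0 <= gker s t.
Proof. by rewrite mulr_ge0 ?powR_ge0 ?expR_ge0. Qed.
Lemma gker_measT s : measurable_fun setT (gker s).
Proof.
apply: measurable_funM; first exact: measurable_powR.
by apply: measurableT_comp => //; exact: measurable_funN.
Qed.
Lemma gker_meas s (D : set R) : measurable_fun D (fun t => (gker s t)%:E).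
Proof. by apply/measurable_EFinP; apply: measurable_funS (gker_measT s). Qed.
Lemma GE_ge0 s : (0 <= GE s)%E.
Proof. by apply: integral_ge0 => t _; rewrite lee_fin gker_ge0. Qed.

(** Monotone convergence along compact boxes confines integration by parts and substitution to
    segments away from 0. The end points are general because t = u^2 maps boxes to squared boxes. *)
Lemma box_cvg (f : R -> R) (a b : nat -> R) : measurable_fun setT f -> (forall x, 0 <= f x) ->
  (forall n, 0 < a n) -> (forall n, a n.+1 <= a n) -> (forall n, b n <= b n.+1) ->
  (forall x, 0 < x -> exists n, a n <= x <= b n) ->
  (\int[mu]_(x in `[a n, b n]) (f x)%:E)%E @[n --> \oo] --> (\int[mu]_(x in `]0%R, +oo[) (f x)%:E)%E.
Proof.
move=> mf f0 a0 da ib ex.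
have ma : {homo a : n m / (n <= m)%N >-> m <= n}.
  by move=> n m nm; rewrite -(subnKC nm); elim: (m - n)%N => [|k ih]; rewrite ?addn0 // addnS (le_trans (da _)).
have mb : {homo b : n m / (n <= m)%N >-> n <= m}.
  by move=> n m nm; rewrite -(subnKC nm); elim: (m - n)%N => [|k ih]; rewrite ?addn0 // addnS (le_trans ih).
have -> : `]0%R, +oo[%classic = \bigcup_n `[a n, b n]%classic.
  apply/seteqP; split => x /=; rewrite in_itv /= andbT.
    by move=> x0; have [n hn] := ex x x0; exists n => //=; rewrite in_itv.
  by move=> [n _] /=; rewrite in_itv /= => /andP[h _]; apply: lt_le_trans h.
apply: ge0_nondecreasing_set_cvg_integral => //.
- move=> n m nm; rewrite subsetEset => x /=; rewrite !in_itv /= => /andP[h1 h2].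
  by rewrite (le_trans (ma _ _ nm) h1) (le_trans h2 (mb _ _ nm)).
- by move=> i; apply/measurable_EFinP; apply: measurable_funS mf.
- by move=> i x _; rewrite lee_fin.
Qed.

Definition bxa n : R := n.+1%:R^-1.
Definition bxb n : R := n.+1%:R.
Lemma bxa_gt0 n : 0 < bxa n. Proof. by rewrite invr_gt0 ltr0n. Qed.
Lemma bxaS n : bxa n.+1 <= bxa n.
Proof. by rewrite lef_pV2 ?posrE ?ltr0n // ler_nat. Qed.
Lemma bxbS n : bxb n <= bxb n.+1. Proof. by rewrite ler_nat. Qed.
Lemma bx_ex x : 0 < x -> exists n, bxa n <= x <= bxb n.
Proof.
move=> x0; have y0 : 0 <= x + x^-1 by rewrite addr_ge0 ?invr_ge0 ?ltW.
have h := truncnS_gt (x + x^-1); exists (Num.truncn (x + x^-1)).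
have xi : 0 < x^-1 by rewrite invr_gt0.
rewrite /bxa /bxb; apply/andP; split; last by lra.
by rewrite -[leRHS]invrK lef_pV2 ?posrE ?ltr0n //; lra.
Qed.
Lemma bxa_lt_b n : (0 < n)%N -> bxa n < bxb n.
Proof.
move=> n0; apply: (@lt_trans _ _ 1); last by rewrite ltr1n.
by rewrite invf_lt1 ?ltr0n // ltr1n.
Qed.

Lemma GE_cvg s : (\int[mu]_(x in `[bxa n, bxb n]) (gker s x)%:E)%E @[n --> \oo] --> GE s.
Proof.
apply: box_cvg; [exact: gker_measT|exact: gker_ge0|exact: bxa_gt0|exact: bxaS|exact: bxbS|exact: bx_ex].
Qed.

Lemma derivable_cont (f : R -> R) a b : 0 < a -> (forall x, 0 < x -> derivable f x 1) ->
  {within `[a, b], continuous f}.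
Proof.
move=> a0 df; apply: derivable_within_continuous => x; rewrite in_itv /= => /andP[ax _].
by apply: df; exact: lt_le_trans ax.
Qed.
Lemma derivable_LR (f : R -> R) a b : 0 < a -> a < b -> (forall x, 0 < x -> derivable f x 1) ->
  derivable_oo_LRcontinuous f a b.
Proof.
move=> a0 ab df; have cf x : 0 < x -> f @ x --> f x.
  by move=> x0; apply: differentiable_continuous; apply/derivable1_diffP; exact: df.
split; last 2 first.
- by apply: cvg_at_right_filter; exact: cf.
- by apply: cvg_at_left_filter; apply: cf; exact: lt_trans ab.
by move=> x; rewrite in_itv /= => /andP[ax _]; apply: df; exact: lt_trans ax.
Qed.

Lemma powR_is_derive s x : 0 < x -> is_derive x 1 (@powR R ^~ s) (s * x `^ (s - 1)).
Proof. exact: is_derive1_powR. Qed.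
Lemma derivable_expN x : derivable (fun t : R => expR (- t)) x 1.
Proof. exact: ex_derive. Qed.
Lemma derive_expN x : derive1 (fun t : R => - expR (- t)) x = expR (- x).
Proof. by rewrite derive1E derive_val /= /GRing.scale /=; ring. Qed.

Lemma gker_integrable s a b : 0 < a -> mu.-integrable `[a, b] (EFin \o gker s).
Proof.
move=> a0; apply: continuous_compact_integrable; first exact: segment_compact.
apply: derivable_cont => // x x0; have h := powR_is_derive (s - 1) x0; exact: ex_derive.
Qed.

Lemma gker_parts s a b : 0 < a -> a < b ->
  (\int[mu]_(x in `[a, b]) (gker (s + 1) x)%:E =
   (a `^ s * expR (- a) - b `^ s * expR (- b))%:E + s%:E * \int[mu]_(x in `[a, b]) (gker s x)%:E)%E.
Proof.
move=> a0 ab.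
have h := @integration_by_parts R (@powR R ^~ s) (fun t => - expR (- t)) (fun x => s * x `^ (s - 1)) (fun t => expR (- t)) a b ab.
have -> : (\int[mu]_(x in `[a, b]) (gker (s + 1) x)%:E = \int[mu]_(x in `[a, b]) (x `^ s * expR (- x))%:E)%E.
  by apply: eq_integral => x _; rewrite /gker addrK.
rewrite h.
- congr (_%:E + _)%E; first by ring.
  have -> : (\int[mu]_(x in `[a, b]) (s * x `^ (s - 1) * - expR (- x))%:E = \int[mu]_(x in `[a, b]) ((- s)%:E * (gker s x)%:E))%E.
    by apply: eq_integral => x _; rewrite -EFinM /gker; congr (_%:E); ring.
  rewrite integralZl //; last exact: gker_integrable.
  by rewrite EFinN mulNe oppeK.
- apply: derivable_cont => // x x0; have hx := powR_is_derive (s - 1) x0; exact: ex_derive.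
- apply: derivable_LR => // x x0; have hx := powR_is_derive s x0; exact: ex_derive.
- move=> x; rewrite in_itv /= => /andP[ax _]; apply: powR_derive1.
  by rewrite in_itv /= andbT (lt_trans a0).
- by apply: derivable_cont => // x _; exact: derivable_expN.
- by apply: derivable_LR => // x _; apply: derivableN; exact: derivable_expN.
- by move=> x _; exact: derive_expN.
Qed.

Lemma powR_exp_le s b : 1 <= b -> b `^ s * expR (- b) <= (Num.truncn `|s|).+2`!%:R / b.
Proof.
move=> b1; have b0 : 0 < b by lra.
set m := (Num.truncn `|s|).+1.
have sm : s <= m%:R by apply: le_trans (ler_norm s) _; apply/ltW; rewrite truncnS_gt.
have h1 : b `^ s <= b ^+ m by rewrite -powR_mulrn ?(ltW b0) //; apply: ler_powR.
apply: le_trans (ler_pM (powR_ge0 _ _) (expR_ge0 _) h1 (pow_expRN m.+1 b0)) _.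
have bm : b ^+ m != 0 by rewrite expf_neq0 // gt_eqF.
rewrite exprS le_eqVlt; apply/orP; left; apply/eqP; move: (b ^+ m) bm => B bm.
by field; rewrite bm gt_eqF.
Qed.

Lemma cvg_inv_succ : (fun n : nat => (n.+1%:R : R)^-1) @ \oo --> (0 : R).
Proof. exact: cvg_harmonic. Qed.

Lemma bxa_cvg s : 0 < s -> (fun n => bxa n `^ s * expR (- bxa n)) @ \oo --> (0 : R).
Proof.
move=> s0; have h : (fun n => bxa n `^ s) @ \oo --> (0 : R).
  apply: (@cvg_comp _ _ _ bxa (@powR R ^~ s) _ (0 : R)^'+); last exact: powR_cvg0.
  move=> P /= [e e0 he].
  have := cvg_inv_succ; move=> /cvgrPdist_lt /(_ e e0); apply: filterS => n hn.
  by apply: he => //=; exact: bxa_gt0.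
apply: (squeeze_cvgr _ (cvg_cst 0) h); near=> n.
rewrite mulr_ge0 ?powR_ge0 ?expR_ge0 //= -[leRHS]mulr1 ler_wpM2l ?powR_ge0 //.
by rewrite -expR0 ler_expR oppr_le0 ltW ?bxa_gt0.
Unshelve. all: by end_near. Qed.

Lemma bxb_cvg s : (fun n => bxb n `^ s * expR (- bxb n)) @ \oo --> (0 : R).
Proof.
pose K : R := (Num.truncn `|s|).+2`!%:R.
have h : (fun n : nat => K * n.+1%:R^-1) @ \oo --> (0 : R).
  by have h0 := cvgM (cvg_cst K : (fun _ : nat => K) @ \oo --> K) cvg_inv_succ; rewrite mulr0 in h0; exact: h0.
apply: (squeeze_cvgr _ (cvg_cst 0) h); near=> n.
rewrite mulr_ge0 ?powR_ge0 ?expR_ge0 //=; apply: powR_exp_le; by rewrite ler1n.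
Unshelve. all: by end_near. Qed.

Lemma GES s : 0 < s -> (GE (s + 1) = s%:E * GE s)%E.
Proof.
move=> s0; pose c n := bxa n `^ s * expR (- bxa n) - bxb n `^ s * expR (- bxb n).
have hc : (fun n => (c n)%:E) @ \oo --> 0%:E.
  apply: cvg_EFin; first by near=> n.
  by have h0 := cvgB (bxa_cvg s0) (bxb_cvg s); rewrite subrr in h0; exact: h0.
have h2 : ((c n)%:E + s%:E * \int[mu]_(x in `[bxa n, bxb n]) (gker s x)%:E)%E @[n --> \oo] --> (0%:E + s%:E * GE s)%E.
  apply: cvgeD => //.
  by apply: cvgeZl => //; exact: GE_cvg.
rewrite add0e in h2.
have h1 := @GE_cvg (s + 1).
apply: (cvg_unique (@ereal_hausdorff R) h1); apply: cvg_trans h2; apply: near_eq_cvg; near=> n.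
rewrite (gker_parts s (bxa_gt0 n)) //; apply: bxa_lt_b.
by near: n; exists 1%N.
Unshelve. all: by end_near. Qed.

Lemma GE1 : GE 1 = 1%E.
Proof.
rewrite /GE integral_itv_obnd_cbnd; last exact: gker_meas.
have -> : (\int[mu]_(x in `[0%R, +oo[) (gker 1 x)%:E = \int[mu]_(x in `[0%R, +oo[) (expR (- x))%:E)%E.
  by apply: eq_integral => x _; rewrite /gker subrr powRr0 mul1r.
rewrite (@ge0_continuous_FTC2y _ (fun x => expR (- x)) (fun x => - expR (- x)) 0 0).
- by rewrite oppr0 expR0 -EFinB opprK add0r.
- by move=> x _; exact: expR_ge0.
- by apply: derivable_within_continuous => x _; exact: derivable_expN.
- by rewrite -[X in _ --> X]oppr0; apply: cvgN; exact: cvgr_expR.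
- by move=> x _; apply: derivableN; exact: derivable_expN.
- have h : continuous (fun x : R => - expR (- x)).
    move=> x; apply: differentiable_continuous; apply/derivable1_diffP.
    by apply: derivableN; exact: derivable_expN.
  by apply: cvg_at_right_filter; exact: h.
- by move=> x _; exact: derive_expN.
Qed.

Lemma GE_nat n : GE n.+1%:R = (n`!%:R)%:E.
Proof.
elim: n => [|n ih]; first exact: GE1.
by rewrite -natr1 GES ?ltr0n // ih -EFinM -natrM factS.
Qed.

Lemma powR_amgm x s : 0 < x -> 0 <= s -> s <= 1 -> x `^ s <= 1 - s + s * x.
Proof.
move=> x0 s0 s1; have m0 : 0 < 1 - s + s * x.
  have [->|sn] := eqVneq s 0; first by rewrite subr0 mul0r addr0.
  have sp : 0 < s by rewrite lt_def sn.
  have := mulr_gt0 sp x0; lra.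
set m := 1 - s + s * x in m0 *.
have h1 := ln_le_sub1 (divr_gt0 x0 m0); have h2 := ln_le_sub1 (divr_gt0 (@ltr01 R) m0).
rewrite lnM ?posrE ?invr_gt0 // lnV ?posrE // in h1.
rewrite lnM ?posrE ?invr_gt0 // lnV ?posrE // ln1 in h2.
rewrite -[leRHS]lnK ?posrE // /powR gt_eqF // ler_expR.
have h3 := ler_wpM2l s0 h1; have s1' : 0 <= 1 - s by lra.
have h4 := ler_wpM2l s1' h2.
have e : s * (x / m - 1) + (1 - s) * (1 / m - 1) = 0.
  by rewrite /m; field; rewrite -/m gt_eqF.
move: h3 h4 e; move: (ln x) (ln m) (x / m) (1 / m) => X Y Z W; nra.
Qed.

(** Weighted AM-GM bounds (t / r)^s by an affine function of t; integrating this pointwise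
    inequality takes the place of Hoelder's inequality. *)
Lemma gker_conv r s t : 0 < r -> 0 <= s -> s <= 1 -> 0 < t ->
  gker (r + s + 1) t <= r `^ s * (1 - s) * gker (r + 1) t + r `^ s * (s / r) * gker (r + 2) t.
Proof.
move=> r0 s0 s1 t0; rewrite /gker.
have -> : r + s + 1 - 1 = r + s by ring.
have -> : r + 1 - 1 = r by ring.
have -> : r + 2 - 1 = r + 1 by ring.
have tn : t != 0 by rewrite gt_eqF.
rewrite !powRD ?tn ?implybT // powRr1 ?(ltW t0) //.
have h := powR_amgm (divr_gt0 t0 r0) s0 s1.
have e : t `^ s = r `^ s * (t / r) `^ s.
  by rewrite -powRM ?divr_ge0 ?(ltW r0) ?(ltW t0) // mulrC mulfVK // gt_eqF.
rewrite e; have := ler_wpM2l (mulr_ge0 (mulr_ge0 (powR_ge0 t r) (powR_ge0 r s)) (expR_ge0 (- t))) h.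
move: (t `^ r) (r `^ s) ((t / r) `^ s) (expR (- t)) => A B D X hh.
have -> : A * (B * D) * X = A * B * X * D by ring.
apply: le_trans hh _; rewrite le_eqVlt; apply/orP; left; apply/eqP; field.
by rewrite gt_eqF.
Qed.

Lemma GE_conv r s : 0 < r -> 0 <= s -> s <= 1 ->
  (GE (r + s + 1) <= (r `^ s * (1 - s))%:E * GE (r + 1) + (r `^ s * (s / r))%:E * GE (r + 2))%E.
Proof.
move=> r0 s0 s1; have k1 : 0 <= r `^ s * (1 - s) by rewrite mulr_ge0 ?powR_ge0 // subr_ge0.
have k2 : 0 <= r `^ s * (s / r) by rewrite mulr_ge0 ?powR_ge0 // divr_ge0 // ltW.
have mI : measurable (`]0%R, +oo[%classic : set R) by exact: measurable_itv.
have p0 u : forall x, `]0%R, +oo[%classic x -> (0 <= (gker u x)%:E)%E by move=> x _; rewrite lee_fin gker_ge0.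
rewrite /GE -(ge0_integralZl_EFin mu mI (p0 (r + 1)) (@gker_meas _ _) k1).
rewrite -(ge0_integralZl_EFin mu mI (p0 (r + 2)) (@gker_meas _ _) k2).
have q0 k u : 0 <= k -> forall x, `]0%R, +oo[%classic x -> (0 <= k%:E * (gker u x)%:E)%E.
  by move=> k0 x _; rewrite -EFinM lee_fin mulr_ge0 // gker_ge0.
have mk k u : measurable_fun (`]0%R, +oo[%classic : set R) (fun x => (k%:E * (gker u x)%:E)%E).
  by apply: measurable_funeM; exact: gker_meas.
rewrite -(ge0_integralD mu mI (q0 _ _ k1) (mk _ _) (q0 _ _ k2) (mk _ _)).
apply: (ge0_le_integral mu mI (p0 _) (@gker_meas _ _)).
  by apply: emeasurable_funD; exact: mk.
move=> x /=; rewrite in_itv /= andbT => x0.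
by rewrite -!EFinM -EFinD lee_fin gker_conv.
Qed.

(** The convexity inequality bounds the value at s + 2 by values at two integers, which are
    factorials; the recursion then descends from s + 2 to s. *)
Lemma GE_fin s : 0 < s -> GE s \is a fin_num.
Proof.
move=> s0; have s1 : 0 < s + 1 by lra.
suff h : GE (s + 1 + 1) \is a fin_num.
  have h1 : GE (s + 1) \is a fin_num.
    rewrite GES // in h; rewrite ge0_fin_numE ?GE_ge0 //.
    rewrite ltey; apply/eqP => e; rewrite e muleC gt0_mulye ?lte_fin // in h.
  rewrite GES // in h1; rewrite ge0_fin_numE ?GE_ge0 //.
  by rewrite ltey; apply/eqP => e; rewrite e muleC gt0_mulye ?lte_fin // in h1.
have /andP[t1 t2] := truncn_itv (ltW s0).
set n := Num.truncn s in t1 t2.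
have n0 : 0 < n.+1%:R :> R by rewrite ltr0n.
have := @GE_conv n.+1%:R (s - n%:R) n0; rewrite subr_ge0 => /(_ t1).
have -> : n.+1%:R + (s - n%:R) + 1 = s + 1 + 1 by rewrite -natr1; ring.
have -> : n.+1%:R + 1 = n.+2%:R :> R by rewrite natr1.
have -> : n.+1%:R + 2 = n.+3%:R :> R by rewrite -(natr1 n.+2) -(natr1 n.+1); ring.
rewrite !GE_nat -natr1 in t2 * => h.
have {}h := h (_ : s - n%:R <= 1).
rewrite ge0_fin_numE ?GE_ge0 //; apply: le_lt_trans (h _) _; first by lra.
by rewrite -!EFinM -EFinD ltey.
Qed.

Lemma Gamma_GE s : 0 < s -> (Gamma_fun s)%:E = GE s.
Proof. by move=> s0; rewrite /Gamma_fun /Rintegral -/(GE s) fineK // GE_fin. Qed.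

Lemma GammaS s : 0 < s -> Gamma_fun (s + 1) = s * Gamma_fun s.
Proof.
move=> s0; apply: EFin_inj; rewrite EFinM !Gamma_GE ?addr_gt0 //.
exact: GES.
Qed.
Lemma Gamma_nat n : Gamma_fun (n.+1%:R : R) = n`!%:R.
Proof. by apply: EFin_inj; rewrite Gamma_GE ?ltr0n // GE_nat. Qed.

Lemma Gamma_conv r s : 0 < r -> 0 <= s -> s <= 1 ->
  Gamma_fun (r + s + 1) <= r `^ s * (1 + s / r) * Gamma_fun (r + 1).
Proof.
move=> r0 s0 s1; have := GE_conv r0 s0 s1.
have r1 : 0 < r + 1 by lra.
have r2 : 0 < r + 2 by lra.
have rs : 0 < r + s + 1 by lra.
rewrite -!Gamma_GE // -!EFinM -EFinD lee_fin => /le_trans; apply.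
have -> : r + 2 = r + 1 + 1 by ring.
rewrite [Gamma_fun (r + 1 + 1)]GammaS //; move: (r `^ s) (Gamma_fun _) => A B.
by rewrite le_eqVlt; apply/orP; left; apply/eqP; field; rewrite gt_eqF.
Qed.

(** Convexity from s up to the next integer bounds a factorial by a multiple of Gamma(s), whose sign
    is thereby determined. *)
Lemma Gamma_gt0 s : 0 < s -> 0 < Gamma_fun s.
Proof.
move=> s0; have /andP[t1 t2] := truncn_itv (ltW s0).
set n := Num.truncn s in t1 t2.
have h := @Gamma_conv s (n.+1%:R - s) s0; rewrite subr_ge0 in h.
have {}h := h (ltW t2); rewrite -natr1 in h t2.
have h1 : n%:R + 1 - s <= 1 by lra.
have {}h := h h1.
have e : s + (n%:R + 1 - s) + 1 = n.+2%:R by rewrite -(natr1 n.+1) -natr1; ring.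
rewrite e Gamma_nat GammaS // mulrA in h.
have f0 : 0 < n.+1`!%:R :> R by rewrite ltr0n fact_gt0.
have := lt_le_trans f0 h; rewrite pmulr_rgt0 // mulr_gt0 // mulr_gt0 ?powR_gt0 //.
by have : 0 <= (n%:R + 1 - s) / s; [apply: divr_ge0; lra|lra].
Qed.

Lemma derive_sqr x : derive1 (fun t : R => t ^+ 2) x = 2 * x.
Proof. by rewrite derive1E (exp_derive 2) /= expr1 /GRing.scale /= mulr1. Qed.

Lemma gker_sq a b : 0 < a -> a < b -> (\int[mu]_(x in `[(a ^+ 2)%R, (b ^+ 2)%R]) (gker 2^-1 x)%:E =
  2%:E * \int[mu]_(x in `[a, b]) (gauss_fun x)%:E)%E.
Proof.
move=> a0 ab; have b0 := lt_trans a0 ab.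
have dsq x : derivable (fun t : R => t ^+ 2) x 1 by exact: exprn_derivable.
have cd : derive1 (fun t : R => t ^+ 2) = (fun t => 2 * t) by apply/funext => x; exact: derive_sqr.
have cc : continuous (fun t : R => 2 * t) by move=> x; apply: mulrl_continuous.
rewrite (@integration_by_substitution_increasing R (fun t => t ^+ 2) (gker 2^-1) a b (ltW ab)).
- rewrite -integralZl //; last first.
    apply: continuous_compact_integrable; first exact: segment_compact.
    by apply: continuous_subspaceT; exact: continuous_gauss_fun.
  apply: eq_integral => x; rewrite inE /= in_itv /= => /andP[ax xb].
  have x0 : 0 < x by exact: lt_le_trans ax.
  rewrite -EFinM; congr (_%:E); rewrite /= fctE /= cd /gker /gauss_fun.
  have -> : 2^-1 - 1 = - 2^-1 :> R by field.
  rewrite powRN powR12_sqrt ?exprn_ge0 ?(ltW x0) // sqrtr_sqr gtr0_norm //.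
  by move: (expR _) => X; field; rewrite gt_eqF.
- move=> x y; rewrite !in_itv /= => /andP[ax _] /andP[ay _] xy.
  by rewrite ltrXn2r ?nnegrE //; lra.
- by rewrite cd => x _; exact: cc.
- by rewrite cd; apply/cvg_ex; exists (2 * a); apply: cvg_at_right_filter; exact: cc.
- by rewrite cd; apply/cvg_ex; exists (2 * b); apply: cvg_at_left_filter; exact: cc.
- by apply: derivable_LR => // x _; exact: dsq.
- apply: derivable_cont; first by rewrite exprn_gt0.
  by move=> x x0; have h := powR_is_derive (2^-1 - 1) x0; exact: ex_derive.
Qed.

(** The substitution t = u^2 turns the integral into twice the Gaussian integral over the
    half-line. *)
Lemma Gamma_half : Gamma_fun (2^-1 : R) = Num.sqrt pi.
Proof.
apply: EFin_inj; rewrite Gamma_GE ?invr_gt0 //.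
have h1 : (\int[mu]_(x in `[(bxa n ^+ 2)%R, (bxb n ^+ 2)%R]) (gker 2^-1 x)%:E)%E @[n --> \oo] --> GE 2^-1.
  apply: (@box_cvg (gker 2^-1) (fun n => bxa n ^+ 2) (fun n => bxb n ^+ 2) (gker_measT _) (gker_ge0 _)).
  - by move=> n; rewrite exprn_gt0 ?bxa_gt0.
  - by move=> n; rewrite lerXn2r ?nnegrE ?bxaS // ltW // bxa_gt0.
  - by move=> n; rewrite lerXn2r ?nnegrE ?bxbS // ler0n.
  move=> x x0; have s0 : 0 < Num.sqrt x by rewrite sqrtr_gt0.
  have [n /andP[n1 n2]] := bx_ex s0; exists n; rewrite -[x]sqr_sqrtr ?(ltW x0) //.
  by rewrite !lerXn2r ?nnegrE ?n1 ?n2 // ?ler0n ?(ltW s0) // ltW // bxa_gt0.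
have h2 : (\int[mu]_(x in `[bxa n, bxb n]) (gauss_fun x)%:E)%E @[n --> \oo] --> (Num.sqrt pi / 2)%:E.
  have -> : ((Num.sqrt pi / 2)%:E = \int[mu]_(x in `]0%R, +oo[) (gauss_fun x)%:E)%E.
    rewrite -integral0y_gauss integral_itv_obnd_cbnd //.
    by apply/measurable_EFinP; apply: measurable_funS (measurable_gauss_fun).
  apply: box_cvg; [exact: measurable_gauss_fun|exact: gauss_fun_ge0|exact: bxa_gt0|exact: bxaS|exact: bxbS|exact: bx_ex].
have h3 : (2%:E * \int[mu]_(x in `[bxa n, bxb n]) (gauss_fun x)%:E)%E @[n --> \oo] --> (2%:E * (Num.sqrt pi / 2)%:E)%E.
  by apply: cvgeZl => //; exact: h2.
have -> : (Num.sqrt pi)%:E = (2%:E * (Num.sqrt pi / 2)%:E)%E :> \bar R by rewrite -EFinM; congr (_%:E); field.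
apply: (cvg_unique (@ereal_hausdorff R) h1); apply: cvg_trans h3; apply: near_eq_cvg; near=> n.
rewrite gker_sq ?bxa_gt0 //; apply: bxa_lt_b.
by near: n; exists 1%N.
Unshelve. all: by end_near. Qed.

Lemma Gamma_half_dfac j : Gamma_fun (j%:R + 2^-1) * 2 ^+ j / Num.sqrt pi = dfac R j.
Proof.
have p0 : Num.sqrt (pi : R) != 0 by rewrite gt_eqF // sqrtr_gt0 pi_gt0.
elim: j => [|j ih]; first by rewrite add0r Gamma_half expr0 mulr1 divff // /dfac big_ord0.
have j0 : 0 < j%:R + 2^-1 :> R by rewrite ltr_wpDl ?ler0n ?invr_gt0.
have -> : j.+1%:R + 2^-1 = j%:R + 2^-1 + 1 :> R by rewrite -natr1; ring.
rewrite GammaS // dfacS -ih exprS.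
have -> : j.*2.+1%:R = 2 * j%:R + 1 :> R by rewrite -natr1 -muln2 natrM mulrC.
by move: (Gamma_fun _) => X; field.
Qed.
End GammaFunction.

(** * The coefficients of Stirling's series *)

Section Stirling.
Variable R : realType.
Implicit Types (x y r s : R).
(* Locking keeps conversion from unfolding the integral. *)
Local Notation G := (locked (@Gamma_fun R)).

Let G_gt0 x : 0 < x -> 0 < G x. Proof. by rewrite -lock; exact: Gamma_gt0. Qed.
Let GS x : 0 < x -> G (x + 1) = x * G x. Proof. by rewrite -!lock; exact: GammaS. Qed.
Let G_nat n : G n.+1%:R = n`!%:R. Proof. by rewrite -lock; exact: Gamma_nat. Qed.
Let G_conv r s : 0 < r -> 0 <= s -> s <= 1 -> G (r + s + 1) <= r `^ s * (1 + s / r) * G (r + 1).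
Proof. by rewrite -!lock; exact: Gamma_conv. Qed.
Let G_half j : G (j%:R + 2^-1) * 2 ^+ j / Num.sqrt pi = dfac R j.
Proof. by rewrite -lock; exact: Gamma_half_dfac. Qed.

(* The logarithm of the Stirling ratio. *)
Definition lnS x : R := ln (G (x + 1)) + x - x * ln x - 2^-1 * ln (2 * pi * x).

Lemma stirlingE x : 0 < x -> stirling_ratio x = expR (lnS x).
Proof.
move=> x0; have g0 : 0 < G (x + 1) by apply: G_gt0; lra.
have p0 : 0 < 2 * pi * x :> R by rewrite !mulr_gt0 ?pi_gt0.
rewrite /stirling_ratio [@Gamma_fun R]lock /lnS !expRD !expRN lnK ?posrE // -powR12_sqrt ?(ltW p0) //.
by rewrite /powR !gt_eqF // invfM mulrA.
Qed.

Lemma lnSB x : 0 < x -> lnS x - lnS (x + 1) = (x + 2^-1) * ln (1 + x^-1) - 1.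
Proof.
move=> x0; have x1 : 0 < x + 1 by lra.
have g0 : 0 < G (x + 1) by exact: G_gt0.
have p0 : 0 < 2 * pi :> R by rewrite mulr_gt0 ?pi_gt0.
have y0 : 0 < 1 + x^-1 by rewrite addr_gt0 ?invr_gt0.
have e : x + 1 = x * (1 + x^-1) by field; rewrite gt_eqF.
rewrite /lnS [G (x + 1 + 1)]GS // [ln (_ * G _)]lnM ?posrE //.
have -> : ln (2 * pi * (x + 1)) = ln (2 * pi * x) + ln (1 + x^-1).
  by rewrite e mulrA lnM ?posrE // mulr_gt0.
have -> : ln (x + 1) = ln x + ln (1 + x^-1) by rewrite [in LHS]e lnM ?posrE.
by move: (ln (G _)) (ln (2 * pi * x)) (ln x) (ln (1 + x^-1)) => A B C D; field.
Qed.

Lemma ln_diff (X Y d : R) : 0 < X -> 0 < Y -> d <= 2^-1 -> `|X - Y| <= d * Y -> `|ln X - ln Y| <= 2 * d.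
Proof.
move=> X0 Y0 d1; rewrite ler_norml => /andP[h1 h2].
have a1 : ln X - ln Y <= X / Y - 1.
  by rewrite -ln_div ?posrE //; apply: ln_le_sub1; exact: divr_gt0.
have a2 : ln Y - ln X <= Y / X - 1.
  by rewrite -ln_div ?posrE //; apply: ln_le_sub1; exact: divr_gt0.
have d0 : 0 <= d by have : 0 <= d * Y by [lra]; rewrite pmulr_lge0.
have b1 : X / Y <= 1 + d by rewrite ler_pdivrMr //; lra.
have b2 : Y / X <= 1 + 2 * d by rewrite ler_pdivrMr //; nra.
rewrite ler_norml; apply/andP; split; lra.
Qed.

(* Logarithmic convexity of Gamma, in the form given by weighting t^s with
   AM-GM, applied to [s] for the upper and to [1 - s] for the lower bound. *)
Lemma lnGamma_bounds r s : 0 < r -> 0 <= s -> s <= 1 ->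
  s * (ln (r + s) - ln r) <= ln (G (r + s + 1)) - ln (G (r + 1)) - s * ln r <= ln (r + s) - ln r.
Proof.
move=> r0 s0 s1; have rs : 0 < r + s by lra.
have g1 : 0 < G (r + s + 1) by apply: G_gt0; lra.
have g2 : 0 < G (r + 1) by apply: G_gt0; lra.
apply/andP; split; last first.
  have h := G_conv r0 s0 s1.
  have e : 1 + s / r = (r + s) / r by field; rewrite gt_eqF.
  rewrite e -ler_ln ?posrE // in h; last by rewrite !mulr_gt0 ?powR_gt0 ?divr_gt0 ?invr_gt0.
  rewrite lnM ?posrE ?mulr_gt0 ?powR_gt0 ?invr_gt0 // lnM ?posrE ?mulr_gt0 ?powR_gt0 ?invr_gt0 // ln_powR in h.
  rewrite ln_div ?posrE // in h; lra.
have s0' : 0 <= 1 - s by lra.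
have s1' : 1 - s <= 1 by lra.
have h := G_conv rs s0' s1'.
have e1 : r + s + (1 - s) + 1 = r + 1 + 1 by ring.
have r1 : 0 < r + 1 by lra.
have e2 : 1 + (1 - s) / (r + s) = (r + 1) / (r + s) by field; rewrite gt_eqF.
rewrite e1 GS // e2 -ler_ln ?posrE ?mulr_gt0 ?powR_gt0 ?invr_gt0 // in h.
rewrite lnM ?posrE // lnM ?posrE ?mulr_gt0 ?powR_gt0 ?invr_gt0 // lnM ?posrE ?mulr_gt0 ?powR_gt0 ?invr_gt0 // in h.
rewrite ln_powR ln_div ?posrE // in h.
move: h; move: (ln (r + 1)) (ln (r + s)) (ln r) (ln (G _)) (ln (G _)) => A B C D E h; nra.
Qed.

Lemma lnratio_bounds r s : 0 < r -> 0 <= s -> s <= (ln (r + s) - ln r) * (r + s) /\ (ln (r + s) - ln r) * r <= s.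
Proof.
move=> r0; rewrite le_eqVlt => /orP[/eqP <-|s0].
  by rewrite addr0 subrr !mul0r.
have rs : 0 < r + s by lra.
have y0 : 0 < s / r by rewrite divr_gt0.
have := ln1D_bounds y0; have e : 1 + s / r = (r + s) / r by field; rewrite gt_eqF.
rewrite e ln_div ?posrE //.
have -> : s / r / ((r + s) / r) = s / (r + s) by field; rewrite !gt_eqF.
by rewrite ler_pdivrMr // ler_pdivlMr // => /andP[].
Qed.

Lemma lnS_shift r s : 0 < r -> 0 <= s -> s <= 1 -> `|lnS (r + s) - lnS r| <= r^-1.
Proof.
move=> r0 s0 s1; have rs : 0 < r + s by lra.
have /andP[h1 h2] := lnGamma_bounds r0 s0 s1; have [h3 h4] := lnratio_bounds r0 s0.
have p0 : 0 < 2 * pi :> R by rewrite mulr_gt0 ?pi_gt0.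
have T0 : 0 <= ln (r + s) - ln r by rewrite subr_ge0 ler_ln ?posrE //; lra.
have e : lnS (r + s) - lnS r = (ln (G (r + s + 1)) - ln (G (r + 1)) - s * ln r) + s - (r + s + 2^-1) * (ln (r + s) - ln r).
  rewrite /lnS (lnM (x := 2 * pi) (y := r + s)) ?posrE // (lnM (x := 2 * pi) (y := r)) ?posrE //.
  by move: (ln (G _)) (ln (G _)) (ln (2 * pi)) (ln (r + s)) (ln r) => A B C D E; field.
rewrite e; move: T0 h1 h2 h3 h4; move: (_ - _ - s * ln r) (ln (r + s) - ln r) => D T T0 h1 h2 h3 h4.
have T1 : T <= r^-1 by rewrite -[leRHS]mul1r ler_pdivlMr //; lra.
by rewrite ler_norml; apply/andP; split; nra.
Qed.

(** With y = 1 / x and z = y / (1 + y), the first two terms of the series of ln(1 + y) in powers of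
    z, multiplied by 1 / y + 1 / 2, give exactly 1 - z^2 / 4: the terms of order y cancel. *)
Lemma lnS_step x : 1 <= x -> `|lnS x - lnS (x + 1)| <= 2 * x^-1 ^+ 2.
Proof.
move=> x1; have x0 : 0 < x by lra.
rewrite lnSB //; have y0 : 0 < x^-1 by rewrite invr_gt0.
have y1 : x^-1 <= 1 by rewrite invf_le1.
have -> : x = x^-1^-1 by rewrite invrK.
set y := x^-1 in y0 y1 *; rewrite invrK.
have p0 : 0 < 1 + y by lra.
have z0 : 0 <= y / (1 + y) by rewrite divr_ge0 ?ltW.
have z1 : y / (1 + y) < 1 by rewrite ltr_pdivrMr //; lra.
have := log_series z0 z1 (isT : (0 < 3)%N); rewrite -(ln1D_rho y0).
rewrite big_ltn // big_ltn // big_geq // addr0 expr1 invr1 mul1r.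
have -> : 1 - y / (1 + y) = (1 + y)^-1 by field; rewrite gt_eqF.
rewrite invrK; set L := ln (1 + y); set z := y / (1 + y) => /andP[h1 h2].
have q0 : 0 < y^-1 + 2^-1 by rewrite addr_gt0 ?invr_gt0.
have e : (y^-1 + 2^-1) * (z + 2%:R^-1 * z ^+ 2) = 1 - z ^+ 2 / 4.
  by rewrite /z; field; rewrite !gt_eqF.
have zy : z <= y by rewrite /z ler_pdivrMr //; nra.
have hz2 : z ^+ 2 <= y ^+ 2 by rewrite lerXn2r ?nnegrE ?(ltW y0).
have h3 : (y^-1 + 2^-1) * (L - (z + 2%:R^-1 * z ^+ 2)) <= 2 * y ^+ 2.
  apply: (@le_trans _ _ ((y^-1 + 2^-1) * (z ^+ 3 * (1 + y)))).
    by rewrite ler_pM2l.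
  have -> : (y^-1 + 2^-1) * (z ^+ 3 * (1 + y)) = z ^+ 2 * (1 + y / 2) by rewrite /z; field; rewrite !gt_eqF.
  by rewrite mulrC; apply: ler_pM => //; rewrite ?sqr_ge0 //; lra.
have h4 : 0 <= (y^-1 + 2^-1) * (L - (z + 2%:R^-1 * z ^+ 2)) by rewrite mulr_ge0 ?(ltW q0).
have e2 : (y^-1 + 2^-1) * L - 1 = (y^-1 + 2^-1) * (L - (z + 2%:R^-1 * z ^+ 2)) - z ^+ 2 / 4.
  rewrite mulrBr e; ring.
rewrite e2 ler_norml; have h6 := sqr_ge0 z.
set A := (y^-1 + 2^-1) * _ in h3 h4 *; apply/andP; split; lra.
Qed.

Lemma tele_partial (u : R -> R) (N : nat) (K x0 : R) : 1 <= x0 -> 0 <= K ->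
  (forall x, x0 <= x -> `|u x - u (x + 1)| <= K * x^-1 ^+ N.+2) ->
  forall x m, x0 <= x -> `|u x - u (x + m%:R)| <= 2 * K * x^-1 ^+ N * (x^-1 - (x + m%:R)^-1).
Proof.
move=> x01 K0 h x m xx; have xp : 0 < x by lra.
elim: m => [|m ih]; first by rewrite addr0 !subrr normr0 mulr0.
have z1 : x <= x + m%:R by rewrite lerDl.
set z := x + m%:R in ih z1 *; have zp : 0 < z by lra.
have -> : x + m.+1%:R = z + 1 by rewrite /z -natr1; ring.
have -> : u x - u (z + 1) = (u x - u z) + (u z - u (z + 1)) by ring.
apply: le_trans (ler_normD _ _) _.
have -> : x^-1 - (z + 1)^-1 = (x^-1 - z^-1) + (z^-1 - (z + 1)^-1) by ring.
rewrite mulrDr; apply: lerD => //; apply: le_trans (h z _) _; first by lra.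
have zx : z^-1 <= x^-1 by rewrite lef_pV2 ?posrE.
have hN : z^-1 ^+ N <= x^-1 ^+ N by rewrite lerXn2r ?nnegrE ?invr_ge0 ?(ltW zp) ?(ltW xp).
have h2 : z^-1 ^+ 2 <= 2 * (z^-1 - (z + 1)^-1).
  have -> : 2 * (z^-1 - (z + 1)^-1) = 2 * z / (z + 1) * z^-1 ^+ 2 by field; rewrite !gt_eqF //; lra.
  rewrite -[leLHS]mul1r ler_wpM2r ?sqr_ge0 // ler_pdivlMr; lra.
have -> : z^-1 ^+ N.+2 = z^-1 ^+ N * z^-1 ^+ 2 by rewrite -exprD addn2.
rewrite [2 * K]mulrC -!mulrA ler_wpM2l //.
have -> : 2 * (x^-1 ^+ N * (z^-1 - (z + 1)^-1)) = x^-1 ^+ N * (2 * (z^-1 - (z + 1)^-1)) by ring.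
by apply: ler_pM; rewrite ?exprn_ge0 ?invr_ge0 ?(ltW zp).
Qed.

(** As u tends to 0 along x + m, the value u(x) is the sum of the increments; summing a bound of
    order N + 2 loses one order. *)
Lemma tele (u : R -> R) (N : nat) (K x0 : R) : 1 <= x0 -> 0 <= K ->
  (forall x, x0 <= x -> `|u x - u (x + 1)| <= K * x^-1 ^+ N.+2) ->
  (forall x, x0 <= x -> (fun m : nat => u (x + m%:R)) @ \oo --> (0 : R)) ->
  forall x, x0 <= x -> `|u x| <= 2 * K * x^-1 ^+ N.+1.
Proof.
move=> x01 K0 h h0 x xx; have xp : 0 < x by lra.
have hc : (fun m : nat => `|u x - u (x + m%:R)|) @ \oo --> `|u x|.
  have h1 : (fun m : nat => u x - u (x + m%:R)) @ \oo --> u x - 0 by apply: cvgB; [exact: cvg_cst|exact: h0].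
  by rewrite subr0 in h1; exact: cvg_norm h1.
apply: (cvg_bound (m0 := 0) hc) => m _; apply: le_trans (tele_partial x01 K0 h m xx) _.
rewrite exprSr mulrA ler_wpM2l ?mulr_ge0 ?exprn_ge0 ?invr_ge0 ?(ltW xp) //.
by rewrite gerBl invr_ge0 addr_ge0 // ltW.
Qed.

Lemma dfac_fact n : dfac R n * (2 ^+ n * n`!%:R) = (n.*2)`!%:R.
Proof.
elim: n => [|n ih]; first by rewrite /dfac big_ord0 expr0 fact0 !mul1r.
rewrite doubleS !factS dfacS exprS !natrM -ih.
have -> : n.*2.+2%:R = 2 * n.+1%:R :> R by rewrite -natrM; congr (_%:R); lia.
by ring.
Qed.

(** As in Wallis' product: Gamma(n + 1/2) has the closed form (2n)! sqrt(pi) / (4^n n!), and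
    log-convexity compares Gamma(n + 3/2) with Gamma(n + 1), which relates (2n)! to the square of
    n!. *)
Lemma lnS_dup n : (0 < n)%N -> `|2 * lnS n%:R - lnS n.*2%:R| <= n%:R^-1.
Proof.
move=> n0; have np : 0 < n%:R :> R by rewrite ltr0n.
have s0 : 0 <= 2^-1 :> R by rewrite invr_ge0.
have s1 : 2^-1 <= 1 :> R by rewrite invf_le1 // ler1n.
have /andP[h1 h2] := lnGamma_bounds np s0 s1; have [h3 h4] := lnratio_bounds np s0.
have f0 k : 0 < k`!%:R :> R by rewrite ltr0n fact_gt0.
have p0 : 0 < pi :> R by exact: pi_gt0.
have t0 k : 0 < 2 ^+ k :> R by rewrite exprn_gt0.
have nh : 0 < n%:R + 2^-1 :> R by lra.
have eG : G (n%:R + 2^-1 + 1) = (n%:R + 2^-1) * ((n.*2)`!%:R * Num.sqrt pi / (2 ^+ n * 2 ^+ n * n`!%:R)).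
  rewrite GS //; congr (_ * _); have := G_half n; rewrite -dfac_fact => <-.
  have sp : Num.sqrt pi != 0 :> R by rewrite gt_eqF // sqrtr_gt0.
  by field; rewrite sp !gt_eqF.
have l2 : ln (2 ^+ n : R) = n%:R * ln 2 by rewrite lnXn // mulr_natl.
have ls : ln (Num.sqrt pi : R) = 2^-1 * ln pi by rewrite -powR12_sqrt ?(ltW p0) // ln_powR.
have lG : ln (G (n%:R + 2^-1 + 1)) = ln (n%:R + 2^-1) + ln (n.*2)`!%:R + 2^-1 * ln pi - 2 * n%:R * ln 2 - ln n`!%:R.
  have sq0 : 0 < Num.sqrt pi :> R by rewrite sqrtr_gt0.
  rewrite eG lnM ?posrE ?divr_gt0 ?mulr_gt0 // ln_div ?posrE ?mulr_gt0 // !lnM ?posrE ?mulr_gt0 // l2 ls; ring.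
have g1 : ln (G (n%:R + 1)) = ln n`!%:R by rewrite natr1 G_nat.
have g2 : ln (G (n.*2%:R + 1)) = ln (n.*2)`!%:R by rewrite natr1 G_nat.
have e2 : n.*2%:R = 2 * n%:R :> R by rewrite -muln2 natrM mulrC.
have e : 2 * lnS n%:R - lnS n.*2%:R = - (ln (G (n%:R + 2^-1 + 1)) - ln (G (n%:R + 1)) - 2^-1 * ln n%:R) + (ln (n%:R + 2^-1) - ln n%:R).
  rewrite /lnS g1 g2 lG e2.
  rewrite (lnM (x := 2 * pi) (y := n%:R)) ?posrE ?mulr_gt0 // (lnM (x := 2 * pi) (y := 2 * n%:R)) ?posrE ?mulr_gt0 //.
  rewrite (lnM (x := 2) (y := pi)) ?posrE // (lnM (x := 2) (y := n%:R)) ?posrE //.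
  by move: (ln (n%:R + 2^-1)) (ln n%:R) (ln pi) (ln 2) (ln (n.*2)`!%:R) (ln n`!%:R) => A B C D E F; field.
rewrite e; move: h1 h2 h3 h4; move: (_ - 2^-1 * ln n%:R) (ln (n%:R + 2^-1) - ln n%:R) => D T h1 h2 h3 h4.
have T1 : T <= n%:R^-1 by rewrite -[leRHS]mul1r ler_pdivlMr //; lra.
have T0 : 0 <= T by rewrite -(pmulr_lge0 _ nh); lra.
by rewrite ler_norml; apply/andP; split; lra.
Qed.

(** Summable increments give a limit L, and [lnS_dup] forces 2 L - L = 0. The recursion alone would
    leave this constant undetermined. *)
Lemma lnS_nat_cvg : (fun n : nat => lnS n.+1%:R) @ \oo --> (0 : R).
Proof.
have hT := @tele_partial lnS 0 2 1 (lexx _) (ler0n _ 2) lnS_step.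
have hb m n : (0 <= m)%N -> (m <= n)%N -> `|lnS n.+1%:R - lnS m.+1%:R| <= 4 * m.+1%:R^-1.
  move=> _ mn; have m1 : 1 <= m.+1%:R :> R by rewrite ler1n.
  have := hT m.+1%:R (n - m)%N m1; rewrite -natrD addSn subnKC // distrC => /le_trans; apply.
  rewrite expr0 mulr1; have -> : 2 * 2 = 4 :> R by ring.
  by rewrite ler_wpM2l // gerBl invr_ge0.
have he : (fun m : nat => 4 * m.+1%:R^-1 : R) @ \oo --> (0 : R).
  have h0 := cvgM (cvg_cst (4 : R) : (fun _ : nat => (4 : R)) @ \oo --> (4 : R)) (@cvg_harmonic R).
  by rewrite mulr0 in h0; exact: h0.
have [L [hL _]] := cauchy_rate hb he.
have hd : (fun n : nat => 2 * lnS n.+1%:R - lnS (n.+1).*2%:R) @ \oo --> 2 * L - L.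
  apply: cvgB.
    exact: (@cvgM _ _ _ _ (fun _ => 2 : R) (fun n : nat => lnS n.+1%:R) 2 L (cvg_cst _) hL).
  apply: (cvg_comp (fun n : nat => (n.*2.+1)%N) (fun n : nat => lnS n.+1%:R) _ hL).
  by apply/cvgnyPge => k; exists k => // n /= kn; lia.
have hd0 : (fun n : nat => 2 * lnS n.+1%:R - lnS (n.+1).*2%:R) @ \oo --> (0 : R).
  apply/cvgr0Pnorm_le => e e0; have := @cvg_harmonic R => /cvgr0Pnorm_le /(_ e e0).
  apply: filterS => n hn; apply: le_trans (lnS_dup (ltn0Sn n)) _.
  by rewrite ger0_norm ?invr_ge0 // in hn.
have hLL : 2 * L - L = 0 := cvg_unique (@Rhausdorff R) hd hd0.
have e1 : 2 * L - L = L by ring.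
by rewrite e1 in hLL; rewrite hLL in hL.
Qed.

Lemma lnS_cvg x : 1 <= x -> (fun m : nat => lnS (x + m%:R)) @ \oo --> (0 : R).
Proof.
move=> x1; have x0 : 0 <= x by lra.
have /andP[t1 t2] := truncn_itv x0.
have n0 : (0 < Num.truncn x)%N by rewrite lt0n; apply/eqP => e; rewrite e in t2; lra.
case: (Num.truncn x) t1 t2 n0 => [|n] // t1 t2 _.
have h1 : (fun m : nat => lnS (m + n).+1%:R) @ \oo --> (0 : R).
  have := lnS_nat_cvg; rewrite -(cvg_shiftn n (fun m : nat => lnS m.+1%:R)) //.
have h2 : (fun m : nat => (m.+1%:R : R)^-1 + `|lnS (m + n).+1%:R|) @ \oo --> (0 : R).
  have h3 : (fun m : nat => `|lnS (m + n).+1%:R|) @ \oo --> `|0 : R| by exact: cvg_norm h1.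
  rewrite normr0 in h3.
  by have h0 := cvgD (@cvg_harmonic R) h3; rewrite addr0 in h0; exact: h0.
apply/cvgr0Pnorm_le => e e0; have /cvgr0Pnorm_le /(_ e e0) := h2.
apply: filterS => m; rewrite ger0_norm ?addr_ge0 ?invr_ge0 // => hm; apply: le_trans hm.
have mp : 0 < (m + n).+1%:R :> R by rewrite ltr0n.
have s0 : 0 <= x - n.+1%:R by lra.
have s1 : x - n.+1%:R <= 1 by rewrite -(natr1 n.+1) in t2; lra.
have := lnS_shift mp s0 s1.
have -> : (m + n).+1%:R + (x - n.+1%:R) = x + m%:R by rewrite -addnS natrD; ring.
move=> h; have -> : lnS (x + m%:R) = (lnS (x + m%:R) - lnS (m + n).+1%:R) + lnS (m + n).+1%:R by rewrite subrK.
apply: le_trans (ler_normD _ _) _; apply: lerD => //; apply: le_trans h _.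
by rewrite lef_pV2 ?posrE ?ltr0n // ler_nat ltnS leq_addr.
Qed.

(* The multiplicative inverse of a power series with constant term 1. *)
Definition invs (a : nat -> R) n : R := (\sum_(i < n.+1) (1 - ser n.+1 a) ^+ i)`_n.

Lemma ser_invs a N : a 0%N = 1 -> eqm N (ser N (invs a) * ser N a) 1.
Proof.
move=> a0; pose E M := \sum_(i < M) (1 - ser M a) ^+ i.
have hE M : eqm M (E M * ser M a) 1.
  have h := geomN (- (1 - ser M a)) M; rewrite opprK in h.
  have -> : E M * ser M a = 1 - (1 - ser M a) ^+ M by rewrite -h /E mulrC; congr (_ * _); ring.
  case: M {E h} => [|M] // i iM; rewrite coefB [X in _ - X](_ : _ = 0) ?subr0 //.
  have u0 : (1 - ser M.+1 a)`_0 = 0 by rewrite coefB coef1 coef_ser // a0 subrr.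
  by rewrite (coef0_XM u0) exprMn coefMXn iM.
have hEE n M : (n < M)%N -> eqm n.+1 (E M) (E n.+1).
  move=> nM; have h1 : eqm n.+1 (E M) (E M * (E n.+1 * ser n.+1 a)).
    by rewrite -[X in eqm _ X _]mulr1; apply: eqmMr; apply: eqm_sym; exact: hE.
  have h2 : eqm n.+1 (E M * ser n.+1 a) 1.
    apply: eqm_trans (eqm_le nM (hE M)); apply: eqmMr; apply: eqm_sym; exact: eqm_ser.
  apply: eqm_trans h1 _; have -> : E M * (E n.+1 * ser n.+1 a) = (E M * ser n.+1 a) * E n.+1 by ring.
  by rewrite -[X in eqm _ _ X]mul1r; apply: eqmMl.
apply: eqm_trans (hE N); apply: eqmMl => i iN.
by rewrite coef_ser // /invs (hEE i N iN).
Qed.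

Local Notation A0 N := (ser N (alpha R 0)).

Lemma A0_near N : exists2 C, 0 <= C & forall y, 0 < y -> y <= 1 -> `|(A0 N.+1).[y] - 1| <= C * y.
Proof.
have [C C0 hC] := poly_bound (drop_poly 1 (A0 N.+1)); exists C => // y y0 y1.
have e : A0 N.+1 = 1 + drop_poly 1 (A0 N.+1) * 'X.
  rewrite -[LHS](poly_take_drop 1) expr1; congr (_ + _).
  by apply/polyP => j; rewrite coef_take_poly coef1; case: j => [|j] //=; rewrite coef_ser ?alpha0.
rewrite e !hornerE addrAC subrr add0r normrM [`|y|]gtr0_norm // ler_wpM2r ?(ltW y0) //.
exact: hC.
Qed.

Definition lnU N x : R := lnS x + ln (A0 N.+1).[x^-1].

(** For y = 1 / x the increment of [lnU] is half of ln f(y) - ln g(y), with f = (1 + y) (cfun A)^2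
    and g = A(y / (1 + y))^2. By [formal_sq] both have the same expansion up to order N + 1, and g
    stays away from 0. *)
Lemma lnU_step N : exists K x0 : R, [/\ 1 <= x0, 0 <= K,
  (forall x, x0 <= x -> `|(A0 N.+1).[x^-1] - 1| <= 2^-1) &
  forall x, x0 <= x -> `|lnU N x - lnU N (x + 1)| <= K * x^-1 ^+ N.+1].
Proof.
have [C C0 hC] := A0_near N; have [P hP] := app_cfun R N.+1.
pose A := A0 N.+1; pose f y := (1 + y) * (cfun y * A.[y]) ^+ 2.
pose g y := A.[y / (1 + y)] ^+ 2.
have hf : app N.+1 f ((A \Po rhop R N.+1) ^+ 2).
  apply: app_eqm (formal_sq hP).
  have h1 := app_add (app_poly N.+1 (1 : {poly R})) (app_poly N.+1 'X).
  have h2 := app_mul hP (app_poly N.+1 A).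
  rewrite [(P * _) ^+ 2]expr2.
  apply: (app_near (@ltr01 R) _ (app_mul h1 (app_mul h2 h2))) => y _ _.
  by rewrite -[(1 : {poly R})]polyC1 hornerC hornerX /f expr2.
have hg : app N.+1 g ((A \Po rhop R N.+1) ^+ 2).
  have h := app_comp A (app_rho R N.+1); exact: (app_mul h h).
case: hf => Kf [df [Kf0 df0 df1 hf]]; case: hg => Kg [dg [Kg0 dg0 dg1 hg]].
pose K := Kf + Kg; have K0 : 0 <= K by rewrite addr_ge0.
(* Each summand imposes one condition on y = 1 / x: y <= df, y <= dg, C y <= 1/2 and 8 K y <= 1. *)
pose x0 := 1 + df^-1 + dg^-1 + 2 * C + 8 * K.
have i1 : 0 < df^-1 by rewrite invr_gt0.
have i2 : 0 < dg^-1 by rewrite invr_gt0.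
have x01 : 1 <= x0 by rewrite /x0; lra.
have hx x : x0 <= x -> [/\ 0 < x^-1, x^-1 <= 1, x^-1 <= df, x^-1 <= dg & 2 * C * x^-1 <= 1 /\ 8 * K * x^-1 <= 1].
  move=> xx; have xp : 0 < x by lra.
  have y0 : 0 < x^-1 by rewrite invr_gt0.
  split=> //.
  - by rewrite invf_le1 //; lra.
  - by rewrite -[leRHS]invrK lef_pV2 ?posrE //; rewrite /x0 in xx; lra.
  - by rewrite -[leRHS]invrK lef_pV2 ?posrE //; rewrite /x0 in xx; lra.
  - by rewrite !ler_pdivrMr // mul1r; rewrite /x0 in xx; split; lra.
have hA x : x0 <= x -> `|A.[x^-1] - 1| <= 2^-1.
  move=> xx; have [y0 y1 _ _ [hc _]] := hx x xx; apply: le_trans (hC _ y0 y1) _; lra.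
exists (4 * K), x0; split=> // [|x xx]; first by rewrite mulr_ge0.
have [y0 y1 yf yg [_ hk]] := hx x xx; have xp : 0 < x by lra.
have xx1 : x0 <= x + 1 by lra.
have e1 : (x + 1)^-1 = x^-1 / (1 + x^-1) by field; rewrite !gt_eqF //; lra.
have := hA _ xx; have := hA _ xx1; rewrite e1; set y := x^-1 in y0 y1 yf yg hk *.
set B := A.[y / (1 + y)] => b1 b2.
have p0 : 0 < 1 + y by lra.
have B0 : 2^-1 <= B by move: b1; rewrite ler_norml => /andP[h9 _]; lra.
have A00 : 2^-1 <= A.[y] by move: b2; rewrite ler_norml => /andP[h9 _]; lra.
have c0 : 0 < cfun y by exact: expR_gt0.
have ap : 0 < A.[y] by lra.
have bp : 0 < B by lra.
have fp : 0 < f y by rewrite /f mulr_gt0 // exprn_gt0 // mulr_gt0.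
have gp : 0 < g y by rewrite /g -/B exprn_gt0.
have g4 : 4^-1 <= g y by rewrite /g -/B; nra.
have hfg : `|f y - g y| <= K * y ^+ N.+1.
  have -> : f y - g y = (f y - ((A \Po rhop R N.+1) ^+ 2).[y]) - (g y - ((A \Po rhop R N.+1) ^+ 2).[y]) by ring.
  by apply: le_trans (ler_normB _ _) _; rewrite mulrDl; apply: lerD; [exact: hf|exact: hg].
have yN : y ^+ N.+1 <= y by rewrite exprS ler_piMr ?(ltW y0) // exprn_ile1 // ltW.
have yN0 : 0 <= y ^+ N.+1 by rewrite exprn_ge0 ?ltW.
have hd : `|ln (f y) - ln (g y)| <= 2 * (4 * K * y ^+ N.+1).
  apply: ln_diff => //.
    have := ler_wpM2l K0 yN; lra.
  have -> : 4 * K * y ^+ N.+1 * g y = 4 * (K * y ^+ N.+1 * g y) by ring.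
  apply: le_trans hfg _; have := mulr_ge0 K0 yN0; move: (K * _) => Z Z0.
  by have := ler_wpM2l Z0 g4; lra.
have ex : (x + 2^-1) * ln (1 + x^-1) - 1 = 2^-1 * ln ((1 + y) * cfun y ^+ 2).
  rewrite lnM ?posrE ?exprn_gt0 // lnXn // /cfun expRK -/y.
  have -> : x = y^-1 by rewrite /y invrK.
  by move: (ln (1 + y)) => L; field; rewrite gt_eqF.
have -> : lnU N x - lnU N (x + 1) = 2^-1 * (ln (f y) - ln (g y)).
  have lf : ln (f y) = ln ((1 + y) * cfun y ^+ 2) + 2 * ln A.[y].
    rewrite /f exprMn mulrA lnM ?posrE ?mulr_gt0 ?exprn_gt0 // [ln (A.[y] ^+ 2)]lnXn // mulr_natl //.
  have lg : ln (g y) = 2 * ln B by rewrite /g -/B lnXn // mulr_natl.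
  rewrite /lnU e1 -/y -/B lf lg.
  have := lnSB xp; rewrite ex; move: (lnS x) (lnS (x + 1)) (ln ((1 + y) * _)) (ln B) (ln (A0 N.+1).[y]) => a b c d e hh.
  have -> : a = b + 2^-1 * c by rewrite -hh; ring.
  by field.
by rewrite normrM ger0_norm ?invr_ge0 //; lra.
Qed.

Lemma lnU_cvg N x : 1 <= x -> (fun m : nat => lnU N (x + m%:R)) @ \oo --> (0 : R).
Proof.
move=> x1; have [C C0 hC] := A0_near N.
have h1 : (fun m : nat => (x + m%:R)^-1) @ \oo --> (0 : R).
  apply: (squeeze_cvgr _ (cvg_cst 0) (@cvg_harmonic R)); near=> m.
  have p : 0 < x + m%:R by rewrite ltr_wpDr //; lra.
  rewrite invr_ge0 (ltW p) /= lef_pV2 ?posrE // -natr1; lra.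
have h2 : (fun m : nat => (A0 N.+1).[(x + m%:R)^-1]) @ \oo --> (1 : R).
  apply/cvgrPdist_le => e e0.
  have hc : (fun m : nat => C * (x + m%:R)^-1) @ \oo --> (0 : R).
    have h0 := cvgM (cvg_cst (C : R) : (fun _ : nat => (C : R)) @ \oo --> (C : R)) h1.
    by rewrite mulr0 in h0; exact: h0.
  have /cvgr0Pnorm_le /(_ e e0) := hc; apply: filterS => m hm; rewrite distrC.
  have p : 0 < x + m%:R by rewrite ltr_wpDr //; lra.
  have y0 : 0 < (x + m%:R)^-1 by rewrite invr_gt0.
  apply: le_trans (hC _ y0 _) _; last by apply: le_trans hm; exact: ler_norm.
  rewrite invf_le1 //; have : 0 <= m%:R :> R by []; lra.
have h3 : (fun m : nat => ln (A0 N.+1).[(x + m%:R)^-1]) @ \oo --> (0 : R).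
  rewrite -[X in _ --> X](@ln1 R); apply: (cvg_comp _ (@ln R) h2); exact: continuous_ln.
by have h0 := cvgD (lnS_cvg x1) h3; rewrite addr0 in h0; exact: h0.
Unshelve. all: by end_near. Qed.

Lemma lnU_bound N : exists K x0 : R, [/\ 1 <= x0, 0 <= K,
  (forall x, x0 <= x -> `|(A0 N.+2).[x^-1] - 1| <= 2^-1) &
  forall x, x0 <= x -> `|lnU N.+1 x| <= K * x^-1 ^+ N.+1].
Proof.
have [K [x0 [x01 K0 hA h]]] := lnU_step N.+1; exists (2 * K), x0; split=> //; first by rewrite mulr_ge0.
by apply: tele => // x xx; apply: lnU_cvg; lra.
Qed.

Local Notation D := (invs (alpha R 0)).

(** Exponentiating the bound on [lnU] gives S A = 1 + O(y^(N + 1)); multiplying by the polynomial D,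
    inverse to A modulo y^(N + 1), gives S = D + O(y^(N + 1)), as S is bounded. *)
Lemma stirling_expansion N : exists K x0 : R, [/\ 1 <= x0, 0 <= K &
  forall x, x0 <= x -> `|stirling_ratio x - \sum_(n < N.+1) D n / x ^+ n| <= K * x^-1 ^+ N.+1].
Proof.
have [K [x0 [x01 K0 hA h]]] := lnU_bound N.
have [CE CE0 hE] := poly_bound (ser N.+1 D).
have hDA : eqm N.+1 (ser N.+1 D * A0 N.+2) 1.
  apply: eqm_trans (@ser_invs (alpha R 0) N.+1 (alpha0 R 0)); apply: eqmMr; exact: eqm_ser.
have /eqmP[S eS] := hDA; have [CS CS0 hS] := poly_bound S.
pose x1 := x0 + K; have k1 : 0 <= expR 1 * K by rewrite mulr_ge0 ?expR_ge0.
exists (2 * (1 + expR 1 * K) * CS + CE * (expR 1 * K)), x1; split.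
- by rewrite /x1; lra.
- by rewrite addr_ge0 ?mulr_ge0 ?addr_ge0.
move=> x xx; have xx0 : x0 <= x by rewrite /x1 in xx; lra.
have xp : 0 < x by lra.
have y0 : 0 < x^-1 by rewrite invr_gt0.
have y1 : x^-1 <= 1 by rewrite invf_le1 //; lra.
have -> : \sum_(n < N.+1) D n / x ^+ n = (ser N.+1 D).[x^-1].
  by rewrite horner_poly; apply: eq_bigr => i _; rewrite exprVn.
have := h x xx0; have := hA x xx0; rewrite /lnU; set y := x^-1 in y0 y1 *.
set A := (A0 N.+2).[y] => hA2 hu.
have A00 : 2^-1 <= A by move: hA2; rewrite ler_norml => /andP[h1 _]; lra.
have ap : 0 < A by lra.
have sp : stirling_ratio x * A = expR (lnS x + ln A) by rewrite stirlingE // expRD lnK ?posrE.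
have yN0 : 0 <= y ^+ N.+1 by rewrite exprn_ge0 ?ltW.
have yN1 : y ^+ N.+1 <= 1 by rewrite exprn_ile1 // ltW.
have yN : y ^+ N.+1 <= y by rewrite exprS ler_piMr ?(ltW y0) // exprn_ile1 // ltW.
have u1 : `|lnS x + ln A| <= 1.
  apply: le_trans hu _; have := ler_wpM2l K0 yN => hh; apply: le_trans hh _.
  by rewrite ler_pdivrMr // mul1r; rewrite /x1 in xx; lra.
have := exp_taylor 1 u1; rewrite big_ord1 expr0 fact0 divr1 expr1 -sp => hSA.
have {}hSA : `|stirling_ratio x * A - 1| <= expR 1 * K * y ^+ N.+1.
  by apply: le_trans hSA _; rewrite -mulrA ler_wpM2l ?expR_ge0.
have hDAy : (ser N.+1 D).[y] * A = 1 + S.[y] * y ^+ N.+1.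
  by rewrite /A -hornerM eS !hornerE.
have s0 : 0 < stirling_ratio x by rewrite stirlingE // expR_gt0.
have sb : stirling_ratio x <= 2 * (1 + expR 1 * K).
  have e1 : stirling_ratio x * A <= 1 + expR 1 * K.
    have := ler_norm (stirling_ratio x * A - 1); have := ler_wpM2l k1 yN1; lra.
  have := ler_wpM2l (ltW s0) A00; lra.
set s := stirling_ratio x in hSA s0 sb *; set E := (ser N.+1 D).[y] in hDAy *.
have -> : s - E = - (s * (S.[y] * y ^+ N.+1)) + E * (s * A - 1).
  have -> : S.[y] * y ^+ N.+1 = E * A - 1 by rewrite hDAy; ring.
  by ring.
apply: le_trans (ler_normD _ _) _; rewrite normrN mulrDl; apply: lerD.
  rewrite [`|s * _|]normrM [`|S.[y] * _|]normrM [`|y ^+ _|]ger0_norm // mulrA ler_wpM2r //.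
  by apply: ler_pM; rewrite ?normr_ge0 // ?hS // gtr0_norm.
by rewrite [`|E * _|]normrM -[leRHS]mulrA; apply: ler_pM; rewrite ?normr_ge0 //; exact: hE.
Qed.

Lemma asymptotic_D : asymptotic_expansion (@stirling_ratio R) D.
Proof.
move=> N; have [K [x0 [x01 K0 h]]] := stirling_expansion N; exists K.
near=> x; have xx : x0 <= x by near: x; apply: nbhs_pinfty_ge; exact: num_real.
by have := h x xx; rewrite exprVn.
Unshelve. all: by end_near. Qed.

Lemma stirling_coefE n : stirling_coef R n = D n.
Proof.
(* [xget] returns an element of the set as soon as there is one, and D is one; the comparison at
   reciprocals of integers then makes it unique. *)
have hs : asymptotic_expansion (@stirling_ratio R) (stirling_coef R).
  by apply: (@xgetPex _ (fun=> 0) [set d | asymptotic_expansion (@stirling_ratio R) d]); exists D; exact: asymptotic_D.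
have [K hK] := hs n; have [K' [x0 [x01 K0' hD]]] := stirling_expansion n.
have [M [Mr hM]] : exists M : R, M \is Num.real /\ forall x, M < x -> `|stirling_ratio x - \sum_(i < n.+1) stirling_coef R i / x ^+ i| <= K / x ^+ n.+1.
  by case: hK => M [Mr hM]; exists M.
suff e : eqm n.+1 (ser n.+1 (stirling_coef R)) (ser n.+1 D) by have := e n (ltnSn n); rewrite !coef_ser.
apply: (@inv_uniq _ _ _ _ (K + K') (Num.truncn (`|M| + x0)).+1) => k kk.
have kM : `|M| + x0 < k%:R by apply: lt_trans (truncnS_gt _) _; rewrite ltr_nat.
have M1 : M < k%:R by have := ler_norm M; lra.
have M2 : x0 <= k%:R by have := normr_ge0 M; lra.
have h1 := hM _ M1; have h2 := hD _ M2.
have eh (d : nat -> R) : (ser n.+1 d).[k%:R^-1] = \sum_(i < n.+1) d i / k%:R ^+ i.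
  by rewrite horner_poly; apply: eq_bigr => i _; rewrite exprVn.
rewrite !eh; move: h1 h2; set s := stirling_ratio _; set a := \sum_(i < _) _; set b := \sum_(i < _) _ => h1 h2.
have -> : a - b = - (s - a) + (s - b) by ring.
by apply: le_trans (ler_normD _ _) _; rewrite normrN mulrDl; apply: lerD => //; rewrite exprVn.
Qed.

Lemma conv_alpha_stirling n : conv (alpha R 0) (stirling_coef R) n = delt R n.
Proof.
rewrite (eq_conv (fun=> erefl) stirling_coefE) convC (@conv_ser _ _ _ n.+1) //.
by rewrite (@ser_invs (alpha R 0) n.+1 (alpha0 R 0)) // coef1.
Qed.
End Stirling.

(** * Assembly of the expansion *)

Lemma expR1_lt3 (R : realType) : expR 1 < 3 :> R.
Proof.
(* Since e^(1/6) <= 1 / (1 - 1/6) and (6/5)^6 < 3, a single tangent inequality suffices for e < 3,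
   which makes log log p positive from p = 3 on. *)
have h : expR (6^-1 : R) <= 6 / 5.
  have h1 := expR_ge1Dx (- (6^-1) : R); have p := expR_gt0 (6^-1 : R).
  rewrite expRN in h1; rewrite -[leLHS]invrK -[leRHS]invrK lef_pV2 ?posrE ?invr_gt0 //; lra.
have -> : 1 = 6%:R * 6^-1 :> R by rewrite mulfV.
rewrite expRM_natl; apply: (@le_lt_trans _ _ ((6 / 5) ^+ 6)); last by lra.
by rewrite lerXn2r ?nnegrE ?expR_ge0 //; lra.
Qed.

Lemma ln3_gt1 (R : realType) (p : nat) : (3 <= p)%N -> 1 < ln (p%:R : R).
Proof.
move=> p3; have p0 : 0 < p%:R :> R by rewrite ltr0n; apply: leq_trans p3.
rewrite -[X in X < _]expRK ltr_ln ?posrE ?expR_gt0 //.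
by apply: lt_le_trans (expR1_lt3 R) _; rewrite ler_nat.
Qed.

(** M is an integer of either sign: for M < 0 the sum is empty, and max(M + 1, 0) is the number of
    terms in both cases. *)
Lemma sum_int_le (T : nmodType) (F : nat -> T) (M : int) :
  \sum_(m < `|M|.+1 | m%:Z <= M) F m = \sum_(m < absz (Num.max (M + 1) 0)) F m.
Proof.
case: M => n.
  have -> : Num.max (n%:Z + 1) 0 = n.+1 :> int by rewrite addrC -intS; apply/max_idPl.
  by apply: eq_bigl => m; rewrite lez_nat -ltnS ltn_ord.
have -> : Num.max (Negz n + 1) 0 = 0 :> int by apply/max_idPr; lia.
by rewrite big_ord0 big_pred0.
Qed.

Theorem theorem3p3 (R : realType) (nu : factor_count) (M : int) (a b : R)
    (ha : 0 < a) (hab : a < b) (hb : (b%:E < nu_radius R nu)%E) :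
  exists K : R, forall p k : nat, prime p -> (3 <= p)%N ->
    a <= k%:R / loglog R p <= b ->
    exists E : Cplx R,
      `|E| <= (K / loglog R p ^ (M + 1))%:C /\
      (lambda_nu R nu p k)%:C =
        (loglog R p ^+ k / k`!%:R)%:C *
        (\sum_(m < `|M|.+1 | m%:Z <= M)
            g_nu nu m (k%:R / loglog R p) / (loglog R p ^+ m)%:C + E).
Proof.
have b0 : 0 < b by exact: lt_trans hab.
(* A radius strictly between b and r_nu: the room above b gives absolute convergence, and for
   [big_omega] it remains below 2. *)
have [rho [rb rnu]] : exists rho : R, b < rho /\ (nu = big_omega -> rho < 2).
  case: nu hb => hb; first by exists (b + 1); split=> //; rewrite ltrDl.
  rewrite lte_fin in hb; exists ((b + 2) / 2); split=> [|_]; lra.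
have rho0 : 0 < rho by exact: lt_trans rb.
pose N := absz (Num.max (M + 1) 0).
have [K K0 hK] := main_real rho0 rnu N ha hab rb.
have ll0 p : (3 <= p)%N -> 0 < loglog R p.
  by move=> p3; rewrite /loglog ln_gt0 // ln3_gt1.
(* For M + 1 < 0 the allowed error is a positive power of log log p. It is bounded below because log
   log p >= log log 3 > 0, so the bounded error at N = 0 is absorbed into K'. *)
have [K' hK'] : exists K' : R, forall p, (3 <= p)%N -> K / loglog R p ^+ N <= K' / loglog R p ^ (M + 1).
  case: (leP 0 (M + 1)) => hM.
    exists K => p p3; rewrite /N (max_idPl hM).
    case: (M + 1) hM => // n _ /=; by rewrite lexx.
  have p3 := ll0 3 (leqnn _).
  exists (K * (loglog R 3)^-1 ^+ absz (M + 1)) => p pp3; have L0 := ll0 p pp3.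
  rewrite /N (max_idPr (ltW hM)) /= expr0 divr1.
  have L3 : loglog R 3 <= loglog R p.
    by rewrite /loglog ler_ln ?posrE ?ler_ln ?posrE ?ltr0n ?ler_nat // ?ln_gt0 ?ltr1n //; lia.
  case: (M + 1) hM => // n _ /=.
  rewrite invrK -mulrA -exprMn -[leLHS]mulr1 ler_wpM2l // -[leLHS](expr1n _ n.+1).
  by rewrite lerXn2r ?nnegrE ?mulr_ge0 ?invr_ge0 ?(ltW p3) ?(ltW L0) // ler_pdivlMl // mulr1.
exists K' => p k pp p3 hv; have L0 := ll0 p p3; set L := loglog R p in L0 hv *.
have kp : 0 < k%:R :> R.
  by move: hv => /andP[h _]; have := lt_le_trans ha h; rewrite pmulr_lgt0 ?invr_gt0.
have v0 : 0 < k%:R / L by rewrite divr_gt0.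
have vr : k%:R / L < rho by case/andP: hv => _ h; exact: le_lt_trans rb.
have Lk0 : 0 < L ^+ k / k`!%:R by rewrite divr_gt0 ?exprn_gt0 // ltr0n fact_gt0.
pose S := \sum_(m < N) gco nu m (k%:R / L) / k%:R ^+ m.
have hS : \sum_(m < `|M|.+1 | m%:Z <= M) g_nu nu m (k%:R / L) / (L ^+ m)%:C = S%:C.
  (* The factor v^(-m) of the saddle-point coefficient with v = k / L gives v^m L^m = k^m, which
     converts the expansion in 1 / L into the one in 1 / k. *)
  have eg m : g_nu nu m (k%:R / L) / (L ^+ m)%:C = (gco nu m (k%:R / L) / k%:R ^+ m)%:C.
    rewrite /g_nu (saddle_gco rho0 rnu v0 vr m (@Gamma_half_dfac R) (@conv_alpha_stirling R)).
    rewrite -fmorphV -rmorphM; congr (_%:C); rewrite -mulrA -invfM -exprMn mulfVK ?gt_eqF //.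
  rewrite (eq_bigr _ (fun (m : 'I__) _ => eg m)) -rmorph_sum; congr (_%:C).
  by rewrite (sum_int_le (fun m => gco nu m (k%:R / L) / k%:R ^+ m)).
pose e := lambda_nu R nu p k / (L ^+ k / k`!%:R) - S.
exists e%:C; split.
  rewrite normE cmod_real lecR; apply: le_trans (hK' p p3); rewrite -/L.
  have := hK p k p3 L0 hv; rewrite -/L -/S => h.
  have -> : e = (lambda_nu R nu p k - L ^+ k / k`!%:R * S) / (L ^+ k / k`!%:R).
    by rewrite /e mulrBl [_ * S / _]mulrAC mulfV ?gt_eqF // mul1r.
  by rewrite normrM normfV (gtr0_norm Lk0) ler_pdivrMr // [leRHS]mulrC.
rewrite hS -rmorphD -rmorphM; congr (_%:C).
by rewrite /e addrC subrK mulrC mulfVK // gt_eqF.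
Qed.
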